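(* There is an explicit algorithm that computes the binary expansion of an absolutely normal real number $z\in[0,1)$ in nearly linear time: the $n$th bit of $z$ is output after $O(n\log^{c}n)$ computation steps, for some constant $c$.
   Context: A real $\alpha$ is normal in base $b\ge2$ if for every $m\ge1$ and every string $w$ of $m$ base-$b$ digits, the asymptotic frequency of occurrences of $w$ in the base-$b$ expansion of $\alpha$ is $b^{-m}$; it is absolutely normal if it is normal in every base $b\ge2$. Computation steps are measured on a log-cost RAM. *)

(* Defs.v *)
From Stdlib Require Import Reals Lra Lia Arith List.
Open Scope R_scope.

(* k-th digit (k = 0 is the first digit after the radix point) of the
   base-b expansion of the fractional part of x: floor(x * b^(k+1)) mod b.
   (Standard greedy/terminating expansion.) *)
Definition digit (b : nat) (x : R) (k : nat) : nat :=
  Z.to_nat (Z.modulo (Int_part (x * (INR b) ^ (S k))) (Z.of_nat b)).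

Definition occurs_at (b : nat) (x : R) (w : list nat) (i : nat) : bool :=
  forallb (fun j => Nat.eqb (digit b x (i + j)) (nth j w 0%nat))
          (seq 0 (length w)).

Definition occ_count (b : nat) (x : R) (w : list nat) (N : nat) : nat :=
  length (filter (occurs_at b x w) (seq 0 N)).

Definition normal_in_base (b : nat) (x : R) : Prop :=
  forall w : list nat,
    (1 <= length w)%nat ->
    Forall (fun d => (d < b)%nat) w ->
    Un_cv (fun N => INR (occ_count b x w N) / INR N) (/ (INR b) ^ (length w)).

Definition absolutely_normal (x : R) : Prop :=
  forall b : nat, (2 <= b)%nat -> normal_in_base b x.

(* Real number in [0,1] with binary expansion 0.f(0) f(1) f(2) ... *)
Definition bin_term (f : nat -> bool) (i : nat) : R :=
  (if f i then 1 else 0) / 2 ^ (S i).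

(* Log-cost RAM (Cook--Reckhow style) with a binary output tape        *)

Inductive instr : Type :=
| LOADC  (r k : nat)
| ADD    (r a b : nat)
| SUB    (r a b : nat)
| LOADI  (r a : nat)
| STOREI (a s : nat)
| JPOS   (a tgt : nat)
| OUT    (a : nat).

Definition program := list instr.

Record state := mkState { pc : nat; reg : nat -> nat; out : list bool }.

Definition init_state : state := mkState 0 (fun _ => 0%nat) nil.

Definition upd (f : nat -> nat) (r v : nat) : nat -> nat :=
  fun i => if Nat.eqb i r then v else f i.

(* logarithmic cost of handling the number x: its binary length *)
Definition lcost (x : nat) : nat := S (Nat.log2 x).

Definition exec (i : instr) (s : state) : state * nat :=
  let R := reg s in
  match i with
  | LOADC r k => (mkState (S (pc s)) (upd R r k) (out s), lcost k)
  | ADD r a b => (mkState (S (pc s)) (upd R r (R a + R b)) (out s),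
                  lcost (R a) + lcost (R b))
  | SUB r a b => (mkState (S (pc s)) (upd R r (R a - R b)) (out s),
                  lcost (R a) + lcost (R b))
  | LOADI r a => (mkState (S (pc s)) (upd R r (R (R a))) (out s),
                  lcost (R a) + lcost (R (R a)))
  | STOREI a s' => (mkState (S (pc s)) (upd R (R a) (R s')) (out s),
                  lcost (R a) + lcost (R s'))
  | JPOS a tgt => (mkState (if Nat.ltb 0 (R a) then tgt else S (pc s)) R (out s),
                  lcost (R a))
  | OUT a => (mkState (S (pc s)) R (out s ++ (Nat.odd (R a) :: nil)),
              lcost (R a))
  end%nat.

Definition step (P : program) (s : state) : option (state * nat) :=
  match nth_error P (pc s) with
  | None => None
  | Some i => Some (exec i s)
  end.

Fixpoint run (P : program) (t : nat) : state * nat :=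
  match t with
  | O => (init_state, 0%nat)
  | S t' =>
      let (s, c) := run P t' in
      match step P s with
      | None => (s, c)
      | Some (s', k) => (s', (c + k)%nat)
      end
  end.

(* Main.v *)
(** The bits of z are produced in stages, each doubling the number n of bits known. A stage consists of blocks of l bits,
    where l grows very slowly (2^l is at most about (log n)^2); l doubles when a new base is added to the list of active bases
    2, 3, ..., and every base is eventually active. For an active base b let kap be maximal with b^kap < 2^l. Each block
    is chosen, among all 2^l candidates, to minimise the sum over the active bases of the number of earlier blocks of the
    stage with the same (approximate) next kap base-b digits. A given digit word is produced by at most 8 b^2 candidates,
    so a minimum is at most the average and the sum of the squared multiplicities of the words in a stage of J blocks is
    at most about C J^2 / 2^l: the words are as equidistributed as random ones up to the constant C, which depends only on
    the active bases. Among all b^kap words the number of occurrences of a fixed pattern has variance O(kap), so by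
    Cauchy-Schwarz the deviation of the pattern frequency in the chosen words is o(1) as l grows, and z is normal.

    The digits needed by the search come from an on-line base conversion: a divide-and-conquer over the blocks carries
    truncations of b^k Z / 2^n mod 1 and b^k / 2^n, where Z is the integer formed by the first n bits, so that a node with
    L bits below it works with about L bits. With integer multiplication in quasi-linear time (Nussbaumer's recursion over
    (Z/2^w)[y] / (y^N + 1)) a stage costs n times a power of log n. The program is written in a small first-order
    functional language on binary trees, whose cost semantics is realised by a RAM program. *)

(* Two obstacles shape the construction. Converting the whole prefix anew for every block would take
   quadratic time, so each node sees only the leading bits of its fractions, at the price of
   rounding errors. All truncations round down, and a level multiplies the error bound by at most
   4B, where B is the largest active base. With T = 16 + t in stage t, a quantity of order log n,
   the T^2 guard bits absorb the factor (4B)^m collected over the m < T levels. The second obstacle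
   is carries: bits chosen later still affect the base-b digits being counted, so a word d stands
   for one of d, d + 1, d + 2, and the analysis charges all three.

   The greedy cost counts equal earlier words because this is, up to a factor 2 and a constant, the
   increment of the sum of squared multiplicities, the only quantity that Cauchy-Schwarz needs. The
   growth of l is dictated from both sides: 2^l <= T^2 keeps the exhaustive search polylogarithmic,
   whereas C is cubic in the number of bases and l exponential in it, so that C = o(l), which beats
   the variance O(kap). *)
Require Import Defs.
From Stdlib Require Import ZArith Reals Lra ClassicalEpsilon FinFun List Arith Lia Bool.
Import ListNotations.
Open Scope nat_scope.

(** * A first-order language on binary trees and its RAM interpreter *)

Inductive tree := Leaf | Node (l r : tree).

Inductive exp :=
| Nil | Top | Shift (e : exp) | Cons (a b : exp) | Case (a b c : exp)
| Call (f : nat) (a : exp).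

(* The environment is itself a tree, read as a list of values with [Top] its
   head.  [Case a b c] runs [b] if [a] is [Leaf] and otherwise runs [c] with the
   two children of [a] pushed.  [Call f a] runs the body of [f] in the environment [a].
   The last argument counts interpreter transitions. *)
Inductive ev (T : nat -> exp) : exp -> tree -> tree -> nat -> Prop :=
| ev_nil env : ev T Nil env Leaf 1
| ev_top h t : ev T Top (Node h t) h 1
| ev_shift e h t v n : ev T e t v n -> ev T (Shift e) (Node h t) v (S n)
| ev_cons a b env v w n m : ev T a env v n -> ev T b env w m ->
    ev T (Cons a b) env (Node v w) (n + m + 3)
| ev_case0 a b c env v n m : ev T a env Leaf n -> ev T b env v m ->
    ev T (Case a b c) env v (n + m + 2)
| ev_case1 a b c env h t v n m : ev T a env (Node h t) n ->
    ev T c (Node h (Node t env)) v m -> ev T (Case a b c) env v (n + m + 2)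
| ev_call f a env w v n m : ev T a env w n -> ev T (T f) w v m ->
    ev T (Call f a) env v (n + m + 2).

Notation rZ := 0. Notation rI := 1. Notation rE := 2. Notation rV := 3.
Notation rK := 4. Notation rH := 5. Notation rA := 6. Notation rB := 7.
Notation rC := 8. Notation rD := 9. Notation rM := 10.
Notation lEVAL := 2. Notation lRET := 30. Notation lPRINT := 92. Notation lLOAD := 106.

(* Register [rH] is the allocation pointer, [rK] the stack of pending frames,
   each frame being four cells: opcode, expression, environment, next frame. *)
Definition interp : program :=
  [ LOADC rI 1; JPOS rI lLOAD;
    (* EVAL *)
    LOADI rA rE; JPOS rA 6; ADD rV rZ rZ; JPOS rI lRET;
    SUB rA rA rI; JPOS rA 10; LOADI rV rV; JPOS rI lRET;
    SUB rA rA rI; JPOS rA 17;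
    ADD rA rV rI; LOADI rV rA; ADD rA rE rI; LOADI rE rA; JPOS rI lEVAL;
    (* 17: push a frame *)
    LOADI rA rE; STOREI rH rA; ADD rB rH rI; STOREI rB rE; ADD rB rB rI; STOREI rB rV;
    ADD rB rB rI; STOREI rB rK; ADD rK rH rZ; ADD rH rB rI;
    ADD rA rE rI; LOADI rE rA; JPOS rI lEVAL;
    (* RET *)
    JPOS rK 32; JPOS rI lPRINT;
    LOADI rA rK; ADD rB rK rI; LOADI rC rB; ADD rB rB rI; LOADI rD rB;
    ADD rB rB rI; LOADI rK rB;
    SUB rA rA rI; SUB rA rA rI; SUB rA rA rI; JPOS rA 57;
    (* Cons, head computed *)
    LOADC rA 6; STOREI rH rA; ADD rB rH rI; STOREI rB rV; ADD rB rB rI; ADD rB rB rI;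
    STOREI rB rK; ADD rK rH rZ; ADD rH rB rI; ADD rV rD rZ;
    ADD rA rC rI; ADD rA rA rI; LOADI rE rA; JPOS rI lEVAL;
    (* 57: Case *)
    SUB rA rA rI; JPOS rA 80;
    ADD rC rC rI; ADD rC rC rI; JPOS rV 65; ADD rV rD rZ; LOADI rE rC; JPOS rI lEVAL;
    ADD rC rC rI; LOADI rE rC; LOADI rA rV; STOREI rH rA; ADD rA rV rI; LOADI rA rA;
    ADD rV rH rZ; ADD rB rH rI; ADD rC rB rI; STOREI rB rC; STOREI rC rA;
    ADD rC rC rI; STOREI rC rD; ADD rH rC rI; JPOS rI lEVAL;
    (* 80: Call *)
    SUB rA rA rI; JPOS rA 86; ADD rC rC rI; ADD rC rC rI; LOADI rE rC; JPOS rI lEVAL;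
    (* 86: Cons, tail computed *)
    STOREI rH rC; ADD rB rH rI; STOREI rB rV; ADD rV rH rZ; ADD rH rB rI; JPOS rI lRET;
    (* PRINT *)
    LOADI rB rV; ADD rA rV rI; LOADI rV rA;
    JPOS rB 98; ADD rE rM rZ; JPOS rI lEVAL;
    LOADI rA rB; JPOS rA 102; OUT rZ; JPOS rI 103; OUT rI;
    ADD rA rB rI; LOADI rB rA; JPOS rI 95 ].

Definition bounded (H : nat) (M : nat -> nat) := forall i, M i <= H.

(** An instruction handles at most two numbers, so once [H] bounds every cell, each step costs at
    most [2 * lcost H] and the total cost reduces to a step count. *)
Inductive reach (P : program) (H : nat) : nat -> state -> state -> Prop :=
| reach_refl s : reach P H 0 s s
| reach_step n s s1 s2 k : step P s = Some (s1, k) -> k <= 2 * lcost H ->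
    reach P H n s1 s2 -> reach P H (S n) s s2.

Lemma lcost_mono a b : a <= b -> lcost a <= lcost b.
Proof. intros h. unfold lcost. pose proof (Nat.log2_le_mono a b h). lia. Qed.

Lemma reach_trans P H n m s1 s2 s3 :
  reach P H n s1 s2 -> reach P H m s2 s3 -> reach P H (n + m) s1 s3.
Proof. induction 1; simpl; auto. intros. econstructor; eauto. Qed.

Lemma upd_eq f r v i : i = r -> upd f r v i = v.
Proof. intros ->. unfold upd. now rewrite Nat.eqb_refl. Qed.

Lemma upd_neq f r v i : i <> r -> upd f r v i = f i.
Proof. intros h. unfold upd. apply Nat.eqb_neq in h. now rewrite h. Qed.

Lemma bounded_upd H M r v : bounded H M -> v <= H -> bounded H (upd M r v).
Proof. intros h hv i. unfold upd. destruct (i =? r); auto. Qed.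

Section Instr.
Context (P : program) (H : nat).

(** These rules are in continuation form, and a computed value is given by a separate equation:
    chaining them executes code symbolically while the final memory is still a metavariable. *)
Lemma reach_LOADC pc r k M o n s : nth_error P pc = Some (LOADC r k) ->
  bounded H M -> k <= H ->
  (bounded H (upd M r k) -> reach P H n (mkState (S pc) (upd M r k) o) s) ->
  reach P H (S n) (mkState pc M o) s.
Proof.
  intros h b hk c. eapply reach_step; [unfold step; simpl; rewrite h; reflexivity| |].
  - pose proof (lcost_mono _ _ hk). unfold lcost in *; cbn [snd fst reg exec] in *; lia.
  - apply c. now apply bounded_upd.
Qed.

Lemma reach_ADD pc r x y v M o n s : nth_error P pc = Some (ADD r x y) ->
  bounded H M -> M x + M y = v -> v <= H ->
  (bounded H (upd M r v) -> reach P H n (mkState (S pc) (upd M r v) o) s) ->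
  reach P H (S n) (mkState pc M o) s.
Proof.
  intros h b <- hk c. eapply reach_step; [unfold step; simpl; rewrite h; reflexivity| |].
  - pose proof (lcost_mono _ _ (b x)). pose proof (lcost_mono _ _ (b y)). unfold lcost in *; cbn [snd fst reg exec] in *; lia.
  - apply c. now apply bounded_upd.
Qed.

Lemma reach_SUB pc r x y v M o n s : nth_error P pc = Some (SUB r x y) ->
  bounded H M -> M x - M y = v ->
  (bounded H (upd M r v) -> reach P H n (mkState (S pc) (upd M r v) o) s) ->
  reach P H (S n) (mkState pc M o) s.
Proof.
  intros h b <- c. eapply reach_step; [unfold step; simpl; rewrite h; reflexivity| |].
  - pose proof (lcost_mono _ _ (b x)). pose proof (lcost_mono _ _ (b y)). unfold lcost in *; cbn [snd fst reg exec] in *; lia.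
  - apply c. apply bounded_upd; auto. pose proof (b x). lia.
Qed.

Lemma reach_LOADI pc r x v M o n s : nth_error P pc = Some (LOADI r x) ->
  bounded H M -> M (M x) = v ->
  (bounded H (upd M r v) -> reach P H n (mkState (S pc) (upd M r v) o) s) ->
  reach P H (S n) (mkState pc M o) s.
Proof.
  intros h b <- c. eapply reach_step; [unfold step; simpl; rewrite h; reflexivity| |].
  - pose proof (lcost_mono _ _ (b x)). pose proof (lcost_mono _ _ (b (M x))). unfold lcost in *; cbn [snd fst reg exec] in *; lia.
  - apply c. now apply bounded_upd.
Qed.

Lemma reach_STOREI pc x y a v M o n s : nth_error P pc = Some (STOREI x y) ->
  bounded H M -> M x = a -> M y = v ->
  (bounded H (upd M a v) -> reach P H n (mkState (S pc) (upd M a v) o) s) ->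
  reach P H (S n) (mkState pc M o) s.
Proof.
  intros h b <- <- c. eapply reach_step; [unfold step; simpl; rewrite h; reflexivity| |].
  - pose proof (lcost_mono _ _ (b x)). pose proof (lcost_mono _ _ (b y)). unfold lcost in *; cbn [snd fst reg exec] in *; lia.
  - apply c. now apply bounded_upd.
Qed.

Lemma reach_JPOS pc x l v M o n s : nth_error P pc = Some (JPOS x l) ->
  bounded H M -> M x = v ->
  reach P H n (mkState (if 0 <? v then l else S pc) M o) s -> reach P H (S n) (mkState pc M o) s.
Proof.
  intros h b <- c.
  eapply reach_step; [unfold step; simpl; rewrite h; reflexivity| |exact c].
  pose proof (lcost_mono _ _ (b x)). unfold lcost in *; cbn [snd fst reg exec] in *; lia.
Qed.

Lemma reach_OUT pc x v M o n s : nth_error P pc = Some (OUT x) ->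
  bounded H M -> M x = v ->
  reach P H n (mkState (S pc) M (o ++ [Nat.odd v])) s ->
  reach P H (S n) (mkState pc M o) s.
Proof.
  intros h b <- c. eapply reach_step; [unfold step; simpl; rewrite h; reflexivity| |exact c].
  pose proof (lcost_mono _ _ (b x)). unfold lcost in *; cbn [snd fst reg exec] in *; lia.
Qed.
End Instr.

(** * Trees and code in memory *)

Fixpoint rep (M : nat -> nat) (h : nat) (v : tree) (a : nat) : Prop :=
  match v with
  | Leaf => a = 0
  | Node l r => 16 <= a /\ a + 1 < h /\ rep M h l (M a) /\ rep M h r (M (a + 1))
  end.

(** Every expression takes four cells, whatever its arity. Addresses have the form [a + 1 + 1]
    because the interpreter reaches fields by repeated increments and symbolic execution rewrites
    with terms of exactly this shape. *)
Fixpoint crep (ad : nat -> nat) (M : nat -> nat) (h : nat) (e : exp) (a : nat) : Prop :=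
  16 <= a /\ a + 3 < h /\
  match e with
  | Nil => M a = 0
  | Top => M a = 1
  | Shift e => M a = 2 /\ crep ad M h e (M (a + 1))
  | Cons e1 e2 => M a = 3 /\ crep ad M h e1 (M (a + 1)) /\ crep ad M h e2 (M (a + 1 + 1))
  | Case e1 e2 e3 => M a = 4 /\ crep ad M h e1 (M (a + 1)) /\ crep ad M h e2 (M (a + 1 + 1))
                   /\ crep ad M h e3 (M (a + 1 + 1 + 1))
  | Call f e => M a = 5 /\ crep ad M h e (M (a + 1)) /\ M (a + 1 + 1) = ad f
  end.

(** [Leaf] is the null pointer 0, and nodes lie between cell 16 and the allocation pointer.
    Registers lie below 16 and nothing is ever freed, so a represented tree survives all later
    writes. *)
Lemma rep_frame M M' h h' v : (forall i, 16 <= i < h -> M' i = M i) -> h <= h' ->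
  forall a, rep M h v a -> rep M' h' v a.
Proof.
  intros e l. induction v as [|u IHu w IHw]; simpl; intros a; auto.
  intros (h1 & h2 & h3 & h4). rewrite !e by lia. repeat split; auto; lia.
Qed.

Lemma crep_frame ad M M' h h' e : (forall i, 16 <= i < h -> M' i = M i) -> h <= h' ->
  forall a, crep ad M h e a -> crep ad M' h' e a.
Proof.
  intros E l. induction e; simpl; intros x; intros (h1 & h2 & h3);
    (split; [lia|]; split; [lia|]); rewrite !E by lia; intuition.
Qed.

Ltac simp_upd :=
  repeat match goal with
  | |- context [upd ?f ?r ?v ?i] =>
      first [ rewrite (upd_neq f r v i) by lia | rewrite (upd_eq f r v i) by lia ]
  | k : ?M ?x = _ |- context [?M ?x] => rewrite k
  end; rewrite ?Nat.add_0_r.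

Ltac fetch := match goal with hP : (forall pc i, nth_error interp pc = Some i -> _) |- _ =>
  apply hP; reflexivity end.

Ltac clr := match goal with b : bounded _ _ |- _ => intros ?; clear b end.
Ltac value := simp_upd; reflexivity.
Ltac jump := match goal with |- context [0 <? ?v] =>
  first [ replace (0 <? v) with true by (symmetry; apply Nat.ltb_lt; lia)
        | replace (0 <? v) with false by (symmetry; apply Nat.ltb_ge; lia) ] end; cbv iota.
Ltac easy_bound := match goal with hb : forall i, _ i <= _ |- _ => apply hb end.
Ltac instr :=
  first [ eapply reach_LOADC; [fetch | assumption | lia | clr]
        | eapply reach_ADD; [fetch | assumption | value | first [lia | easy_bound] | clr]
        | eapply reach_SUB; [fetch | assumption | value | clr]
        | eapply reach_LOADI; [fetch | assumption | value | clr]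
        | eapply reach_STOREI; [fetch | assumption | value | value | clr]
        | eapply reach_JPOS; [fetch | assumption | value | jump ]
        | eapply reach_OUT; [fetch | assumption | value | ] ].

Section Sim.
Context (T : nat -> exp) (P : program) (H : nat) (ad : nat -> nat).
Context (hP : forall pc i, nth_error interp pc = Some i -> nth_error P pc = Some i).

Definition same (h : nat) (M M' : nat -> nat) := forall i, 16 <= i < h -> M' i = M i.

(** The bound occurs twice on purpose: [clr] discards the folded copy after each instruction, while
    [easy_bound] and [bnd] still need the unfolded one for the initial memory. *)
Definition consts (h : nat) (M : nat -> nat) :=
  M rZ = 0 /\ M rI = 1 /\ M rH = h /\ 16 <= h /\ 8 <= H /\ bounded H M /\ forall i, M i <= H.

Ltac bnd := repeat (apply bounded_upd; [|first [lia | easy_bound]]);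
  match goal with hb : forall i, _ i <= _ |- _ => exact hb end.
Ltac fin := unfold consts, same; repeat apply conj;
  try assumption; try (simp_upd; (reflexivity || lia)); try (intros; now simp_upd);
  try match goal with
  | |- bounded _ _ => bnd
  | |- forall i, ?M i <= _ => change (bounded H M); bnd
  end.

(* [cycle 1] runs the instructions first, since they determine the number of steps and the final
   memory on which the other goals depend. *)
Tactic Notation "trans" integer(n) := do 2 eexists; split; [|split]; cycle 1; [do n instr; apply reach_refl | fin | lia].

Lemma eval_nil M o h : consts h M -> M (M rE) = 0 ->
  exists k M', k <= 10 /\ reach P H k (mkState lEVAL M o) (mkState lRET M' o) /\ consts h M' /\
   M' rM = M rM /\ M' rK = M rK /\ M' rV = 0 /\ same h M M'.
Proof. intros (h0 & h1 & h5 & hh & h8 & hb & hb0) hE. trans 4. Qed.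

Lemma eval_top M o h a : consts h M -> M (M rE) = 1 -> M rV = a -> 16 <= a ->
  exists k M', k <= 10 /\ reach P H k (mkState lEVAL M o) (mkState lRET M' o) /\ consts h M' /\
   M' rM = M rM /\ M' rK = M rK /\ M' rV = M a /\ same h M M'.
Proof. intros (h0 & h1 & h5 & hh & h8 & hb & hb0) hE hV ha. trans 6. Qed.

Lemma eval_shift M o h p a : consts h M -> M rE = p -> 16 <= p -> p < H -> M p = 2 ->
  M rV = a -> 16 <= a -> a < H ->
  exists k M', k <= 20 /\ reach P H k (mkState lEVAL M o) (mkState lEVAL M' o) /\ consts h M' /\
   M' rM = M rM /\ M' rK = M rK /\ M' rV = M (a + 1) /\ M' rE = M (p + 1) /\ same h M M'.
Proof. intros (h0 & h1 & h5 & hh & h8 & hb & hb0) hE hp hpH op hV ha haH. trans 11. Qed.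

Lemma eval_push M o h p op : consts h M -> M rE = p -> 16 <= p -> p + 3 < h -> M p = S (S (S op)) ->
  h + 8 < H ->
  exists k M', k <= 30 /\ reach P H k (mkState lEVAL M o) (mkState lEVAL M' o) /\ consts (h + 1 + 1 + 1 + 1) M' /\
   M' rM = M rM /\ M' rK = h /\ M' rV = M rV /\ M' rE = M (p + 1) /\ same h M M' /\
   M' h = S (S (S op)) /\ M' (h + 1) = p /\ M' (h + 1 + 1) = M rV /\ M' (h + 1 + 1 + 1) = M rK.
Proof.
  intros (h0 & h1 & h5 & hh & h8 & hb & hb0) hE hp hpH hop hH.
  pose proof (hb p) as hq; rewrite hop in hq. trans 19.
Qed.

Lemma ret_cons1 M o h f p : consts h M -> M rK = f -> 16 <= f -> f + 3 < h -> M f = 3 ->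
  M (f + 1) = p -> 16 <= p -> p + 3 < h -> h + 8 < H ->
  exists k M', k <= 35 /\ reach P H k (mkState lRET M o) (mkState lEVAL M' o) /\ consts (h + 1 + 1 + 1 + 1) M' /\
   M' rM = M rM /\ M' rK = h /\ M' rV = M (f + 1 + 1) /\ M' rE = M (p + 1 + 1) /\ same h M M' /\
   M' h = 6 /\ M' (h + 1) = M rV /\ M' (h + 1 + 1 + 1) = M (f + 1 + 1 + 1).
Proof.
  intros (h0 & h1 & h5 & hh & h8 & hb & hb0) hK hf hfh tg hp hp1 hp2 hH. trans 26.
Qed.

Lemma ret_case0 M o h f p : consts h M -> M rK = f -> 16 <= f -> f + 3 < h -> M f = 4 ->
  M (f + 1) = p -> 16 <= p -> p + 3 < h -> h + 8 < H -> M rV = 0 ->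
  exists k M', k <= 35 /\ reach P H k (mkState lRET M o) (mkState lEVAL M' o) /\ consts h M' /\
   M' rM = M rM /\ M' rK = M (f + 1 + 1 + 1) /\ M' rV = M (f + 1 + 1) /\ M' rE = M (p + 1 + 1) /\ same h M M'.
Proof.
  intros (h0 & h1 & h5 & hh & h8 & hb & hb0) hK hf hfh tg hp hp1 hp2 hH hV. trans 20.
Qed.

Lemma ret_case1 M o h f p a : consts h M -> M rK = f -> 16 <= f -> f + 3 < h -> M f = 4 ->
  M (f + 1) = p -> 16 <= p -> p + 3 < h -> h + 8 < H -> M rV = S a -> 16 <= S a -> S a + 1 < h ->
  exists k M', k <= 40 /\ reach P H k (mkState lRET M o) (mkState lEVAL M' o) /\ consts (h + 1 + 1 + 1 + 1) M' /\
   M' rM = M rM /\ M' rK = M (f + 1 + 1 + 1) /\ M' rV = h /\ M' rE = M (p + 1 + 1 + 1) /\ same h M M' /\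
   M' h = M (S a) /\ M' (h + 1) = h + 1 + 1 /\ M' (h + 1 + 1) = M (S a + 1) /\ M' (h + 1 + 1 + 1) = M (f + 1 + 1).
Proof.
  intros (h0 & h1 & h5 & hh & h8 & hb & hb0) hK hf hfh tg hp hp1 hp2 hH hV ha1 ha2. trans 32.
Qed.

Lemma ret_call M o h f p : consts h M -> M rK = f -> 16 <= f -> f + 3 < h -> M f = 5 ->
  M (f + 1) = p -> 16 <= p -> p + 3 < h -> h + 8 < H ->
  exists k M', k <= 35 /\ reach P H k (mkState lRET M o) (mkState lEVAL M' o) /\ consts h M' /\
   M' rM = M rM /\ M' rK = M (f + 1 + 1 + 1) /\ M' rV = M rV /\ M' rE = M (p + 1 + 1) /\ same h M M'.
Proof.
  intros (h0 & h1 & h5 & hh & h8 & hb & hb0) hK hf hfh tg hp hp1 hp2 hH. trans 20.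
Qed.

Lemma ret_cons2 M o h f : consts h M -> M rK = f -> 16 <= f -> f + 3 < h -> M f = 6 -> h + 8 < H ->
  exists k M', k <= 35 /\ reach P H k (mkState lRET M o) (mkState lRET M' o) /\ consts (h + 1 + 1) M' /\
   M' rM = M rM /\ M' rK = M (f + 1 + 1 + 1) /\ M' rV = h /\ same h M M' /\
   M' h = M (f + 1) /\ M' (h + 1) = M rV.
Proof.
  intros (h0 & h1 & h5 & hh & h8 & hb & hb0) hK hf hfh tg hH. trans 22.
Qed.

Definition tabok M h := forall f, crep ad M h (T f) (ad f).

Lemma tabok_frame M M' h h' : same h M M' -> h <= h' -> tabok M h -> tabok M' h'.
Proof. intros s l t f. eapply crep_frame; eauto. Qed.

Lemma consts_16 h M : consts h M -> 16 <= h.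
Proof. unfold consts. tauto. Qed.

Lemma same_trans h h' M M1 M2 : same h M M1 -> h <= h' -> same h' M1 M2 -> same h M M2.
Proof. intros a l b i hi. rewrite b by lia. apply a; lia. Qed.

(** Cells below the allocation pointer are never overwritten ([same]), so a frame pushed before a
    subevaluation is intact after it, and the stack pointer comes back. The greediest case, [Cons],
    allocates two frames and a pair, ten cells, which [12 * n] covers. *)
Theorem simulation e env v n : ev T e env v n ->
  forall M h o, consts h M -> crep ad M h e (M rE) -> tabok M h -> rep M h env (M rV) ->
  h + 12 * n + 8 < H ->
  exists k M' h', k <= 100 * n /\ reach P H k (mkState lEVAL M o) (mkState lRET M' o) /\
    consts h' M' /\ M' rM = M rM /\ M' rK = M rK /\ h <= h' <= h + 12 * n /\
    rep M' h' v (M' rV) /\ same h M M'.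
Proof.
  induction 1; intros M h0 o hc hE ht hV hH.
  - simpl in hE. destruct hE as (_ & _ & hE).
    destruct (eval_nil M o h0 hc hE) as (k & M' & r1 & r2 & r3 & r4 & r5 & r6 & r7).
    exists k, M', h0. repeat (split; try assumption); try lia.
  - simpl in hE, hV. destruct hE as (_ & _ & hE). destruct hV as (q1 & q2 & q3 & q4).
    destruct (eval_top M o h0 (M rV) hc hE eq_refl q1) as (k & M' & r1 & r2 & r3 & r4 & r5 & r6 & r7).
    exists k, M', h0. repeat (split; try assumption); try lia.
    rewrite r6. eapply rep_frame; eauto.
  - simpl in hE, hV. destruct hE as (p1 & p2 & p3 & p4). destruct hV as (q1 & q2 & q3 & q4).
    destruct (eval_shift M o h0 (M rE) (M rV) hc eq_refl) as (k & M' & r1 & r2 & r3 & r4 & r5 & r6 & r7 & r8); auto; try lia.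
    destruct (IHev M' h0 o r3) as (k' & M2 & h' & s1 & s2 & s3 & s4 & s5 & s6 & s7 & s8).
    + rewrite r7. eapply crep_frame; eauto.
    + eapply tabok_frame; eauto.
    + rewrite r6. eapply rep_frame; eauto.
    + lia.
    + exists (k + k'), M2, h'. split; [lia|]. split; [eapply reach_trans; eauto|].
      repeat (split; try assumption); try lia; try congruence. eapply same_trans; eauto; lia.
  - simpl in hE. destruct hE as (p1 & p2 & p3 & p4 & p5).
    destruct (eval_push M o h0 (M rE) 0 hc eq_refl) as
      (k & M1 & r1 & r2 & r3 & r4 & r5 & r6 & r7 & r8 & r9 & r10 & r11 & r12); auto; try lia.
    destruct (IHev1 M1 _ o r3) as (k' & M2 & h' & s1 & s2 & s3 & s4 & s5 & s6 & s7 & s8).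
    + rewrite r7. eapply crep_frame; eauto; lia.
    + eapply tabok_frame; eauto; lia.
    + rewrite r6. eapply rep_frame; eauto; lia.
    + lia.
    + pose proof (consts_16 _ _ hc). pose proof (s8 h0 ltac:(lia)) as u0.
      pose proof (s8 (h0+1) ltac:(lia)) as u1.
      pose proof (s8 (h0+1+1) ltac:(lia)) as u2. pose proof (s8 (h0+1+1+1) ltac:(lia)) as u3.
      assert (S02 : same h0 M M2) by (eapply same_trans; [exact r8| |exact s8]; lia).
      destruct (ret_cons1 M2 o h' h0 (M rE) s3) as
        (k2 & M3 & t1 & t2 & t3 & t4 & t5 & t6 & t7 & t8 & t9 & t10 & t11); try congruence; try lia.
      assert (S03 : same h0 M M3) by (eapply same_trans; [exact S02| |exact t8]; lia).
      destruct (IHev2 M3 _ o t3) as (k3 & M4 & h4 & w1 & w2 & w3 & w4 & w5 & w6 & w7 & w8).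
      * rewrite t7, (S02 (M rE + 1 + 1)) by lia. eapply crep_frame; [| |exact p5]; auto; lia.
      * eapply tabok_frame; [exact S03| |exact ht]; lia.
      * rewrite t6, u2, r11. eapply rep_frame; [exact S03| |exact hV]; lia.
      * lia.
      * pose proof (w8 h' ltac:(lia)) as v0. pose proof (w8 (h'+1) ltac:(lia)) as v1.
        pose proof (w8 (h'+1+1+1) ltac:(lia)) as v3.
        destruct (ret_cons2 M4 o h4 h' w3) as
          (k5 & M5 & x1 & x2 & x3 & x4 & x5 & x6 & x7 & x8 & x9); try congruence; try lia.
        exists (k + (k' + (k2 + (k3 + k5)))), M5, (h4 + 1 + 1). split; [lia|].
        split; [repeat (eapply reach_trans; [eassumption|]); assumption|].
        assert (S35 : same (h' + 1 + 1 + 1 + 1) M3 M5) by (eapply same_trans; [exact w8| |exact x7]; lia).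
        assert (S25 : same h' M2 M5) by (eapply same_trans; [exact t8| |exact S35]; lia).
        split; [assumption|]. split; [congruence|]. split; [congruence|]. split; [lia|].
        split.
        -- simpl. rewrite x6, x8, x9, v1, t10. repeat split; try lia.
           ++ eapply rep_frame; [exact S25| |exact s7]; lia.
           ++ eapply rep_frame; [exact x7| |exact w7]; lia.
        -- eapply same_trans; [exact S02| |exact S25]; lia.
  - simpl in hE. destruct hE as (p1 & p2 & p3 & p4 & p5 & p6).
    destruct (eval_push M o h0 (M rE) 1 hc eq_refl) as
      (k & M1 & r1 & r2 & r3 & r4 & r5 & r6 & r7 & r8 & r9 & r10 & r11 & r12); auto; try lia.
    destruct (IHev1 M1 _ o r3) as (k' & M2 & h' & s1 & s2 & s3 & s4 & s5 & s6 & s7 & s8).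
    + rewrite r7. eapply crep_frame; eauto; lia.
    + eapply tabok_frame; eauto; lia.
    + rewrite r6. eapply rep_frame; eauto; lia.
    + lia.
    + pose proof (consts_16 _ _ hc). pose proof (s8 h0 ltac:(lia)) as u0.
      pose proof (s8 (h0+1) ltac:(lia)) as u1.
      pose proof (s8 (h0+1+1) ltac:(lia)) as u2. pose proof (s8 (h0+1+1+1) ltac:(lia)) as u3.
      assert (S02 : same h0 M M2) by (eapply same_trans; [exact r8| |exact s8]; lia).
      simpl in s7.
      destruct (ret_case0 M2 o h' h0 (M rE) s3) as
        (k2 & M3 & t1 & t2 & t3 & t4 & t5 & t6 & t7 & t8); try congruence; try lia.
      assert (S03 : same h0 M M3) by (eapply same_trans; [exact S02| |exact t8]; lia).
      destruct (IHev2 M3 _ o t3) as (k3 & M4 & h4 & w1 & w2 & w3 & w4 & w5 & w6 & w7 & w8).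
      * rewrite t7, (S02 (M rE + 1 + 1)) by lia. eapply crep_frame; [| |exact p5]; auto; lia.
      * eapply tabok_frame; [exact S03| |exact ht]; lia.
      * rewrite t6, u2, r11. eapply rep_frame; [exact S03| |exact hV]; lia.
      * lia.
      * exists (k + (k' + (k2 + k3))), M4, h4. split; [lia|].
        split; [repeat (eapply reach_trans; [eassumption|]); assumption|].
        split; [assumption|]. split; [congruence|]. split; [congruence|]. split; [lia|].
        split; [assumption|]. eapply same_trans; [exact S03| |exact w8]; lia.
  - simpl in hE. destruct hE as (p1 & p2 & p3 & p4 & p5 & p6).
    destruct (eval_push M o h0 (M rE) 1 hc eq_refl) as
      (k & M1 & r1 & r2 & r3 & r4 & r5 & r6 & r7 & r8 & r9 & r10 & r11 & r12); auto; try lia.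
    destruct (IHev1 M1 _ o r3) as (k' & M2 & h' & s1 & s2 & s3 & s4 & s5 & s6 & s7 & s8).
    + rewrite r7. eapply crep_frame; eauto; lia.
    + eapply tabok_frame; eauto; lia.
    + rewrite r6. eapply rep_frame; eauto; lia.
    + lia.
    + pose proof (consts_16 _ _ hc). pose proof (s8 h0 ltac:(lia)) as u0.
      pose proof (s8 (h0+1) ltac:(lia)) as u1.
      pose proof (s8 (h0+1+1) ltac:(lia)) as u2. pose proof (s8 (h0+1+1+1) ltac:(lia)) as u3.
      assert (S02 : same h0 M M2) by (eapply same_trans; [exact r8| |exact s8]; lia).
      simpl in s7. destruct s7 as (z1 & z2 & z3 & z4).
      destruct (M2 rV) as [|va] eqn:hva; [lia|].
      destruct (ret_case1 M2 o h' h0 (M rE) va s3) as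
        (k2 & M3 & t1 & t2 & t3 & t4 & t5 & t6 & t7 & t8 & t9 & t10 & t11 & t12); try congruence; try lia.
      assert (S03 : same h0 M M3) by (eapply same_trans; [exact S02| |exact t8]; lia).
      destruct (IHev2 M3 _ o t3) as (k3 & M4 & h4 & w1 & w2 & w3 & w4 & w5 & w6 & w7 & w8).
      * rewrite t7, (S02 (M rE + 1 + 1 + 1)) by lia. eapply crep_frame; [| |exact p6]; auto; lia.
      * eapply tabok_frame; [exact S03| |exact ht]; lia.
      * simpl. rewrite t6, t9, t10, t11, t12, u2, r11. repeat split; try lia.
        -- eapply rep_frame; [exact t8| |exact z3]; lia.
        -- eapply rep_frame; [exact t8| |exact z4]; lia.
        -- eapply rep_frame; [exact S03| |exact hV]; lia.
      * lia.
      * exists (k + (k' + (k2 + k3))), M4, h4. split; [lia|].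
        split; [repeat (eapply reach_trans; [eassumption|]); assumption|].
        split; [assumption|]. split; [congruence|]. split; [congruence|]. split; [lia|].
        split; [assumption|]. eapply same_trans; [exact S03| |exact w8]; lia.
  - simpl in hE. destruct hE as (p1 & p2 & p3 & p4 & p5).
    destruct (eval_push M o h0 (M rE) 2 hc eq_refl) as
      (k & M1 & r1 & r2 & r3 & r4 & r5 & r6 & r7 & r8 & r9 & r10 & r11 & r12); auto; try lia.
    destruct (IHev1 M1 _ o r3) as (k' & M2 & h' & s1 & s2 & s3 & s4 & s5 & s6 & s7 & s8).
    + rewrite r7. eapply crep_frame; eauto; lia.
    + eapply tabok_frame; eauto; lia.
    + rewrite r6. eapply rep_frame; eauto; lia.
    + lia.
    + pose proof (consts_16 _ _ hc). pose proof (s8 h0 ltac:(lia)) as u0.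
      pose proof (s8 (h0+1) ltac:(lia)) as u1.
      pose proof (s8 (h0+1+1) ltac:(lia)) as u2. pose proof (s8 (h0+1+1+1) ltac:(lia)) as u3.
      assert (S02 : same h0 M M2) by (eapply same_trans; [exact r8| |exact s8]; lia).
      destruct (ret_call M2 o h' h0 (M rE) s3) as
        (k2 & M3 & t1 & t2 & t3 & t4 & t5 & t6 & t7 & t8); try congruence; try lia.
      assert (S03 : same h0 M M3) by (eapply same_trans; [exact S02| |exact t8]; lia).
      destruct (IHev2 M3 _ o t3) as (k3 & M4 & h4 & w1 & w2 & w3 & w4 & w5 & w6 & w7 & w8).
      * rewrite t7, (S02 (M rE + 1 + 1)), p5 by lia. eapply crep_frame; [exact S03| |exact (ht f)]; lia.
      * eapply tabok_frame; [exact S03| |exact ht]; lia.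
      * rewrite t6. eapply rep_frame; [exact t8| |exact s7]; lia.
      * lia.
      * exists (k + (k' + (k2 + k3))), M4, h4. split; [lia|].
        split; [repeat (eapply reach_trans; [eassumption|]); assumption|].
        split; [assumption|]. split; [congruence|]. split; [congruence|]. split; [lia|].
        split; [assumption|]. eapply same_trans; [exact S03| |exact w8]; lia.
Qed.

Definition b2t (b : bool) : tree := if b then Node Leaf Leaf else Leaf.
Fixpoint tl_of {A} (f : A -> tree) (l : list A) : tree :=
  match l with [] => Leaf | x :: l => Node (f x) (tl_of f l) end.

Lemma print_loop bs : forall M o h, consts h M -> h + 8 < H ->
  rep M h (tl_of b2t bs) (M rB) ->
  exists k M', k <= 8 * length bs + 3 /\
   reach P H k (mkState 95 M o) (mkState lEVAL M' (o ++ bs)) /\ consts h M' /\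
   M' rM = M rM /\ M' rK = M rK /\ M' rV = M rV /\ M' rE = M rM /\ same h M M'.
Proof.
  induction bs as [|b bs IH]; intros M o h hc hH hB.
  - simpl in hB. rewrite app_nil_r. pose proof hc as (h0 & h1 & h5 & hh & h8 & hb & hb0).
    do 2 eexists; split; [|split]; cycle 1; [do 3 instr; apply reach_refl | fin | simpl; lia].
  - simpl in hB. destruct hB as (p1 & p2 & p3 & p4).
    remember (M rB) as p eqn:hp. symmetry in hp.
    assert (exists k M', k <= 8 /\
       reach P H k (mkState 95 M o) (mkState 95 M' (o ++ [b])) /\ consts h M' /\
       M' rM = M rM /\ M' rK = M rK /\ M' rV = M rV /\ M' rB = M (p + 1) /\ same h M M')
      as (k & M' & r1 & r2 & r3 & r4 & r5 & r6 & r7 & r8).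
    { pose proof hc as (h0 & h1 & h5 & hh & h8 & hb & hb0).
      destruct b; simpl in p3.
      - destruct p3 as (p3 & _).
        do 2 eexists; split; [|split]; cycle 1.
        + do 3 instr. instr. replace (Nat.odd 1) with true by reflexivity. do 3 instr. apply reach_refl.
        + fin.
        + lia.
      - do 2 eexists; split; [|split]; cycle 1.
        + do 3 instr. instr. replace (Nat.odd 0) with false by reflexivity. do 4 instr. apply reach_refl.
        + fin.
        + lia. }
    destruct (IH M' (o ++ [b]) h r3 hH) as (k2 & M2 & s1 & s2 & s3 & s4 & s5 & s6 & s7 & s8).
    { rewrite r7. eapply rep_frame; eauto. }
    exists (k + k2), M2. rewrite <- app_assoc in s2.
    split; [simpl; lia|]. split; [eapply reach_trans; eauto|].
    repeat (split; try assumption); try congruence. eapply same_trans; eauto.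
Qed.

Lemma ret_print M o h p : consts h M -> h + 8 < H -> M rK = 0 -> M rV = p -> 16 <= p -> p + 1 < h ->
  exists k M', k <= 8 /\ reach P H k (mkState lRET M o) (mkState 95 M' o) /\ consts h M' /\
   M' rM = M rM /\ M' rK = 0 /\ M' rV = M (p + 1) /\ M' rB = M p /\ same h M M'.
Proof. intros (h0 & h1 & h5 & hh & h8 & hb & hb0) hH hK hV p1 p2. trans 5. Qed.

(** [rM] keeps the address of the main function throughout: after printing the first component of
    the result, the machine runs this function again in the second component as environment. *)
Lemma round M o h st bs st' n : consts h M -> tabok M h -> ev T (T 0) st (Node (tl_of b2t bs) st') n ->
  M rE = ad 0 -> M rM = ad 0 -> M rK = 0 -> rep M h st (M rV) -> h + 12 * n + 8 < H ->
  exists k M' h', k <= 100 * n + 8 * length bs + 11 /\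
   reach P H k (mkState lEVAL M o) (mkState lEVAL M' (o ++ bs)) /\ consts h' M' /\ tabok M' h' /\
   M' rE = ad 0 /\ M' rM = ad 0 /\ M' rK = 0 /\ rep M' h' st' (M' rV) /\ h' <= h + 12 * n.
Proof.
  intros hc ht he hE hM hK hV hH.
  destruct (simulation _ _ _ _ he M h o hc) as (k & M1 & h1 & r1 & r2 & r3 & r4 & r5 & r6 & r7 & r8); auto.
  { rewrite hE. apply ht. }
  simpl in r7. destruct r7 as (q1 & q2 & q3 & q4).
  destruct (ret_print M1 o h1 (M1 rV) r3) as (k2 & M2 & s1 & s2 & s3 & s4 & s5 & s6 & s7 & s8);
    try congruence; try lia.
  destruct (print_loop bs M2 o h1 s3) as (k3 & M3 & t1 & t2 & t3 & t4 & t5 & t6 & t7 & t8).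
  { lia. }
  { rewrite s7. eapply rep_frame; eauto. }
  assert (S : same h1 M1 M3) by (eapply same_trans; eauto).
  exists (k + (k2 + k3)), M3, h1. split; [lia|].
  split; [repeat (eapply reach_trans; [eassumption|]); assumption|].
  split; [assumption|]. split.
  { eapply tabok_frame; [|apply r6|exact ht]. eapply same_trans; [exact r8| |exact S]; lia. }
  split; [congruence|]. split; [congruence|]. split; [congruence|]. split; [|lia].
  rewrite t6, s6. eapply rep_frame; [exact S| |exact q4]; lia.
Qed.
End Sim.

(** * Code layout and the loader *)

Fixpoint esize (e : exp) : nat :=
  match e with
  | Nil | Top => 1
  | Shift e | Call _ e => S (esize e)
  | Cons a b => S (esize a + esize b)
  | Case a b c => S (esize a + esize b + esize c)
  end.

Fixpoint layout (ad : nat -> nat) (e : exp) (p : nat) : list nat :=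
  match e with
  | Nil => [0; 0; 0; 0]
  | Top => [1; 0; 0; 0]
  | Shift e => [2; p + 4; 0; 0] ++ layout ad e (p + 4)
  | Cons a b => let q := p + 4 + 4 * esize a in
      [3; p + 4; q; 0] ++ layout ad a (p + 4) ++ layout ad b q
  | Case a b c => let q := p + 4 + 4 * esize a in let r := q + 4 * esize b in
      [4; p + 4; q; r] ++ layout ad a (p + 4) ++ layout ad b q ++ layout ad c r
  | Call f a => [5; p + 4; ad f; 0] ++ layout ad a (p + 4)
  end.

Lemma layout_length ad e : forall p, length (layout ad e p) = 4 * esize e.
Proof. induction e; intros p; cbn -[Nat.mul]; rewrite ?length_app, ?IHe, ?IHe1, ?IHe2, ?IHe3; lia. Qed.

Definition segment (M : nat -> nat) (p : nat) (ws : list nat) :=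
  forall i, i < length ws -> M (p + i) = nth i ws 0.

Lemma segment_app M p u v : segment M p (u ++ v) -> segment M p u /\ segment M (p + length u) v.
Proof.
  intros s; split; intros i hi.
  - rewrite s by (rewrite length_app; lia). now rewrite app_nth1.
  - rewrite <- Nat.add_assoc, s by (rewrite length_app; lia).
    rewrite app_nth2 by lia. f_equal. lia.
Qed.

Lemma segment4 M p a b c d v : segment M p ([a; b; c; d] ++ v) ->
  M p = a /\ M (p + 1) = b /\ M (p + 1 + 1) = c /\ M (p + 1 + 1 + 1) = d /\ segment M (p + 4) v.
Proof.
  intros s. pose proof (s 0) as s0. pose proof (s 1) as s1. pose proof (s 2) as s2.
  pose proof (s 3) as s3. simpl in *. apply (segment_app M p [a; b; c; d] v) in s. simpl in s.
  rewrite Nat.add_0_r in s0. rewrite <- !Nat.add_assoc. repeat split; try tauto;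
  [apply s0|apply s1|apply s2|apply s3]; lia.
Qed.

Lemma crep_layout ad M h e : forall p, segment M p (layout ad e p) -> 16 <= p -> p + 4 * esize e <= h ->
  crep ad M h e p.
Proof.
  induction e; intros p s h1 h2; cbn [layout] in s;
    [apply (segment4 M p 0 0 0 0 []) in s | apply (segment4 M p 1 0 0 0 []) in s
    | apply segment4 in s.. ];
    destruct s as (s0 & s1 & s2 & s3 & s4); cbn [esize] in h2; cbn [crep];
    (split; [lia|]); (split; [lia|]); auto.
  - split; auto. rewrite s1. apply IHe; auto; lia.
  - apply segment_app in s4. rewrite layout_length in s4. destruct s4 as [s4 s5].
    rewrite s1, s2. repeat split; auto; [apply IHe1|apply IHe2]; auto; lia.
  - apply segment_app in s4. rewrite layout_length in s4. destruct s4 as [s4 s5].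
    apply segment_app in s5. rewrite layout_length in s5. destruct s5 as [s5 s6].
    rewrite s1, s2, s3. repeat split; auto; [apply IHe1|apply IHe2|apply IHe3]; auto; lia.
  - rewrite s1. repeat split; auto. apply IHe; auto; lia.
Qed.

Fixpoint layouts (ad : nat -> nat) (es : list exp) (p : nat) : list nat :=
  match es with [] => [] | e :: es => layout ad e p ++ layouts ad es (p + 4 * esize e) end.

Fixpoint offset (es : list exp) (p f : nat) : nat :=
  match es, f with
  | e :: es, S f => offset es (p + 4 * esize e) f
  | _, _ => p
  end.

(* The extra [Nil] is what calls of undefined functions run. *)
Definition table (tab : list exp) (f : nat) : exp := nth f (tab ++ [Nil]) Nil.
Definition addr (tab : list exp) (f : nat) : nat := offset (tab ++ [Nil]) 18 (min f (length tab)).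

Lemma crep_layouts ad M h es : forall p f, segment M p (layouts ad es p) -> 16 <= p ->
  p + length (layouts ad es p) <= h -> f < length es -> crep ad M h (nth f es Nil) (offset es p f).
Proof.
  induction es as [|e es IH]; intros p f s h1 h2 hf; simpl in hf; [lia|].
  cbn [layouts] in *. rewrite length_app, layout_length in h2. apply segment_app in s.
  rewrite layout_length in s. destruct s as [s1 s2].
  destruct f as [|f]; cbn [offset nth].
  - apply crep_layout; auto; lia.
  - apply IH; auto; lia.
Qed.

Lemma tabok_layouts tab M h :
  segment M 18 (layouts (addr tab) (tab ++ [Nil]) 18) ->
  18 + length (layouts (addr tab) (tab ++ [Nil]) 18) <= h -> tabok (table tab) (addr tab) M h.
Proof.
  intros s l f. unfold table, addr.
  replace (nth f (tab ++ [Nil]) Nil) with (nth (min f (length tab)) (tab ++ [Nil]) Nil).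
  - apply crep_layouts; auto; try lia. rewrite length_app; simpl; lia.
  - destruct (Nat.le_gt_cases f (length tab)); [now rewrite Nat.min_l by lia|].
    rewrite Nat.min_r by lia. rewrite app_nth2, Nat.sub_diag by lia.
    cbn [nth]. symmetry. apply nth_overflow. rewrite length_app; simpl; lia.
Qed.

Fixpoint store_words (ws : list nat) (p : nat) : program :=
  match ws with
  | [] => []
  | w :: ws => [LOADC rA p; LOADC rB w; STOREI rA rB] ++ store_words ws (S p)
  end.

(** Cells 16 and 17 hold the node [Node Leaf Leaf], the environment whose only value is [Leaf].
    Hence [rV] starts as 16 and the code as 18. *)
Definition image (tab : list exp) : list nat := [0; 0] ++ layouts (addr tab) (tab ++ [Nil]) 18.

Definition machine (tab : list exp) : program :=
  interp ++ store_words (image tab) 16 ++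
  [LOADC rM (addr tab 0); LOADC rE (addr tab 0); LOADC rV 16;
   LOADC rH (16 + length (image tab)); JPOS rI lEVAL].

Lemma reach_store_words P H ws : forall p pc M o,
  (forall i x, nth_error (store_words ws p) i = Some x -> nth_error P (pc + i) = Some x) ->
  bounded H M -> 16 <= p -> p + length ws <= H -> (forall w, In w ws -> w <= H) ->
  exists M', reach P H (3 * length ws) (mkState pc M o) (mkState (pc + 3 * length ws) M' o) /\
    bounded H M' /\ segment M' p ws /\ (forall i, i < p -> i <> rA -> i <> rB -> M' i = M i).
Proof.
  induction ws as [|w ws IH]; intros p pc M o hP hb h1 h2 h3.
  - exists M. simpl. rewrite Nat.add_0_r. split; [apply reach_refl|]. split; auto.
    split; auto. intros i hi; simpl in hi; lia.
  - set (M1 := upd (upd (upd M rA p) rB w) p w).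
    assert (hw : w <= H) by (apply h3; now left). simpl in h2.
    destruct (IH (S p) (pc + 3) M1 o) as (M' & r1 & r2 & r3 & r4).
    + intros i x hi. rewrite <- Nat.add_assoc. apply hP. exact hi.
    + unfold M1. repeat apply bounded_upd; auto; lia.
    + lia.
    + lia.
    + intros w' hw'. apply h3. now right.
    + exists M'. split; [|split; [assumption|split]].
      * cbn [length]. replace (3 * S (length ws)) with (3 + 3 * length ws) by lia.
        rewrite Nat.add_assoc.
        eapply reach_trans; [|exact r1].
        eapply reach_LOADC; [rewrite <- (Nat.add_0_r pc); apply hP; reflexivity|auto|lia|intros b1].
        eapply reach_LOADC; [rewrite <- (Nat.add_1_r pc); apply hP; reflexivity|auto|lia|intros b2].
        eapply reach_STOREI with (a := p) (v := w);
          [replace (S (S pc)) with (pc + 2) by lia; apply hP; reflexivity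
          |auto|now simp_upd|now simp_upd|intros b3].
        replace (S (S (S pc))) with (pc + 3) by lia. apply reach_refl.
      * intros i hi. destruct i as [|i]; cbn [nth].
        -- rewrite Nat.add_0_r, r4 by lia. unfold M1. now simp_upd.
        -- rewrite Nat.add_succ_r, <- Nat.add_succ_l. apply r3. simpl in hi; lia.
      * intros i hi ha hb'. rewrite r4 by lia. unfold M1. now simp_upd.
Qed.

Lemma boot tab H : 16 + length (image tab) + 16 <= H -> (forall w, In w (image tab) -> w <= H) ->
  addr tab 0 <= H -> 106 <= H ->
  exists k M h, k <= 3 * length (image tab) + 10 /\
   reach (machine tab) H k init_state (mkState lEVAL M []) /\ consts H h M /\
   h = 16 + length (image tab) /\
   tabok (table tab) (addr tab) M h /\ M rE = addr tab 0 /\ M rM = addr tab 0 /\ M rK = 0 /\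
   rep M h (Node Leaf Leaf) (M rV).
Proof.
  intros h1 h2 h3 h106. set (P := machine tab).
  assert (hP : forall pc i, nth_error interp pc = Some i -> nth_error P pc = Some i).
  { intros pc i hi. unfold P, machine. rewrite nth_error_app1; auto.
    apply nth_error_Some. congruence. }
  assert (b0 : bounded H (fun _ => 0)) by (intros i; lia).
  set (M1 := upd (fun _ => 0) rI 1).
  assert (b1 : bounded H M1) by (apply bounded_upd; auto; lia).
  destruct (reach_store_words P H (image tab) 16 106 M1 []) as (M2 & r1 & r2 & r3 & r4); auto; try lia.
  { intros i x hi. unfold P, machine. rewrite nth_error_app2 by (simpl; lia).
    replace (106 + i - length interp) with i by (simpl length; lia).
    rewrite nth_error_app1; auto. apply nth_error_Some. congruence. }
  assert (hI : M2 rI = 1) by (rewrite r4 by lia; reflexivity).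
  assert (hZ : M2 rZ = 0) by (rewrite r4 by lia; reflexivity).
  assert (hK : M2 rK = 0) by (rewrite r4 by lia; reflexivity).
  assert (hL : length (store_words (image tab) 16) = 3 * length (image tab)).
  { generalize (image tab), 16. induction l; intros n; simpl; auto. rewrite IHl. lia. }
  assert (tail : forall i x, nth_error [LOADC rM (addr tab 0); LOADC rE (addr tab 0); LOADC rV 16;
   LOADC rH (16 + length (image tab)); JPOS rI lEVAL] i = Some x ->
    nth_error P (106 + 3 * length (image tab) + i) = Some x).
  { intros i x hi. unfold P, machine. rewrite nth_error_app2 by (simpl length; lia).
    rewrite nth_error_app2 by (rewrite hL; simpl length; lia).
    rewrite hL. rewrite <- hi. f_equal. simpl length. lia. }
  set (q := 106 + 3 * length (image tab)) in *.
  assert (ex : exists M', reach P H 5 (mkState q M2 []) (mkState lEVAL M' []) /\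
     M' = upd (upd (upd (upd M2 rM (addr tab 0)) rE (addr tab 0)) rV 16) rH (16 + length (image tab))
     /\ bounded H M').
  { eexists. split; [|split].
    - eapply reach_LOADC; [rewrite <- (Nat.add_0_r q); apply tail; reflexivity|auto|lia|intros].
      eapply reach_LOADC; [replace (S q) with (q + 1) by lia; apply tail; reflexivity|auto|lia|intros].
      eapply reach_LOADC; [replace (S (S q)) with (q + 2) by lia; apply tail; reflexivity|auto|lia|intros].
      eapply reach_LOADC; [replace (S (S (S q))) with (q + 3) by lia; apply tail; reflexivity|auto|lia|intros].
      eapply reach_JPOS with (v := 1); [replace (S (S (S (S q)))) with (q + 4) by lia; apply tail; reflexivity|auto| |].
      { now simp_upd. }
      apply reach_refl.
    - reflexivity.
    - repeat apply bounded_upd; auto; lia. }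
  destruct ex as (M' & e1 & e2 & e3).
  assert (E : forall i, 16 <= i -> M' i = M2 i) by (intros i hi; subst M'; now simp_upd).
  exists (2 + (3 * length (image tab) + 5)), M', (16 + length (image tab)).
  split; [lia|]. split.
  { eapply reach_trans; [|eapply reach_trans; [exact r1|exact e1]].
    eapply reach_LOADC; [apply hP; reflexivity|auto|lia|intros b].
    eapply reach_JPOS with (v := 1); [apply hP; reflexivity|auto|reflexivity|].
    apply reach_refl. }
  unfold image in r3. apply segment_app in r3. destruct r3 as [r3 r5].
  assert (seg : segment M' 18 (layouts (addr tab) (tab ++ [Nil]) 18)).
  { intros i hi. rewrite E by lia. now apply r5. }
  split; [|split; [reflexivity|]].
  { unfold consts. repeat split; try lia; auto; subst M'; now simp_upd. }
  split.
  { now apply tabok_layouts. }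
  split; [subst M'; now simp_upd|]. split; [subst M'; now simp_upd|].
  split; [subst M'; now simp_upd|].
  assert (hV : M' rV = 16) by (subst M'; now simp_upd). rewrite hV.
  cbn [rep]. rewrite !E by lia. split; [lia|]. split; [unfold image; rewrite length_app; simpl length; lia|].
  split; [apply (r3 0)|apply (r3 1)]; simpl; lia.
Qed.

(** * Rounds of the machine and their cost *)

Inductive rounds (tab : list exp) : nat -> tree -> list bool -> nat -> Prop :=
| rounds0 : rounds tab 0 (Node Leaf Leaf) [] 0
| roundsS i st o N bs st' n : rounds tab i st o N ->
    ev (table tab) (table tab 0) st (Node (tl_of b2t bs) st') n ->
    rounds tab (S i) st' (o ++ bs) (N + n + length bs + 1).

(** The memory in use grows along the run, but [H] must be fixed beforehand for all steps. Therefore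
    [H] is quantified outside, and only required to be large for the final [N]. *)
Lemma rounds_reach tab : exists c, forall H i st o N, rounds tab i st o N -> c + 12 * N <= H ->
  exists k M h, k <= c + 100 * N /\
   reach (machine tab) H k init_state (mkState lEVAL M o) /\ consts H h M /\ h + 16 <= c + 12 * N /\
   tabok (table tab) (addr tab) M h /\ M rE = addr tab 0 /\ M rM = addr tab 0 /\ M rK = 0 /\
   rep M h st (M rV).
Proof.
  assert (hw : exists c, forall w, In w (image tab) -> w <= c).
  { generalize (image tab). induction l as [|a l [c IH]]; [exists 0; intros w []|].
    exists (a + c). intros w [->|hw]; [lia|]. apply IH in hw. lia. }
  destruct hw as [cw hw].
  exists (cw + addr tab 0 + 3 * length (image tab) + 150). intros H i st o N r.
  induction r as [|i st o N bs st' n r IH he]; intros hH.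
  - destruct (boot tab H) as (k & M & h & r1 & r2 & r3 & r4 & r5 & r6 & r7 & r8 & r9); try lia.
    { intros w i. apply hw in i. lia. }
    exists k, M, h. repeat (split; auto); lia.
  - destruct IH as (k & M & h & r1 & r2 & r3 & r4 & r5 & r6 & r7 & r8 & r9); [lia|].
    destruct (round (table tab) (machine tab) H (addr tab)) with (M := M) (o := o) (h := h) (st := st)
      (bs := bs) (st' := st') (n := n) as (k2 & M2 & h2 & s1 & s2 & s3 & s4 & s5 & s6 & s7 & s8 & s9); auto.
    + intros pc x hx. unfold machine. rewrite nth_error_app1; auto. apply nth_error_Some. congruence.
    + lia.
    + exists (k + k2), M2, h2. split; [lia|]. split; [eapply reach_trans; eauto|].
      repeat (split; auto); lia.
Qed.

Lemma run_reach P H n s : forall t c, run P t = (s, c) -> forall s', reach P H n s s' ->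
  exists c', run P (t + n) = (s', c') /\ c' <= c + n * (2 * lcost H).
Proof.
  revert s. induction n as [|n IH]; intros s t c hr s' r; inversion r; subst.
  - exists c. rewrite Nat.add_0_r. split; auto. lia.
  - destruct (IH s1 (S t) (c + k)) with (s' := s') as (c' & e & l); auto.
    + simpl. now rewrite hr, H1.
    + exists c'. rewrite Nat.add_succ_r, <- Nat.add_succ_l. split; auto. lia.
Qed.

(** Contents and addresses are at most linear in [N], so logarithmic cost adds a single logarithmic
    factor to the number of steps. *)
Theorem machine_rounds tab : exists c, forall i st o N, rounds tab i st o N ->
  exists t, out (fst (run (machine tab) t)) = o /\
   snd (run (machine tab) t) <= (c + 100 * N) * (2 * lcost (c + 12 * N)).
Proof.
  destruct (rounds_reach tab) as [c hc]. exists c. intros i st o N r.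
  destruct (hc (c + 12 * N) i st o N r) as (k & M & h & r1 & r2 & _); [lia|].
  destruct (run_reach (machine tab) _ k init_state 0 0 eq_refl _ r2) as (c' & e & l).
  exists (0 + k). rewrite e. split; auto. simpl snd.
  eapply Nat.le_trans; [exact l|]. simpl (0 + _). apply Nat.mul_le_mono_r. lia.
Qed.

(** * The program *)

(* Expressions with binders as functions; variables are numbered by de Bruijn levels. *)
Inductive hexp :=
| hv (n : nat) | hnil | hcons (a b : hexp) | hcase (a b : hexp) (c : nat -> nat -> hexp)
| hcall (f : nat) (a : hexp).

Fixpoint shifts (n : nat) (e : exp) := match n with 0 => e | S n => Shift (shifts n e) end.

Fixpoint compile (d : nat) (e : hexp) : exp :=
  match e with
  | hv i => shifts (d - 1 - i) Top
  | hnil => Nil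
  | hcons a b => Cons (compile d a) (compile d b)
  | hcase a b c => Case (compile d a) (compile d b) (compile (S (S d)) (c (S d) d))
  | hcall f a => Call f (compile d a)
  end.

Coercion hv : nat >-> hexp.
(** The argument list is the environment of the callee. Its first item is on top and so has the
    highest level, which is why parameters are numbered downwards to 0. *)
Definition call (f : nat) (args : list hexp) := hcall f (fold_right hcons hnil args).
(** A [let] is a [Case] on the one-element list of [a]: the first branch never runs, and the second
    binds the head. *)
Definition hlet (a : hexp) (f : nat -> hexp) := hcase (hcons a hnil) hnil (fun h _ => f h).
Definition hif (a b c : hexp) := hcase a c (fun _ _ => b).
Definition hhd (a : hexp) := hcase a hnil (fun h _ => h).
Definition htl (a : hexp) := hcase a hnil (fun _ t => t).
Definition htt := hcons hnil hnil.
Definition hxor (a b : hexp) := hif a (hif b hnil htt) b.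

Notation "'LET' x := a 'IN' b" := (hlet a (fun x => b)) (at level 200, x name, b at level 200).
Notation "'CASE' a 'OF' 'NIL' => b | ( x , y ) => c" := (hcase a b (fun x y => c))
  (at level 200, x name, y name, b at level 200, c at level 200).
Notation "'IF' a 'THEN' b 'ELSE' c" := (hif a b c) (at level 200, c at level 200).
Notation "f @[ x ; .. ; y ]" := (call f (cons (x : hexp) .. (cons (y : hexp) nil) ..)) (at level 10).

Notation fMAIN := 0. Notation fADDS := 1. Notation fVAS := 2. Notation fMAS := 3.
Notation fAPP := 4. Notation fTAKE := 5. Notation fDROP := 6. Notation fROT := 7.
Notation fMROT := 8. Notation fHALF := 9. Notation fSMUL := 10. Notation fSVEC := 11.
Notation fCONV := 12. Notation fLEQ := 13. Notation fSPLIT := 14. Notation fCHUNK := 15.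
Notation fPADM := 16. Notation fOV := 17. Notation fLAST := 18. Notation fMULMOD := 19.
Notation fPMUL := 20. Notation fTOPOLY := 21. Notation fMKLW := 22. Notation fUNSC := 23.
Notation fREL := 24. Notation fIMUL := 25. Notation fISZ := 26. Notation fTRYB := 27.
Notation fNORM := 28. Notation fPOW := 29. Notation fPOWS := 30. Notation fSTEPS := 31.
Notation fLEVELS := 32. Notation fROOT := 33. Notation fTRUNC := 34. Notation fADVANCE := 35.
Notation fSOLVE := 36. Notation fWORD := 37. Notation fLOOKUP := 38. Notation fCOST := 39.
Notation fLESS := 40. Notation fBEST := 41. Notation fINCR := 42. Notation fINCRS := 43.
Notation fWORDS := 44. Notation fMAPC := 45. Notation fREV := 46. Notation fRPT := 47.

(* Integers are lists of bits, least significant first; a size is passed as any list of that length.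
   [fADDS @[s; c; x; y]] adds [y] (complemented if [s]) and the carry [c] to [x], modulo 2^|x|. *)
Definition code_adds := compile 4 (let s := 3 in let c := 2 in let xs := 1 in let ys := 0 in
  CASE xs OF NIL => hnil | (x, xs') =>
  LET y := hxor s (hhd ys) IN
  hcons (hxor x (hxor y c))
    (fADDS @[s; IF x THEN (IF y THEN htt ELSE c) ELSE (IF y THEN c ELSE hnil); xs'; htl ys])).
Definition code_vas := compile 3 (let s := 2 in let f := 1 in let g := 0 in
  CASE f OF NIL => hnil | (x, f') => hcons (fADDS @[s; s; x; hhd g]) (fVAS @[s; f'; htl g])).
Definition code_mas := compile 3 (let s := 2 in let f := 1 in let g := 0 in
  CASE f OF NIL => hnil | (x, f') => hcons (fVAS @[s; x; hhd g]) (fMAS @[s; f'; htl g])).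
Definition code_app := compile 2 (let x := 1 in let y := 0 in
  CASE x OF NIL => y | (h, t) => hcons h (fAPP @[t; y])).
Definition code_take := compile 2 (let u := 1 in let x := 0 in
  CASE u OF NIL => hnil | (_h, u') => CASE x OF NIL => hnil | (h, t) => hcons h (fTAKE @[u'; t])).
Definition code_drop := compile 2 (let u := 1 in let x := 0 in
  CASE u OF NIL => x | (_h, u') => CASE x OF NIL => hnil | (h, t) => fDROP @[u'; t]).
(* Multiplication by y^-|e| modulo y^|f| + 1.  As [t - t - t], [fVAS @[htt; fVAS @[htt; t; t]; t]] is [- t]. *)
Definition code_rot := compile 2 (let e := 1 in let f := 0 in
  LET t := fTAKE @[e; f] IN
  fAPP @[fDROP @[e; f]; fVAS @[htt; fVAS @[htt; t; t]; t]]).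
Definition code_mrot := compile 2 (let e := 1 in let F := 0 in
  CASE F OF NIL => hnil | (f, F') => hcons (fROT @[e; f]) (fMROT @[e; F'])).
(** Sizes and exponents are lists read as unary numbers, so a number is halved by keeping every
    other item. *)
Definition code_half := compile 1 (let u := 0 in
  CASE u OF NIL => hnil | (x, u') => CASE u' OF NIL => hnil | (_h, u'') => hcons x (fHALF @[u''])).
Definition code_smul := compile 2 (let x := 1 in let y := 0 in
  CASE x OF NIL => fADDS @[htt; htt; y; y] | (b, x') =>
  LET r := fSMUL @[x'; fADDS @[hnil; hnil; y; y]] IN
  IF b THEN fADDS @[hnil; hnil; y; r] ELSE r).
Definition code_svec := compile 2 (let a := 1 in let g := 0 in
  CASE g OF NIL => hnil | (x, g') => hcons (fSMUL @[a; x]) (fSVEC @[a; g'])).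
(** Horner's scheme modulo y^N + 1. Rotating by N - 1 places divides by y^(N-1), which is
    multiplication by -y since y^N = -1; the negation in [r2] corrects the sign. *)
Definition code_conv := compile 2 (let f := 1 in let g := 0 in
  CASE f OF NIL => fVAS @[htt; g; g] | (a, f') =>
  LET r := fCONV @[f'; g] IN
  LET r1 := fROT @[htl r; r] IN
  LET r2 := fVAS @[htt; fVAS @[htt; r1; r1]; r1] IN
  fVAS @[hnil; fSVEC @[a; g]; r2]).
Definition code_leq := compile 2 (let a := 1 in let b := 0 in
  CASE a OF NIL => htt | (_h, a') => CASE b OF NIL => hnil | (_k, b') => fLEQ @[a'; b']).
Definition code_split := compile 1 (let F := 0 in
  CASE F OF NIL => hnil | (c, F') =>
  LET h := fHALF @[c] IN
  hcons (fTAKE @[h; c]) (hcons (fDROP @[h; c]) (fSPLIT @[F']))).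
(** Cutting stops once the chunks are at most as long as they are numerous. Their number M is then
    at most twice their length s, and y, of order 4s modulo y^(2s) + 1, provides the roots of unity
    for a product modulo x^M + 1. *)
Definition code_chunk := compile 1 (let F := 0 in
  IF fLEQ @[hhd F; F] THEN F ELSE fCHUNK @[fSPLIT @[F]]).
(** [c - c] is a chunk of zeros. Doubling the chunks makes room for the product of two of them, so
    that nothing wraps around. *)
Definition code_padm := compile 1 (let F := 0 in
  CASE F OF NIL => hnil | (c, F') => hcons (fAPP @[c; fVAS @[htt; c; c]]) (fPADM @[F'])).
(** Substitution of x = y^s in a polynomial with coefficients of length 2s: the upper half of each
    coefficient overlaps the lower half of the next. *)
Definition code_ov := compile 2 (let h := 1 in let C := 0 in
  CASE C OF NIL => hnil | (c, C') =>
  LET k := fHALF @[c] IN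
  fAPP @[fVAS @[hnil; fTAKE @[k; c]; h]; fOV @[fDROP @[k; c]; C']]).
Definition code_last := compile 1 (let C := 0 in
  CASE C OF NIL => hnil | (c, C') => CASE C' OF NIL => c | (_h, _t) => fLAST @[C']).
(* Product in R[x] / (x^M - y^-|e|), where R = (Z/2^w)[y] / (y^N + 1): the modulus factors as
   (x^(M/2) - y^-|h|) (x^(M/2) + y^-|h|).  The two products are recombined without halving, so the result
   is scaled by a power of two. *)
Definition code_mulmod := compile 3 (let e := 2 in let F := 1 in let G := 0 in
  CASE F OF NIL => hnil | (f, F') =>
  CASE F' OF NIL => hcons (fPMUL @[f; hhd G]) hnil | (_h, _t) =>
  LET h := fHALF @[e] IN
  LET k := fHALF @[F] IN
  LET F0 := fTAKE @[k; F] IN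
  LET G0 := fTAKE @[k; G] IN
  LET F1 := fMROT @[h; fDROP @[k; F]] IN
  LET G1 := fMROT @[h; fDROP @[k; G]] IN
  LET C1 := fMULMOD @[h; fMAS @[hnil; F0; F1]; fMAS @[hnil; G0; G1]] IN
  LET C2 := fMULMOD @[fAPP @[h; f]; fMAS @[htt; F0; F1]; fMAS @[htt; G0; G1]] IN
  fAPP @[fMAS @[hnil; C1; C2]; fMROT @[fDROP @[h; f]; fMAS @[htt; C2; C1]]]).
Definition hfour := hcons hnil (hcons hnil (hcons hnil (hcons hnil hnil))).
(** One step of Nussbaumer's recursion. The exponent passed to [fMULMOD] is a padded chunk, of
    length S, and y^-S = -1 makes the modulus x^M + 1. After substitution the upper half [t] of the
    last coefficient wraps around with a minus sign, whence the initial overlap [- t]. *)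
Definition code_pmul := compile 2 (let f := 1 in let g := 0 in
  IF fLEQ @[f; hfour] THEN fCONV @[f; g] ELSE
  LET F := fPADM @[fCHUNK @[hcons f hnil]] IN
  LET G := fPADM @[fCHUNK @[hcons g hnil]] IN
  LET C := fMULMOD @[hhd F; F; G] IN
  LET c := fLAST @[C] IN
  LET t := fDROP @[fHALF @[c]; c] IN
  fOV @[fVAS @[htt; fVAS @[htt; t; t]; t]; C]).
Definition code_topoly := compile 3 (let L := 2 in let W := 1 in let X := 0 in
  CASE L OF NIL => hnil | (_h, L') => hcons (hcons (hhd X) W) (fTOPOLY @[L'; W; htl X])).
(** Four more bits per doubling give coefficients of 4r + 1 bits at length 2^r, enough for scaled
    coefficients, which are below 2^(3r). *)
Definition code_mklw := compile 3 (let X := 2 in let L := 1 in let W := 0 in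
  IF fLEQ @[X; L] THEN hcons L W ELSE
  fMKLW @[X; fAPP @[L; L]; hcons hnil (hcons hnil (hcons hnil (hcons hnil W)))]).
(** One low bit of [x] is dropped for each zero of [u] below its first one: for [u = 2^k] this
    divides by [2^k] without any arithmetic. *)
Definition code_unsc := compile 2 (let u := 1 in let x := 0 in
  CASE u OF NIL => x | (o, u') => IF o THEN x ELSE fUNSC @[u'; htl x]).
(** Evaluation of the coefficient list at 2, [acc] being the carry. *)
Definition code_rel := compile 3 (let u := 2 in let acc := 1 in let P := 0 in
  CASE P OF NIL => hnil | (c, P') =>
  LET s := fADDS @[hnil; hnil; fUNSC @[u; c]; acc] IN
  hcons (hhd s) (fREL @[u; htl s; P'])).
(* The power of two by which [fPMUL] scales its result is read off from the product 1 * 1. *)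
Definition code_imul := compile 2 (let X := 1 in let Y := 0 in
  CASE fMKLW @[fAPP @[X; Y]; hfour; hcons hnil (hcons hnil (hcons hnil (hcons hnil hfour)))]
  OF NIL => hnil | (L, W) =>
  LET o := fTOPOLY @[L; W; hcons htt hnil] IN
  fREL @[hhd (fPMUL @[o; o]); hnil; fPMUL @[fTOPOLY @[L; W; X]; fTOPOLY @[L; W; Y]]]).

Definition code_isz := compile 1 (let x := 0 in
  CASE x OF NIL => htt | (b, x') => IF b THEN hnil ELSE fISZ @[x']).
(* [TRYB b P] is [b * P] if that still fits in the length of [P], and [P] otherwise. *)
Definition code_tryb := compile 2 (let b := 1 in let P := 0 in
  LET Q := fIMUL @[b; P] IN
  IF fISZ @[fDROP @[P; Q]] THEN fTAKE @[P; Q] ELSE P).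
(** Raising k by one whenever b^(k+1) / 2^n still fits below 1 keeps this fraction above about 1/b,
    and hence its relative precision. *)
Definition code_norm := compile 3 (let b := 2 in let X := 1 in let l := 0 in
  LET Q := fIMUL @[b; l] IN
  IF fISZ @[fDROP @[l; Q]] THEN hcons (fTAKE @[l; fIMUL @[b; X]]) (fTAKE @[l; Q]) ELSE hcons X l).
Definition code_pow := compile 3 (let u := 2 in let b := 1 in let P := 0 in
  CASE u OF NIL => P | (_h, u') => fPOW @[u'; b; fTRYB @[b; P]]).
(** The starting power is 1, written on [|u|] bits: [u] consists of zeros, and its lowest bit is
    replaced by a one. *)
Definition code_pows := compile 2 (let u := 1 in let bs := 0 in
  CASE bs OF NIL => hnil | (b, bs') =>
  hcons (fPOW @[u; b; CASE u OF NIL => hnil | (_h, u') => hcons htt u']) (fPOWS @[u; bs'])).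
(** If P is the largest power of b below 2^L, then b^2 P^2 >= 2^(2L), so from P^2 at most one more
    factor b leads to the largest power below 2^(2L). *)
Definition code_steps := compile 2 (let bs := 1 in let Ps := 0 in
  CASE bs OF NIL => hnil | (b, bs') =>
  LET P := hhd Ps IN
  hcons (fTRYB @[b; fTAKE @[fAPP @[P; P]; fIMUL @[P; P]]]) (fSTEPS @[bs'; htl Ps])).
Definition code_levels := compile 4 (let W := 3 in let bs := 2 in let acc := 1 in let Ps := 0 in
  IF fLEQ @[W; hhd Ps] THEN hcons Ps acc ELSE
  fLEVELS @[W; bs; hcons Ps acc; fSTEPS @[bs; Ps]]).
Definition code_root := compile 3 (let g := 2 in let W := 1 in let Ps := 0 in
  CASE Ps OF NIL => hnil | (P, Ps') =>
  hcons (hcons (fAPP @[g; fTAKE @[W; fIMUL @[P; W]]]) (fAPP @[g; P])) (fROOT @[g; W; Ps'])).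
Definition code_trunc := compile 2 (let Ps := 1 in let rs := 0 in
  CASE rs OF NIL => hnil | (r, rs') =>
  CASE r OF NIL => hnil | (X, l) =>
  LET P := hhd Ps IN
  hcons (hcons (fDROP @[P; X]) (fDROP @[P; l])) (fTRUNC @[htl Ps; rs'])).
(** Appending L bits divides by 2^L, and the power P of b, just below 2^L, brings the fractions back
    to order 1. Of the two [fDROP] by [P] applied to [l], one is this division; the other shortens
    the fraction to the precision of the right child. *)
Definition code_advance := compile 4 (let bs := 3 in let Ps := 2 in let rs := 1 in let U := 0 in
  CASE rs OF NIL => hnil | (r, rs') =>
  CASE r OF NIL => hnil | (X, l) =>
  LET P := hhd Ps IN
  LET Y := fADDS @[hnil; hnil; X; fDROP @[U; fIMUL @[l; U]]] IN
  LET X' := fDROP @[P; fTAKE @[X; fIMUL @[Y; P]]] IN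
  LET l' := fTAKE @[X'; fDROP @[P; fDROP @[P; fIMUL @[l; P]]]] IN
  hcons (fNORM @[hhd bs; X'; l']) (fADVANCE @[htl bs; htl Ps; rs'; U])).
(* [U1] is found from the leading bits of the fractions [rs] alone; [U2] needs them advanced past [U1]. *)
Definition code_solve := compile 7
  (let lv := 6 in let bs := 5 in let P0 := 4 in let cs := 3 in let zq := 2 in let rs := 1 in
   let ts := 0 in
  CASE lv OF NIL =>
    LET u := fBEST @[P0; rs; ts; zq; cs; hhd cs; fCOST @[P0; rs; ts; hhd cs; zq]] IN
    hcons u (fINCRS @[zq; P0; rs; ts; u])
  | (Ps, lv') =>
    CASE fSOLVE @[lv'; bs; P0; cs; zq; fTRUNC @[Ps; rs]; ts] OF NIL => hnil | (U1, t1) =>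
    CASE fSOLVE @[lv'; bs; P0; cs; zq; fADVANCE @[bs; Ps; rs; U1]; t1] OF NIL => hnil | (U2, t2) =>
    hcons (fAPP @[U2; U1]) t2).
Definition code_word := compile 3 (let P := 2 in let r := 1 in let u := 0 in
  CASE r OF NIL => hnil | (X, l) =>
  LET Y := fADDS @[hnil; hnil; X; fDROP @[u; fIMUL @[l; u]]] IN
  fTAKE @[P; fDROP @[X; fIMUL @[P; Y]]]).
Definition code_lookup := compile 2 (let t := 1 in let k := 0 in
  CASE k OF NIL => t | (b, k') =>
  CASE t OF NIL => hnil | (x, y) => IF b THEN fLOOKUP @[y; k'] ELSE fLOOKUP @[x; k']).
Definition code_cost := compile 5 (let Ps := 4 in let rs := 3 in let ts := 2 in let u := 1 in let acc := 0 in
  CASE rs OF NIL => acc | (r, rs') =>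
  fCOST @[htl Ps; rs'; htl ts; u;
    fADDS @[hnil; hnil; acc; fLOOKUP @[hhd ts; fWORD @[hhd Ps; r; u]]]]).
Definition code_less := compile 3 (let c := 2 in let x := 1 in let y := 0 in
  CASE x OF NIL => c | (a, x') =>
  LET b := hhd y IN
  fLESS @[IF a THEN (IF b THEN c ELSE hnil) ELSE (IF b THEN htt ELSE c); x'; htl y]).
Definition code_best := compile 7 (let Ps := 6 in let rs := 5 in let ts := 4 in let zq := 3 in
  let cs := 2 in let cu := 1 in let cc := 0 in
  CASE cs OF NIL => cu | (u, cs') =>
  LET c := fCOST @[Ps; rs; ts; u; zq] IN
  IF fLESS @[hnil; c; cc] THEN fBEST @[Ps; rs; ts; zq; cs'; u; c]
  ELSE fBEST @[Ps; rs; ts; zq; cs'; cu; cc]).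
(** The new counter is zero plus the old one plus a carry, computed on the width of [zq]: all
    counters get the same width, and an absent one counts as 0. *)
Definition code_incr := compile 3 (let zq := 2 in let t := 1 in let k := 0 in
  CASE k OF NIL => fADDS @[hnil; htt; zq; t] | (b, k') =>
  IF b THEN hcons (hhd t) (fINCR @[zq; htl t; k'])
  ELSE hcons (fINCR @[zq; hhd t; k']) (htl t)).
Definition code_incrs := compile 5 (let zq := 4 in let Ps := 3 in let rs := 2 in let ts := 1 in let u := 0 in
  CASE rs OF NIL => hnil | (r, rs') =>
  hcons (fINCR @[zq; hhd ts; fWORD @[hhd Ps; r; u]]) (fINCRS @[zq; htl Ps; rs'; htl ts; u])).
Definition code_words := compile 1 (let l := 0 in
  CASE l OF NIL => hcons hnil hnil | (_h, l') =>
  LET w := fWORDS @[l'] IN fAPP @[fMAPC @[hnil; w]; fMAPC @[htt; w]]).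
Definition code_mapc := compile 2 (let b := 1 in let w := 0 in
  CASE w OF NIL => hnil | (x, w') => hcons (hcons b x) (fMAPC @[b; w'])).
Definition code_rev := compile 2 (let x := 1 in let acc := 0 in
  CASE x OF NIL => acc | (h, t) => fREV @[t; hcons h acc]).
Definition code_rpt := compile 2 (let a := 1 in let b := 0 in
  CASE a OF NIL => hnil | (_h, a') => fAPP @[b; fRPT @[a'; b]]).
(** The state is (W, l, bases, t) with l and t in unary; a list of t * t zeros gives both the guard
    bits and the zero counter. W has its lowest bit first, so new bits are reversed for printing.
    The first round, on [Leaf], prints sixteen zeros and sets l = 1, base 2 and t = 16. *)
Definition code_main := compile 1 (let st := 0 in
  CASE st OF NIL =>
    LET x := fAPP @[hfour; hfour] IN
    LET y := fAPP @[x; x] IN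
    hcons y (hcons (hcons y (hcons (hcons hnil hnil)
      (hcons (hcons (hcons hnil (hcons htt hnil)) hnil) y))) hnil)
  | (W, p) => CASE p OF NIL => hnil | (l, q) => CASE q OF NIL => hnil | (bs, t) =>
    LET g := fRPT @[t; t] IN
    LET cs := fWORDS @[l] IN
    LET P0 := fPOWS @[l; bs] IN
    CASE fLEVELS @[W; bs; hnil; P0] OF NIL => hnil | (Ps, lv) =>
    CASE fSOLVE @[lv; bs; P0; cs; g; fROOT @[g; W; Ps]; hnil] OF NIL => hnil | (U, _t) =>
    hcons (fREV @[U; hnil]) (hcons (hcons (fAPP @[U; W])
      (IF fLEQ @[cs; t] THEN
         hcons (fAPP @[l; l])
           (hcons (hcons (fADDS @[hnil; htt; fAPP @[hhd bs; hcons hnil hnil]; hnil]) bs) (hcons hnil t))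
       ELSE hcons l (hcons bs (hcons hnil t)))) hnil)).

Definition prog : list exp :=
  [code_main; code_adds; code_vas; code_mas; code_app; code_take; code_drop; code_rot; code_mrot;
   code_half; code_smul; code_svec; code_conv; code_leq; code_split; code_chunk; code_padm; code_ov;
   code_last; code_mulmod; code_pmul; code_topoly; code_mklw; code_unsc; code_rel; code_imul;
   code_isz; code_tryb; code_norm; code_pow; code_pows; code_steps; code_levels; code_root;
   code_trunc; code_advance; code_solve; code_word; code_lookup; code_cost; code_less; code_best;
   code_incr; code_incrs; code_words; code_mapc; code_rev; code_rpt].

(** * Weakest preconditions with cost *)

Definition W (f : nat) (a : tree) (Q : tree -> nat -> Prop) : Prop :=
  exists v n, ev (table prog) (table prog f) a v n /\ Q v n.

(** Code is unfolded by recursion while calls stay behind as [W] goals, to be discharged by the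
    specification of the callee or by the induction hypothesis. *)
Fixpoint wp (e : exp) (env : tree) (Q : tree -> nat -> Prop) : Prop :=
  match e with
  | Nil => Q Leaf 1
  | Top => match env with Node h _ => Q h 1 | Leaf => False end
  | Shift e => match env with Node _ t => wp e t (fun v n => Q v (S n)) | Leaf => False end
  | Cons a b => wp a env (fun v n => wp b env (fun w m => Q (Node v w) (n + m + 3)))
  | Case a b c => wp a env (fun v n =>
      match v with
      | Leaf => wp b env (fun w m => Q w (n + m + 2))
      | Node h t => wp c (Node h (Node t env)) (fun w m => Q w (n + m + 2))
      end)
  | Call f a => wp a env (fun v n => W f v (fun w m => Q w (n + m + 2)))
  end.

Lemma wp_sound e : forall env Q, wp e env Q -> exists v n, ev (table prog) e env v n /\ Q v n.
Proof.
  induction e; simpl; intros env Q h.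
  - eauto using ev.
  - destruct env; [tauto|]. eauto using ev.
  - destruct env; [tauto|]. apply IHe in h. destruct h as (v & n & h1 & h2). eauto using ev.
  - apply IHe1 in h. destruct h as (v & n & h1 & h2).
    apply IHe2 in h2. destruct h2 as (w & m & h2 & h3). eauto using ev.
  - apply IHe1 in h. destruct h as (v & n & h1 & h2). destruct v.
    + apply IHe2 in h2. destruct h2 as (w & m & h2 & h3). eauto using ev.
    + apply IHe3 in h2. destruct h2 as (w & m & h2 & h3). eauto using ev.
  - apply IHe in h. destruct h as (v & n & h1 & (w & m & h2 & h3)). eauto using ev.
Qed.

Lemma W_intro f a Q : wp (table prog f) a Q -> W f a Q.
Proof. apply wp_sound. Qed.

Lemma W_mono f a (Q Q' : tree -> nat -> Prop) : W f a Q -> (forall v n, Q v n -> Q' v n) -> W f a Q'.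
Proof. intros (v & n & h1 & h2) h. exists v, n. auto. Qed.

Arguments W : simpl never.

Ltac body := apply W_intro;
  match goal with |- wp ?t _ _ => let t' := eval vm_compute in t in change t with t' end;
  cbn [wp].

(** * Fast multiplication *)

Notation B := (tl_of b2t).
Notation V := (tl_of B).
Notation MX := (tl_of V).
Notation "<< x ; .. ; y >>" := (Node x .. (Node y Leaf) ..).
Notation ok x b := (fun r n => r = x /\ n <= b).

Ltac use L := eapply W_mono; [eapply L |
  let r := fresh "r" in let n := fresh "n" in let e := fresh in let b := fresh "b" in
  cbv beta; intros r n [e b]; subst r; cbn [wp tl_of]].
Ltac done_ := cbn [tl_of b2t]; split; [reflexivity | cbn [length] in *; try lia].

Fixpoint adds (s c : bool) (xs ys : list bool) : list bool :=
  match xs with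
  | [] => []
  | x :: xs => let y := xorb s (hd false ys) in
      xorb x (xorb y c) :: adds s (if x then (if y then true else c) else (if y then c else false)) xs (tl ys)
  end.

Lemma W_adds xs : forall s c ys,
  W fADDS <<b2t s; b2t c; B xs; B ys>> (ok (B (adds s c xs ys)) (200 * (length xs + 1))).
Proof.
  induction xs as [|x xs IH]; intros s c ys; body.
  - done_.
  - cbn [tl_of].
    destruct ys as [|y ys]; cbn [tl_of].
    + destruct s, x, c; cbn [b2t wp tl_of]; eapply W_mono;
      match goal with |- W _ <<?a; ?b; _; _>> _ =>
        first [apply (IH true true []) | apply (IH true false []) | apply (IH false true []) | apply (IH false false [])]
      | |- _ => cbv beta; intros r n [-> hn]; split; [reflexivity|cbn [length]; lia] end.
    + destruct s, x, y, c; cbn [b2t wp tl_of]; eapply W_mono;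
      match goal with |- W _ <<?a; ?b; _; _>> _ =>
        first [apply (IH true true ys) | apply (IH true false ys) | apply (IH false true ys) | apply (IH false false ys)]
      | |- _ => cbv beta; intros r n [-> hn]; split; [reflexivity|cbn [length]; lia] end.
Qed.

Lemma W_app {A} (f : A -> tree) x y :
  W fAPP <<tl_of f x; tl_of f y>> (ok (tl_of f (x ++ y)) (50 * (length x + 1))).
Proof.
  induction x as [|a x IH]; body; cbn [tl_of].
  - done_.
  - use IH. done_.
Qed.

Lemma W_take {A C} (g : C -> tree) (f : A -> tree) u : forall x,
  W fTAKE <<tl_of g u; tl_of f x>> (ok (tl_of f (firstn (length u) x)) (60 * (length u + 1))).
Proof.
  induction u as [|a u IH]; intros [|b x]; body; cbn [tl_of]; try (done_; fail).
  use IH. done_.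
Qed.

Lemma W_drop {A C} (g : C -> tree) (f : A -> tree) u : forall x,
  W fDROP <<tl_of g u; tl_of f x>> (ok (tl_of f (skipn (length u) x)) (60 * (length u + 1))).
Proof.
  induction u as [|a u IH]; intros [|b x]; body; cbn [tl_of]; try (done_; fail).
  use IH. done_.
Qed.

Fixpoint halve {A} (x : list A) : list A :=
  match x with a :: _ :: x => a :: halve x | _ => [] end.

Lemma W_half {A} (f : A -> tree) : forall x,
  W fHALF <<tl_of f x>> (ok (tl_of f (halve x)) (60 * (length x + 1))).
Proof.
  fix IH 1. intros [|a [|b x]]; body; cbn [tl_of]; try (done_; fail).
  use (IH x). done_.
Qed.

Lemma W_leq {A C} (f : A -> tree) (g : C -> tree) x : forall y,
  W fLEQ <<tl_of f x; tl_of g y>> (ok (b2t (length x <=? length y)) (60 * (length x + 1))).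
Proof.
  induction x as [|a x IH]; intros [|b y]; body; cbn [tl_of]; try (done_; fail).
  use IH. done_.
Qed.

Fixpoint vas (s : bool) (f g : list (list bool)) :=
  match f with [] => [] | x :: f => adds s s x (hd [] g) :: vas s f (tl g) end.

Definition vlen w (f : list (list bool)) := Forall (fun x => length x = w) f.
Definition mlen w S (F : list (list (list bool))) := Forall (fun f => length f = S /\ vlen w f) F.

Lemma adds_length xs : forall s c ys, length (adds s c xs ys) = length xs.
Proof. induction xs; simpl; auto. Qed.

Lemma vas_length f : forall s g, length (vas s f g) = length f.
Proof. induction f; simpl; auto. Qed.

Lemma vas_vlen w f : forall s g, vlen w f -> vlen w (vas s f g).
Proof.
  induction f; simpl; intros s g h; constructor; inversion h; subst; auto.
  - now rewrite adds_length.
  - now apply IHf.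
Qed.

Lemma W_vas w f : vlen w f -> forall s g,
  W fVAS <<b2t s; V f; V g>> (ok (V (vas s f g)) (300 * (w + 1) * (length f + 1))).
Proof.
  induction 1 as [|x f hx hf IH]; intros s g; body; cbn [tl_of].
  - done_.
  - destruct g as [|y g]; cbn [tl_of].
    + use (W_adds x s s []). use (IH s []). done_.
    + use (W_adds x s s y). use (IH s g). done_.
Qed.

Fixpoint mas (s : bool) (F G : list (list (list bool))) :=
  match F with [] => [] | x :: F => vas s x (hd [] G) :: mas s F (tl G) end.

Lemma W_mas w S F : mlen w S F -> forall s G,
  W fMAS <<b2t s; MX F; MX G>> (ok (MX (mas s F G)) (400 * ((w + 1) * (S + 1)) * (length F + 1))).
Proof.
  induction 1 as [|x f [hx hx'] hf IH]; intros s g; body; cbn [tl_of].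
  - done_.
  - destruct g as [|y g]; cbn [tl_of].
    + use (W_vas w x hx' s []). use (IH s []). done_.
    + use (W_vas w x hx' s y). use (IH s g). done_.
Qed.

Definition vneg f := vas true (vas true f f) f.
Definition nrot e f := skipn e f ++ vneg (firstn e f).

Lemma vlen_app w f g : vlen w f -> vlen w g -> vlen w (f ++ g).
Proof. intros. apply Forall_app; auto. Qed.
Lemma vlen_firstn w f n : vlen w f -> vlen w (firstn n f).
Proof. intros h. revert n. induction h; destruct n; simpl; constructor; auto. apply IHh. Qed.
Lemma vlen_skipn w f n : vlen w f -> vlen w (skipn n f).
Proof. intros h. revert n. induction h; destruct n; simpl; auto; constructor; auto. Qed.
Lemma vneg_vlen w f : vlen w f -> vlen w (vneg f).
Proof. intros. now repeat apply vas_vlen. Qed.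
Lemma vneg_length f : length (vneg f) = length f.
Proof. unfold vneg. now rewrite !vas_length. Qed.
Lemma rot_vlen w f e : vlen w f -> vlen w (nrot e f).
Proof. intros. apply vlen_app; [now apply vlen_skipn|apply vneg_vlen; now apply vlen_firstn]. Qed.
Lemma rot_length e f : length (nrot e f) = length f.
Proof. unfold nrot. rewrite length_app, vneg_length, length_skipn, length_firstn. lia. Qed.

Lemma W_rot {C} (g : C -> tree) w f e : vlen w f -> length e <= length f ->
  W fROT <<tl_of g e; V f>> (ok (V (nrot (length e) f)) (1000 * (w + 1) * (length f + 1))).
Proof.
  intros hf he. body.
  use (W_take g B e f). use (W_drop g B e f).
  assert (hv : vlen w (firstn (length e) f)) by now apply vlen_firstn.
  change (Node Leaf Leaf) with (b2t true).
  use (W_vas w _ hv true). use (W_vas w _ (vas_vlen w _ true (firstn (length e) f) hv) true).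
  use (W_app B). split; [reflexivity|].
  rewrite vas_length, length_firstn in *. rewrite length_skipn in *.
  replace (Nat.min (length e) (length f)) with (length e) in * by lia. nia.
Qed.

Lemma mrot_mlen w S F e : mlen w S F -> mlen w S (map (nrot e) F).
Proof.
  induction 1 as [|f F [h1 h2] h IH]; simpl; constructor; auto.
  split; [now rewrite rot_length|now apply rot_vlen].
Qed.

Lemma W_mrot {C} (g : C -> tree) w S F e : mlen w S F -> length e <= S ->
  W fMROT <<tl_of g e; MX F>>
    (ok (MX (map (nrot (length e)) F)) (1100 * ((w + 1) * (S + 1)) * (length F + 1))).
Proof.
  intros hF he. induction hF as [|f F [h1 h2] h IH]; body; cbn [tl_of].
  - done_.
  - use (W_rot g w f e); [auto|lia|]. use IH. cbn [map tl_of]. split; [reflexivity|]. cbn [length].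
    rewrite h1 in *. nia.
Qed.

Fixpoint smul (x y : list bool) : list bool :=
  match x with
  | [] => adds true true y y
  | b :: x => let r := smul x (adds false false y y) in if b then adds false false y r else r
  end.

Lemma smul_length x : forall y, length (smul x y) = length y.
Proof.
  induction x as [|[] x IH]; intros y; simpl; rewrite ?adds_length; auto.
  now rewrite IH, adds_length.
Qed.

Lemma W_smul x : forall y, W fSMUL <<B x; B y>> (ok (B (smul x y)) (600 * (length y + 1) * (length x + 1))).
Proof.
  induction x as [|b x IH]; intros y; body; cbn [tl_of].
  - use (W_adds y true true y). done_.
  - use (W_adds y false false y). use IH. rewrite adds_length in *. destruct b; cbn [b2t].
    + use (W_adds y false false (smul x (adds false false y y))). done_.
    + done_.
Qed.

Lemma W_svec w a g : length a = w -> vlen w g ->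
  W fSVEC <<B a; V g>> (ok (V (map (smul a) g)) (700 * ((w + 1) * (w + 1)) * (length g + 1))).
Proof.
  intros ha. induction 1 as [|x g hx hg IH]; body; cbn [tl_of].
  - done_.
  - use (W_smul a x). use IH. cbn [map tl_of]. split; [reflexivity|]. cbn [length]. subst w.
    rewrite hx in *. nia.
Qed.

Fixpoint conv (f g : list (list bool)) : list (list bool) :=
  match f with
  | [] => vas true g g
  | a :: f => let r := conv f g in vas false (map (smul a) g) (vneg (nrot (length (tl r)) r))
  end.

Lemma svec_vlen w a g : vlen w g -> vlen w (map (smul a) g).
Proof. induction 1; simpl; constructor; auto. now rewrite smul_length. Qed.

Lemma conv_length f g : length (conv f g) = length g.
Proof. destruct f; simpl; rewrite vas_length, ?length_map; auto. Qed.

Lemma conv_vlen w f g : vlen w g -> vlen w (conv f g).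
Proof. destruct f; simpl; intros; apply vas_vlen; auto. now apply svec_vlen. Qed.

Lemma W_conv w f g : vlen w f -> vlen w g ->
  W fCONV <<V f; V g>> (ok (V (conv f g))
    (4000 * ((w + 1) * (w + 1) * (length g + 1)) * (length f + 1))).
Proof.
  intros hf hg. induction hf as [|x f hx hf IH]; body; cbn [tl_of].
  - change (Node Leaf Leaf) with (b2t true). use (W_vas w _ hg true). split; [reflexivity|]. cbn [length]. nia.
  - use IH. set (r := conv f g) in *.
    assert (hr : vlen w r) by now apply conv_vlen.
    assert (lr : length r = length g) by apply conv_length.
    change (Node Leaf Leaf) with (b2t true).
    assert (ll : length (tl r) <= length r) by (destruct r; simpl; lia).
    set (q := nrot (length (tl r)) r).
    assert (hq : vlen w q) by now apply rot_vlen.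
    assert (lq : length q = length g) by (unfold q; now rewrite rot_length).
    assert (sv : vlen w (map (smul x) g)) by now apply svec_vlen.
    destruct r as [|r0 r'] eqn:hr0; cbn [tl_of].
    + use (W_rot B w [] []); [constructor|simpl; lia|]. fold q.
      use (W_vas w q hq true). use (W_vas w _ (vas_vlen w _ true q hq) true).
      use (W_svec w x g hx hg). use (W_vas w _ sv false).
      split; [cbn [conv]; fold r; rewrite hr0; reflexivity|].
      rewrite ?vas_length, ?length_map, ?lq in *. simpl length in *. nia.
    + use (W_rot B w (r0 :: r') r' hr); [simpl; lia|].
      change (nrot (length r') (r0 :: r')) with q.
      use (W_vas w q hq true). use (W_vas w _ (vas_vlen w _ true q hq) true).
      use (W_svec w x g hx hg). use (W_vas w _ sv false).
      split; [cbn [conv]; fold r; rewrite hr0; reflexivity|].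
      rewrite ?vas_length, ?length_map, ?lq, ?lr in *. simpl length. nia.
Qed.

Lemma half_length {A} : forall x : list A, length (halve x) = Nat.div2 (length x).
Proof. fix IH 1. intros [|a [|b x]]; simpl; auto. Qed.

Lemma div2_le n : Nat.div2 n <= n.
Proof. pose proof (Nat.div2_odd n). destruct (Nat.odd n); simpl in *; lia. Qed.

Fixpoint split2 {A} (F : list (list A)) : list (list A) :=
  match F with
  | [] => []
  | c :: F => firstn (length (halve c)) c :: skipn (length (halve c)) c :: split2 F
  end.

Lemma W_split S F : Forall (fun f => length f = S) F ->
  W fSPLIT <<MX F>> (ok (MX (split2 F)) (300 * (S + 1) * (length F + 1))).
Proof.
  induction 1 as [|c F hc hF IH]; body; cbn [tl_of].
  - done_.
  - use (W_half B c). use (W_take B B (halve c) c). use (W_drop B B (halve c) c). use IH.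
    split; [reflexivity|]. rewrite half_length in *. pose proof (div2_le (length c)).
    cbn [length]. rewrite hc in *. lia.
Qed.

Fixpoint chunk {A} (k : nat) (F : list (list A)) : list (list A) :=
  match k with
  | 0 => F
  | S k => if length (hd [] F) <=? length F then F else chunk k (split2 F)
  end.

Lemma split2_length {A} (F : list (list A)) : length (split2 F) = 2 * length F.
Proof. induction F; simpl; lia. Qed.

Lemma split2_even {A} n (F : list (list A)) : Forall (fun f => length f = 2 * n) F ->
  Forall (fun f => length f = n) (split2 F).
Proof.
  induction 1 as [|c F hc hF IH]; cbn [split2]; constructor; [|constructor; [|auto]].
  - rewrite length_firstn, half_length, hc, Nat.div2_double. lia.
  - rewrite length_skipn, half_length, hc, Nat.div2_double. lia.
Qed.

Lemma split2_concat {A} (F : list (list A)) : concat (split2 F) = concat F.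
Proof.
  induction F; cbn [split2 concat]; auto. now rewrite app_assoc, firstn_skipn, IHF.
Qed.

Lemma Forall_hd {A} (P : A -> Prop) d F : Forall P F -> F <> [] -> P (hd d F).
Proof. destruct 1; simpl; tauto. Qed.

(** Each cut moves one factor 2 from the length to the number of chunks and keeps their product.
    Stopping as soon as [b <= a] leaves the exponents at most one apart. *)
Lemma chunk_spec {A} k : forall a b (F : list (list A)), length F = 2 ^ a -> Forall (fun f => length f = 2 ^ b) F ->
  a <= b + 1 -> b <= a + k ->
  exists a' b', a' + b' = a + b /\ b' <= a' <= b' + 1 /\ length (chunk k F) = 2 ^ a' /\
    Forall (fun f => length f = 2 ^ b') (chunk k F) /\ concat (chunk k F) = concat F.
Proof.
  induction k as [|k IH]; intros a b F h1 h2 h3 h4; cbn [chunk].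
  - exists a, b. repeat split; auto; lia.
  - assert (hd0 : length (hd [] F) = 2 ^ b).
    { apply (Forall_hd (fun f => length f = 2 ^ b)); auto. intros ->. simpl in h1.
      pose proof (Nat.pow_nonzero 2 a). lia. }
    rewrite hd0, h1. destruct (Nat.leb_spec (2 ^ b) (2 ^ a)) as [l|l].
    + exists a, b. apply Nat.pow_le_mono_r_iff in l; [|lia]. repeat split; auto; lia.
    + apply Nat.pow_lt_mono_r_iff in l; [|lia]. destruct b as [|b]; [lia|].
      destruct (IH (S a) b (split2 F)) as (a' & b' & e1 & e2 & e3 & e4 & e5).
      * rewrite split2_length, h1. reflexivity.
      * now apply split2_even.
      * lia.
      * lia.
      * exists a', b'. rewrite split2_concat in e5. repeat split; auto; lia.
Qed.

Lemma W_chunk k : forall a b F, length F = 2 ^ a -> Forall (fun f => length f = 2 ^ b) F -> b <= a + k ->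
  W fCHUNK <<MX F>> (ok (MX (chunk k F)) (2000 * 2 ^ (a + b) * (k + 1))).
Proof.
  induction k as [|k IH]; intros a b F h1 h2 h4; body;
    assert (hd0 : length (hd [] F) = 2 ^ b) by
     (apply (Forall_hd (fun f => length f = 2 ^ b)); auto; intros ->; simpl in h1;
      pose proof (Nat.pow_nonzero 2 a); lia);
    assert (pa : 1 <= 2 ^ a) by (pose proof (Nat.pow_nonzero 2 a); lia);
    assert (pb : 1 <= 2 ^ b) by (pose proof (Nat.pow_nonzero 2 b); lia);
    destruct F as [|f F]; try (simpl in h1; lia); cbn [tl_of];
    change (Node (V f) (MX F)) with (MX (f :: F));
    use (W_leq B V f (f :: F)); cbn [chunk hd] in *; rewrite Nat.pow_add_r.
  - rewrite hd0, h1 in *.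
    assert (2 ^ b <= 2 ^ a) by (apply Nat.pow_le_mono_r; lia).
    destruct (Nat.leb_spec (2 ^ b) (2 ^ a)); [|lia]. cbn [b2t]. split; [reflexivity|]. nia.
  - rewrite hd0, h1 in *.
    destruct (Nat.leb_spec (2 ^ b) (2 ^ a)) as [l|l]; cbn [b2t].
    + split; [reflexivity|]. nia.
    + change (Node (V f) (MX F)) with (MX (f :: F)).
      use (W_split (2 ^ b) (f :: F) h2).
      apply Nat.pow_lt_mono_r_iff in l; [|lia]. destruct b as [|b]; [lia|].
      use (IH (S a) b (split2 (f :: F))).
      * rewrite split2_length, h1. reflexivity.
      * now apply split2_even.
      * lia.
      * split; [reflexivity|]. rewrite h1 in *. rewrite <- Nat.pow_add_r in *.
        replace (S a + b) with (a + S b) in * by lia. rewrite Nat.pow_add_r in *. nia.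
Qed.

Definition pad (f : list (list bool)) := f ++ vas true f f.

Lemma W_padm w S F : mlen w S F -> W fPADM <<MX F>>
  (ok (MX (map pad F)) (400 * ((w + 1) * (S + 1)) * (length F + 1))).
Proof.
  induction 1 as [|f F [h1 h2] h IH]; body; cbn [tl_of].
  - done_.
  - change (Node Leaf Leaf) with (b2t true). use (W_vas w f h2 true f). use (W_app B f). use IH.
    cbn [map tl_of]. split; [reflexivity|]. cbn [length]. rewrite h1 in *. nia.
Qed.

Fixpoint ov (h : list (list bool)) (C : list (list (list bool))) : list (list bool) :=
  match C with
  | [] => []
  | c :: C => let k := length (halve c) in vas false (firstn k c) h ++ ov (skipn k c) C
  end.

Lemma W_ov w S C : mlen w S C -> forall h,
  W fOV <<V h; MX C>> (ok (V (ov h C)) (800 * ((w + 1) * (S + 1)) * (length C + 1))).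
Proof.
  induction 1 as [|c C [h1 h2] hC IH]; intros h; body; cbn [tl_of].
  - done_.
  - use (W_half B c). use (W_take B B (halve c) c).
    change Leaf with (b2t false) at 1. use (W_vas w _ (vlen_firstn w c (length (halve c)) h2) false h).
    use (W_drop B B (halve c) c). use IH. use (W_app B).
    split; [reflexivity|]. rewrite ?vas_length, ?length_firstn, ?half_length in *.
    pose proof (div2_le S). cbn [length]. rewrite h1 in *.
    replace (Nat.min (Nat.div2 S) S) with (Nat.div2 S) in * by lia.
    assert ((w + 1) * (Nat.div2 S + 1) <= (w + 1) * (S + 1)) by (apply Nat.mul_le_mono_l; lia).
    assert (S + 1 <= (w + 1) * (S + 1)) by lia. lia.
Qed.

Lemma W_last C : W fLAST <<MX C>> (ok (V (last C [])) (60 * (length C + 1))).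
Proof.
  induction C as [|c [|d C] IH]; body; cbn [tl_of]; try (done_; fail).
  change (Node (V d) (MX C)) with (MX (d :: C)). use IH. done_.
Qed.

Fixpoint mulmod (pm : list (list bool) -> list (list bool) -> list (list bool)) (m e : nat)
  (F G : list (list (list bool))) : list (list (list bool)) :=
  match m with
  | 0 => [pm (hd [] F) (hd [] G)]
  | S m =>
    let h := Nat.div2 e in
    let k := Nat.div2 (length F) in
    let F1 := map (nrot h) (skipn k F) in
    let G1 := map (nrot h) (skipn k G) in
    let C1 := mulmod pm m h (mas false (firstn k F) F1) (mas false (firstn k G) G1) in
    let C2 := mulmod pm m (h + length (hd [] F)) (mas true (firstn k F) F1) (mas true (firstn k G) G1) in
    mas false C1 C2 ++ map (nrot (length (hd [] F) - h)) (mas true C2 C1)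
  end.

Definition mat w S M F := length F = M /\ mlen w S F.

Lemma mas_length F : forall s G, length (mas s F G) = length F.
Proof. induction F; simpl; auto. Qed.
Lemma mas_mlen w S F : mlen w S F -> forall s G, mlen w S (mas s F G).
Proof.
  induction 1 as [|f F [h1 h2] h IH]; intros s G; simpl; constructor; auto.
  - split; [now rewrite vas_length|now apply vas_vlen].
  - apply IH.
Qed.
Lemma mat_mas w S M s F G : mat w S M F -> mat w S M (mas s F G).
Proof. intros [h1 h2]. split; [now rewrite mas_length|now apply mas_mlen]. Qed.
Lemma mat_rot w S M e F : mat w S M F -> mat w S M (map (nrot e) F).
Proof. intros [h1 h2]. split; [now rewrite length_map|now apply mrot_mlen]. Qed.
Lemma mlen_firstn w S F n : mlen w S F -> mlen w S (firstn n F).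
Proof. intros h. revert n. induction h; destruct n; simpl; constructor; auto. apply IHh. Qed.
Lemma mlen_skipn w S F n : mlen w S F -> mlen w S (skipn n F).
Proof. intros h. revert n. induction h; destruct n; simpl; auto; constructor; auto. Qed.
Lemma mat_firstn w S m F : mat w S (2 * m) F -> mat w S m (firstn m F).
Proof. intros [h1 h2]. split; [rewrite length_firstn; lia|now apply mlen_firstn]. Qed.
Lemma mat_skipn w S m F : mat w S (2 * m) F -> mat w S m (skipn m F).
Proof. intros [h1 h2]. split; [rewrite length_skipn; lia|now apply mlen_skipn]. Qed.
Lemma mat_app w S m F G : mat w S m F -> mat w S m G -> mat w S (2 * m) (F ++ G).
Proof. intros [h1 h2] [h3 h4]. split; [rewrite length_app; lia|now apply Forall_app]. Qed.
Lemma mat_hd w S M F : mat w S M F -> 1 <= M -> length (hd [] F) = S /\ vlen w (hd [] F).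
Proof. intros [h1 h2] h. apply (Forall_hd (fun f => length f = S /\ vlen w f)); auto. intros ->; simpl in h1; lia. Qed.

Lemma mulmod_mat pm w S : (forall f g, length f = S -> vlen w f -> length g = S -> vlen w g ->
    length (pm f g) = S /\ vlen w (pm f g)) ->
  forall m e F G, mat w S (2 ^ m) F -> mat w S (2 ^ m) G -> mat w S (2 ^ m) (mulmod pm m e F G).
Proof.
  intros hpm. induction m as [|m IH]; intros e F G hF hG; cbn [mulmod].
  - destruct (mat_hd _ _ _ _ hF ltac:(simpl; lia)). destruct (mat_hd _ _ _ _ hG ltac:(simpl; lia)).
    split; [reflexivity|]. repeat constructor; apply hpm; auto.
  - pose proof (proj1 hF) as lF. rewrite lF. rewrite Nat.pow_succ_r' in *. rewrite Nat.div2_double.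
    apply mat_app; [|apply mat_rot]; apply mat_mas; apply IH; apply mat_mas; now apply mat_firstn.
Qed.

(** Unary numbers mix items of different kinds, as in [fAPP @[h; f]]. Seeing every item as a bare
    tree gives them a common type. *)
Lemma tl_of_id {A} (f : A -> tree) l : tl_of f l = tl_of (fun t => t) (map f l).
Proof. induction l; simpl; congruence. Qed.

Notation U := (tl_of (fun t : tree => t)).

(** [TS] is the cost of one product of coefficients, and there are [2 ^ m] of them. Each of the [m]
    levels adds work linear in the size of the whole array. *)
Lemma W_mulmod pm w S TS : 1 <= S ->
  (forall f g, length f = S -> vlen w f -> length g = S -> vlen w g ->
    length (pm f g) = S /\ vlen w (pm f g)) ->
  (forall f g, length f = S -> vlen w f -> length g = S -> vlen w g ->
    W fPMUL <<V f; V g>> (ok (V (pm f g)) TS)) ->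
  forall m e F G, length e <= 2 * S -> mat w S (2 ^ m) F -> mat w S (2 ^ m) G ->
  W fMULMOD <<U e; MX F; MX G>> (ok (MX (mulmod pm m (length e) F G))
     (2 ^ m * (TS + 100) + 5000 * 2 * ((w + 1) * (S + 1)) * (m * 2 ^ m))).
Proof.
  intros hS hl hW. induction m as [|m IH]; intros e F G he hF hG.
  - destruct hF as [h1 h2]. destruct hG as [h3 h4]. simpl in h1, h3.
    destruct F as [|f [|f' F]]; try discriminate. destruct G as [|g [|g' G]]; try discriminate.
    inversion h2 as [|? ? [q1 q2]]. inversion h4 as [|? ? [q3 q4]]. subst.
    body. cbn [tl_of]. use (hW f g); auto. split; [reflexivity|]. change (2 ^ 0) with 1. lia.
  - pose proof hF as [h1 h2]. pose proof hG as [h3 h4]. rewrite Nat.pow_succ_r' in *.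
    assert (p2 : 1 <= 2 ^ m) by (pose proof (Nat.pow_nonzero 2 m); lia).
    pose proof (mulmod_mat pm w S hl m) as MM.
    pose proof (mat_hd _ _ _ _ hF ltac:(lia)) as [hd1 hd2].
    destruct F as [|f [|f' F]]; try (simpl in h1; lia). set (FF := f :: f' :: F) in *.
    assert (eF : MX FF = Node (V f) (Node (V f') (MX F))) by reflexivity.
    body. rewrite eF. cbv iota. cbn [tl_of]. rewrite <- eF.
    use (W_half (fun t : tree => t) e). use (W_half V FF).
    use (W_take V V (halve FF) FF). use (W_take V V (halve FF) G).
    use (W_drop V V (halve FF) FF).
    set (h := halve e) in *. assert (lh : length h = Nat.div2 (length e)) by apply half_length.
    assert (lhS : length h <= S).
    { rewrite lh. pose proof (Nat.div2_odd (length e)). destruct (Nat.odd (length e)); simpl in *; lia. }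
    assert (lk : length (halve FF) = 2 ^ m) by (rewrite half_length, h1, Nat.div2_double; reflexivity).
    rewrite !lk in *.
    pose proof (mat_firstn _ _ _ _ hF) as hF0. pose proof (mat_firstn _ _ _ _ hG) as hG0.
    pose proof (mat_skipn _ _ _ _ hF) as hF1. pose proof (mat_skipn _ _ _ _ hG) as hG1.
    use (W_mrot (fun t : tree => t) w S (skipn (2 ^ m) FF) h); [apply hF1|lia|].
    use (W_drop V V (halve FF) G). rewrite !lk in *.
    use (W_mrot (fun t : tree => t) w S (skipn (2 ^ m) G) h); [apply hG1|lia|].
    change Leaf with (b2t false) at 1.
    use (W_mas w S (firstn (2 ^ m) FF)); [apply hF0|].
    change (Node Leaf Leaf) with (b2t true). change Leaf with (b2t false) at 1.
    use (W_mas w S (firstn (2 ^ m) G)); [apply hG0|].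
    use (IH h); [lia|now apply mat_mas|now apply mat_mas|].
    rewrite (tl_of_id B f).
    use (W_app (fun t : tree => t) h (map B f)).
    use (W_mas w S (firstn (2 ^ m) FF)); [apply hF0|].
    use (W_mas w S (firstn (2 ^ m) G)); [apply hG0|].
    assert (lhf : length (h ++ map B f) = length h + S).
    { rewrite length_app, length_map. f_equal. exact hd1. }
    use (IH (h ++ map B f)); [lia|now apply mat_mas|now apply mat_mas|].
    rewrite lhf in *.
    set (F1 := map (nrot (length h)) (skipn (2 ^ m) FF)) in *.
    set (G1 := map (nrot (length h)) (skipn (2 ^ m) G)) in *.
    set (C1 := mulmod pm m (length h) _ _) in *.
    set (C2 := mulmod pm m (length h + S) _ _) in *.
    assert (m1 : mat w S (2 ^ m) C1) by (apply MM; now apply mat_mas).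
    assert (m2 : mat w S (2 ^ m) C2) by (apply MM; now apply mat_mas).
    change Leaf with (b2t false) at 1.
    use (W_mas w S C1); [apply m1|].
    use (W_drop (fun t : tree => t) (fun t : tree => t) h (map B f)).
    use (W_mas w S C2); [apply m2|].
    assert (ld : length (skipn (length h) (map B f)) = S - length h).
    { rewrite length_skipn, length_map. f_equal. exact hd1. }
    use (W_mrot (fun t : tree => t) w S (mas true C2 C1) (skipn (length h) (map B f)));
      [apply (mat_mas w S (2 ^ m)), m2|lia|].
    use (W_app V (mas false C1 C2)).
    split.
    + cbn [mulmod]. rewrite h1, Nat.div2_double, hd1, <- lh. fold F1 G1. fold C1 C2. now rewrite ld.
    + rewrite ?mas_length, ?(proj1 hF0), ?(proj1 hG0), ?(proj1 hF1), ?(proj1 hG1), ?(proj1 m1), ?(proj1 m2),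
       ?h1, ?h3 in *.
      assert (x : 2 * 2 ^ m <= (w + 1) * (S + 1) * (2 * 2 ^ m)) by nia.
      set (X := (w + 1) * (S + 1)) in *.
      assert (S + 1 <= X) by (unfold X; nia).
      set (Y := 2 ^ m) in *. assert (X <= X * Y) by nia. lia.
Qed.

Fixpoint pmul (n : nat) (f g : list (list bool)) : list (list bool) :=
  match n with
  | 0 => conv f g
  | S n => if length f <=? 4 then conv f g else
    let F := map pad (chunk (Nat.log2 (length f)) [f]) in
    let G := map pad (chunk (Nat.log2 (length g)) [g]) in
    let C := mulmod (pmul n) (Nat.log2 (length F)) (length (hd [] F)) F G in
    ov (vneg (skipn (length (halve (last C []))) (last C []))) C
  end.

Lemma chunk_vlen w k : forall F, Forall (vlen w) F -> Forall (vlen w) (chunk k F).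
Proof.
  induction k; intros F h; cbn [chunk]; auto.
  destruct (_ <=? _); auto. apply IHk. clear -h.
  induction h; cbn [split2]; constructor; [now apply vlen_firstn|constructor; [now apply vlen_skipn|auto]].
Qed.

Lemma pad_length f : length (pad f) = 2 * length f.
Proof. unfold pad. rewrite length_app, vas_length. lia. Qed.

Lemma pad_vlen w f : vlen w f -> vlen w (pad f).
Proof. intros. apply vlen_app; auto. now apply vas_vlen. Qed.

(* The shape of the two-level splitting of a polynomial of length 2^r. *)
Lemma chunk_shape w r f : length f = 2 ^ r -> vlen w f -> 3 <= r ->
  mat w (2 ^ (r / 2)) (2 ^ (r - r / 2)) (chunk (Nat.log2 (length f)) [f]) /\
  concat (chunk (Nat.log2 (length f)) [f]) = f.
Proof.
  intros lf vf hr. rewrite lf, Nat.log2_pow2 by lia.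
  destruct (chunk_spec r 0 r [f]) as (a & b & e1 & e2 & e3 & e4 & e5); try lia; auto.
  assert (b = r / 2) by (apply Nat.div_unique with (r := a - b); lia).
  replace (r - r / 2) with a by lia. rewrite <- H. simpl in e5. rewrite app_nil_r in e5.
  split; auto. split; auto.
  pose proof (chunk_vlen w r [f] ltac:(constructor; auto)) as hv.
  revert e4 hv. generalize (chunk r [f]). induction 1; intros hv; constructor; inversion hv; subst; auto.
  now apply IHe4.
Qed.

Lemma mat_pad w S M F : mat w S M F -> mat w (2 * S) M (map pad F).
Proof.
  intros [h1 h2]. split; [now rewrite length_map|].
  clear h1. induction h2 as [|f F [q1 q2] h IH]; simpl; constructor; auto.
  split; [rewrite pad_length; lia|now apply pad_vlen].
Qed.

Lemma ov_length w s C : mlen w (2 * s) C -> forall h, length (ov h C) = length C * s.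
Proof.
  induction 1 as [|c C [q1 q2] hC IH]; intros h; cbn [ov length]; auto.
  rewrite length_app, vas_length, length_firstn, IH, half_length, q1, Nat.div2_double. lia.
Qed.

Lemma ov_vlen w S C : mlen w S C -> forall h, vlen w (ov h C).
Proof.
  induction 1 as [|c C [q1 q2] hC IH]; intros h; cbn [ov]; [constructor|].
  apply vlen_app; [|apply IH]. apply vas_vlen. now apply vlen_firstn.
Qed.

Lemma half_lt r : 3 <= r -> r / 2 + 1 < r /\ 1 <= r / 2 /\ r / 2 <= r.
Proof. intros h. pose proof (Nat.div_mod_eq r 2). pose proof (Nat.mod_upper_bound r 2). lia. Qed.

Lemma pmul_shape w n : forall r f g, 2 <= r <= n + 2 -> length f = 2 ^ r -> vlen w f ->
  length g = 2 ^ r -> vlen w g -> length (pmul n f g) = 2 ^ r /\ vlen w (pmul n f g).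
Proof.
  induction n as [|n IH]; intros r f g hr lf vf lg vg; cbn [pmul].
  - split; [now rewrite conv_length|now apply conv_vlen].
  - destruct (Nat.leb_spec (length f) 4) as [l|l].
    + split; [now rewrite conv_length|now apply conv_vlen].
    + assert (h3 : 3 <= r).
      { destruct (Nat.eq_dec r 2) as [->|]; [rewrite lf in l; simpl in l; lia|lia]. }
      destruct (chunk_shape w r f lf vf h3) as [mf cf]. destruct (chunk_shape w r g lg vg h3) as [mg cg].
      apply mat_pad in mf, mg. pose proof (half_lt r h3) as hh.
      rewrite (proj1 mf), Nat.log2_pow2 by lia. rewrite <- Nat.pow_succ_r' in mf, mg.
      set (F := map pad (chunk _ [f])) in *. set (G := map pad (chunk _ [g])) in *.
      assert (mC : mat w (2 ^ S (r / 2)) (2 ^ (r - r / 2)) (mulmod (pmul n) (r - r / 2) (length (hd [] F)) F G)).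
      { apply mulmod_mat; auto. intros f' g' h1 h2 h4 h5. apply IH; auto; lia. }
      set (C := mulmod _ _ _ _ _) in *. destruct mC as [q1 q2]. split.
      * rewrite Nat.pow_succ_r' in q2. rewrite (ov_length _ _ _ q2), q1, <- Nat.pow_add_r. f_equal. lia.
      * eapply ov_vlen; eauto.
Qed.

(** Opaque, so that the arithmetic tactics never expand this large unary numeral; [D1_eq] is used
    only where its size matters. *)
Definition D1 := 50 * 2000.
Lemma D1_eq : D1 = 50 * 2000. Proof. reflexivity. Qed.
Global Opaque D1.

(** Exponent 3 in the cost: the padding doubles the total length at each level of recursion, and
    this inequality absorbs the doubling together with a linear term. With squares it would fail
    already at r = 3. *)
Lemma cube_rec r : 3 <= r -> 2 * (r / 2 + 1) ^ 3 + r <= r ^ 3.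
Proof.
  intros h. pose proof (Nat.div_mod_eq r 2) as e. pose proof (Nat.mod_upper_bound r 2 ltac:(lia)) as u.
  remember (r / 2) as x eqn:hx. clear hx. assert (r = 2 * x \/ r = 2 * x + 1) as [->| ->] by lia.
  - assert (2 <= x) by lia. simpl. nia.
  - assert (1 <= x) by lia. simpl. nia.
Qed.

Lemma pow2_pos n : 1 <= 2 ^ n.
Proof. pose proof (Nat.pow_nonzero 2 n). lia. Qed.

Lemma mul_ge_r a b : 1 <= a -> b <= a * b.
Proof. nia. Qed.

Lemma W_pmul w n : forall r f g, 2 <= r <= n + 2 -> length f = 2 ^ r -> vlen w f ->
  length g = 2 ^ r -> vlen w g ->
  W fPMUL <<V f; V g>> (ok (V (pmul n f g)) (D1 * ((w + 1) * (w + 1)) * (2 ^ r * r ^ 3))).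
Proof.
  assert (base : forall n f g, length f = 2 ^ 2 -> vlen w f -> length g = 2 ^ 2 -> vlen w g ->
    W fPMUL <<V f; V g>> (ok (V (pmul n f g)) (D1 * ((w + 1) * (w + 1)) * (2 ^ 2 * 2 ^ 3)))).
  { clear n. intros n f g lf vf lg vg. simpl in lf, lg. body.
    change (Node Leaf (Node Leaf (Node Leaf (Node Leaf Leaf)))) with (U [Leaf; Leaf; Leaf; Leaf]).
    use (W_leq B (fun t : tree => t) f [Leaf; Leaf; Leaf; Leaf]).
    rewrite lf in *. cbn [length Nat.leb b2t]. use (W_conv w f g vf vg). rewrite lf, lg in *.
    split; [destruct n; simpl; rewrite ?lf; reflexivity|].
    pose proof D1_eq. simpl Nat.pow. nia. }
  induction n as [|n IH]; intros r f g hr lf vf lg vg.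
  - replace r with 2 in * by lia. now apply base.
  - destruct (Nat.eq_dec r 2) as [->|hr2]; [now apply base|].
    assert (h3 : 3 <= r) by lia. pose proof (half_lt r h3) as hh.
    assert (f8 : 2 ^ 3 <= length f) by (rewrite lf; apply Nat.pow_le_mono_r; lia). simpl in f8.
    destruct (chunk_shape w r f lf vf h3) as [mf cf]. destruct (chunk_shape w r g lg vg h3) as [mg cg].
    pose proof (mat_pad _ _ _ _ mf) as pf. pose proof (mat_pad _ _ _ _ mg) as pg.
    rewrite <- Nat.pow_succ_r' in pf, pg.
    body. change (Node Leaf (Node Leaf (Node Leaf (Node Leaf Leaf)))) with (U [Leaf; Leaf; Leaf; Leaf]).
    use (W_leq B (fun t : tree => t) f [Leaf; Leaf; Leaf; Leaf]).
    replace (length f <=? length [Leaf; Leaf; Leaf; Leaf]) with false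
      by (symmetry; apply Nat.leb_gt; simpl; lia).
    cbn [b2t].
    change (Node (V f) Leaf) with (MX [f]). change (Node (V g) Leaf) with (MX [g]).
    assert (ll : Nat.log2 (length f) = r) by (rewrite lf; apply Nat.log2_pow2; lia).
    assert (lg2 : Nat.log2 (length g) = r) by (rewrite lg; apply Nat.log2_pow2; lia).
    rewrite ll in mf, pf. rewrite lg2 in mg, pg.
    use (W_chunk r 0 r [f]); [reflexivity|now constructor|lia|].
    use (W_padm w _ _ (proj2 mf)).
    use (W_chunk r 0 r [g]); [reflexivity|now constructor|lia|].
    use (W_padm w _ _ (proj2 mg)).
    set (F := map pad (chunk r [f])) in *. set (G := map pad (chunk r [g])) in *.
    set (ea := r - r / 2) in *. set (eb := r / 2) in *.
    pose proof (mat_hd _ _ _ _ pf (pow2_pos ea)) as [hd1 hd2].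
    assert (F <> []) by (intros e; rewrite e in pf; destruct pf as [q _]; simpl in q; pose proof (pow2_pos ea); lia).
    assert (hdF : exists F0 F', F = F0 :: F') by (destruct F as [|F0 F']; [tauto|eauto]).
    destruct hdF as (F0 & F' & hF). rewrite hF. cbn [tl_of].
    change (Node (V F0) (MX F')) with (MX (F0 :: F')). rewrite <- hF in *.
    replace F0 with (hd [] F) by (rewrite hF; reflexivity).
    rewrite (tl_of_id B (hd [] F)).
    assert (lm : length (map B (hd [] F)) = length (hd [] F)) by apply length_map.
    assert (hpm : forall f g, length f = 2 ^ S eb -> vlen w f -> length g = 2 ^ S eb -> vlen w g ->
        length (pmul n f g) = 2 ^ S eb /\ vlen w (pmul n f g)).
    { intros. eapply pmul_shape; eauto. lia. }
    pose proof (fun H => W_mulmod (pmul n) w (2 ^ S eb) (D1 * ((w + 1) * (w + 1)) * (2 ^ S eb * S eb ^ 3))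
      (pow2_pos _) hpm H ea) as WM.
    use WM.
    { intros f' g' h1 h2 h4 h5. apply IH; auto; lia. }
    { rewrite lm, hd1. lia. }
    { exact pf. }
    { exact pg. }
    rewrite lm in *.
    pose proof (mulmod_mat (pmul n) w (2 ^ S eb) hpm ea (length (hd [] F)) F G pf pg) as mC.
    set (C := mulmod _ _ _ _ _) in *.
    use (W_last C). set (c := last C []) in *.
    assert (hc : length c = 2 ^ S eb /\ vlen w c).
    { destruct mC as [q1 q2]. unfold c. destruct C as [|c0 C'] using rev_ind.
      - simpl in q1. pose proof (pow2_pos ea). lia.
      - rewrite last_last. apply Forall_app in q2. destruct q2 as [_ q2]. now inversion q2. }
    destruct hc as [hc1 hc2].
    use (W_half B c). use (W_drop B B (halve c) c).
    assert (lc : length (halve c) = 2 ^ eb) by (rewrite half_length, hc1, Nat.pow_succ_r', Nat.div2_double; auto).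
    set (t := skipn (length (halve c)) c) in *.
    assert (vt : vlen w t) by now apply vlen_skipn.
    assert (lt : length t = 2 ^ eb).
    { unfold t. rewrite length_skipn, hc1, lc, Nat.pow_succ_r'. lia. }
    change (Node Leaf Leaf) with (b2t true).
    use (W_vas w t vt true). use (W_vas w _ (vas_vlen w t true t vt) true).
    use (W_ov w _ C (proj2 mC)).
    split.
    + cbn [pmul]. replace (length f <=? 4) with false by (symmetry; apply Nat.leb_gt; lia).
      rewrite ll, lg2. fold F G. rewrite (proj1 pf), Nat.log2_pow2 by lia. reflexivity.
    + rewrite ?vas_length in *. rewrite (proj1 mC), (proj1 mf), (proj1 mg), lt, lf, hc1, lc in *.
      rewrite Nat.add_0_l in *.
      assert (N : 2 ^ ea * 2 ^ eb = 2 ^ r) by (rewrite <- Nat.pow_add_r; f_equal; lia).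
      rewrite Nat.pow_succ_r' in *.
      pose proof (pow2_pos ea) as pa. pose proof (pow2_pos eb) as pb.
      pose proof (cube_rec r h3) as cr. fold eb in cr. rewrite Nat.add_1_r in cr.
      set (A := 2 ^ ea) in *. set (Bq := 2 ^ eb) in *. rewrite <- N in *.
      set (K3 := S eb ^ 3) in *. set (R3 := r ^ 3) in *. set (w1 := w + 1) in *.
      assert (hw1 : 1 <= w1) by (unfold w1; lia).
      (* By [cube_rec] the recursive products leave a slack of [D1 * ZZ], from which all linear
         passes estimated below are paid. *)
      assert (i1 : A * (D1 * (w1 * w1) * (2 * Bq * K3)) + D1 * (w1 * w1) * (A * Bq) * r
              <= D1 * (w1 * w1) * (A * Bq * R3)).
      { replace (D1 * (w1 * w1) * (A * Bq * R3)) with (D1 * (w1 * w1) * (A * Bq) * R3) by ring.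
        replace (A * (D1 * (w1 * w1) * (2 * Bq * K3)) + D1 * (w1 * w1) * (A * Bq) * r)
          with (D1 * (w1 * w1) * (A * Bq) * (2 * K3 + r)) by ring.
        now apply Nat.mul_le_mono_l. }
      assert (i2 : A <= A * Bq /\ Bq <= A * Bq) by (clear - pa pb; nia).
      assert (i3 : A * Bq * r <= w1 * (A * Bq * r)) by now apply mul_ge_r.
      assert (i4 : w1 * (A * Bq * r) <= w1 * w1 * (A * Bq * r))
        by (apply Nat.mul_le_mono_r; now apply mul_ge_r).
      assert (i5 : A * Bq <= A * Bq * r) by (rewrite (Nat.mul_comm _ r); apply mul_ge_r; lia).
      assert (i6 : w1 * (2 * Bq + 1) * (ea * A) <= 3 * (w1 * (A * Bq * r))).
      { replace (w1 * (2 * Bq + 1) * (ea * A)) with (w1 * A * ea * (2 * Bq + 1)) by ring.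
        replace (3 * (w1 * (A * Bq * r))) with (w1 * A * r * (3 * Bq)) by ring.
        apply Nat.mul_le_mono; [|lia]. apply Nat.mul_le_mono_l. lia. }
      assert (i7 : w1 * (Bq + 1) * (A + 1) <= 4 * (w1 * (A * Bq))).
      { replace (4 * (w1 * (A * Bq))) with (w1 * (2 * Bq) * (2 * A)) by ring.
        apply Nat.mul_le_mono; [|lia]. apply Nat.mul_le_mono_l. lia. }
      assert (i8 : w1 * (2 * Bq + 1) * (A + 1) <= 6 * (w1 * (A * Bq))).
      { replace (6 * (w1 * (A * Bq))) with (w1 * (3 * Bq) * (2 * A)) by ring.
        apply Nat.mul_le_mono; [|lia]. apply Nat.mul_le_mono_l. lia. }
      assert (i9 : w1 * (Bq + 1) <= 2 * (w1 * (A * Bq)))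
        by (replace (2 * (w1 * (A * Bq))) with (w1 * (2 * (A * Bq))) by ring; apply Nat.mul_le_mono_l; lia).
      assert (i10 : w1 * (A * Bq) <= w1 * (A * Bq * r)) by now apply Nat.mul_le_mono_l.
      set (Z := w1 * (A * Bq * r)) in *. set (ZZ := w1 * w1 * (A * Bq * r)) in *.
      replace (D1 * (w1 * w1) * (A * Bq) * r) with (D1 * ZZ) in i1 by (unfold ZZ; ring).
      pose proof D1_eq as d1.
      assert (i11 : 50 * 2000 * ZZ <= D1 * ZZ) by (rewrite d1; lia).
      clear d1.
      set (GG := D1 * (w1 * w1) * (A * Bq * R3)) in *.
      set (TT := D1 * (w1 * w1) * (2 * Bq * K3)) in *.
      assert (i12 : 2000 * (A * Bq) * (r + 1) <= 4000 * (A * Bq * r)) by lia.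
      assert (i13 : A * Bq * r <= Z) by (unfold Z; lia).
      change (r * r ^ 2) with R3. fold GG. lia.
Qed.

(** * Values of bit lists and polynomials over the natural numbers *)

Fixpoint bval (x : list bool) : nat :=
  match x with [] => 0 | b :: x => Nat.b2n b + 2 * bval x end.

Lemma bval_lt x : bval x < 2 ^ length x.
Proof. induction x as [|[] x IH]; simpl; lia. Qed.

Lemma adds_val xs : forall c ys, length ys <= length xs ->
  exists k, bval (adds false c xs ys) + k * 2 ^ length xs = bval xs + bval ys + Nat.b2n c.
Proof.
  induction xs as [|x xs IH]; intros c ys h.
  - destruct ys; [|simpl in h; lia]. exists (Nat.b2n c). simpl. lia.
  - destruct ys as [|y ys]; simpl in h; cbn [adds hd tl bval length].
    + destruct (IH (if x then (if xorb false false then true else c) else if xorb false false then c else false) []) as [k hk]; [simpl; lia|].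
      exists k. rewrite Nat.pow_succ_r'. destruct x, c; simpl in *; lia.
    + destruct (IH (if x then (if xorb false y then true else c) else if xorb false y then c else false) ys) as [k hk]; [lia|].
      exists k. rewrite Nat.pow_succ_r'. destruct x, y, c; simpl in *; lia.
Qed.

(** Subtraction adds the complement 2^n - 1 - y and the carry [c]; the terms are distributed so that
    truncated subtraction does not occur. *)
Lemma subs_val xs : forall c ys, length ys = length xs ->
  exists k, bval (adds true c xs ys) + k * 2 ^ length xs + bval ys + 1 = bval xs + 2 ^ length xs + Nat.b2n c.
Proof.
  induction xs as [|x xs IH]; intros c ys h.
  - destruct ys; [|simpl in h; lia]. exists (Nat.b2n c). simpl. lia.
  - destruct ys as [|y ys]; simpl in h; [lia|]; cbn [adds hd tl bval length].
    destruct (IH (if x then (if xorb true y then true else c) else if xorb true y then c else false) ys) as [k hk]; [lia|].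
    exists k. rewrite Nat.pow_succ_r'. destruct x, y, c; simpl in *; lia.
Qed.

Fixpoint topoly (N : nat) (z : list bool) (X : list bool) : list (list bool) :=
  match N with 0 => [] | S N => (hd false X :: z) :: topoly N z (tl X) end.

Lemma topoly_length N : forall z X, length (topoly N z X) = N.
Proof. induction N; simpl; auto. Qed.

Lemma topoly_vlen N : forall z X, vlen (S (length z)) (topoly N z X).
Proof. induction N; simpl; constructor; auto. apply IHN. Qed.

Fixpoint naddp (a b : list nat) : list nat :=
  match a, b with
  | [], _ => b
  | _, [] => a
  | x :: a, y :: b => x + y :: naddp a b
  end.
Fixpoint nmulp (a b : list nat) : list nat :=
  match a with [] => [] | x :: a => naddp (map (Nat.mul x) b) (0 :: nmulp a b) end.
Fixpoint eval2 (a : list nat) : nat := match a with [] => 0 | x :: a => x + 2 * eval2 a end.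

Lemma naddp_length a : forall b, length (naddp a b) = max (length a) (length b).
Proof. induction a; destruct b; simpl; auto. Qed.
Lemma naddp_eval a : forall b, eval2 (naddp a b) = eval2 a + eval2 b.
Proof. induction a; destruct b; simpl; auto. rewrite IHa. lia. Qed.
Lemma nmulp_length a b : length (nmulp a b) <= length a + length b.
Proof. induction a; cbn [nmulp length]; [lia|]. rewrite naddp_length, length_map. cbn [length]. lia. Qed.
Lemma scale_eval x b : eval2 (map (Nat.mul x) b) = x * eval2 b.
Proof. induction b; cbn [map eval2]; [lia|]. rewrite IHb. lia. Qed.
Lemma nmulp_eval a b : eval2 (nmulp a b) = eval2 a * eval2 b.
Proof. induction a; cbn [nmulp]; [reflexivity|]. rewrite naddp_eval, scale_eval. cbn [eval2]. rewrite IHa. lia. Qed.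
Lemma naddp_bound p q a : forall b, Forall (fun x => x <= p) a -> Forall (fun x => x <= q) b ->
  Forall (fun x => x <= p + q) (naddp a b).
Proof.
  induction a as [|x a IH]; intros b ha hb; simpl.
  - eapply Forall_impl; [|exact hb]. simpl; lia.
  - destruct b as [|y b]; [eapply Forall_impl; [|exact ha]; simpl; lia|].
    inversion ha; inversion hb; subst. constructor; [lia|auto].
Qed.
Lemma nmulp_bound a b : Forall (fun x => x <= 1) a -> Forall (fun x => x <= 1) b ->
  Forall (fun x => x <= length a) (nmulp a b).
Proof.
  intros ha hb. induction ha as [|x a hx ha IH]; cbn [nmulp length]; [constructor|].
  apply (naddp_bound 1 (length a)).
  - clear -hx hb. induction hb; simpl; constructor; auto. nia.
  - constructor; [lia|auto].
Qed.
Lemma eval2_bits X : eval2 (map Nat.b2n X) = bval X.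
Proof. induction X; cbn [map eval2 bval]; auto. Qed.

Set Warnings "-notation-overridden,-ambiguous-paths".
From mathcomp Require ssreflect ssrfun ssrbool eqtype ssrnat seq div choice fintype bigop ssralg poly polydiv zmodp ring.

(** * Correctness of the product in R[y] / (y^N + 1) *)

Module Alg.
Import mathcomp.boot.ssreflect mathcomp.boot.ssrfun mathcomp.boot.ssrbool mathcomp.boot.eqtype mathcomp.boot.ssrnat mathcomp.boot.seq mathcomp.boot.div mathcomp.boot.choice mathcomp.boot.fintype mathcomp.boot.bigop mathcomp.algebra.ssralg mathcomp.algebra.poly mathcomp.algebra.polydiv mathcomp.algebra.zmodp mathcomp.algebra_tactics.ring.
Import GRing.Theory.
Local Open Scope ring_scope.
Section Ring.
Context (R : comNzRingType) (w : nat) (h2w : (Nat.pow 2 w)%:R = 0 :> R).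

(** With 2^w = 0 in R the overflow of w-bit arithmetic vanishes, so bit lists of width w compute
    exactly in R. Later R is Z / 2^w. *)
Definition cf (x : list bool) : R := (bval x)%:R.

Lemma cf_add x y : length x = w -> length y = w -> cf (adds false false x y) = cf x + cf y.
Proof.
move=> hx hy; case: (adds_val x false y); first by rewrite hx hy.
move=> k; rewrite hx => /(congr1 (fun n : nat => n%:R : R)).
by rewrite !natrD natrM h2w mulr0 !addr0.
Qed.

Lemma cf_sub x y : length x = w -> length y = w -> cf (adds true true x y) = cf x - cf y.
Proof.
move=> hx hy; case: (subs_val x true y); first by rewrite hx hy.
move=> k; rewrite hx => /(congr1 (fun n : nat => n%:R : R)).
by rewrite !natrD natrM h2w mulr0 !addr0 /cf => /addIr <-; ring.
Qed.

Fixpoint pol (f : list (list bool)) : {poly R} :=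
  if f is x :: f then (cf x)%:P + 'X * pol f else 0.

Fixpoint bip (F : list (list (list bool))) : {poly {poly R}} :=
  if F is f :: F then (pol f)%:P + 'X * bip F else 0.

Lemma pol_app f g : pol (List.app f g) = pol f + 'X^(length f) * pol g.
Proof. by elim: f => [|x f IH] /=; rewrite ?IH ?exprS; ring. Qed.

Lemma bip_app F G : bip (List.app F G) = bip F + 'X^(length F) * bip G.
Proof. by elim: F => [|x f IH] /=; rewrite ?IH ?exprS; ring. Qed.

Lemma pol_vas f : forall s g, vlen w f -> vlen w g -> length f = length g ->
  pol (vas s f g) = if s then pol f - pol g else pol f + pol g.
Proof.
elim: f => [|x f IH] s [|y g] // hf hg; first by case: s; rewrite /= ?subr0 ?addr0.
move=> [hl]; have hx := Forall_inv hf; have hy := Forall_inv hg.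
have hf' := Forall_inv_tail hf; have hg' := Forall_inv_tail hg; rewrite /= IH //.
by case: s => /=; rewrite ?cf_sub ?cf_add ?polyCB ?polyCD //; ring.
Qed.

Lemma pol_neg f : vlen w f -> pol (vneg f) = - pol f.
Proof.
move=> h; rewrite /vneg pol_vas //; [|exact: vas_vlen|by rewrite vas_length].
by rewrite pol_vas //; ring.
Qed.

(** Since y^N = -1, the e lowest terms reappear at the top with opposite sign. The multiplied form,
    here and below, avoids negative powers of y, and congruences carry explicit cofactors. *)
Lemma pol_rot e f : vlen w f -> (e <= length f)%coq_nat ->
  'X^e * pol (nrot e f) = pol f - ('X^(length f) + 1) * pol (firstn e f).
Proof.
move=> h le; rewrite /nrot pol_app pol_neg; last exact: vlen_firstn.
rewrite length_skipn.
have -> : pol f = pol (firstn e f) + 'X^e * pol (skipn e f).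
  by rewrite -{1}(firstn_skipn e f) pol_app firstn_length_le.
have -> : 'X^(length f) = 'X^e * 'X^(length f - e)%coq_nat :> {poly R}.
  have E : length f = Nat.add e (Nat.sub (length f) e) by lia.
  rewrite {1}E; exact: exprD.
ring.
Qed.

Lemma cf_smul x : forall y, length y = w -> cf (smul x y) = cf x * cf y.
Proof.
elim: x => [|b x IH] y hy /=; first by rewrite cf_sub // /cf /= ; ring.
have h2 : length (adds false false y y) = w by rewrite adds_length.
have e : cf (b :: x) = (b : nat)%:R + 2%:R * cf x.
  by rewrite /cf /= -natrM -natrD; congr (_%:R); case: b => /=; lia.
have h3 : length (smul x (adds false false y y)) = w by rewrite smul_length.
have e3 : cf (smul x (adds false false y y)) = cf x * (cf y + cf y) by rewrite IH // cf_add.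
by case: b e => ->; rewrite ?(cf_add _ _ hy h3) e3 /=; ring.
Qed.

Lemma pol_svec a g : vlen w g -> pol (List.map (smul a) g) = (cf a)%:P * pol g.
Proof.
elim: g => [|x g IH] h /=; first by ring.
have hx := Forall_inv h; have h' := Forall_inv_tail h.
by rewrite IH // cf_smul // polyCM; ring.
Qed.

Lemma pol_conv f g : vlen w f -> vlen w g -> (1 <= length g)%coq_nat ->
  exists Q, pol (conv f g) = pol f * pol g + Q * ('X^(length g) + 1).
Proof.
move=> hf hg lg; elim: hf => [|x f' hx hf' [Q IH]] /=.
  by exists 0; rewrite pol_vas //; ring.
set r := conv f' g; set t := nrot _ _.
have hr : vlen w r by exact: conv_vlen.
have lr : length r = length g by exact: conv_length.
have ht : vlen w t by exact: rot_vlen.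
have le : (length (tl r) <= length r)%coq_nat by case: (r) => //= ? ?; lia.
have lr' : length r = S (length (tl r)) by move: lg; rewrite -lr; case: (r) => //=; lia.
rewrite pol_vas //; [|exact: svec_vlen|exact: vneg_vlen|by rewrite List.length_map vneg_length rot_length].
rewrite pol_svec // pol_neg //.
have e := pol_rot _ _ hr le; rewrite -/t in e.
have e2 : 'X^(length g) * pol t = 'X * (pol r - ('X^(length r) + 1) * pol (firstn (length (tl r)) r)).
  by rewrite -lr {1}lr' exprS -mulrA e.
exists ('X * Q - 'X * pol (firstn (length (tl r)) r) - pol t).
rewrite lr in e2.
rewrite IH in e2.
rewrite -[LHS]addr0 -(subrr ('X^(length g) * pol t)) {1}e2; ring.
Qed.

Lemma bip_mas F : forall s G S, mlen w S F -> mlen w S G -> length F = length G ->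
  bip (mas s F G) = if s then bip F - bip G else bip F + bip G.
Proof.
elim: F => [|x F IH] s [|y G] // S hF hG; first by case: s; rewrite /= ?subr0 ?addr0.
move=> [hl]; have [h1 h2] := Forall_inv hF; have [h4 h5] := Forall_inv hG.
have h3 := Forall_inv_tail hF; have h6 := Forall_inv_tail hG => /=.
rewrite (IH s G S) // pol_vas //; last by rewrite h4.
by case: s => /=; rewrite ?polyCB ?polyCD; ring.
Qed.

Lemma bip_rot S e F : mlen w S F -> (e <= S)%coq_nat ->
  exists Q, ('X^e)%:P * bip (List.map (nrot e) F) = bip F + Q * ('X^S + 1)%:P.
Proof.
move=> hF he; elim: hF => [|f F' [h1 h2] h3 [Q IH]] /=; first by exists 0; ring.
exists ('X * Q - (pol (firstn e f))%:P).
have e1 : ('X^e)%:P * (pol (nrot e f))%:P = (pol f)%:P - ('X^S + 1)%:P * (pol (firstn e f))%:P :> {poly {poly R}}.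
  by rewrite -polyCM pol_rot ?h1 // polyCB polyCM.
have -> : ('X^e)%:P * ((pol (nrot e f))%:P + 'X * bip (List.map (nrot e) F')) =
   ('X^e)%:P * (pol (nrot e f))%:P + 'X * (('X^e)%:P * bip (List.map (nrot e) F')) by ring.
rewrite e1 IH; ring.
Qed.

Lemma scalC n : (2%:R ^+ n)%:P = 2%:R ^+ n :> {poly {poly R}}.
Proof. by rewrite rmorphXn /= rmorph_nat. Qed.

(** Multiplied by y^e, the modulus becomes y^e x^M - 1. For e = 2h and M = 2k it factors as (y^h x^k
    - 1)(y^h x^k + 1), and because y^S = -1 the second factor is, up to sign, the modulus of
    exponent h + S. The divisibility hypotheses let exponents be halved at every level; recombining
    without division by 2 gives the exponent [E + m]. *)
Lemma bip_mulmod pm S E : (1 <= S)%coq_nat ->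
  (forall f g, length f = S -> vlen w f -> length g = S -> vlen w g ->
    length (pm f g) = S /\ vlen w (pm f g)) ->
  (forall f g, length f = S -> vlen w f -> length g = S -> vlen w g ->
    exists Q, pol (pm f g) = 2%:R ^+ E * (pol f * pol g) + Q * ('X^S + 1)) ->
  forall m e F G, (exists k, e = Nat.mul k (Nat.pow 2 m)) -> (exists k, Nat.mul 2 S = Nat.mul k (Nat.pow 2 m)) ->
  (e <= Nat.mul 2 S)%coq_nat ->
  mat w S (Nat.pow 2 m) F -> mat w S (Nat.pow 2 m) G ->
  exists Q1 Q2, bip (mulmod pm m e F G) = 2%:R ^+ (E + m) * (bip F * bip G)
    + Q1 * (('X^e)%:P * 'X^(Nat.pow 2 m) - 1) + Q2 * ('X^S + 1)%:P.
Proof.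
move=> hS hl hpm; elim=> [|m IH] e F G [ke he] [kS hkS] hle hF hG.
  case: hF hG => [lF vF] [lG vG].
  case: F lF vF => [|f [|? ?]] //= _ vF; case: G lG vG => [|g [|? ?]] //= _ vG.
  have [f1 f2] := Forall_inv vF; have [g1 g2] := Forall_inv vG.
  case: (hpm f g) => // Q ->.
  exists 0, Q%:P; rewrite addn0 !polyCD !polyCM scalC; ring.
have [h eh] : exists h, e = Nat.mul 2 h.
  by exists (Nat.mul ke (Nat.pow 2 m)); rewrite he Nat.pow_succ_r'; lia.
have dh : Nat.div2 e = h by rewrite eh Nat.div2_double.
have hh : exists k, h = Nat.mul k (Nat.pow 2 m).
  by exists ke; move: he; rewrite eh Nat.pow_succ_r'; lia.
have hS2 : exists k, S = Nat.mul k (Nat.pow 2 m).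
  by exists kS; move: hkS; rewrite Nat.pow_succ_r'; lia.
have hS3 : exists k, Nat.mul 2 S = Nat.mul k (Nat.pow 2 m).
  by case: hS2 => k ->; exists (Nat.mul 2 k); lia.
have hhS : exists k, Nat.add h S = Nat.mul k (Nat.pow 2 m).
  by case: hh => k1 ->; case: hS2 => k2 {1}->; exists (Nat.add k1 k2); lia.
have leh : (h <= S)%coq_nat by lia.
have [l1 l2] := hF; have [l3 l4] := hG.
have [hd1 hd2] := mat_hd _ _ _ _ hF (pow2_pos _).
rewrite /= l1 hd1 dh.
have -> : Nat.div2 (Nat.pow 2 (m.+1)) = Nat.pow 2 m by rewrite Nat.pow_succ_r' Nat.div2_double.
have {}hF : mat w S (Nat.mul 2 (Nat.pow 2 m)) F by move: hF; rewrite Nat.pow_succ_r'.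
have {}hG : mat w S (Nat.mul 2 (Nat.pow 2 m)) G by move: hG; rewrite Nat.pow_succ_r'.
have hF0 := mat_firstn _ _ _ _ hF; have hF1 := mat_skipn _ _ _ _ hF.
have hG0 := mat_firstn _ _ _ _ hG; have hG1 := mat_skipn _ _ _ _ hG.
set k := Nat.pow 2 m in hF0 hF1 hG0 hG1 IH *.
set F0 := firstn k F in hF0 *; set F1 := List.map (nrot h) (skipn k F).
set G0 := firstn k G in hG0 *; set G1 := List.map (nrot h) (skipn k G).
have mF1 : mat w S k F1 by exact: mat_rot.
have mG1 : mat w S k G1 by exact: mat_rot.
have bF : bip F = bip F0 + 'X^k * bip (skipn k F).
  by rewrite -{1}(firstn_skipn k F) bip_app (proj1 hF0).
have bG : bip G = bip G0 + 'X^k * bip (skipn k G).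
  by rewrite -{1}(firstn_skipn k G) bip_app (proj1 hG0).
case: (bip_rot S h (skipn k F) (proj2 hF1) leh) => q1; rewrite -/F1 => rF.
case: (bip_rot S h (skipn k G) (proj2 hG1) leh) => q2; rewrite -/G1 => rG.
case: (IH h (mas false F0 F1) (mas false G0 G1) hh hS3) => [||| A1 [B1]];
  [lia|exact: mat_mas|exact: mat_mas|].
set C1 := mulmod _ _ _ _ _ => hC1.
case: (IH (Nat.add h S) (mas true F0 F1) (mas true G0 G1) hhS hS3) => [||| A2 [B2]];
  [lia|exact: mat_mas|exact: mat_mas|].
set C2 := mulmod _ _ _ _ _ => hC2.
have mC1 : mat w S k C1 by apply: mulmod_mat => //; exact: mat_mas.
have mC2 : mat w S k C2 by apply: mulmod_mat => //; exact: mat_mas.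
have eF : length F0 = length F1 by rewrite (proj1 hF0) (proj1 mF1).
have eG : length G0 = length G1 by rewrite (proj1 hG0) (proj1 mG1).
have eC : length C1 = length C2 by rewrite (proj1 mC1) (proj1 mC2).
rewrite (bip_mas F0 false F1 S (proj2 hF0) (proj2 mF1) eF) in hC1.
rewrite (bip_mas G0 false G1 S (proj2 hG0) (proj2 mG1) eG) in hC1.
rewrite (bip_mas F0 true F1 S (proj2 hF0) (proj2 mF1) eF) in hC2.
rewrite (bip_mas G0 true G1 S (proj2 hG0) (proj2 mG1) eG) in hC2.
have mD := mat_mas w S k true C2 C1 mC2.
case: (bip_rot S (Nat.sub S h) (mas true C2 C1) (proj2 mD)) => [|q3]; first by lia.
rewrite (bip_mas C2 true C1 S (proj2 mC2) (proj2 mC1) (esym eC)).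
set H := bip (List.map _ _) => hH.
rewrite bip_app mas_length (proj1 mC1) (bip_mas C1 false C2 S (proj2 mC1) (proj2 mC2) eC) -/H.
set J : {poly {poly R}} := ('X^S + 1)%:P in rF rG hC1 hC2 hH *.
set Yh : {poly {poly R}} := ('X^h)%:P in rF rG hC1 *.
have eYe : ('X^e)%:P = Yh * Yh :> {poly {poly R}}.
  by rewrite -polyCM -exprD eh; congr (('X^_)%:P); rewrite /= Nat.add_0_r.
have eYS : Yh * ('X^(Nat.sub S h))%:P = J - 1.
  rewrite -polyCM -exprD /J polyCD polyC1 addrK.
  by congr (('X^_)%:P); rewrite -[addn]/Nat.add; lia.
have eYhS : ('X^(Nat.add h S))%:P = Yh * (J - 1).
  by rewrite /J polyCD polyC1 addrK -polyCM -exprD.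
have ek : 'X^(Nat.add k (Nat.add k 0)) = 'X^k * 'X^k :> {poly {poly R}}.
  by rewrite Nat.add_0_r -exprD.
rewrite eYhS in hC2.
(* [H] is known only after multiplication by y^(S-h). A further factor y^h gives y^S = J - 1, from
   which [H] can be isolated. *)
have eH : H = J * H - Yh * (bip C2 - bip C1 + q3 * J).
  rewrite -hH mulrA eYS; ring.
set T := 2%:R ^+ (E + m) in hC1 hC2.
have eT : 2%:R ^+ (E + m.+1) = 2%:R * T by rewrite addnS exprS.
have eF1 : bip (skipn k F) = Yh * bip F1 - q1 * J by rewrite rF; ring.
have eG1 : bip (skipn k G) = Yh * bip G1 - q2 * J by rewrite rG; ring.
(* The cofactors come from expanding the recombination: the first one collects the multiples of y^e
   x^M - 1, the second one those of y^S + 1. What remains is a ring identity. *)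
exists (A1 + A2 - 2%:R * T * bip F1 * bip G1).
exists (B1 + A2 * Yh * 'X^k + B2 + 'X^k * H - 'X^k * Yh * (A2 * Yh * 'X^k + B2 - B1) - 'X^k * Yh * q3
  + 2%:R * T * 'X^k * (q1 * (bip G0 + 'X^k * Yh * bip G1) + q2 * (bip F0 + 'X^k * Yh * bip F1))
  - 2%:R * T * J * 'X^k * 'X^k * q1 * q2).
rewrite bF bG eF1 eG1 eT eYe ek {1}eH hC1 hC2.
ring.
Qed.

Lemma size_XnD1 S : (0 < S)%N -> size ('X^S + 1 : {poly R}) = S.+1.
Proof. by move=> h; rewrite size_polyDl size_polyXn // size_poly1. Qed.

Lemma monic_XnD1 S : (0 < S)%N -> ('X^S + 1 : {poly R}) \is monic.
Proof. by move=> h; rewrite monicE lead_coefDl ?lead_coefXn // size_polyXn size_poly1. Qed.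

Definition ysize S (p : {poly {poly R}}) := forall i, (size p`_i <= S)%N.

(** A nonzero multiple of the monic polynomial y^S + 1 has degree at least S in y. *)
Lemma ysize_mul0 S p Q : (0 < S)%N -> ysize S p -> p = Q * ('X^S + 1)%:P -> p = 0.
Proof.
move=> hS hp e; apply/polyP => i; rewrite coef0.
have ei : p`_i = Q`_i * ('X^S + 1) by rewrite e coefMC.
have [q0|q0] := eqVneq Q`_i 0; first by rewrite ei q0 mul0r.
have := hp i; rewrite ei size_Mmonic ?monic_XnD1 // size_XnD1 // addnS /=.
have : (0 < size Q`_i)%N by rewrite size_poly_gt0.
by move=> h1 h2; have := leq_trans (leq_add h1 (leqnn S)) h2; rewrite add1n ltnn.
Qed.

Lemma ysize_div S Q : (0 < S)%N -> exists Qr Qq, Q = Qr + Qq * ('X^S + 1)%:P /\ ysize S Qr.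
Proof.
move=> hS; elim/poly_ind: Q => [|Q c [Qr [Qq [e h]]]].
  by exists 0, 0; split=> [|i]; [ring|rewrite coef0 size_poly0].
exists (Qr * 'X + (Pdiv.Ring.rmodp c ('X^S + 1))%:P), (Qq * 'X + (Pdiv.Ring.rdivp c ('X^S + 1))%:P); split.
  have ec : c%:P = (Pdiv.Ring.rdivp c ('X^S + 1))%:P * ('X^S + 1)%:P + (Pdiv.Ring.rmodp c ('X^S + 1))%:P.
    by rewrite -polyCM -polyCD -Pdiv.RingMonic.rdivp_eq // monic_XnD1.
  rewrite e {1}ec; ring.
move=> [|i]; rewrite coefD coefMX coefC /= ?add0r ?addr0 //.
rewrite -ltnS -(size_XnD1 _ hS); apply: Pdiv.Ring.ltn_rmodpN0.
by apply: monic_neq0; exact: monic_XnD1.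
Qed.

Lemma ysizeD S p q : ysize S p -> ysize S q -> ysize S (p + q).
Proof. by move=> hp hq i; rewrite coefD (leq_trans (size_polyD _ _)) // geq_max hp hq. Qed.
Lemma ysizeN S p : ysize S p -> ysize S (- p).
Proof. by move=> hp i; rewrite coefN size_polyN. Qed.
Lemma ysizeXn S p k : ysize S p -> ysize S (p * 'X^k).
Proof. by move=> hp i; rewrite coefMXn; case: ifP => _; rewrite ?size_poly0. Qed.
Lemma ysizeM s p q : ysize s p -> ysize s q -> ysize (Nat.mul 2 s) (p * q).
Proof.
move=> hp hq i; rewrite coefM (leq_trans (size_sum _ _ _)) //.
apply/bigmax_leqP => j _; rewrite (leq_trans (size_polyMleq _ _)) //.
rewrite (leq_trans (leq_pred _)) //= Nat.add_0_r -[Nat.add]/addn; exact: leq_add.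
Qed.
Lemma ysizeZ s n p : ysize s p -> ysize s (2%:R ^+ n * p).
Proof.
move=> hp; elim: n => [|n IH]; first by rewrite expr0 mul1r.
by rewrite exprS -mulrA mulr_natl mulr2n; exact: ysizeD.
Qed.

Lemma size_pol f : (size (pol f) <= length f)%N.
Proof.
elim: f => [|x f IH] /=; first by rewrite size_poly0.
rewrite (leq_trans (size_polyD _ _)) // geq_max (leq_trans (size_polyC_leq1 _)) //=.
by rewrite mulrC; have [->|h] := eqVneq (pol f) 0; rewrite ?mul0r ?size_poly0 // size_mulX.
Qed.

Lemma ysize_bip S F : mlen w S F -> ysize S (bip F).
Proof.
elim: F => [|f F IH] h /= i; first by rewrite coef0 size_poly0.
have [h1 _] := Forall_inv h; have h2 := Forall_inv_tail h.
rewrite coefD coefXM coefC; case: i => [|i] /=; rewrite ?addr0 ?add0r; last exact: IH.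
by rewrite -h1 size_pol.
Qed.

Lemma pol_concat s F : mlen w s F -> pol (concat F) = (bip F).['X^s].
Proof.
elim: F => [|f F IH] h /=; first by rewrite horner0.
have [h1 _] := Forall_inv h; have h2 := Forall_inv_tail h.
by rewrite pol_app IH // h1 hornerD hornerC hornerM hornerX.
Qed.

Lemma bip_pad s F : mlen w s F -> bip (List.map pad F) = bip F.
Proof.
elim: F => [|f F IH] h //=.
have [h1 h3] := Forall_inv h; have h2 := Forall_inv_tail h.
by rewrite IH // /pad pol_app pol_vas // subrr mulr0 addr0.
Qed.

Definition hi (c : list (list bool)) := skipn (length (halve c)) c.

(** The overlaps telescope: everything is written out except the upper half of the last coefficient,
    which belongs at y^(Ms) and which [pmul] feeds back, negated, as [h]. *)
Lemma pol_ov s C : C <> nil -> mlen w (Nat.mul 2 s) C -> forall h, length h = s -> vlen w h ->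
  pol (ov h C) + 'X^(Nat.mul (length C) s) * pol (hi (List.last C nil)) = pol h + (bip C).['X^s].
Proof.
elim: C => [|c C IH] // _ hC h lh vh.
have [h1 h2] := Forall_inv hC; have h3 := Forall_inv_tail hC.
have lhalf : length (halve c) = s by rewrite half_length h1 Nat.div2_double.
have ec : pol c = pol (firstn s c) + 'X^s * pol (hi c).
  rewrite -{1}(firstn_skipn s c) pol_app /hi lhalf firstn_length_le //; lia.
have lhi : length (hi c) = s by rewrite /hi lhalf length_skipn; lia.
have vhi : vlen w (hi c) by exact: vlen_skipn.
have lf : length (firstn s c) = s by rewrite firstn_length_le; lia.
have -> : ov h (c :: C) = List.app (vas false (firstn s c) h) (ov (hi c) C) by rewrite /= /hi lhalf.
have -> : bip (c :: C) = (pol c)%:P + 'X * bip C by [].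
rewrite pol_app vas_length lf pol_vas //; [|exact: vlen_firstn|by rewrite lf].
case: C IH hC h3 => [|d C] IH hC h3.
  by rewrite /= Nat.add_0_r !mulr0 !addr0 hornerC ec; ring.
have {}IH := IH (fun e => nil_cons (esym e)) h3 (hi c) lhi vhi.
rewrite hornerD hornerC hornerM hornerX ec.
have -> : List.last (c :: d :: C) nil = List.last (d :: C) nil by [].
have -> : 'X^(Nat.mul (length (c :: d :: C)) s) = 'X^s * 'X^(Nat.mul (length (d :: C)) s) :> {poly R}.
  by rewrite -exprD.
have {}IH : (bip (d :: C)).['X^s] = pol (ov (hi c) (d :: C)) +
   'X^(Nat.mul (length (d :: C)) s) * pol (hi (List.last (d :: C) nil)) - pol (hi c).
  by rewrite IH; ring.
rewrite IH; ring.
Qed.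

(** Exponent of the power of two by which [pmul] multiplies the product: one for each level of
    [mulmod], plus that of the recursive call. *)
Fixpoint scale (n r : nat) : nat :=
  match n with
  | 0 => 0
  | n.+1 => if Nat.leb r 2 then 0 else Nat.add (scale n (Nat.div r 2).+1) (Nat.sub r (Nat.div r 2))
  end.

Lemma pol_pmul n : forall r f g, (2 <= r)%coq_nat /\ (r <= Nat.add n 2)%coq_nat -> length f = Nat.pow 2 r -> vlen w f ->
  length g = Nat.pow 2 r -> vlen w g ->
  exists Q, pol (pmul n f g) = 2%:R ^+ (scale n r) * (pol f * pol g) + Q * ('X^(Nat.pow 2 r) + 1).
Proof.
have base : forall r f g, length f = Nat.pow 2 r -> vlen w f ->
  length g = Nat.pow 2 r -> vlen w g ->
  exists Q, pol (conv f g) = 2%:R ^+ 0 * (pol f * pol g) + Q * ('X^(Nat.pow 2 r) + 1).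
  move=> r f g lf vf lg vg; case: (pol_conv f g) => [//|//||Q ->]; first by rewrite lg; exact: pow2_pos.
  by exists Q; rewrite lg; ring.
elim: n => [|n IH] r f g hr lf vf lg vg; first exact: base.
rewrite /=; case: (Nat.leb_spec (length f) 4) => l.
  have hr2 : r = 2%N.
    have h : (Nat.pow 2 r <= Nat.pow 2 2)%coq_nat by move: l; rewrite lf /=; lia.
    have := proj2 (Nat.pow_le_mono_r_iff 2 r 2 ltac:(lia)) h; lia.
  by rewrite hr2 /=; apply: (base 2%N); rewrite ?lf ?lg ?hr2.
have h3 : (3 <= r)%coq_nat.
  suff : r <> 2%N by lia. by move=> e; move: l; rewrite lf e /=; lia.
have -> : Nat.leb r 2 = false by apply/Nat.leb_gt; lia.
have [mf cf'] := chunk_shape w r f lf vf h3; have [mg cg] := chunk_shape w r g lg vg h3.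
have hh := half_lt r h3.
set F := chunk _ [:: f] in mf cf' *; set G := chunk _ [:: g] in mg cg *.
set eb := Nat.div r 2 in mf mg hh *; set ea := Nat.sub r eb in mf mg *.
have pf := mat_pad _ _ _ _ mf; have pg := mat_pad _ _ _ _ mg.
rewrite (proj1 pf) Nat.log2_pow2; last by lia.
have [hd1 hd2] := mat_hd _ _ _ _ pf (pow2_pos _).
rewrite hd1; set PF := List.map pad F in pf *; set PG := List.map pad G in pg *.
have eS : Nat.mul 2 (Nat.pow 2 eb) = Nat.pow 2 eb.+1 by rewrite Nat.pow_succ_r'.
have hpm : forall f g, length f = Nat.mul 2 (Nat.pow 2 eb) -> vlen w f -> length g = Nat.mul 2 (Nat.pow 2 eb) -> vlen w g ->
    length (pmul n f g) = Nat.mul 2 (Nat.pow 2 eb) /\ vlen w (pmul n f g).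
  by rewrite eS => f' g' *; apply: pmul_shape => //; lia.
case: (bip_mulmod (pmul n) (Nat.mul 2 (Nat.pow 2 eb)) (scale n eb.+1) _ hpm _ ea
   (Nat.mul 2 (Nat.pow 2 eb)) PF PG) => [|||||||Q1 [Q2]]; rewrite ?eS.
- exact: pow2_pos.
- by move=> f' g' *; apply: IH => //; lia.
- exists (Nat.pow 2 (Nat.sub eb.+1 ea)); rewrite -Nat.pow_add_r; congr (Nat.pow 2 _); rewrite /ea /eb.
  have := Nat.div_mod_eq r 2; have := Nat.mod_upper_bound r 2; rewrite -/eb; lia.
- exists (Nat.pow 2 (Nat.sub eb.+2 ea)); rewrite -(Nat.pow_succ_r' 2 (eb.+1)) -Nat.pow_add_r.
  congr (Nat.pow 2 _); rewrite /ea /eb.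
  have := Nat.div_mod_eq r 2; have := Nat.mod_upper_bound r 2; rewrite -/eb; lia.
- lia.
- by move: pf; rewrite eS.
- by move: pg; rewrite eS.
have mC : mat w (Nat.mul 2 (Nat.pow 2 eb)) (Nat.pow 2 ea) (mulmod (pmul n) ea (Nat.pow 2 eb.+1) PF PG).
  exact: mulmod_mat.
set C := mulmod _ _ _ _ _ in mC *.
rewrite (bip_pad _ _ (proj2 mf)) (bip_pad _ _ (proj2 mg)) => eC.
set S := Nat.pow 2 eb.+1 in eC eS *; set s := Nat.pow 2 eb in mf mg mC eS *; set M := Nat.pow 2 ea in mC eC mf mg *.
have S0 : (0 < S)%N by apply/ltP; exact: pow2_pos.
set T := 2%:R ^+ _ in eC.
have [Qr [Qq [eQ yQ]]] := ysize_div S Q1 S0.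
(* So far the identity holds modulo y^S + 1, which would not survive the substitution x = y^s.
   Thanks to the padding both sides have degree below S in y once the cofactor of x^M + 1 is
   reduced, so the identity is exact. *)
have {}eC : bip C = T * (bip F * bip G) - Qr * ('X^M + 1).
  set J := ('X^S + 1)%:P in eC eQ.
  have eYS : ('X^S)%:P = J - 1 :> {poly {poly R}} by rewrite /J polyCD polyC1 addrK.
  apply/eqP; rewrite -subr_eq0; apply/eqP.
  apply: (ysize_mul0 S _ (Q2 + Q1 * 'X^M - Qq * ('X^M + 1)) S0).
    have yC : ysize S (bip C) by apply: ysize_bip; rewrite -eS; exact: (proj2 mC).
    have yF : ysize S (bip F * bip G).
      by rewrite -eS; apply: ysizeM; apply: ysize_bip; [exact: (proj2 mf)|exact: (proj2 mg)].
    have -> : bip C - (T * (bip F * bip G) - Qr * ('X^M + 1)) =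
       bip C + - (T * (bip F * bip G)) + (Qr * 'X^M + Qr) by ring.
    by repeat apply: ysizeD => //; [apply: ysizeN; exact: ysizeZ|exact: ysizeXn].
  rewrite eC eYS eQ -/J; ring.
have Cn : C <> nil.
  by move=> e; move: (proj1 mC); rewrite e /= => e'; have := pow2_pos ea; rewrite -/M -e'; lia.
have lhi : length (hi (List.last C nil)) = s /\ vlen w (hi (List.last C nil)).
  have : length (List.last C nil) = Nat.mul 2 s /\ vlen w (List.last C nil).
    move: Cn (proj2 mC); elim: (C) => [|c [|d C'] IHC] // _ hC; first exact: (Forall_inv hC).
    by apply: IHC => //; exact: (Forall_inv_tail hC).
  move=> [q1 q2]; split; last exact: vlen_skipn.
  by rewrite /hi length_skipn half_length q1 Nat.div2_double; lia.
have := pol_ov s C Cn (proj2 mC) (vneg (hi (List.last C nil))).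
rewrite vneg_length => /(_ (proj1 lhi) (vneg_vlen _ _ (proj2 lhi))).
rewrite pol_neg; last exact: (proj2 lhi).
rewrite (proj1 mC) -/(hi (List.last C nil)).
have eN : Nat.mul M s = Nat.pow 2 r by rewrite /M /s -Nat.pow_add_r; congr (Nat.pow 2 _); rewrite /ea; lia.
rewrite eN eC hornerD hornerN !hornerM -!pol_concat; [|exact: (proj2 mg)|exact: (proj2 mf)].
rewrite cf' cg hornerD hornerXn hornerC -exprM.
have -> : 'X^(s * M) = 'X^(Nat.pow 2 r) :> {poly R} by rewrite mulnC -eN.
have -> : T.['X^s] = 2%:R ^+ (Nat.add (scale n eb.+1) ea) by rewrite /T -scalC hornerC.
move=> e; exists (- Qr.['X^s] - pol (hi (List.last C nil))).
set p := pol (ov _ _) in e *.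
have -> : p = (p + 'X^(Nat.pow 2 r) * pol (hi (List.last C nil))) - 'X^(Nat.pow 2 r) * pol (hi (List.last C nil)) by ring.
rewrite e; ring.
Qed.

Fixpoint npol (a : list nat) : {poly R} := if a is x :: a then (x%:R)%:P + 'X * npol a else 0.

Lemma npol_add a : forall b, npol (naddp a b) = npol a + npol b.
Proof.
elim: a => [|x a IH] [|y b] /=; rewrite ?add0r ?addr0 // IH natrD polyCD; ring.
Qed.

Lemma npol_mul a b : npol (nmulp a b) = npol a * npol b.
Proof.
have e x : npol (List.map (Nat.mul x) b) = (x%:R)%:P * npol b.
  elim: b => [|y b IH] /=; first by rewrite mulr0.
  by rewrite IH natrM polyCM; ring.
elim: a => [|x a IH] /=; first by rewrite mul0r.
rewrite npol_add e /= IH /=; ring.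
Qed.

Lemma pol_topoly N : forall z X, bval z = 0%N -> (length X <= N)%coq_nat ->
  pol (topoly N z X) = npol (List.map Nat.b2n X).
Proof.
elim: N => [|N IH] z X hz hX; first by case: X hX => //= ? ?; lia.
case: X hX => [|x X] hX /=.
  by rewrite IH //= ?mulr0 ?addr0 /cf /= ?hz ?polyC0 //; lia.
rewrite IH //; last by move: hX => /=; lia.
by congr ((_%:R)%:P + _); rewrite /= hz; lia.
Qed.

Lemma size_npol a : (size (npol a) <= length a)%N.
Proof.
elim: a => [|x f IH] /=; first by rewrite size_poly0.
rewrite (leq_trans (size_polyD _ _)) // geq_max (leq_trans (size_polyC_leq1 _)) //=.
by rewrite mulrC; have [->|h] := eqVneq (npol f) 0; rewrite ?mul0r ?size_poly0 // size_mulX.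
Qed.

Lemma coef_pol f k : (pol f)`_k = cf (List.nth k f nil).
Proof.
elim: f k => [|x f IH] [|k] /=; rewrite ?coef0 ?coefD ?coefC ?coefXM //= ?addr0 ?add0r //.
Qed.

Lemma coef_npol a k : (npol a)`_k = (List.nth k a 0%N)%:R.
Proof.
elim: a k => [|x f IH] [|k] /=; rewrite ?coef0 ?coefD ?coefC ?coefXM //= ?addr0 ?add0r //.
Qed.
End Ring.

Lemma scale_le n : forall r, (2 <= r)%coq_nat -> (Nat.add (scale n r) 4 <= Nat.mul 2 r)%coq_nat.
Proof.
elim: n => [|n IH] r h; cbn [scale]; first by lia.
case: (Nat.leb_spec r 2) => l; first by lia.
have h1 := Nat.div_mod_eq r 2; have h2 := Nat.mod_upper_bound r 2 ltac:(lia).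
have h3 : (2 <= (Nat.div r 2).+1)%coq_nat by lia.
have := IH _ h3; lia.
Qed.

(** Neither modulus interferes. The condition on the lengths keeps the degree below 2^r, so the
    cofactor of y^N + 1 vanishes; a scaled coefficient is at most 2^(2r-4) 2^r, below 2^w. *)
Theorem pmul_bits n r z X Y : (2 <= r)%coq_nat /\ (r <= Nat.add n 2)%coq_nat -> bval z = 0%N ->
  (Nat.add (length X) (length Y) <= Nat.pow 2 r)%coq_nat ->
  (Nat.mul 3 r <= length z)%coq_nat ->
  forall k, (k < Nat.pow 2 r)%coq_nat ->
  bval (List.nth k (pmul n (topoly (Nat.pow 2 r) z X) (topoly (Nat.pow 2 r) z Y)) nil) =
  Nat.mul (Nat.pow 2 (scale n r)) (List.nth k (nmulp (List.map Nat.b2n X) (List.map Nat.b2n Y)) 0%N).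
Proof.
move=> hr hz hXY hw k hk.
set w := (length z).+1; set f := topoly _ z X; set g := topoly _ z Y.
set a := List.map Nat.b2n X; set b := List.map Nat.b2n Y; set E := scale n r.
have w1 : (1 < Nat.pow 2 w)%N.
  by apply/ltP; rewrite /w Nat.pow_succ_r'; have := pow2_pos (length z); lia.
have h2w : (Nat.pow 2 w)%:R = 0 :> 'Z_(Nat.pow 2 w) by rewrite pchar_Zp.
have lf : length f = Nat.pow 2 r by exact: topoly_length.
have lg : length g = Nat.pow 2 r by exact: topoly_length.
have vf : vlen w f by exact: topoly_vlen.
have vg : vlen w g by exact: topoly_vlen.
have [Q] := pol_pmul _ w h2w n r f g hr lf vf lg vg.
have [lh vh] := pmul_shape w n r f g hr lf vf lg vg.
rewrite !pol_topoly //; [|lia|lia].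
rewrite -npol_mul -/a -/b -/E => e.
set h := pmul n f g in e lh vh *; set c := nmulp a b in e *.
have N0 : (0 < Nat.pow 2 r)%N by apply/ltP; exact: pow2_pos.
have lc : (length c <= Nat.pow 2 r)%coq_nat.
  by have := nmulp_length a b; rewrite -/c /a /b !List.length_map; lia.
have Q0 : Q = 0.
  apply/eqP; apply/negPn/negP => Qn.
  have eQ : Q * ('X^(Nat.pow 2 r) + 1) = pol _ h - 2%:R ^+ E * npol _ c by rewrite e; ring.
  have s1 : (size (pol [the comNzRingType of 'Z_(Nat.pow 2 w)] h) <= Nat.pow 2 r)%N.
    by apply: leq_trans (size_pol _ _) _; rewrite lh.
  have s2 : (size (2%:R ^+ E * npol [the comNzRingType of 'Z_(Nat.pow 2 w)] c)%R <= Nat.pow 2 r)%N.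
    have -> : 2%:R ^+ E = (2%:R ^+ E)%:P :> {poly 'Z_(Nat.pow 2 w)} by rewrite rmorphXn /= rmorph_nat.
    rewrite mul_polyC; apply: leq_trans (size_scale_leq _ _) _.
    by apply: leq_trans (size_npol _ _) _; apply/leP.
  have := size_Mmonic Qn (monic_XnD1 _ _ N0); rewrite eQ size_XnD1 // addnS /= => s3.
  have : (size Q + Nat.pow 2 r <= Nat.pow 2 r)%N.
    by rewrite -s3 (leq_trans (size_polyD _ _)) // geq_max s1 size_polyN s2.
  have : (0 < size Q)%N by rewrite size_poly_gt0.
  by move=> q1 q2; have := leq_trans (leq_add q1 (leqnn _)) q2; rewrite add1n ltnn.
move: e; rewrite Q0 mul0r addr0 => /(congr1 (fun p : {poly _} => p`_k)).
have -> : 2%:R ^+ E = (2%:R ^+ E)%:P :> {poly 'Z_(Nat.pow 2 w)} by rewrite rmorphXn /= rmorph_nat.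
rewrite coefCM coef_pol coef_npol /cf -natrX -natrM => /(congr1 (fun x : 'Z_(Nat.pow 2 w) => nat_of_ord x)).
rewrite !val_Zp_nat //.
have xpow m : expn 2 m = Nat.pow 2 m.
  by elim: m => [|m IHm] //; rewrite expnS IHm Nat.pow_succ_r'.
have b1 : (bval (List.nth k h nil) < Nat.pow 2 w)%N.
  apply/ltP; have -> : w = length (List.nth k h nil).
    apply: esym; have /List.Forall_forall hv := vh; apply: hv; apply: nth_In; lia.
  exact: bval_lt.
have b2 : (expn 2 E * List.nth k c 0%N < Nat.pow 2 w)%N.
  apply/ltP; rewrite xpow.
  have cb : (List.nth k c 0%N <= length X)%coq_nat.
    have : Forall (fun x => x <= length a)%coq_nat c.
      by apply: nmulp_bound; apply/List.Forall_forall => x /List.in_map_iff [[] [<- _]] /=; lia.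
    move=> /List.Forall_forall hc; case: (Nat.le_gt_cases (length c) k) => l.
      by rewrite List.nth_overflow //; lia.
    have := hc _ (nth_In c 0%N l); rewrite /a List.length_map; lia.
  have sE := scale_le n r (proj1 hr); rewrite -/E in sE.
  have p1 : (Nat.mul (Nat.pow 2 E) (List.nth k c 0%N) <= Nat.mul (Nat.pow 2 E) (Nat.pow 2 r))%coq_nat.
    by apply: Nat.mul_le_mono_l; lia.
  apply: Nat.le_lt_trans p1 _; rewrite -Nat.pow_add_r; apply: Nat.pow_lt_mono_r; rewrite /w; lia.
by rewrite !modn_small // xpow.
Qed.
End Alg.

(** * Integer multiplication *)

Fixpoint unsc (u x : list bool) : list bool :=
  match u with [] => x | o :: u => if o then x else unsc u (tl x) end.

Lemma W_unsc u : forall x, W fUNSC <<B u; B x>> (ok (B (unsc u x)) (60 * (length u + 1))).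
Proof.
  induction u as [|o u IH]; intros x; body; cbn [tl_of].
  - done_.
  - destruct o; cbn [b2t]; [done_|]. destruct x as [|a x]; cbn [tl_of].
    + use (IH []). done_.
    + use (IH x). done_.
Qed.

Fixpoint rel (u acc : list bool) (P : list (list bool)) : list bool :=
  match P with
  | [] => []
  | c :: P => let s := adds false false (unsc u c) acc in hd false s :: rel u (tl s) P
  end.

Lemma unsc_length u : forall x, length (unsc u x) <= length x.
Proof.
  induction u as [|[] u IH]; intros x; simpl; auto.
  specialize (IH (tl x)). destruct x; simpl in *; lia.
Qed.

Lemma W_rel w u P : length u = w -> vlen w P -> forall acc,
  W fREL <<B u; B acc; V P>> (ok (B (rel u acc P)) (400 * (w + 1) * (length P + 1))).
Proof.
  intros hu. induction 1 as [|c P hc hP IH]; intros acc; body; cbn [tl_of].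
  - done_.
  - use (W_unsc u c). change Leaf with (b2t false) at 1 2.
    use (W_adds (unsc u c) false false acc).
    pose proof (unsc_length u c). cbn [rel].
    destruct (adds false false (unsc u c) acc) as [|s0 s]; cbn [tl_of hd tl b2t] in *.
    + use (IH []). cbn [tl_of b2t]. split; [reflexivity|]. cbn [length] in *. nia.
    + use (IH s). cbn [tl_of b2t]. split; [reflexivity|]. cbn [length] in *. nia.
Qed.

Lemma W_topoly {C} (g : C -> tree) z N : forall L X, length L = N ->
  W fTOPOLY <<tl_of g L; B z; B X>> (ok (V (topoly N z X)) (60 * (N + 1))).
Proof.
  induction N as [|N IH]; intros [|a L] X h; try discriminate; body; cbn [tl_of].
  - done_.
  - injection h as h. destruct X as [|x X]; cbn [tl_of].
    + use (IH L [] h). cbn [topoly hd tl tl_of b2t]. split; [reflexivity|]. lia.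
    + use (IH L X h). cbn [topoly hd tl tl_of b2t]. split; [reflexivity|]. lia.
Qed.

Lemma W_mklw k : forall (s : list bool) a (L : list tree), length L = 2 ^ a -> length s <= 2 ^ (a + k) ->
  W fMKLW <<B s; U L; B (repeat false (4 * a))>> (fun r n => exists b L', a <= b <= a + k /\
    length L' = 2 ^ b /\ length s <= 2 ^ b /\ (a < b -> 2 ^ b < 2 * length s) /\
    r = Node (U L') (B (repeat false (4 * b))) /\ n <= 300 * (length s + 2 ^ b) * (k + 1)).
Proof.
  induction k as [|k IH]; intros s a L hL hs; body; use (W_leq b2t (fun t : tree => t) s L);
    pose proof (pow2_pos a); destruct (Nat.leb_spec (length s) (length L)) as [l|l]; cbn [b2t].
  - exists a, L. rewrite hL in *. repeat split; auto; try lia.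
  - rewrite Nat.add_0_r, <- hL in hs. lia.
  - exists a, L. rewrite hL in *. repeat split; auto; try lia.
  - use (W_app (fun t : tree => t) L L).
    change (Node Leaf (Node Leaf (Node Leaf (Node Leaf (B (repeat false (4 * a)))))))
      with (B (repeat false (4 + 4 * a))).
    replace (4 + 4 * a) with (4 * S a) by lia.
    eapply W_mono; [apply (IH s (S a) (L ++ L))|].
    + rewrite length_app, hL, Nat.pow_succ_r'. lia.
    + replace (S a + k) with (a + S k) by lia. exact hs.
    + cbv beta. intros r m (b' & L' & h1 & h2 & h3 & h4 & h5 & h6). subst r.
      exists b', L'. rewrite hL in *.
      assert (2 ^ S a <= 2 ^ b') by (apply Nat.pow_le_mono_r; lia). rewrite Nat.pow_succ_r' in *.
      repeat split; auto; try lia.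
      intros _. destruct (Nat.eq_dec (S a) b') as [<-|]; [rewrite Nat.pow_succ_r'; lia|apply h4; lia].
Qed.

Definition imul_with (r : nat) (X Y : list bool) : list bool :=
  let z := repeat false (4 * r) in
  let o := topoly (2 ^ r) z [true] in
  rel (hd [] (pmul r o o)) [] (pmul r (topoly (2 ^ r) z X) (topoly (2 ^ r) z Y)).

Lemma bval_zeros n : bval (repeat false n) = 0.
Proof. induction n; simpl; lia. Qed.

Lemma unsc_skipn u : forall e x, bval u = 2 ^ e -> unsc u x = skipn e x.
Proof.
  induction u as [|o u IH]; intros e x h.
  - simpl in h. pose proof (pow2_pos e). lia.
  - destruct o; cbn [bval Nat.b2n] in h.
    + destruct e as [|e]; [reflexivity|]. rewrite Nat.pow_succ_r' in h. lia.
    + destruct e as [|e]; [simpl in h; lia|]. cbn [unsc]. rewrite (IH e).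
      * destruct x; simpl; auto. now rewrite skipn_nil.
      * rewrite Nat.pow_succ_r' in h. lia.
Qed.

Lemma bval_skipn e : forall x c, bval x = 2 ^ e * c -> bval (skipn e x) = c.
Proof.
  induction e as [|e IH]; intros x c h.
  - simpl in *. lia.
  - destruct x as [|b x]; simpl skipn.
    + cbn [bval] in *. pose proof (pow2_pos (S e)). nia.
    + apply IH. rewrite Nat.pow_succ_r' in h. cbn [bval] in h. destruct b; simpl Nat.b2n in h; lia.
Qed.

Lemma rel_val u e w K : 1 <= K -> bval u = 2 ^ e -> 2 * K < 2 ^ (w - e) ->
  forall P cs acc, Forall2 (fun x c => length x = w /\ bval x = 2 ^ e * c /\ c <= K) P cs ->
  bval acc <= K -> length acc <= w - e ->
  exists a, bval (rel u acc P) + 2 ^ length P * a = bval acc + eval2 cs.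
Proof.
  intros hK1 hu hK P cs acc h. revert acc.
  induction h as [|x c P cs (h1 & h2 & h3) hP IH]; intros acc ha la.
  - exists (bval acc). simpl. lia.
  - cbn [rel]. rewrite (unsc_skipn u e x hu). set (y := skipn e x).
    assert (ly : length y = w - e) by (unfold y; rewrite length_skipn; lia).
    assert (vy : bval y = c) by (apply bval_skipn; auto).
    destruct (adds_val y false acc) as [k hk]; [lia|]. rewrite ly, vy in hk. cbn [Nat.b2n] in hk.
    pose proof (adds_length y false false acc) as ls.
    assert (k = 0) by nia. subst k.
    destruct (adds false false y acc) as [|s0 s] eqn:es.
    + exfalso. simpl in ls. rewrite ly in ls. rewrite <- ls in hK. simpl in hK. lia.
    + cbn [hd tl bval] in *. destruct (IH s) as [a hA]; [lia|simpl in ls; lia|].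
      exists a. cbn [length eval2]. rewrite Nat.pow_succ_r'. lia.
Qed.

Lemma nth_hd_eq {A} (d : A) l : hd d l = nth 0 l d.
Proof. now destruct l. Qed.

Lemma eval2_app a : forall n, eval2 (a ++ repeat 0 n) = eval2 a.
Proof.
  induction a; intros n; cbn [app eval2]; [|now rewrite IHa].
  induction n; cbn [repeat eval2]; lia.
Qed.

Lemma nth_app_zeros (l : list nat) n k : nth k (l ++ repeat 0 n) 0 = nth k l 0.
Proof.
  destruct (Nat.lt_ge_cases k (length l)); [now rewrite app_nth1|].
  rewrite app_nth2, (nth_overflow l) by lia. apply nth_repeat.
Qed.

Lemma Forall2_nth {A C} (P : A -> C -> Prop) d d' l l' : length l = length l' ->
  (forall k, k < length l -> P (nth k l d) (nth k l' d')) -> Forall2 P l l'.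
Proof.
  revert l'. induction l as [|a l IH]; intros [|b l'] h hp; try discriminate; constructor.
  - apply (hp 0). simpl; lia.
  - apply IH; [simpl in h; lia|]. intros k hk. apply (hp (S k)). simpl; lia.
Qed.

Lemma imul_with_spec r X Y : 2 <= r -> length X + length Y <= 2 ^ r ->
  bval (imul_with r X Y) = bval X * bval Y /\ length (imul_with r X Y) = 2 ^ r.
Proof.
  intros hr hXY. unfold imul_with. set (z := repeat false (4 * r)). set (N := 2 ^ r) in *.
  assert (lz : length z = 4 * r) by apply repeat_length.
  assert (bz : bval z = 0) by apply bval_zeros.
  assert (N4 : 4 <= N) by (apply (Nat.pow_le_mono_r 2 2 r); lia).
  set (E := Alg.scale r r). pose proof (Alg.scale_le r r hr) as hE. fold E in hE.
  set (u := hd [] (pmul r (topoly N z [true]) (topoly N z [true]))).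
  assert (hu : bval u = 2 ^ E).
  { pose proof (Alg.pmul_bits r r z [true] [true]) as h.
    unfold u. rewrite nth_hd_eq. unfold N. rewrite h; fold N; try lia; [|cbn [length]; lia].
    change (nth 0 (nmulp (map Nat.b2n [true]) (map Nat.b2n [true])) 0) with 1. fold E. lia. }
  set (P := pmul r (topoly N z X) (topoly N z Y)).
  destruct (pmul_shape (S (length z)) r r (topoly N z X) (topoly N z Y)) as [lP vP];
    try apply topoly_length; try apply topoly_vlen; try lia. fold P N in lP, vP.
  set (C := nmulp (map Nat.b2n X) (map Nat.b2n Y)).
  assert (lC : length C <= N).
  { pose proof (nmulp_length (map Nat.b2n X) (map Nat.b2n Y)) as l. rewrite !length_map in l. fold C in l. lia. }
  assert (bC : forall k, nth k C 0 <= N).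
  { intros k. destruct (Nat.lt_ge_cases k (length C)); [|rewrite nth_overflow; lia].
    assert (hb : Forall (fun x => x <= length (map Nat.b2n X)) C).
    { apply nmulp_bound; apply Forall_forall; intros x hx; apply in_map_iff in hx;
      destruct hx as [[] [<- _]]; simpl; lia. }
    rewrite Forall_forall in hb. specialize (hb _ (nth_In C 0 H)). rewrite length_map in hb. lia. }
  destruct (rel_val u E (S (length z)) N) with (P := P) (cs := C ++ repeat 0 (N - length C)) (acc := @nil bool)
    as [a ha]; try (simpl; lia); auto.
  { change (2 * N) with (2 * 2 ^ r). rewrite <- Nat.pow_succ_r'. apply Nat.pow_lt_mono_r; lia. }
  { apply (Forall2_nth _ [] 0).
    - rewrite length_app, repeat_length. lia.
    - intros k hk. rewrite nth_app_zeros. split; [|split].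
      + unfold vlen in vP. rewrite Forall_forall in vP. apply vP. now apply nth_In.
      + apply Alg.pmul_bits; fold N; auto; lia.
      + apply bC. }
  assert (lr : forall acc Q, length (rel u acc Q) = length Q).
  { intros acc Q. revert acc. induction Q; intros; cbn [rel length]; auto. }
  rewrite lr, lP. split; [|reflexivity].
  rewrite eval2_app in ha. unfold C in ha. rewrite nmulp_eval, !eval2_bits, lP in ha. cbn [bval] in ha.
  pose proof (bval_lt X) as bX. pose proof (bval_lt Y) as bY.
  assert (bXY : bval X * bval Y < 2 ^ N).
  { apply Nat.lt_le_trans with (2 ^ length X * 2 ^ length Y).
    - apply Nat.mul_lt_mono; auto.
    - rewrite <- Nat.pow_add_r. apply Nat.pow_le_mono_r; lia. }
  (* A nonzero final carry would make the product at least [2 ^ N]. *)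
  destruct a as [|a]; [lia|]. nia.
Qed.

Definition CI := 200 * D1.
Lemma CI_eq : CI = 200 * D1. Proof. reflexivity. Qed.
Global Opaque CI.

(** [R] is a bound on logarithms of sizes shared by a whole stage, so that costs are linear in the
    lengths. Of the exponent 5, three come from [W_pmul] and two from the squared width of the
    coefficients. *)
Lemma W_imul R X Y : 2 <= R -> length X + length Y <= 2 ^ R ->
  W fIMUL <<B X; B Y>> (fun v n => exists Z, v = B Z /\ bval Z = bval X * bval Y /\
    length X + length Y <= length Z <= 2 * (length X + length Y) + 4 /\
    n <= CI * (length X + length Y + 4) * R ^ 5).
Proof.
  intros hR hXY. body. use (W_app b2t X Y).
  change (Node Leaf (Node Leaf (Node Leaf (Node Leaf Leaf)))) with (U [Leaf; Leaf; Leaf; Leaf]).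
  change (Node Leaf (Node Leaf (Node Leaf (Node Leaf (U [Leaf; Leaf; Leaf; Leaf])))))
    with (B (repeat false (4 * 2))).
  eapply W_mono; [apply (W_mklw (R - 2) (X ++ Y) 2 [Leaf; Leaf; Leaf; Leaf])|].
  { reflexivity. }
  { replace (2 + (R - 2)) with R by lia. now rewrite length_app. }
  cbv beta. intros v m (r & L & hr & lL & hs & hlt & -> & hm). cbn [wp]. rewrite length_app in *.
  set (z := repeat false (4 * r)). set (N := 2 ^ r) in *.
  change (Node (Node Leaf Leaf) Leaf) with (B [true]).
  use (W_topoly (fun t : tree => t) z N L [true] lL).
  set (o := topoly N z [true]).
  assert (lz : length z = 4 * r) by apply repeat_length.
  assert (N4 : 4 <= N) by (apply (Nat.pow_le_mono_r 2 2 r); lia).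
  assert (lo : length o = 2 ^ r) by apply topoly_length.
  assert (vo : vlen (S (4 * r)) o) by (rewrite <- lz; apply topoly_vlen).
  assert (hr2 : 2 <= r <= r + 2) by lia.
  use (W_pmul (S (4 * r)) r r o o hr2 lo vo lo vo).
  set (oo := pmul r o o).
  assert (ho : exists o1 o2, oo = o1 :: o2).
  { destruct (pmul_shape _ r r o o hr2 lo vo lo vo) as [l _]. fold oo N in l.
    destruct oo; [simpl in l; lia|eauto]. }
  destruct ho as (o1 & o2 & eo). rewrite eo. cbn [tl_of].
  assert (lo1 : length o1 = S (4 * r)).
  { destruct (pmul_shape _ r r o o hr2 lo vo lo vo) as [_ l]. fold oo in l. rewrite eo in l. now inversion l. }
  use (W_topoly (fun t : tree => t) z N L X lL). use (W_topoly (fun t : tree => t) z N L Y lL).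
  assert (vX : vlen (S (4 * r)) (topoly N z X)) by (rewrite <- lz; apply topoly_vlen).
  assert (vY : vlen (S (4 * r)) (topoly N z Y)) by (rewrite <- lz; apply topoly_vlen).
  use (W_pmul (S (4 * r)) r r _ _ hr2 (topoly_length N z X) vX (topoly_length N z Y) vY).
  destruct (pmul_shape _ r r _ _ hr2 (topoly_length N z X) vX (topoly_length N z Y) vY) as [lP vP].
  set (P := pmul r (topoly N z X) (topoly N z Y)) in *.
  change Leaf with (B []) at 1.
  use (W_rel (S (4 * r)) o1 P lo1 vP []).
  exists (imul_with r X Y). destruct (imul_with_spec r X Y) as [s1 s2]; auto; try lia.
  assert (iN : N <= 2 * (length X + length Y) + 4).
  { destruct (Nat.eq_dec r 2) as [->|]; [unfold N; simpl; lia|]. assert (2 < r) by lia. specialize (hlt H). lia. }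
  split; [|split; [assumption|split; [fold N in s2; lia|]]].
  - unfold imul_with. fold z N o oo. rewrite eo. reflexivity.
  - rewrite lP in *. change (2 ^ r) with N in b1, b4, b5.
    assert (lXs : length X <= length X + length Y) by lia.
    set (s := length X + length Y) in *. clearbody s N.
    assert (q1 : (S (4 * r) + 1) * (S (4 * r) + 1) * (N * r ^ 3) <= 25 * (N * R ^ 5)).
    { apply Nat.le_trans with (25 * (N * r ^ 5)).
      - replace (25 * (N * r ^ 5)) with ((5 * r) * (5 * r) * (N * r ^ 3)) by (simpl; ring).
        apply Nat.mul_le_mono_r. apply Nat.mul_le_mono; lia.
      - apply Nat.mul_le_mono_l, Nat.mul_le_mono_l, Nat.pow_le_mono_l. lia. }
    assert (q2 : R <= R ^ 5).
    { rewrite <- (Nat.pow_1_r R) at 1. apply Nat.pow_le_mono_r; lia. }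
    assert (q3 : 400 * (S (4 * r) + 1) * (N + 1) <= 4 * 2000 * (N * R ^ 5)).
    { apply Nat.le_trans with (400 * (5 * R) * (4 * N)); [apply Nat.mul_le_mono; lia|].
      replace (400 * (5 * R) * (4 * N)) with (4 * 2000 * (N * R)) by ring.
      apply Nat.mul_le_mono_l, Nat.mul_le_mono_l, q2. }
    assert (q4 : 300 * (s + N) * (R - 2 + 1) <= 600 * (N * R ^ 5)).
    { apply Nat.le_trans with (300 * (2 * N) * R); [apply Nat.mul_le_mono; lia|].
      replace (300 * (2 * N) * R) with (600 * (N * R)) by ring.
      apply Nat.mul_le_mono_l, Nat.mul_le_mono_l, q2. }
    assert (q5 : N <= N * R ^ 5) by (rewrite Nat.mul_comm; apply mul_ge_r; lia).
    assert (q6 : N * R ^ 5 <= (2 * s + 4) * R ^ 5) by (apply Nat.mul_le_mono_r; lia).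
    assert (q7 : D1 * ((S (4 * r) + 1) * (S (4 * r) + 1)) * (N * r ^ 3) <= D1 * (25 * (N * R ^ 5)))
      by (rewrite <- Nat.mul_assoc; now apply Nat.mul_le_mono_l).
    set (Q := N * R ^ 5) in *. pose proof D1_eq as d1. pose proof CI_eq as ci.
    assert (q8 : 50 * 2000 * Q <= D1 * Q) by (rewrite d1; lia).
    replace (D1 * (25 * Q)) with (25 * (D1 * Q)) in q7 by ring.
    apply Nat.le_trans with (100 * (D1 * Q)); [lia|].
    rewrite ci. replace (200 * D1 * (s + 4) * R ^ 5) with (100 * (D1 * ((2 * s + 8) * R ^ 5))) by ring.
    apply Nat.mul_le_mono_l, Nat.mul_le_mono_l. lia.
Qed.

(** * One stage of the construction *)

Definition QR R := CI * R ^ 5.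

Lemma QR_ge R : 2 <= R -> 1000 <= QR R.
Proof.
  intros h. unfold QR. rewrite CI_eq, D1_eq. assert (1 <= R ^ 5) by (pose proof (Nat.pow_nonzero R 5); lia). nia.
Qed.

Lemma bval_split k : forall x, bval x = bval (firstn k x) + 2 ^ k * bval (skipn k x).
Proof.
  induction k as [|k IH]; intros x; [simpl; lia|].
  destruct x as [|b x]; [simpl; lia|]. cbn [firstn skipn bval]. rewrite (IH x), Nat.pow_succ_r'. lia.
Qed.

Lemma bval_firstn_lt k x : bval (firstn k x) < 2 ^ k.
Proof.
  pose proof (bval_lt (firstn k x)). rewrite length_firstn in H.
  apply Nat.lt_le_trans with (1 := H). apply Nat.pow_le_mono_r; lia.
Qed.

Lemma bval_firstn k x : bval (firstn k x) = bval x mod 2 ^ k.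
Proof. apply Nat.mod_unique with (bval (skipn k x)); [apply bval_firstn_lt|]. rewrite (bval_split k x). lia. Qed.

Lemma bval_skipn_div k x : bval (skipn k x) = bval x / 2 ^ k.
Proof. apply Nat.div_unique with (bval (firstn k x)); [apply bval_firstn_lt|]. rewrite (bval_split k x). lia. Qed.

Lemma bval_app x : forall y, bval (x ++ y) = bval x + 2 ^ length x * bval y.
Proof. induction x; intros y; cbn [app bval length]; [simpl; lia|]. rewrite IHx, Nat.pow_succ_r'. lia. Qed.

Lemma bval_inj x : forall y, length x = length y -> bval x = bval y -> x = y.
Proof.
  induction x as [|a x IH]; intros [|b y] l v; try discriminate; auto.
  cbn [bval] in v. simpl in l. f_equal; [destruct a, b; simpl in v; auto; lia|].
  apply IH; [lia|]. destruct a, b; simpl Nat.b2n in v; lia.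
Qed.

Lemma W_isz x : W fISZ <<B x>> (ok (b2t (bval x =? 0)) (60 * (length x + 1))).
Proof.
  induction x as [|b x IH]; body; cbn [tl_of].
  - done_.
  - destruct b; cbn [b2t].
    + split; [|cbn [length]; lia]. cbn [bval Nat.b2n]. destruct (Nat.eqb_spec (1 + 2 * bval x) 0); [lia|reflexivity].
    + use IH. split; [|cbn [length]; lia]. cbn [bval Nat.b2n].
      destruct (Nat.eqb_spec (0 + 2 * bval x) 0), (Nat.eqb_spec (bval x) 0); auto; lia.
Qed.

Ltac useI R X Y := eapply W_mono; [apply (W_imul R X Y) |
  let r := fresh "r" in let n := fresh "n" in let Z := fresh "Z" in
  let e := fresh "eZ" in let v := fresh "vZ" in let l := fresh "lZ" in let b := fresh "b" in
  cbv beta; intros r n (Z & e & v & l & b); subst r; cbn [wp tl_of]].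

Lemma W_tryb R (hR : 2 <= R) b P : length b + length P <= 2 ^ R ->
  W fTRYB <<B b; B P>> (fun v n => exists P', v = B P' /\ length P' = length P /\
   ((bval P' = bval b * bval P /\ bval b * bval P < 2 ^ length P) \/
    (bval P' = bval P /\ 2 ^ length P <= bval b * bval P)) /\
   n <= 2 * QR R * (length b + length P + 4)).
Proof.
  intros h. body. useI R b P; [lia|lia|].
  use (W_drop b2t b2t P Z). use (W_isz (skipn (length P) Z)).
  rewrite bval_skipn_div, vZ. rewrite length_skipn in *.
  pose proof (QR_ge R hR) as hq. unfold QR in *.
  replace (CI * (length b + length P + 4) * R ^ 5) with (CI * R ^ 5 * (length b + length P + 4)) in * by ring.
  set (q := CI * R ^ 5) in *.
  assert (hq2 : 1000 * (length b + length P + 4) <= q * (length b + length P + 4)) by now apply Nat.mul_le_mono_r.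
  destruct (Nat.eqb_spec (bval b * bval P / 2 ^ length P) 0) as [e|e]; cbn [b2t].
  - apply Nat.div_small_iff in e; [|pose proof (pow2_pos (length P)); lia].
    use (W_take b2t b2t P Z). exists (firstn (length P) Z).
    split; [reflexivity|]. split; [rewrite length_firstn; lia|]. split; [left|nia].
    rewrite bval_firstn, vZ, Nat.mod_small; auto.
  - exists P. split; [reflexivity|]. split; [reflexivity|]. split; [right|nia].
    split; auto. destruct (Nat.le_gt_cases (2 ^ length P) (bval b * bval P)); auto.
    exfalso. apply e. now apply Nat.div_small.
Qed.

Lemma W_norm R (hR : 2 <= R) b X l : length b + length X <= 2 ^ R -> length l = length X ->
  W fNORM <<B b; B X; B l>> (fun v n => exists X' l', v = Node (B X') (B l') /\
   length X' = length X /\ length l' = length X /\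
   ((bval b * bval l < 2 ^ length X /\ bval l' = bval b * bval l /\
      bval X' = (bval b * bval X) mod 2 ^ length X) \/
    (2 ^ length X <= bval b * bval l /\ l' = l /\ X' = X)) /\
   n <= 4 * QR R * (length b + length X + 4)).
Proof.
  intros h hl. body. useI R b l; [lia|lia|].
  use (W_drop b2t b2t l Z). use (W_isz (skipn (length l) Z)).
  rewrite bval_skipn_div, vZ. rewrite length_skipn, hl in *.
  pose proof (QR_ge R hR) as hq. unfold QR in *.
  replace (CI * (length b + length X + 4) * R ^ 5) with (CI * R ^ 5 * (length b + length X + 4)) in * by ring.
  destruct (Nat.eqb_spec (bval b * bval l / 2 ^ length X) 0) as [e|e]; cbn [b2t].
  - apply Nat.div_small_iff in e; [|pose proof (pow2_pos (length X)); lia].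
    useI R b X; [lia|lia|]. use (W_take b2t b2t l Z0). use (W_take b2t b2t l Z). rewrite hl in *.
    exists (firstn (length X) Z0), (firstn (length X) Z).
    split; [reflexivity|]. split; [rewrite length_firstn; lia|]. split; [rewrite length_firstn; lia|].
    split; [left|].
    + split; auto. rewrite !bval_firstn, vZ, vZ0. split; auto. now apply Nat.mod_small.
    + replace (CI * (length b + length X + 4) * R ^ 5) with (CI * R ^ 5 * (length b + length X + 4)) in * by ring.
      set (q := CI * R ^ 5) in *.
      assert (hq2 : 1000 * (length b + length X + 4) <= q * (length b + length X + 4)) by now apply Nat.mul_le_mono_r.
      lia.
  - exists X, l. split; [reflexivity|]. split; [reflexivity|]. split; [lia|]. split; [right|].
    + split; auto. destruct (Nat.le_gt_cases (2 ^ length X) (bval b * bval l)); auto.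
      exfalso. apply e. now apply Nat.div_small.
    + set (q := CI * R ^ 5) in *.
      assert (hq2 : 1000 * (length b + length X + 4) <= q * (length b + length X + 4)) by now apply Nat.mul_le_mono_r.
      lia.
Qed.

Definition renc (r : list bool * list bool) := Node (B (fst r)) (B (snd r)).

(* Value read off by WORD: the integer part of P * (X + l u / 2^|u|) mod 1, for p-bit fractions. *)
Definition wordN (P X l u p lu : nat) := P * ((X + l * u / 2 ^ lu) mod 2 ^ p) / 2 ^ p.

Lemma adds_mod X T : length T <= length X ->
  bval (adds false false X T) = (bval X + bval T) mod 2 ^ length X.
Proof.
  intros h. destruct (adds_val X false T h) as [k hk]. cbn [Nat.b2n] in hk.
  apply Nat.mod_unique with k.
  - pose proof (bval_lt (adds false false X T)). now rewrite adds_length in H.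
  - lia.
Qed.

(* The product of l and u has length at least |l| + |u|, so it must be cut before the addition. *)
Lemma adds_firstn s c xs : forall ys, adds s c xs ys = adds s c xs (firstn (length xs) ys).
Proof.
  revert c. induction xs as [|x xs IH]; intros c ys; cbn [adds length]; auto.
  destruct ys as [|y ys]; cbn [firstn hd tl]; auto. f_equal. apply IH.
Qed.

Lemma adds_mod' X T : bval (adds false false X T) = (bval X + bval T) mod 2 ^ length X.
Proof.
  rewrite adds_firstn, adds_mod by (rewrite length_firstn; lia).
  rewrite bval_firstn. pose proof (pow2_pos (length X)). rewrite Nat.Div0.add_mod_idemp_r. reflexivity.
Qed.

Lemma W_word R (hR : 2 <= R) P r u : length (snd r) = length (fst r) -> length P = length u ->
  length (fst r) + length u <= 2 ^ R -> bval P < 2 ^ length P ->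
  W fWORD <<B P; renc r; B u>> (fun v n => exists k, v = B k /\ length k = length u /\
    bval k = wordN (bval P) (bval (fst r)) (bval (snd r)) (bval u) (length (fst r)) (length u) /\
    n <= 4 * QR R * (length (fst r) + length u + 4)).
Proof.
  destruct r as [X l]. cbn [fst snd]. intros hl hP h bP. unfold renc. cbn [fst snd]. body.
  useI R l u; [lia|lia|]. use (W_drop b2t b2t u Z).
  change Leaf with (b2t false) at 1 2. use (W_adds X false false (skipn (length u) Z)).
  set (Y := adds false false X (skipn (length u) Z)).
  assert (lY : length Y = length X) by apply adds_length.
  assert (vY : bval Y = (bval X + bval l * bval u / 2 ^ length u) mod 2 ^ length X).
  { unfold Y. now rewrite adds_mod', bval_skipn_div, vZ. }
  useI R P Y; [lia|lia|]. use (W_drop b2t b2t X Z0). use (W_take b2t b2t P (skipn (length X) Z0)).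
  exists (firstn (length P) (skipn (length X) Z0)). split; [reflexivity|]. split; [|split].
  - rewrite length_firstn, length_skipn. lia.
  - rewrite bval_firstn, bval_skipn_div, vZ0. unfold wordN. rewrite <- vY. apply Nat.mod_small.
    apply Nat.Div0.div_lt_upper_bound.
    pose proof (bval_lt Y) as bY. rewrite lY in bY. rewrite (Nat.mul_comm (2 ^ length X)).
    apply Nat.mul_lt_mono; auto.
  - pose proof (QR_ge R hR) as hq. unfold QR in *. rewrite lY, hl, hP in *.
    replace (CI * (length X + length u + 4) * R ^ 5) with (CI * R ^ 5 * (length X + length u + 4)) in * by ring.
    replace (CI * (length u + length X + 4) * R ^ 5) with (CI * R ^ 5 * (length X + length u + 4)) in * by ring.
    set (q := CI * R ^ 5) in *.
    assert (hq2 : 1000 * (length X + length u + 4) <= q * (length X + length u + 4)) by now apply Nat.mul_le_mono_r.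
    lia.
Qed.

(** * Tries of counters and the greedy choice *)

Fixpoint lookup (t : tree) (k : list bool) {struct k} : tree :=
  match k with
  | [] => t
  | b :: k => match t with Leaf => Leaf | Node x y => lookup (if b then y else x) k end
  end.
Fixpoint tupd (t : tree) (k : list bool) (v : tree) {struct k} : tree :=
  match k with
  | [] => v
  | b :: k => let x := match t with Leaf => Leaf | Node x _ => x end in
              let y := match t with Leaf => Leaf | Node _ y => y end in
      if b then Node x (tupd y k v) else Node (tupd x k v) y
  end.

(** [Leaf] is both the empty trie and the empty bit list, that is, the counter 0. Tries can
    therefore start empty and grow only along the words that occur. *)
Lemma lookup_leaf k : lookup Leaf k = Leaf.
Proof. now destruct k. Qed.

Lemma lookup_tupd_same k : forall t v, lookup (tupd t k v) k = v.
Proof. induction k as [|[] k IH]; intros t v; cbn [tupd lookup]; [reflexivity|apply IH..]. Qed.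

Lemma lookup_tupd_other k : forall k' t v, length k = length k' -> k <> k' ->
  lookup (tupd t k v) k' = lookup t k'.
Proof.
  induction k as [|b k IH]; intros [|b' k'] t v l n; try discriminate; [tauto|].
  simpl in l. destruct b, b', t; cbn [tupd lookup]; auto;
   try (rewrite IH; [auto using lookup_leaf|lia|congruence]); auto using lookup_leaf.
Qed.

Lemma W_lookup k : forall t, W fLOOKUP <<t; B k>> (ok (lookup t k) (60 * (length k + 1))).
Proof.
  induction k as [|b k IH]; intros t; body; cbn [tl_of].
  - done_.
  - destruct t as [|x y]; [done_|]. destruct b; cbn [b2t]; use IH; done_.
Qed.

Lemma W_incr zq k : forall t c, lookup t k = B c ->
  W fINCR <<B zq; t; B k>> (ok (tupd t k (B (adds false true zq c)))
    (60 * (length k + 1) + 200 * (length zq + 1))).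
Proof.
  induction k as [|b k IH]; intros t c h; body; cbn [tl_of].
  - simpl in h. subst t. change Leaf with (b2t false) at 1. change (Node Leaf Leaf) with (b2t true).
    use (W_adds zq false true c). cbn [tupd]. split; [reflexivity|]. cbn [length]. lia.
  - destruct t as [|x y]; destruct b; cbn [b2t lookup] in *.
    + assert (c = []) by (destruct c; [auto|discriminate]). subst c.
      use (IH Leaf []); [apply lookup_leaf|]. cbn [tupd]. split; [reflexivity|]. cbn [length]. lia.
    + assert (c = []) by (destruct c; [auto|discriminate]). subst c.
      use (IH Leaf []); [apply lookup_leaf|]. cbn [tupd]. split; [reflexivity|]. cbn [length]. lia.
    + use (IH y c h). cbn [tupd]. split; [reflexivity|]. cbn [length]. lia.
    + use (IH x c h). cbn [tupd]. split; [reflexivity|]. cbn [length]. lia.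
Qed.

Lemma W_less x : forall c y, length y = length x ->
  W fLESS <<b2t c; B x; B y>> (ok (b2t (if bval x =? bval y then c else bval x <? bval y)) (100 * (length x + 1))).
Proof.
  induction x as [|a x IH]; intros c [|b y] l; try discriminate; body; cbn [tl_of].
  - destruct c; done_.
  - simpl in l.
    set (c' := if a then (if b then c else false) else if b then true else c).
    assert (e : (if bval x =? bval y then c' else bval x <? bval y) =
      if bval (a :: x) =? bval (b :: y) then c else bval (a :: x) <? bval (b :: y)).
    { unfold c'. cbn [bval]. destruct a, b; simpl Nat.b2n;
       destruct (Nat.eqb_spec (bval x) (bval y)), (Nat.ltb_spec (bval x) (bval y));
       repeat match goal with |- context [?p =? ?q] => destruct (Nat.eqb_spec p q) end;
       repeat match goal with |- context [?p <? ?q] => destruct (Nat.ltb_spec p q) end; auto; lia. }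
    rewrite <- e. clear e.
    destruct a, b; cbn [b2t]; cbv beta iota; unfold c'; clear c'.
    + use (IH c y); [lia|]. cbn [length]. split; [reflexivity|lia].
    + change Leaf with (b2t false) at 1. use (IH false y); [lia|]. split; [reflexivity|cbn [length]; lia].
    + change (Node Leaf Leaf) with (b2t true). use (IH true y); [lia|]. split; [reflexivity|cbn [length]; lia].
    + use (IH c y); [lia|]. split; [reflexivity|cbn [length]; lia].
Qed.
Fixpoint words (l : nat) : list (list bool) :=
  match l with 0 => [[]] | S l => map (cons false) (words l) ++ map (cons true) (words l) end.

Lemma words_length l : length (words l) = 2 ^ l.
Proof. induction l; cbn [words]; auto. rewrite length_app, !length_map, IHl, Nat.pow_succ_r'. lia. Qed.

Lemma words_in l u : In u (words l) <-> length u = l.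
Proof.
  revert u. induction l as [|l IH]; intros u; cbn [words].
  - destruct u; simpl; split; auto; [intros [h|h]; [discriminate|tauto]|discriminate].
  - rewrite in_app_iff, !in_map_iff. split.
    + intros [(v & <- & h)|(v & <- & h)]; simpl; f_equal; now apply IH.
    + destruct u as [|[] u]; simpl; intros h; try discriminate; injection h as h;
        [right|left]; exists u; split; auto; now apply IH.
Qed.

Lemma words_nodup l : NoDup (words l).
Proof.
  induction l as [|l IH]; cbn [words]; [repeat constructor; simpl; tauto|].
  apply NoDup_app; [apply Injective_map_NoDup; auto; intros ? ? e; congruence|
    apply Injective_map_NoDup; auto; intros ? ? e; congruence|].
  intros u. rewrite !in_map_iff. intros (v & <- & _) (v' & e & _). discriminate.
Qed.

Lemma W_mapc b x : W fMAPC <<b2t b; V x>> (ok (V (map (cons b) x)) (60 * (length x + 1))).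
Proof.
  induction x as [|a x IH]; body; cbn [tl_of].
  - done_.
  - use IH. cbn [map tl_of]. split; [reflexivity|cbn [length]; lia].
Qed.

Lemma W_words {A} (g : A -> tree) l : W fWORDS <<tl_of g l>>
  (ok (V (words (length l))) (500 * 2 ^ length l)).
Proof.
  induction l as [|a l IH]; body; cbn [tl_of].
  - split; [reflexivity|]. simpl. lia.
  - use IH. change Leaf with (b2t false) at 1. use (W_mapc false (words (length l))).
    change (Node Leaf Leaf) with (b2t true). use (W_mapc true (words (length l))).
    use (W_app B). cbn [words length]. split; [reflexivity|].
    rewrite ?length_map, ?words_length, Nat.pow_succ_r' in *. pose proof (pow2_pos (length l)). lia.
Qed.

Lemma W_rev {A} (g : A -> tree) x : forall y,
  W fREV <<tl_of g x; tl_of g y>> (ok (tl_of g (rev x ++ y)) (60 * (length x + 1))).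
Proof.
  induction x as [|a x IH]; intros y; body; cbn [tl_of].
  - done_.
  - change (Node (g a) (tl_of g y)) with (tl_of g (a :: y)). use IH.
    cbn [rev]. rewrite <- app_assoc. cbn [app]. split; [reflexivity|cbn [length]; lia].
Qed.

Lemma W_rpt a k : W fRPT <<B (repeat false a); B (repeat false k)>>
  (ok (B (repeat false (a * k))) (60 * (k + 2) * (a + 1))).
Proof.
  induction a as [|a IH]; body; cbn [repeat tl_of].
  - done_.
  - use IH. use (W_app b2t (repeat false k)). rewrite <- repeat_app. rewrite repeat_length in *.
    split; [reflexivity|]. lia.
Qed.

Notation rec := (list bool * list bool)%type.
Notation RS := (tl_of renc).
Definition recp (p : nat) (r : rec) := length (fst r) = p /\ length (snd r) = p.
Definition wordr (P : list bool) (r : rec) (u : list bool) :=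
  wordN (bval P) (bval (fst r)) (bval (snd r)) (bval u) (length (fst r)) (length u).
Notation cnt := (count_occ Nat.eq_dec).

(** The trie is specified by the list of all words met so far, which is what the counting argument
    works with; a word is identified with its value. *)
Definition trep (l : nat) (t : tree) (H : list nat) := forall k, length k = l ->
  exists c, lookup t k = B c /\ bval c = cnt H (bval k).
Fixpoint treps (l n : nat) (ts : list tree) (Hs : list (list nat)) : Prop :=
  match n with 0 => True | S n => trep l (hd Leaf ts) (hd [] Hs) /\ treps l n (tl ts) (tl Hs) end.

Fixpoint costN (Ps : list (list bool)) (rs : list rec) (Hs : list (list nat)) (u : list bool) : nat :=
  match rs with
  | [] => 0
  | r :: rs => cnt (hd [] Hs) (wordr (hd [] Ps) r u) + costN (tl Ps) rs (tl Hs) u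
  end.
Fixpoint push (Ps : list (list bool)) (rs : list rec) (Hs : list (list nat)) (u : list bool) : list (list nat) :=
  match rs with
  | [] => []
  | r :: rs => (wordr (hd [] Ps) r u :: hd [] Hs) :: push (tl Ps) rs (tl Hs) u
  end.
Definition vecl l n (Ps : list (list bool)) := length Ps = n /\ Forall (fun P => length P = l) Ps.

Lemma vecl_S l n Ps : vecl l (S n) Ps -> exists P Ps', Ps = P :: Ps' /\ length P = l /\ vecl l n Ps'.
Proof.
  intros [h1 h2]. destruct Ps as [|P Ps]; [discriminate|]. inversion h2; subst.
  exists P, Ps. repeat split; auto.
Qed.

Lemma W_cost R (hR : 2 <= R) l g p u rs : length u = l -> p + l <= 2 ^ R -> Forall (recp p) rs ->
  forall Ps ts Hs acc, vecl l (length rs) Ps -> treps l (length rs) ts Hs -> length acc = g ->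
  bval acc + costN Ps rs Hs u < 2 ^ g ->
  W fCOST <<V Ps; RS rs; U ts; B u; B acc>> (fun v n => exists a, v = B a /\ length a = g /\
    bval a = bval acc + costN Ps rs Hs u /\ n <= (length rs + 1) * (5 * QR R * (p + l + g + 4))).
Proof.
  intros hu hpl. pose proof (QR_ge R hR) as hq. set (q := QR R) in *.
  assert (hq2 : 1000 * (p + l + g + 4) <= q * (p + l + g + 4)) by now apply Nat.mul_le_mono_r.
  induction 1 as [|r rs [r1 r2] hrs IH]; intros Ps ts Hs acc hPs hts ha hv; body; cbn [tl_of].
  - exists acc. cbn [costN length] in *. repeat split; auto; lia.
  - cbn [length] in hPs. destruct (vecl_S _ _ _ hPs) as (P & Ps' & -> & lP & hPs').
    cbn [treps length costN hd tl tl_of] in *. destruct hts as [ht hts].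
    (* The code takes the head and the tail of the list of tries by [Case]. With [X] and [tsx]
       abstracted, one proof serves both the nonempty list and the exhausted one, where the defaults
       stand for empty tries. *)
    assert (step : forall (X : tree) (tsx : list tree), X = hd Leaf ts -> tsx = tl ts ->
      W fWORD <<B P; renc r; B u>> (fun w m0 => W fLOOKUP <<X; w>> (fun w0 m1 => W fADDS <<Leaf; Leaf; B acc; w0>>
        (fun w1 m2 => W fCOST <<V Ps'; RS rs; U tsx; B u; w1>> (fun v n => exists a, v = B a /\ length a = g /\
    bval a = bval acc + (cnt (hd [] Hs) (wordr P r u) + costN Ps' rs (tl Hs) u) /\
       n + m0 + m1 + m2 + 200 <= (S (length rs) + 1) * (5 * q * (p + l + g + 4))))))).
    { intros X tsx -> ->. eapply W_mono; [apply (W_word R hR P r u); try congruence; try lia; apply bval_lt|].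
      cbv beta. intros v n (k & -> & lk & vk & bn).
      use (W_lookup k (hd Leaf ts)). destruct (ht k) as (c & hc1 & hc2); [congruence|]. rewrite hc1.
      change Leaf with (b2t false) at 1 2. use (W_adds acc false false c).
      eapply W_mono; [apply (IH Ps' (tl ts) (tl Hs) (adds false false acc c)); auto|].
      - rewrite adds_length. auto.
      - rewrite adds_mod', ha, hc2, vk. fold (wordr P r u). rewrite Nat.mod_small; lia.
      - cbv beta. intros v' n' (a & -> & la & va & bn'). exists a. split; auto. split; auto. split.
        + rewrite va, adds_mod', ha, hc2, vk. fold (wordr P r u). rewrite Nat.mod_small; lia.
        + rewrite lk, r1, ha, hu in *. fold q in bn.
          assert (4 * q * (p + l + 4) <= 4 * q * (p + l + g + 4)) by (apply Nat.mul_le_mono_l; lia).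
          lia. }
    destruct ts as [|t ts]; cbn [tl_of hd tl] in *.
    + eapply W_mono; [apply (step Leaf []); auto|]. cbv beta. intros v n h.
      eapply W_mono; [exact h|]. clear h. cbv beta. intros v1 n1 h.
      eapply W_mono; [exact h|]. clear h. cbv beta. intros v2 n2 h.
      eapply W_mono; [exact h|]. clear h. cbv beta. intros v3 n3 (a & e1 & e2 & e3 & e4).
      exists a. repeat split; auto. lia.
    + eapply W_mono; [apply (step t ts); auto|]. cbv beta. intros v n h.
      eapply W_mono; [exact h|]. clear h. cbv beta. intros v1 n1 h.
      eapply W_mono; [exact h|]. clear h. cbv beta. intros v2 n2 h.
      eapply W_mono; [exact h|]. clear h. cbv beta. intros v3 n3 (a & e1 & e2 & e3 & e4).
      exists a. repeat split; auto. lia.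
Qed.

Lemma W_best R (hR : 2 <= R) l g p Ps rs ts Hs : p + l <= 2 ^ R -> Forall (recp p) rs -> vecl l (length rs) Ps ->
  treps l (length rs) ts Hs -> (forall u, costN Ps rs Hs u < 2 ^ g) ->
  forall cs cu cc, Forall (fun u => length u = l) cs -> length cu = l -> length cc = g ->
  bval cc = costN Ps rs Hs cu ->
  W fBEST <<V Ps; RS rs; U ts; B (repeat false g); V cs; B cu; B cc>> (fun v n => exists u, v = B u /\
    length u = l /\ costN Ps rs Hs u <= costN Ps rs Hs cu /\
    (forall u', In u' cs -> costN Ps rs Hs u <= costN Ps rs Hs u') /\
    n <= (length cs + 1) * ((length rs + 2) * (5 * QR R * (p + l + g + 4)))).
Proof.
  intros hpl hrs hPs hts hlt. pose proof (QR_ge R hR) as hq.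
  induction cs as [|u cs IH]; intros cu cc hcs hcu hcc hv; body; cbn [tl_of].
  - exists cu. split; auto. split; auto. split; auto. split; [intros u' []|]. cbn [length]. nia.
  - pose proof (Forall_inv hcs) as h1. pose proof (Forall_inv_tail hcs) as h2. cbv beta in h1.
    eapply W_mono; [apply (W_cost R hR l g p u rs h1 hpl hrs Ps ts Hs (repeat false g)); auto|].
    { apply repeat_length. }
    { rewrite bval_zeros. apply hlt. }
    cbv beta. intros v n (a & -> & la & va & bn). rewrite bval_zeros in va.
    change Leaf with (b2t false) at 1. use (W_less a false cc); [lia|].
    set (q := QR R) in *.
    assert (hq2 : 1000 * (p + l + g + 4) <= q * (p + l + g + 4)) by now apply Nat.mul_le_mono_r.
    assert (e : (if bval a =? bval cc then false else bval a <? bval cc) = (bval a <? bval cc)).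
    { destruct (Nat.eqb_spec (bval a) (bval cc)); auto. symmetry. apply Nat.ltb_ge. lia. }
    rewrite e. destruct (Nat.ltb_spec (bval a) (bval cc)) as [lt|ge]; cbn [b2t].
    + eapply W_mono; [apply (IH u a); auto; lia|]. cbv beta.
      intros v m (u' & -> & k1 & k2 & k3 & k4). exists u'. split; auto. split; auto. split; [lia|]. split.
      * intros x [<-|hx]; auto.
      * cbn [length]. set (y := 5 * q * (p + l + g + 4)) in *.
        assert (5000 * (p + l + g + 4) <= y) by (unfold y; lia).
        replace ((S (length cs) + 1) * ((length rs + 2) * y)) with ((length cs + 1) * ((length rs + 2) * y) + (length rs + 1) * y + y) by ring. lia.
    + eapply W_mono; [apply (IH cu cc); auto; lia|]. cbv beta.
      intros v m (u' & -> & k1 & k2 & k3 & k4). exists u'. split; auto. split; auto. split; [lia|]. split.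
      * intros x [<-|hx]; [lia|auto].
      * cbn [length]. set (y := 5 * q * (p + l + g + 4)) in *.
        assert (5000 * (p + l + g + 4) <= y) by (unfold y; lia).
        replace ((S (length cs) + 1) * ((length rs + 2) * y)) with ((length cs + 1) * ((length rs + 2) * y) + (length rs + 1) * y + y) by ring. lia.
Qed.

(** A counter is at most the number of words met, so [length H + 1 < 2 ^ g] keeps the increment from
    overflowing. *)
Lemma trep_push l g t H k : length k = l -> trep l t H -> length H + 1 < 2 ^ g ->
  forall c, lookup t k = B c -> trep l (tupd t k (B (adds false true (repeat false g) c))) (bval k :: H).
Proof.
  intros hk ht hH c hc k' hk'. destruct (list_eq_dec Bool.bool_dec k k') as [<-|ne].
  - rewrite lookup_tupd_same. eexists; split; [reflexivity|].
    destruct (ht k hk) as (c' & e1 & e2). rewrite hc in e1.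
    assert (c = c').
    { clear -e1. revert c' e1. induction c as [|a c IH]; intros [|a' c'] e; try discriminate; auto.
      cbn [tl_of] in e. injection e as e1 e2. f_equal; [destruct a, a'; auto; discriminate|auto]. }
    subst c'. rewrite count_occ_cons_eq by auto. rewrite <- e2.
    rewrite adds_firstn. destruct (adds_val (repeat false g) true (firstn (length (repeat false g)) c)) as [m hm].
    { rewrite length_firstn. lia. }
    rewrite bval_zeros, repeat_length, bval_firstn in hm. rewrite repeat_length. cbn [Nat.b2n] in hm.
    assert (hc2 : bval c < 2 ^ g).
    { rewrite e2. pose proof (count_occ_bound Nat.eq_dec (bval k) H). lia. }
    rewrite Nat.mod_small in hm by lia.
    assert (bval c + 1 < 2 ^ g).
    { rewrite e2. pose proof (count_occ_bound Nat.eq_dec (bval k) H). lia. }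
    destruct m; [lia|]. nia.
  - rewrite lookup_tupd_other by (auto; lia). destruct (ht k' hk') as (c' & e1 & e2).
    exists c'. split; auto. rewrite count_occ_cons_neq; auto.
    intros e. apply ne. apply bval_inj; auto; lia.
Qed.

Lemma W_incrs R (hR : 2 <= R) l g p h u rs : length u = l -> p + l <= 2 ^ R -> Forall (recp p) rs -> h + 1 < 2 ^ g ->
  forall Ps ts Hs, vecl l (length rs) Ps -> treps l (length rs) ts Hs ->
  (forall H, In H Hs -> length H <= h) ->
  W fINCRS <<B (repeat false g); V Ps; RS rs; U ts; B u>> (fun v n => exists ts', v = U ts' /\
    treps l (length rs) ts' (push Ps rs Hs u) /\ n <= (length rs + 1) * (5 * QR R * (p + l + g + 4))).
Proof.
  intros hu hpl hrs hh. pose proof (QR_ge R hR) as hq. set (q := QR R) in *.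
  assert (hq2 : 1000 * (p + l + g + 4) <= q * (p + l + g + 4)) by now apply Nat.mul_le_mono_r.
  induction hrs as [|r rs [r1 r2] hrs IH]; intros Ps ts Hs hPs hts hH; body; cbn [tl_of].
  - exists []. cbn [treps length] in *. repeat split; auto; lia.
  - cbn [length] in hPs. destruct (vecl_S _ _ _ hPs) as (P & Ps' & -> & lP & hPs').
    cbn [treps length push hd tl tl_of] in *. destruct hts as [ht hts].
    assert (hH0 : length (hd [] Hs) <= h) by (destruct Hs; simpl; [lia|apply hH; now left]).
    assert (hH1 : forall H, In H (tl Hs) -> length H <= h) by (destruct Hs; simpl in *; auto).
    assert (step : forall (X : tree) (tsx : list tree), X = hd Leaf ts -> tsx = tl ts ->
      W fWORD <<B P; renc r; B u>> (fun w m0 => W fINCR <<B (repeat false g); X; w>> (fun w0 m1 =>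
        W fINCRS <<B (repeat false g); V Ps'; RS rs; U tsx; B u>> (fun v n => exists ts', Node w0 v = U ts' /\
         treps l (S (length rs)) ts' ((wordr P r u :: hd [] Hs) :: push Ps' rs (tl Hs) u) /\
       n + m0 + m1 + 200 <= (S (length rs) + 1) * (5 * q * (p + l + g + 4)))))).
    { intros X tsx -> ->. eapply W_mono; [apply (W_word R hR P r u); try congruence; try lia; apply bval_lt|].
      cbv beta. intros v n (k & -> & lk & vk & bn).
      destruct (ht k) as (c & hc1 & hc2); [congruence|].
      use (W_incr (repeat false g) k (hd Leaf ts) c hc1).
      eapply W_mono; [apply (IH Ps' (tl ts) (tl Hs)); auto|].
      cbv beta. intros v' n' (ts' & -> & k1 & k2).
      exists (tupd (hd Leaf ts) k (B (adds false true (repeat false g) c)) :: ts'). split; [reflexivity|]. split.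
      - cbn [treps hd tl]. split; auto. unfold wordr. rewrite <- vk. apply trep_push; auto; lia.
      - rewrite repeat_length in b. rewrite lk, r1, hu in *. fold q in bn.
        assert (4 * q * (p + l + 4) <= 4 * q * (p + l + g + 4)) by (apply Nat.mul_le_mono_l; lia). lia. }
    destruct ts as [|t ts]; cbn [tl_of hd tl] in *.
    + eapply W_mono; [apply (step Leaf []); auto|]. cbv beta. intros v n h'.
      eapply W_mono; [exact h'|]. clear h'. cbv beta. intros v1 n1 h'.
      eapply W_mono; [exact h'|]. clear h'. cbv beta. intros v2 n2 (a & e1 & e2 & e3).
      exists a. repeat split; auto; try apply e2. lia.
    + eapply W_mono; [apply (step t ts); auto|]. cbv beta. intros v n h'.
      eapply W_mono; [exact h'|]. clear h'. cbv beta. intros v1 n1 h'.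
      eapply W_mono; [exact h'|]. clear h'. cbv beta. intros v2 n2 (a & e1 & e2 & e3).
      exists a. repeat split; auto; try apply e2. lia.
Qed.

(** * The divide-and-conquer over the blocks *)

Fixpoint trunc (Ps : list (list bool)) (rs : list rec) : list rec :=
  match rs with
  | [] => []
  | r :: rs => (skipn (length (hd [] Ps)) (fst r), skipn (length (hd [] Ps)) (snd r)) :: trunc (tl Ps) rs
  end.

Lemma W_trunc L rs : forall Ps, vecl L (length rs) Ps ->
  W fTRUNC <<V Ps; RS rs>> (ok (RS (trunc Ps rs)) (200 * (L + 1) * (length rs + 1))).
Proof.
  induction rs as [|r rs IH]; intros Ps h; body; cbn [tl_of].
  - done_.
  - cbn [length] in h. destruct (vecl_S _ _ _ h) as (P & Ps' & -> & lP & hPs').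
    unfold renc at 1. cbn [tl_of]. use (W_drop b2t b2t P (fst r)). use (W_drop b2t b2t P (snd r)).
    use (IH Ps' hPs'). cbn [trunc hd tl tl_of renc fst snd]. split; [reflexivity|]. cbn [length]. lia.
Qed.

(** [x1] and [l1] are the fractions with [U] appended and the power [P] multiplied in, cut to
    [p - L] bits; the alternatives are the two outcomes of [fNORM]. *)
Definition adv1 (b P : list bool) (r : rec) (U : list bool) (r' : rec) : Prop :=
  let p := length (fst r) in let L := length P in
  let x1 := ((bval (fst r) + bval (snd r) * bval U / 2 ^ L) mod 2 ^ p * bval P) mod 2 ^ p / 2 ^ L in
  let l1 := bval (snd r) * bval P / 2 ^ L / 2 ^ L in
  recp (p - L) r' /\
  ((bval b * l1 < 2 ^ (p - L) /\ bval (snd r') = bval b * l1 /\ bval (fst r') = (bval b * x1) mod 2 ^ (p - L)) \/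
   (2 ^ (p - L) <= bval b * l1 /\ bval (snd r') = l1 /\ bval (fst r') = x1)).

Fixpoint adv (bs Ps : list (list bool)) (rs : list rec) (U : list bool) (rs' : list rec) : Prop :=
  match rs, rs' with
  | [], [] => True
  | r :: rs, r' :: rs' => adv1 (hd [] bs) (hd [] Ps) r U r' /\ adv (tl bs) (tl Ps) rs U rs'
  | _, _ => False
  end.

(** The nested conclusion is the goal that symbolic execution of the body leaves, with an arbitrary
    postcondition for the rest of the loop. *)
Lemma W_advance1 R (hR : 2 <= R) b P r U p L g : recp p r -> length P = L -> length U = L -> L <= p -> length b <= g -> g <= p ->
  2 * p <= 2 ^ R ->
  forall Q : tree -> nat -> Prop,
  (forall r' n, adv1 b P r U r' -> n <= 9 * QR R * (2 * p + 4) -> Q (renc r') n) ->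
  W fIMUL <<B (snd r); B U>> (fun v n => W fDROP <<B U; v>> (fun v1 n1 => W fADDS <<Leaf; Leaf; B (fst r); v1>> (fun Y n2 =>
   W fIMUL <<Y; B P>> (fun v3 n3 => W fTAKE <<B (fst r); v3>> (fun v4 n4 => W fDROP <<B P; v4>> (fun X' n5 =>
   W fIMUL <<B (snd r); B P>> (fun v6 n6 => W fDROP <<B P; v6>> (fun v7 n7 => W fDROP <<B P; v7>> (fun v8 n8 =>
   W fTAKE <<X'; v8>> (fun l' n9 => W fNORM <<B b; X'; l'>> (fun v n10 =>
     Q v (n + n1 + n2 + n3 + n4 + n5 + n6 + n7 + n8 + n9 + n10)))))))))))).
Proof.
  intros [h1 h2] hP hU hL hb hgp hR2 Q hQ. destruct r as [X l]. cbn [fst snd] in *.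
  useI R l U; [lia|lia|]. use (W_drop b2t b2t U Z).
  change Leaf with (b2t false) at 1 2. use (W_adds X false false (skipn (length U) Z)).
  set (Y := adds false false X (skipn (length U) Z)).
  assert (lY : length Y = p) by (unfold Y; rewrite adds_length; auto).
  assert (vY : bval Y = (bval X + bval l * bval U / 2 ^ L) mod 2 ^ p).
  { unfold Y. now rewrite adds_mod', bval_skipn_div, vZ, hU, h1. }
  useI R Y P; [lia|lia|]. use (W_take b2t b2t X Z0). use (W_drop b2t b2t P (firstn (length X) Z0)).
  set (X' := skipn (length P) (firstn (length X) Z0)).
  assert (lX' : length X' = p - L) by (unfold X'; rewrite length_skipn, length_firstn; lia).
  assert (vX' : bval X' = (bval Y * bval P) mod 2 ^ p / 2 ^ L).
  { unfold X'. now rewrite bval_skipn_div, bval_firstn, vZ0, h1, hP. }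
  useI R l P; [lia|lia|]. use (W_drop b2t b2t P Z1). use (W_drop b2t b2t P (skipn (length P) Z1)).
  use (W_take b2t b2t X' (skipn (length P) (skipn (length P) Z1))).
  set (l' := firstn (length X') (skipn (length P) (skipn (length P) Z1))).
  assert (ll' : length l' = length X').
  { unfold l'. rewrite length_firstn, !length_skipn. lia. }
  assert (vl' : bval l' = bval l * bval P / 2 ^ L / 2 ^ L).
  { unfold l'. rewrite bval_firstn, !bval_skipn_div, vZ1, lX', hP. apply Nat.mod_small.
    pose proof (bval_lt l) as q1. pose proof (bval_lt P) as q2. rewrite h2 in q1. rewrite hP in q2.
    apply Nat.Div0.div_lt_upper_bound. apply Nat.Div0.div_lt_upper_bound.
    rewrite <- !Nat.pow_add_r. apply Nat.lt_le_trans with (2 ^ p * 2 ^ L).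
    - apply Nat.mul_lt_mono; auto.
    - rewrite <- Nat.pow_add_r. apply Nat.pow_le_mono_r; lia. }
  eapply W_mono; [apply (W_norm R hR b X' l'); lia|]. cbv beta.
  intros v m (X2 & l2 & -> & k1 & k2 & k3 & k4).
  apply (hQ (X2, l2)).
  - unfold adv1. cbn [fst snd]. rewrite h1, hP, <- vY, <- vX', <- vl', <- lX'. split; [split; auto|].
    destruct k3 as [k3|(k3 & -> & ->)]; auto.
  - pose proof (QR_ge R hR) as hq. unfold QR in *. rewrite lY, lX', hP, hU, h1, h2 in *.
    replace (CI * (p + L + 4) * R ^ 5) with (CI * R ^ 5 * (p + L + 4)) in * by ring.
    set (q := CI * R ^ 5) in *.
    assert (q * (p + L + 4) <= q * (2 * p + 4)) by (apply Nat.mul_le_mono_l; lia).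
    assert (4 * q * (length b + (p - L) + 4) <= 4 * q * (2 * p + 4)) by (apply Nat.mul_le_mono_l; lia).
    assert (1000 * (2 * p + 4) <= q * (2 * p + 4)) by now apply Nat.mul_le_mono_r.
    lia.
Qed.

Lemma W_advance R (hR : 2 <= R) p L g U rs : Forall (recp p) rs -> length U = L -> L <= p -> g <= p -> 2 * p <= 2 ^ R ->
  forall bs Ps, length bs = length rs -> Forall (fun b => length b <= g) bs -> vecl L (length rs) Ps ->
  W fADVANCE <<V bs; V Ps; RS rs; B U>> (fun v n => exists rs', v = RS rs' /\ adv bs Ps rs U rs' /\
    n <= 10 * QR R * (2 * p + 4) * (length rs + 1)).
Proof.
  intros hrs hU hL hg h2. pose proof (QR_ge R hR) as hq.
  assert (hq2 : 1000 * (2 * p + 4) <= QR R * (2 * p + 4)) by now apply Nat.mul_le_mono_r.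
  induction hrs as [|r rs hr hrs IH]; intros bs Ps lb hb hPs; body; cbn [tl_of].
  - exists []. split; [reflexivity|]. split; [exact I|]. cbn [length]. lia.
  - cbn [length] in *. destruct (vecl_S _ _ _ hPs) as (P & Ps' & -> & lP & hPs').
    destruct bs as [|b bs]; [discriminate|]. inversion hb as [|? ? hb1 hb2]; subst. cbn [tl_of].
    unfold renc at 1. cbn [tl_of].
    pose proof (W_advance1 R hR b P r U p (length U) g hr lP eq_refl hL hb1 hg h2) as A.
    eapply W_mono; [apply A with (Q := fun v m => W fADVANCE <<V bs; V Ps'; RS rs; B U>> (fun w n =>
       exists rs', Node v w = RS rs' /\ adv (b :: bs) (P :: Ps') (r :: rs) U rs' /\
       n + m + 500 <= 10 * QR R * (2 * p + 4) * (S (length rs) + 1)))|].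
    { intros r' n hadv hn. eapply W_mono; [apply IH; auto; lia|]. cbv beta.
      intros w m (rs' & -> & k1 & k2). exists (r' :: rs'). split; [reflexivity|]. split; [split; auto|]. lia. }
    cbv beta. intros v n h. repeat (eapply W_mono; [exact h|]; clear h; cbv beta; intros ? ? h).
    destruct h as (rs' & k1 & k2 & k3). exists rs'. split; auto. split; auto. lia.
Qed.

(* [sol l bs P0 lv rs Hs U Hs']: started with the fractions [rs] and the word histories [Hs]
   (one per base, most recent word first), the search over the levels [lv] appends the bits [U]. *)
Inductive sol (l : nat) (bs P0 : list (list bool)) :
  list (list (list bool)) -> list rec -> list (list nat) -> list bool -> list (list nat) -> Prop :=
| sol_leaf rs Hs u : length u = l ->
    (forall u', length u' = l -> costN P0 rs Hs u <= costN P0 rs Hs u') ->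
    sol l bs P0 [] rs Hs u (push P0 rs Hs u)
| sol_node Ps lv rs Hs rs' U1 H1 U2 H2 : sol l bs P0 lv (trunc Ps rs) Hs U1 H1 ->
    adv bs Ps rs U1 rs' -> sol l bs P0 lv rs' H1 U2 H2 ->
    sol l bs P0 (Ps :: lv) rs Hs (U2 ++ U1) H2.

Fixpoint levels_ok (l K : nat) (lv : list (list (list bool))) : Prop :=
  match lv with
  | [] => True
  | Ps :: lv => vecl (l * 2 ^ length lv) K Ps /\ levels_ok l K lv
  end.

Lemma trunc_length rs : forall Ps, length (trunc Ps rs) = length rs.
Proof. induction rs; intros; simpl; auto. Qed.

Lemma trunc_recp p L rs : Forall (recp p) rs -> forall Ps, vecl L (length rs) Ps ->
  Forall (recp (p - L)) (trunc Ps rs).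
Proof.
  induction 1 as [|r rs [h1 h2] h IH]; intros Ps hP; cbn [trunc]; constructor; cbn [length] in hP;
    destruct (vecl_S _ _ _ hP) as (P & Ps' & -> & lP & hPs'); cbn [hd tl].
  - split; cbn [fst snd]; rewrite length_skipn; lia.
  - now apply IH.
Qed.

Lemma adv_recp p L U rs : Forall (recp p) rs -> forall bs Ps rs', vecl L (length rs) Ps -> adv bs Ps rs U rs' ->
  Forall (recp (p - L)) rs' /\ length rs' = length rs.
Proof.
  induction 1 as [|r rs [h1 h2] h IH]; intros bs Ps rs' hP ha; destruct rs' as [|r' rs']; cbn [adv] in ha; try tauto.
  - split; constructor.
  - cbn [length] in hP. destruct (vecl_S _ _ _ hP) as (P & Ps' & -> & lP & hPs'). cbn [hd tl] in ha.
    destruct ha as [[q1 _] q2]. rewrite h1, lP in q1. destruct (IH _ _ _ hPs' q2) as [q3 q4].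
    split; [now constructor|simpl; lia].
Qed.

Lemma costN_le h rs : forall Ps Hs u, (forall H, In H Hs -> length H <= h) -> costN Ps rs Hs u <= length rs * h.
Proof.
  induction rs as [|r rs IH]; intros Ps Hs u hH; cbn [costN length]; [lia|].
  assert (hH0 : length (hd [] Hs) <= h) by (destruct Hs; simpl; [lia|apply hH; now left]).
  assert (hH1 : forall H, In H (tl Hs) -> length H <= h) by (destruct Hs; simpl in *; auto).
  pose proof (count_occ_bound Nat.eq_dec (wordr (hd [] Ps) r u) (hd [] Hs)).
  specialize (IH (tl Ps) (tl Hs) u hH1). lia.
Qed.

Lemma push_le h rs : forall Ps Hs u, (forall H, In H Hs -> length H <= h) ->
  forall H, In H (push Ps rs Hs u) -> length H <= h + 1.
Proof.
  induction rs as [|r rs IH]; intros Ps Hs u hH H; cbn [push]; [intros []|].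
  assert (hH0 : length (hd [] Hs) <= h) by (destruct Hs; simpl; [lia|apply hH; now left]).
  assert (hH1 : forall H, In H (tl Hs) -> length H <= h) by (destruct Hs; simpl in *; auto).
  intros [<-|hin]; [simpl; lia|eauto].
Qed.

Lemma sol_length l bs P0 lv rs Hs U H' : sol l bs P0 lv rs Hs U H' -> length U = l * 2 ^ length lv.
Proof. induction 1; cbn [length]; [simpl; lia|]. rewrite length_app, Nat.pow_succ_r'. lia. Qed.

Section Solve.
Context (R l g K : nat) (hR : 2 <= R) (bs P0 : list (list bool)).
Context (hbs : length bs = K) (hbg : Forall (fun b => length b <= g) bs) (hP0 : vecl l K P0).

(** A leaf tries [2 ^ l] candidates against [K] bases. [node_cost] is the work of a node per leaf
    below it; it is the same at all levels because a node with 2^h leaves handles at most 2^h (l +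
    g) bits. *)
Definition leaf_cost := (2 ^ l + 5) * ((K + 2) * (5 * QR R * (2 * l + 2 * g + 4))).
Definition node_cost := (K + 2) * (20 * QR R * (2 * l + 2 * g + 4)).

(** The cost of a candidate adds the counters of all [K] bases in [g] bits;
    [(K + 1) * (h + 2 ^ length lv) < 2 ^ g] excludes overflow up to the last leaf. *)
Lemma W_solve lv : forall rs ts Hs h, levels_ok l K lv -> length rs = K ->
  Forall (recp (l * 2 ^ length lv + g)) rs -> 2 * (l * 2 ^ length lv + g) <= 2 ^ R -> 2 * l <= 2 ^ R ->
  treps l K ts Hs -> (forall H, In H Hs -> length H <= h) -> (K + 1) * (h + 2 ^ length lv) < 2 ^ g ->
  W fSOLVE <<tl_of V lv; V bs; V P0; V (words l); B (repeat false g); RS rs; U ts>>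
    (fun v n => exists Ub ts' Hs', v = Node (B Ub) (U ts') /\ sol l bs P0 lv rs Hs Ub Hs' /\
      treps l K ts' Hs' /\ (forall H, In H Hs' -> length H <= h + 2 ^ length lv) /\
      n <= 2 ^ length lv * (leaf_cost + length lv * node_cost)).
Proof.
  pose proof (QR_ge R hR) as hq.
  induction lv as [|Ps lv IH]; intros rs ts Hs h hlv lrs hrs hpR hlR hts hH hlt; body; cbn [tl_of length].
  - cbn [length Nat.pow] in *. rewrite Nat.mul_1_r in *.
    assert (hc : forall u, costN P0 rs Hs u < 2 ^ g).
    { intros u. pose proof (costN_le h rs P0 Hs u hH). rewrite lrs in *. lia. }
    assert (hw : Forall (fun u => length u = l) (words l)) by (apply Forall_forall; intros u; now rewrite words_in).
    destruct (words l) as [|u0 us] eqn:ew.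
    { pose proof (words_length l) as e. rewrite ew in e. pose proof (pow2_pos l). simpl in e. lia. }
    cbn [tl_of]. change (Node (B u0) (V us)) with (V (u0 :: us)).
    assert (hpl : l + g + l <= 2 ^ R) by lia.
    eapply W_mono; [apply (W_cost R hR l g (l + g) u0 rs) with (Ps := P0) (ts := ts) (Hs := Hs)|]; auto.
    { now inversion hw. }
    { now rewrite lrs. }
    { now rewrite lrs. }
    { apply repeat_length. }
    { rewrite bval_zeros. apply hc. }
    cbv beta. intros v n (a & -> & la & va & bn). rewrite bval_zeros in va.
    eapply W_mono; [apply (W_best R hR l g (l + g) P0 rs ts Hs) with (cs := u0 :: us) (cu := u0) (cc := a)|]; auto.
    { now rewrite lrs. }
    { now rewrite lrs. }
    { now inversion hw. }
    cbv beta. intros v m (u & -> & lu & k1 & k2 & k3). cbn [wp].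
    eapply W_mono; [apply (W_incrs R hR l g (l + g) h u rs) with (Ps := P0) (ts := ts) (Hs := Hs)|]; auto.
    { nia. }
    { now rewrite lrs. }
    { now rewrite lrs. }
    cbv beta. intros v n2 (ts' & -> & k4 & k5).
    exists u, ts', (push P0 rs Hs u). split; [reflexivity|]. split; [|split; [|split]].
    + apply sol_leaf; auto. intros u' hu'. apply k2. rewrite <- ew. now apply words_in.
    + now rewrite lrs in k4.
    + now apply push_le.
    + rewrite <- ew, words_length, lrs in *. unfold leaf_cost.
      replace (l + g + l + g + 4) with (2 * l + 2 * g + 4) in * by lia.
      set (y := 5 * QR R * (2 * l + 2 * g + 4)) in *.
      assert (200 <= y) by (unfold y; nia).
      assert (y <= (K + 2) * y) by nia.
      assert ((K + 1) * y <= (K + 2) * y) by nia. nia.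
  - cbn [levels_ok] in hlv. destruct hlv as [hPs hlv]. cbn [length] in *.
    set (L := l * 2 ^ length lv) in *.
    assert (eL : l * 2 ^ S (length lv) = 2 * L) by (unfold L; rewrite Nat.pow_succ_r'; lia).
    rewrite eL in *. rewrite Nat.pow_succ_r' in *.
    assert (hPs' : vecl L (length rs) Ps) by now rewrite lrs.
    use (W_trunc L rs Ps hPs').
    assert (e1 : 2 * L + g - L = L + g) by lia.
    pose proof (trunc_recp _ _ _ hrs _ hPs') as ht. rewrite e1 in ht.
    eapply W_mono; [apply (IH (trunc Ps rs) ts Hs h)|]; auto; try lia.
    { now rewrite trunc_length. }
    cbv beta. intros v n1 (U1 & t1 & H1 & -> & s1 & s2 & s3 & s4). cbn [wp].
    assert (lU1 : length U1 = L) by (eapply sol_length; eauto).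
    eapply W_mono; [apply (W_advance R hR (2 * L + g) L g U1 rs) with (bs := bs) (Ps := Ps)|]; auto; try lia.
    cbv beta. intros v n2 (rs' & -> & a1 & a2).
    destruct (adv_recp _ _ _ _ hrs _ _ _ hPs' a1) as [a3 a4]. rewrite e1 in a3.
    eapply W_mono; [apply (IH rs' t1 H1 (h + 2 ^ length lv))|]; auto; try lia.
    cbv beta. intros v n3 (U2 & t2 & H2 & -> & r1 & r2 & r3 & r4). cbn [wp].
    assert (lU2 : length U2 = L) by (eapply sol_length; eauto).
    use (W_app b2t U2 U1). exists (U2 ++ U1), t2, H2. split; [reflexivity|]. split; [|split; [auto|split]].
    + econstructor; eauto.
    + intros H hin. specialize (r3 H hin). lia.
    + rewrite lrs, lU2 in *. set (X := leaf_cost + length lv * node_cost) in *.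
      replace (leaf_cost + S (length lv) * node_cost) with (X + node_cost) by (unfold X; ring).
      set (y := 2 ^ length lv) in *. assert (y1 : 1 <= y) by apply pow2_pos.
      assert (nc : 10 * QR R * (2 * (2 * L + g) + 4) * (K + 1) + 1000 * (2 * L + 1) * (K + 2) <= 2 * y * node_cost).
      { unfold node_cost.
        replace (2 * y * ((K + 2) * (20 * QR R * (2 * l + 2 * g + 4)))) with
          (20 * QR R * (2 * y * (2 * l + 2 * g + 4)) * (K + 2)) by ring.
        assert (z1 : 2 * (2 * L + g) + 4 <= 2 * y * (2 * l + 2 * g + 4)) by (unfold L; fold y; nia).
        assert (z2 : 10 * QR R * (2 * (2 * L + g) + 4) * (K + 1) <= 10 * QR R * (2 * y * (2 * l + 2 * g + 4)) * (K + 2)).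
        { apply Nat.mul_le_mono; [|lia]. now apply Nat.mul_le_mono_l. }
        assert (z3 : 1000 * (2 * L + 1) * (K + 2) <= 10 * QR R * (2 * y * (2 * l + 2 * g + 4)) * (K + 2)).
        { apply Nat.mul_le_mono_r. apply Nat.mul_le_mono; lia. }
        lia. }
      assert (200 * (L + 1) * (K + 1) + 50 * (L + 1) + 300 <= 1000 * (2 * L + 1) * (K + 2)) by nia.
      nia.
Qed.
End Solve.

(** * Powers of the bases and a whole stage *)

Definition maxpow (L : nat) (b P : list bool) :=
  length P = L /\ (exists D, bval P = bval b ^ D) /\ 2 ^ L <= bval b * bval P.

(** If two further factors b certainly overflow [L] bits, a single attempt to multiply by b,
    successful or not, ends at the largest power. *)
Lemma maxpow_step L b P P' : 2 <= bval b -> length P = L -> (exists D, bval P = bval b ^ D) ->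
  2 ^ L <= bval b * bval b * bval P -> length P' = L ->
  (bval P' = bval b * bval P /\ bval b * bval P < 2 ^ L) \/ (bval P' = bval P /\ 2 ^ L <= bval b * bval P) ->
  maxpow L b P'.
Proof.
  intros hb lP [D hD] h lP' [[e1 e2]|[e1 e2]].
  - split; auto. split; [exists (S D); rewrite e1, hD; reflexivity|]. rewrite e1. lia.
  - split; auto. split; [exists D; congruence|]. now rewrite e1.
Qed.

(** A failed multiplication shows that P is maximal, and it stays so. If none failed, the exponent D
    would have reached |P| when [u] is exhausted, against b^D < 2^|P|. *)
Lemma W_pow R (hR : 2 <= R) {A} (f : A -> tree) b u : 2 <= bval b -> forall P,
  length b + length P <= 2 ^ R -> (exists D, bval P = bval b ^ D /\ length P <= D + length u) \/ maxpow (length P) b P ->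
  W fPOW <<tl_of f u; B b; B P>> (fun v n => exists P', v = B P' /\ maxpow (length P) b P' /\
    n <= 3 * QR R * (length b + length P + 4) * (length u + 1)).
Proof.
  intros hb. pose proof (QR_ge R hR) as hq.
  induction u as [|a u IH]; intros P hs hP; body; cbn [tl_of].
  - exists P. split; auto. split; [|cbn [length]; nia].
    destruct hP as [(D & h1 & h2)|h]; auto. exfalso. cbn [length] in h2.
    pose proof (bval_lt P) as lt. rewrite h1 in lt.
    assert (2 ^ length P <= 2 ^ D) by (apply Nat.pow_le_mono_r; lia).
    assert (2 ^ D <= bval b ^ D) by (apply Nat.pow_le_mono_l; lia). lia.
  - eapply W_mono; [apply (W_tryb R hR b P); lia|]. cbv beta. intros v n (P' & -> & l' & k & bn).
    eapply W_mono; [apply (IH P'); [lia|]|].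
    + destruct k as [[e1 e2]|[e1 e2]].
      * destruct hP as [(D & h1 & h2)|(_ & _ & h)]; [|exfalso; lia].
        left. exists (S D). rewrite e1, h1, l'. split; [reflexivity|]. cbn [length] in h2. lia.
      * right. split; [lia|]. rewrite l', e1. split; [|auto].
        destruct hP as [(D & h1 & h2)|(_ & (D & h1) & _)]; exists D; auto.
    + cbv beta. intros v m (P'' & -> & k1 & k2). exists P''. split; auto. rewrite l' in *. split; auto.
      cbn [length]. set (q := QR R * (length b + length P + 4)) in *.
      assert (1000 <= q) by (unfold q; nia).
      replace (3 * QR R * (length b + length P + 4) * (length u + 1)) with (3 * q * (length u + 1)) in * by (unfold q; ring).
      replace (3 * QR R * (length b + length P + 4) * (S (length u) + 1)) with (3 * q * (S (length u) + 1)) by (unfold q; ring).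
      replace (2 * QR R * (length b + length P + 4)) with (2 * q) in * by (unfold q; ring). lia.
Qed.

Lemma W_pows R (hR : 2 <= R) l g bs : 1 <= l -> g + l <= 2 ^ R ->
  Forall (fun b => 2 <= bval b /\ length b <= g) bs ->
  W fPOWS <<B (repeat false l); V bs>> (fun v n => exists Ps, v = V Ps /\ Forall2 (maxpow l) bs Ps /\
    n <= 4 * QR R * (g + l + 4) * (l + 1) * (length bs + 1)).
Proof.
  intros hl hs. pose proof (QR_ge R hR) as hq.
  induction 1 as [|b bs [h1 h2] hbs IH]; body; cbn [tl_of].
  - exists []. split; auto. split; [constructor|]. cbn [length]. nia.
  - destruct l as [|l]; [lia|]. cbn [repeat tl_of].
    change (Node (Node Leaf Leaf) (B (repeat false l))) with (B (true :: repeat false l)).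
    change (Node (b2t false) (B (repeat false l))) with (B (repeat false (S l))).
    assert (lP : length (true :: repeat false l) = S l) by (cbn [length]; now rewrite repeat_length).
    eapply W_mono; [apply (W_pow R hR b2t b (repeat false (S l)) h1 (true :: repeat false l))|].
    { rewrite lP. lia. }
    { left. exists 0. rewrite lP, repeat_length. cbn [bval Nat.b2n Nat.pow]. rewrite bval_zeros. lia. }
    cbv beta. intros v n (P & -> & k1 & k2). rewrite lP, repeat_length in *.
    eapply W_mono; [apply IH|]. cbv beta. intros v m (Ps & -> & k3 & k4).
    exists (P :: Ps). split; auto. split; [now constructor|]. cbn [length].
    assert (3 * QR R * (length b + S l + 4) * (S l + 1) <= 3 * QR R * (g + S l + 4) * (S l + 1)).
    { apply Nat.mul_le_mono_r, Nat.mul_le_mono_l. lia. }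
    set (q := QR R * (g + S l + 4) * (S l + 1)) in *.
    assert (1000 <= q) by (unfold q; nia).
    replace (4 * QR R * (g + S l + 4) * (S l + 1) * (length bs + 1)) with (4 * q * (length bs + 1)) in * by (unfold q; ring).
    replace (4 * QR R * (g + S l + 4) * (S l + 1) * (S (length bs) + 1)) with (4 * q * (S (length bs) + 1)) by (unfold q; ring).
    replace (3 * QR R * (g + S l + 4) * (S l + 1)) with (3 * q) in * by (unfold q; ring). lia.
Qed.

Lemma W_steps R (hR : 2 <= R) L g bs Ps : g + 2 * L <= 2 ^ R ->
  Forall (fun b => 2 <= bval b /\ length b <= g) bs -> Forall2 (maxpow L) bs Ps ->
  W fSTEPS <<V bs; V Ps>> (fun v n => exists Ps', v = V Ps' /\ Forall2 (maxpow (2 * L)) bs Ps' /\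
    n <= 4 * QR R * (g + 2 * L + 4) * (length bs + 1)).
Proof.
  intros hs hb hP. pose proof (QR_ge R hR) as hq.
  induction hP as [|b P bs Ps (p1 & p2 & p3) hP IH]; body; cbn [tl_of].
  - exists []. split; auto. split; [constructor|]. cbn [length]. nia.
  - inversion hb as [|? ? [h1 h2] hb']; subst.
    use (W_app b2t P P). useI R P P; [lia|lia|]. use (W_take b2t b2t (P ++ P) Z).
    rewrite length_app in *. set (L := length P) in *.
    set (Q := firstn (L + L) Z).
    assert (lQ : length Q = 2 * L) by (unfold Q; rewrite length_firstn; lia).
    pose proof (bval_lt P) as bP. fold L in bP.
    assert (vQ : bval Q = bval P * bval P).
    { unfold Q. rewrite bval_firstn, vZ. apply Nat.mod_small. rewrite Nat.pow_add_r. apply Nat.mul_lt_mono; auto. }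
    eapply W_mono; [apply (W_tryb R hR b Q); lia|]. cbv beta. intros v n3 (P' & -> & k1 & k2 & k3).
    eapply W_mono; [apply IH; auto|]. cbv beta. intros v n4 (Ps' & -> & k4 & k5).
    exists (P' :: Ps'). split; auto. split.
    + constructor; auto. rewrite lQ in *. apply (maxpow_step (2 * L) b Q); auto.
      * destruct p2 as [D hD]. exists (D + D). rewrite vQ, hD, Nat.pow_add_r. reflexivity.
      * rewrite vQ. replace (2 * L) with (L + L) by lia. rewrite Nat.pow_add_r.
        replace (bval b * bval b * (bval P * bval P)) with ((bval b * bval P) * (bval b * bval P)) by ring.
        now apply Nat.mul_le_mono.
    + cbn [length]. rewrite lQ in *.
      assert (2 * QR R * (length b + 2 * L + 4) <= 2 * QR R * (g + 2 * L + 4)) by (apply Nat.mul_le_mono_l; lia).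
      assert (CI * (L + L + 4) * R ^ 5 <= QR R * (g + 2 * L + 4)).
      { unfold QR. replace (CI * (L + L + 4) * R ^ 5) with (CI * R ^ 5 * (L + L + 4)) by ring. apply Nat.mul_le_mono_l. lia. }
      set (q := QR R * (g + 2 * L + 4)) in *.
      assert (1000 * (2 * L + 4) <= q) by (unfold q; nia).
      replace (4 * QR R * (g + 2 * L + 4) * (length bs + 1)) with (4 * q * (length bs + 1)) in * by (unfold q; ring).
      replace (4 * QR R * (g + 2 * L + 4) * (S (length bs) + 1)) with (4 * q * (S (length bs) + 1)) by (unfold q; ring).
      replace (2 * QR R * (g + 2 * L + 4)) with (2 * q) in * by (unfold q; ring). lia.
Qed.

Fixpoint levels_pow (l : nat) (bs : list (list bool)) (lv : list (list (list bool))) : Prop :=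
  match lv with
  | [] => True
  | Ps :: lv => Forall2 (maxpow (l * 2 ^ length lv)) bs Ps /\ levels_pow l bs lv
  end.

Lemma maxpow_vecl L bs Ps : Forall2 (maxpow L) bs Ps -> vecl L (length bs) Ps.
Proof.
  induction 1 as [|b P bs Ps (h & _) hh [IH1 IH2]]; split; simpl; auto.
Qed.

Lemma levels_pow_ok l bs lv : levels_pow l bs lv -> levels_ok l (length bs) lv.
Proof. induction lv; simpl; auto. intros [h1 h2]. split; auto. now apply maxpow_vecl. Qed.

Lemma W_levels R (hR : 2 <= R) l g bs (W0 : list bool) m : 1 <= l -> length W0 = l * 2 ^ m -> g + length W0 <= 2 ^ R ->
  Forall (fun b => 2 <= bval b /\ length b <= g) bs -> 1 <= length bs ->
  forall j acc Ps, length acc + j = m -> levels_pow l bs acc -> Forall2 (maxpow (l * 2 ^ length acc)) bs Ps ->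
  W fLEVELS <<B W0; V bs; MX acc; V Ps>> (fun v n => exists Ps' lv, v = Node (V Ps') (MX lv) /\
    length lv = m /\ levels_pow l bs lv /\ Forall2 (maxpow (length W0)) bs Ps' /\
    n <= 5 * QR R * (g + length W0 + 4) * (length bs + 1) * (j + 1)).
Proof.
  intros hl lW hs hb hK. pose proof (QR_ge R hR) as hq.
  induction j as [|j IH]; intros acc Ps ha hacc hPs; body;
   (destruct Ps as [|P Ps]; [inversion hPs; subst; simpl in hK; lia|]);
   cbn [tl_of]; change (Node (B P) (V Ps)) with (V (P :: Ps)); use (W_leq b2t b2t W0 P);
   assert (lP : length P = l * 2 ^ length acc) by (inversion hPs as [|? ? ? ? (q & _)]; auto).
  - replace m with (length acc) in * by lia.
    replace (length W0 <=? length P) with true by (symmetry; apply Nat.leb_le; lia). cbn [b2t].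
    exists (P :: Ps), acc. repeat split; auto; try lia.
    + now rewrite lW.
    + nia.
  - assert (lt : 2 ^ length acc < 2 ^ m) by (apply Nat.pow_lt_mono_r; lia).
    replace (length W0 <=? length P) with false by (symmetry; apply Nat.leb_gt; nia). cbn [b2t].
    assert (l2 : 2 * (l * 2 ^ length acc) <= length W0).
    { rewrite lW. assert (2 ^ S (length acc) <= 2 ^ m) by (apply Nat.pow_le_mono_r; lia).
      rewrite Nat.pow_succ_r' in H. nia. }
    change (Node (B P) (V Ps)) with (V (P :: Ps)).
    change (Node (V (P :: Ps)) (MX acc)) with (MX ((P :: Ps) :: acc)).
    eapply W_mono; [apply (W_steps R hR (l * 2 ^ length acc) g bs (P :: Ps)); auto; lia|].
    cbv beta. intros v n' (Ps' & -> & k1 & k2).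
    eapply W_mono; [apply (IH ((P :: Ps) :: acc) Ps')|]; cbn [length levels_pow]; auto; try lia.
    { rewrite Nat.pow_succ_r'. replace (l * (2 * 2 ^ length acc)) with (2 * (l * 2 ^ length acc)) by ring. auto. }
    cbv beta. intros v m' (Ps'' & lv & -> & k3 & k4 & k5 & k6). exists Ps'', lv. repeat split; auto.
    assert (4 * QR R * (g + 2 * (l * 2 ^ length acc) + 4) * (length bs + 1) <= 4 * QR R * (g + length W0 + 4) * (length bs + 1)).
    { apply Nat.mul_le_mono_r, Nat.mul_le_mono_l. lia. }
    set (q := QR R * (g + length W0 + 4) * (length bs + 1)) in *.
    assert (1000 * (length W0 + 4) <= q) by (unfold q; nia).
    replace (5 * QR R * (g + length W0 + 4) * (length bs + 1) * (j + 1)) with (5 * q * (j + 1)) in * by (unfold q; ring).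
    replace (5 * QR R * (g + length W0 + 4) * (length bs + 1) * (S j + 1)) with (5 * q * (S j + 1)) by (unfold q; ring).
    replace (4 * QR R * (g + length W0 + 4) * (length bs + 1)) with (4 * q) in * by (unfold q; ring).
    lia.
Qed.

(** At the root both fractions are exact, with [g] zero guard bits below; all errors arise further
    down. *)
Definition root1 (g : nat) (W0 P : list bool) (r : rec) :=
  recp (g + length W0) r /\ bval (fst r) = 2 ^ g * ((bval P * bval W0) mod 2 ^ length W0) /\
  bval (snd r) = 2 ^ g * bval P.

Lemma W_root R (hR : 2 <= R) g (W0 : list bool) Ps : 2 * length W0 <= 2 ^ R ->
  Forall (fun P => length P = length W0) Ps ->
  W fROOT <<B (repeat false g); B W0; V Ps>> (fun v n => exists rs, v = RS rs /\ Forall2 (root1 g W0) Ps rs /\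
    n <= 2 * QR R * (2 * length W0 + 2 * g + 4) * (length Ps + 1)).
Proof.
  intros hs. pose proof (QR_ge R hR) as hq.
  induction 1 as [|P Ps lP hPs IH]; body; cbn [tl_of].
  - exists []. split; auto. split; [constructor|]. cbn [length]. nia.
  - useI R P W0; [lia|lia|]. use (W_take b2t b2t W0 Z).
    use (W_app b2t (repeat false g) (firstn (length W0) Z)).
    use (W_app b2t (repeat false g) P).
    eapply W_mono; [apply IH|]. cbv beta. intros v m (rs & -> & k1 & k2).
    exists ((repeat false g ++ firstn (length W0) Z, repeat false g ++ P) :: rs). split; auto. split.
    + constructor; auto. split; [split|split]; cbn [fst snd].
      * rewrite length_app, repeat_length, length_firstn. lia.
      * rewrite length_app, repeat_length. lia.
      * rewrite bval_app, bval_zeros, repeat_length, bval_firstn, vZ. lia.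
      * rewrite bval_app, bval_zeros, repeat_length. lia.
    + cbn [length]. rewrite repeat_length, lP in *.
      assert (CI * (length W0 + length W0 + 4) * R ^ 5 <= QR R * (2 * length W0 + 2 * g + 4)).
      { unfold QR. replace (CI * (length W0 + length W0 + 4) * R ^ 5) with (CI * R ^ 5 * (length W0 + length W0 + 4)) by ring.
        apply Nat.mul_le_mono_l. lia. }
      set (q := QR R * (2 * length W0 + 2 * g + 4)) in *.
      assert (1000 * (2 * length W0 + 2 * g + 4) <= q) by (unfold q; apply Nat.mul_le_mono_r; auto).
      replace (2 * QR R * (2 * length W0 + 2 * g + 4) * (length Ps + 1)) with (2 * q * (length Ps + 1)) in * by (unfold q; ring).
      replace (2 * QR R * (2 * length W0 + 2 * g + 4) * (S (length Ps) + 1)) with (2 * q * (S (length Ps) + 1)) by (unfold q; ring).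
      lia.
Qed.

Definition state_enc (W0 : list bool) (l : nat) (bs : list (list bool)) (t : nat) : tree :=
  Node (B W0) (Node (B (repeat false l)) (Node (V bs) (B (repeat false t)))).

Definition next_base (bs : list (list bool)) := adds false true (hd [] bs ++ [false]) [].

Lemma treps_nil l K : treps l K [] [].
Proof.
  induction K; simpl; auto. split; auto. intros k hk. exists []. rewrite lookup_leaf. auto.
Qed.

Definition main_cost R l K m t :=
  1000 * (2 ^ m * ((m + 2) * ((2 ^ l + 5) * ((K + 2) * ((l + 1) * (QR R * (2 * l + 2 * (t * t) + 4))))))).

Theorem W_main R l K m t bs W0 : 2 <= R -> 1 <= l -> 1 <= K -> length bs = K -> 16 <= t ->
  Forall (fun b => 2 <= bval b /\ length b <= t * t) bs -> length W0 = l * 2 ^ m ->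
  2 * (l * 2 ^ m + t * t) <= 2 ^ R -> 2 * l <= 2 ^ R -> (K + 1) * 2 ^ m < 2 ^ (t * t) ->
  W fMAIN <<state_enc W0 l bs t>> (fun v n => exists P0 lv Ps rs Ub Hs,
    Forall2 (maxpow l) bs P0 /\ length lv = m /\ levels_pow l bs lv /\
    Forall2 (maxpow (length W0)) bs Ps /\ Forall2 (root1 (t * t) W0) Ps rs /\
    sol l bs P0 lv rs [] Ub Hs /\
    v = Node (B (rev Ub)) <<if 2 ^ l <=? t then state_enc (Ub ++ W0) (2 * l) (next_base bs :: bs) (S t)
                          else state_enc (Ub ++ W0) l bs (S t)>> /\
    n <= main_cost R l K m t).
Proof.
  intros hR hl hK lbs ht hbs lW hpR hlR hJ. pose proof (QR_ge R hR) as hq. set (g := t * t) in *.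
  unfold state_enc at 1. body.
  use (W_rpt t t). fold g.
  use (W_words b2t (repeat false l)). rewrite repeat_length in *.
  eapply W_mono; [apply (W_pows R hR l g bs); auto; lia|]. cbv beta. intros v n1 (P0 & -> & p1 & p2). cbn [wp].
  change Leaf with (MX []) at 1.
  eapply W_mono; [apply (W_levels R hR l g bs W0 m hl lW) with (j := m) (acc := @nil (list (list bool))) (Ps := P0)|];
    auto; try lia.
  { exact I. }
  { simpl. now rewrite Nat.mul_1_r. }
  cbv beta. intros v n2 (Ps & lv & -> & e1 & e2 & e3 & e4). cbn [wp].
  assert (hvPs : vecl (length W0) K Ps) by (rewrite <- lbs; now apply maxpow_vecl).
  eapply W_mono; [apply (W_root R hR g W0 Ps); [lia|apply hvPs]|].
  cbv beta. intros v n3 (rs & -> & r1 & r2).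
  assert (lrs : length rs = K) by (rewrite <- (Forall2_length r1); apply hvPs).
  assert (hrs : Forall (recp (l * 2 ^ length lv + g)) rs).
  { rewrite e1, <- lW, Nat.add_comm. clear -r1. induction r1 as [|P r Ps rs (h & _)]; constructor; auto. }
  rewrite e1 in hrs. change Leaf with (U []) at 1.
  assert (hb2 : Forall (fun b => length b <= g) bs) by (eapply Forall_impl; [|exact hbs]; simpl; tauto).
  assert (hP0 : vecl l K P0) by (rewrite <- lbs; now apply maxpow_vecl).
  eapply W_mono; [apply (W_solve R l g K hR bs P0 lbs hb2 hP0 lv rs [] [] 0); rewrite ?e1; auto|].
  { rewrite <- lbs. now apply levels_pow_ok. }
  { apply treps_nil. }
  { intros H []. }
  cbv beta. intros v n4 (Ub & ts & Hs & -> & s1 & _ & _ & s2). cbn [wp].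
  assert (lU : length Ub = l * 2 ^ m) by (rewrite (sol_length _ _ _ _ _ _ _ _ s1), e1; auto).
  change Leaf with (B []) at 1. use (W_rev b2t Ub []). rewrite app_nil_r.
  use (W_app b2t Ub W0). use (W_leq B b2t (words l) (repeat false t)).
  rewrite words_length, repeat_length in *.
  set (Y := QR R * (2 * l + 2 * g + 4)).
  assert (cost : 900 + n + n0 + n1 + n2 + n3 + n4 + n5 + n6 + n7 +
     50 * (l + 1) + 50 * (g + 1) + 200 * (g + 2) <= main_cost R l K m t).
  { unfold main_cost. fold g Y. rewrite lbs, e1, lW, lU in *.
    rewrite (proj1 hvPs) in r2.
    set (y := 2 ^ m) in *. assert (y1 : 1 <= y) by apply pow2_pos.
    set (z := 2 ^ l) in *. assert (z1 : 1 <= z) by apply pow2_pos.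
    assert (Y1 : 1000 * (2 * l + 2 * g + 4) <= Y) by (unfold Y; now apply Nat.mul_le_mono_r).
    (* Every phase is compared with [F], the product of the numbers of leaves, levels, candidates
       and bases, a factor for the block length, and the cost of arithmetic at one leaf. *)
    set (F := y * ((m + 2) * ((z + 5) * ((K + 2) * ((l + 1) * Y))))).
    assert (B0 : Y <= (l + 1) * Y) by (apply mul_ge_r; lia).
    set (Y2 := (l + 1) * Y) in *.
    assert (B1 : (K + 2) * Y2 <= (z + 5) * ((K + 2) * Y2)) by (apply mul_ge_r; lia).
    assert (B2 : (z + 5) * ((K + 2) * Y2) <= (m + 2) * ((z + 5) * ((K + 2) * Y2))) by (apply mul_ge_r; lia).
    assert (B3 : (m + 2) * ((z + 5) * ((K + 2) * Y2)) <= F) by (apply mul_ge_r; lia).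
    assert (Y2a : Y2 <= (K + 2) * Y2) by (apply mul_ge_r; lia).
    assert (zz : z <= (z + 5) * ((K + 2) * Y2)) by (clear - hK Y1 Y2a B0; nia).
    assert (yy : l * y + y <= F).
    { apply Nat.le_trans with (y * ((m + 2) * ((z + 5) * ((K + 2) * Y2)))); [|lia].
      replace (l * y + y) with (y * (l + 1)) by ring. apply Nat.mul_le_mono_l.
      apply Nat.le_trans with Y2; [unfold Y2; clear - Y1; nia|lia]. }
    assert (c1 : 4 * QR R * (g + l + 4) * (l + 1) * (K + 1) <= 4 * F).
    { apply Nat.le_trans with (4 * ((K + 2) * Y2)); [|lia].
      unfold Y2, Y. replace (4 * ((K + 2) * ((l + 1) * (QR R * (2 * l + 2 * g + 4))))) with
        (4 * QR R * (2 * l + 2 * g + 4) * (l + 1) * (K + 2)) by ring.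
      apply Nat.mul_le_mono; [|lia]. apply Nat.mul_le_mono_r, Nat.mul_le_mono_l. lia. }
    assert (c0 : forall c, c <= y * (2 * l + 2 * g + 4) -> QR R * c <= y * Y).
    { intros c hc. unfold Y. replace (y * (QR R * (2 * l + 2 * g + 4))) with (QR R * (y * (2 * l + 2 * g + 4))) by ring.
      now apply Nat.mul_le_mono_l. }
    assert (c2 : 5 * QR R * (g + l * y + 4) * (K + 1) * (m + 1) <= 5 * F).
    { apply Nat.le_trans with (5 * (y * ((m + 2) * ((K + 2) * Y)))).
      - replace (5 * (y * ((m + 2) * ((K + 2) * Y)))) with (5 * (y * Y) * (K + 2) * (m + 2)) by ring.
        apply Nat.mul_le_mono; [|lia]. apply Nat.mul_le_mono; [|lia].
        rewrite <- Nat.mul_assoc. apply Nat.mul_le_mono_l. apply c0. clear - y1; nia.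
      - apply Nat.mul_le_mono_l. unfold F. apply Nat.mul_le_mono_l, Nat.mul_le_mono_l.
        apply Nat.le_trans with ((K + 2) * Y2); [now apply Nat.mul_le_mono_l|lia]. }
    assert (c3 : 2 * QR R * (2 * (l * y) + 2 * g + 4) * (K + 1) <= 2 * F).
    { apply Nat.le_trans with (2 * (y * ((K + 2) * Y))).
      - replace (2 * (y * ((K + 2) * Y))) with (2 * (y * Y) * (K + 2)) by ring.
        apply Nat.mul_le_mono; [|lia].
        rewrite <- Nat.mul_assoc. apply Nat.mul_le_mono_l. apply c0. clear - y1; nia.
      - apply Nat.mul_le_mono_l. unfold F. apply Nat.mul_le_mono_l.
        apply Nat.le_trans with ((K + 2) * Y2); [now apply Nat.mul_le_mono_l|lia]. }
    assert (c4 : y * (leaf_cost R l g K + m * node_cost R l g K) <= 25 * F).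
    { unfold leaf_cost, node_cost, F. fold z.
      replace (25 * (y * ((m + 2) * ((z + 5) * ((K + 2) * Y2))))) with
        (y * (25 * ((m + 2) * ((z + 5) * ((K + 2) * Y2))))) by ring.
      apply Nat.mul_le_mono_l.
      replace ((K + 2) * (5 * QR R * (2 * l + 2 * g + 4))) with (5 * ((K + 2) * Y)) by (unfold Y; ring).
      replace ((K + 2) * (20 * QR R * (2 * l + 2 * g + 4))) with (20 * ((K + 2) * Y)) by (unfold Y; ring).
      assert (w1 : (K + 2) * Y <= (K + 2) * Y2) by now apply Nat.mul_le_mono_l.
      set (a := (K + 2) * Y) in *. set (a2 := (K + 2) * Y2) in *.
      assert (w2 : (z + 5) * a <= (z + 5) * a2) by now apply Nat.mul_le_mono_l.
      assert (w3 : a <= (z + 5) * a2) by lia.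
      assert (w4 : m * a <= m * ((z + 5) * a2)) by now apply Nat.mul_le_mono_l.
      lia. }
    assert (gg : g + 2 <= F) by lia.
    assert (tt : 60 * (t + 2) * (t + 1) <= 300 * F).
    { apply Nat.le_trans with (60 * (5 * g)); [unfold g; clear - ht; nia|lia]. }
    clear - p2 e4 r2 s2 c1 c2 c3 c4 gg tt zz B1 B2 B3 yy b b0 b1 b2 b3 Y2a B0 Y1 y1 z1. lia. }
  destruct (Nat.leb_spec (2 ^ l) t) as [le|gt]; cbn [b2t].
  - use (W_app b2t (repeat false l) (repeat false l)).
    destruct bs as [|b0' bs']; [simpl in lbs; lia|]. cbn [tl_of].
    change (Node Leaf Leaf) with (B [false]) at 1.
    use (W_app b2t b0' [false]).
    change Leaf with (b2t false) at 1. change (Node Leaf Leaf) with (b2t true).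
    change Leaf with (B []) at 1.
    use (W_adds (b0' ++ [false]) false true []).
    exists P0, lv, Ps, rs, Ub, Hs. repeat (split; [assumption|]). split.
    + unfold state_enc. rewrite <- repeat_app. replace (l + l) with (2 * l) by lia. reflexivity.
    + inversion hb2; subst. rewrite repeat_length, length_app in *. cbn [length] in *. lia.
  - exists P0, lv, Ps, rs, Ub, Hs. repeat (split; [assumption|]). split; [reflexivity|]. lia.
Qed.

(** * Digit blocks read by the greedy search *)

(** One-sided, because every truncation rounds down: errors never need a sign. *)
Definition near (v : R) (a e : nat) := (INR a <= v <= INR (a + e))%R.
Definition nearm (M : nat) (v : R) (a e : nat) := exists q, near v (q * M + a) e.

Lemma near_weak v a e e' : near v a e -> e <= e' -> near v a e'.
Proof. intros [h1 h2] h. split; auto. apply Rle_trans with (1 := h2), le_INR. lia. Qed.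

Lemma nearm_weak M v a e e' : nearm M v a e -> e <= e' -> nearm M v a e'.
Proof. intros [q h] h'. exists q. eapply near_weak; eauto. Qed.

Lemma nearm_mod M v a e : nearm M v a e -> nearm M v (a mod M) e.
Proof.
  intros [q h]. exists (q + a / M). rewrite Nat.mul_add_distr_r, <- Nat.add_assoc.
  replace (a / M * M + a mod M) with a; auto. rewrite (Nat.div_mod_eq a M) at 1. lia.
Qed.

(* The factor [u / T] is at most 1, so that the error grows by the rounding only. *)
Lemma near_frac v a e u T : near v a e -> 1 <= T -> u <= T -> near (v * INR u / INR T) (a * u / T) (e + 1).
Proof.
  intros [h1 h2] hT hu. set (f := a * u / T).
  assert (f1 : T * f <= a * u) by apply Nat.Div0.mul_div_le.
  assert (f2 : a * u < T * (f + 1)) by (rewrite Nat.add_1_r; apply Nat.mul_succ_div_gt; lia).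
  apply le_INR in f1. apply lt_INR in f2. rewrite !mult_INR in *. rewrite !plus_INR in *. change (INR 1) with 1%R in *.
  assert (t1 : (1 <= INR T)%R) by (apply (le_INR 1); auto).
  assert (u0 : (0 <= INR u)%R) by apply pos_INR.
  assert (u1 : (INR u <= INR T)%R) by now apply le_INR.
  assert (e0 : (0 <= INR e)%R) by apply pos_INR.
  pose proof (Rmult_le_compat_r _ _ _ u0 h1) as m1. pose proof (Rmult_le_compat_r _ _ _ u0 h2) as m2.
  pose proof (Rmult_le_compat_l _ _ _ e0 u1) as m3.
  split; apply (Rmult_le_reg_l (INR T)); try lra.
  - replace (INR T * (v * INR u / INR T))%R with (v * INR u)%R by (field; lra). lra.
  - replace (INR T * (v * INR u / INR T))%R with (v * INR u)%R by (field; lra). rewrite !plus_INR. change (INR 1) with 1%R. lra.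
Qed.

(** Only residues modulo [M * T] are stored; the multiples of [M * T] lost from the product become
    multiples of [M] after the division by [T]. *)
Lemma nearm_frac M v a e u T : nearm (M * T) v a e -> 1 <= T -> u <= T ->
  nearm M (v * INR u / INR T) ((a * u) mod (M * T) / T) (e + 1).
Proof.
  intros [q h] hT hu. pose proof (near_frac _ _ _ u T h hT hu) as h'.
  exists (q * u + a * u / (M * T)).
  replace ((q * u + a * u / (M * T)) * M + (a * u) mod (M * T) / T) with ((q * (M * T) + a) * u / T); auto.
  rewrite Nat.mul_add_distr_r. rewrite (Nat.div_mod_eq (a * u) (M * T)) at 1.
  replace (q * (M * T) * u + (M * T * (a * u / (M * T)) + (a * u) mod (M * T))) with
    ((a * u) mod (M * T) + (q * u + a * u / (M * T)) * M * T) by ring.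
  rewrite Nat.div_add by lia. lia.
Qed.

Lemma nearm_div M v a e T : nearm (M * T) v a e -> 1 <= T -> nearm M (v / INR T) (a / T) (e + 1).
Proof.
  intros [q h] hT. pose proof (near_frac _ _ _ 1 T h hT hT) as h'. exists q.
  replace (q * M + a / T) with ((q * (M * T) + a) * 1 / T).
  - replace (v / INR T)%R with (v * INR 1 / INR T)%R by (simpl; field; apply not_0_INR; lia). exact h'.
  - rewrite Nat.mul_1_r. replace (q * (M * T) + a) with (a + (q * M) * T) by ring. rewrite Nat.div_add by lia. lia.
Qed.

Lemma nearm_add M v a e w c e' : nearm M v a e -> near w c e' -> nearm M (v + w) (a + c) (e + e').
Proof.
  intros [q [h1 h2]] [h3 h4]. exists q. rewrite !plus_INR in *. unfold near. rewrite !plus_INR. lra.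
Qed.

Lemma near_scal v a e b : near v a e -> near (INR b * v) (b * a) (b * e).
Proof.
  intros [h1 h2]. assert (0 <= INR b)%R by apply pos_INR. unfold near.
  rewrite <- Nat.mul_add_distr_l, !mult_INR. split; now apply Rmult_le_compat_l.
Qed.

Lemma nearm_scal M v a e b : nearm M v a e -> nearm M (INR b * v) (b * a) (b * e).
Proof.
  intros [q h]. exists (b * q). replace (b * q * M + b * a) with (b * (q * M + a)) by ring. now apply near_scal.
Qed.

(* The record [r], read as a pair of [p]-bit fractions, approximates from below, up to [e] units in the last
   place, the pair (b^k Z / 2^n mod 1, b^k / 2^n). *)
Definition lamv b k n p : R := (INR (b ^ k) * INR (2 ^ p) / INR (2 ^ n))%R.
Definition approx (b p e Z n k : nat) (r : rec) :=
  recp p r /\ near (lamv b k n p) (bval (snd r)) e /\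
  nearm (2 ^ p) (lamv b k n p * INR Z) (bval (fst r)) e /\ 2 ^ n <= b ^ (k + 1).

Lemma INR_pow2 n : (0 < INR (2 ^ n))%R.
Proof. apply lt_0_INR. pose proof (pow2_pos n). lia. Qed.

Lemma lamv_sub b k n p L : L <= p -> lamv b k n (p - L) = (lamv b k n p / INR (2 ^ L))%R.
Proof.
  intros h. unfold lamv. pose proof (INR_pow2 n). pose proof (INR_pow2 L).
  replace p with (p - L + L) at 2 by lia. rewrite Nat.pow_add_r, (mult_INR (2 ^ (p - L))). field. lra.
Qed.

Lemma lamv_add b k n p D L : lamv b (k + D) (n + L) p = (lamv b k n p * INR (b ^ D) / INR (2 ^ L))%R.
Proof.
  unfold lamv. pose proof (INR_pow2 n). pose proof (INR_pow2 L).
  rewrite !Nat.pow_add_r, !mult_INR. field. lra.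
Qed.

Lemma pow_sub p L : L <= p -> 2 ^ p = 2 ^ (p - L) * 2 ^ L.
Proof. intros h. rewrite <- Nat.pow_add_r. f_equal. lia. Qed.

Lemma approx_trunc b p e Z n k r L : approx b p e Z n k r -> L <= p ->
  approx b (p - L) (e + 1) Z n k (skipn L (fst r), skipn L (snd r)).
Proof.
  intros ([l1 l2] & h1 & h2 & h3) hL. split; [|split; [|split]]; auto; cbn [fst snd].
  - split; cbn [fst snd]; rewrite length_skipn; lia.
  - rewrite bval_skipn_div, lamv_sub by auto. pose proof (pow2_pos L).
    replace (bval (snd r)) with (bval (snd r) * 1) by lia.
    replace (lamv b k n p) with (lamv b k n p * INR 1)%R by (simpl; ring). apply near_frac; auto.
  - rewrite bval_skipn_div, lamv_sub by auto. pose proof (pow2_pos L). pose proof (INR_pow2 L).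
    replace (lamv b k n p / INR (2 ^ L) * INR Z)%R with (lamv b k n p * INR Z / INR (2 ^ L))%R by (field; lra).
    apply nearm_div; auto. now rewrite <- pow_sub.
Qed.

Lemma approx_read b p e Z n k r u L : approx b p e Z n k r -> u <= 2 ^ L ->
  nearm (2 ^ p) (lamv b k (n + L) p * INR (Z * 2 ^ L + u))
    ((bval (fst r) + bval (snd r) * u / 2 ^ L) mod 2 ^ p) (2 * e + 1).
Proof.
  intros (_ & h1 & h2 & _) hu. pose proof (pow2_pos L) as hL. pose proof (INR_pow2 L). pose proof (INR_pow2 n).
  apply nearm_mod. replace (2 * e + 1) with (e + (e + 1)) by lia.
  replace (lamv b k (n + L) p * INR (Z * 2 ^ L + u))%R with
    (lamv b k n p * INR Z + lamv b k n p * INR u / INR (2 ^ L))%R.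
  - apply nearm_add; auto. now apply near_frac.
  - unfold lamv. rewrite Nat.pow_add_r, plus_INR, !mult_INR. field. lra.
Qed.

(** Reading [U], multiplying by [P] and cutting turn the error e into 2e + 2, and a normalising
    factor b multiplies it. The new exponent is k + D, or k + D + 1 if [fNORM] multiplied. Its lower
    bound follows from the maximality of [P] in the latter case and from the refused multiplication
    in the former. *)
Lemma approx_adv b p e Z n k r P D U r' L : 2 <= bval b -> approx (bval b) p e Z n k r -> maxpow L b P -> bval P = bval b ^ D ->
  length U = L -> L <= p -> adv1 b P r U r' ->
  exists k', approx (bval b) (p - L) (bval b * (2 * e + 2)) (Z * 2 ^ L + bval U) (n + L) k' r'.
Proof.
  intros hb hr (lP & _ & mP) hD lU hL [q1 q2]. pose proof hr as ([l1 l2] & h1 & h2 & h3).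
  rewrite lP, l1 in *. pose proof (pow2_pos L) as L0. pose proof (INR_pow2 L).
  assert (PT : bval P < 2 ^ L) by (rewrite <- lP; apply bval_lt).
  assert (hu : bval U <= 2 ^ L) by (rewrite <- lU; apply Nat.lt_le_incl, bval_lt).
  pose proof (approx_read _ _ _ _ _ _ _ (bval U) L hr hu) as hy. rewrite (pow_sub p L) in hy at 1 by auto.
  apply nearm_frac with (u := bval P) in hy; [|lia|lia]. rewrite <- pow_sub in hy by auto.
  replace (2 * e + 1 + 1) with (2 * e + 2) in hy by lia.
  replace (lamv (bval b) k (n + L) p * INR (Z * 2 ^ L + bval U) * INR (bval P) / INR (2 ^ L))%R with
    (lamv (bval b) (k + D) (n + L) (p - L) * INR (Z * 2 ^ L + bval U))%R in hy.
  2:{ rewrite lamv_sub by auto. unfold lamv. rewrite (Nat.pow_add_r _ k), mult_INR, hD.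
      pose proof (INR_pow2 (n + L)). field. lra. }
  assert (hl : near (lamv (bval b) (k + D) (n + L) (p - L))
     (bval (snd r) * bval P / 2 ^ L / 2 ^ L) (2 * e + 2)).
  { apply near_frac with (u := bval P) (T := 2 ^ L) in h1; [|lia|lia].
    apply near_frac with (u := 1) (T := 2 ^ L) in h1; [|lia|lia]. rewrite Nat.mul_1_r in h1.
    rewrite lamv_sub, lamv_add, <- hD by auto. change (INR 1) with 1%R in h1. rewrite Rmult_1_r in h1.
    apply near_weak with (1 := h1). lia. }
  set (x1 := ((bval (fst r) + bval (snd r) * bval U / 2 ^ L) mod 2 ^ p * bval P) mod 2 ^ p / 2 ^ L) in *.
  set (l1' := bval (snd r) * bval P / 2 ^ L / 2 ^ L) in *.
  destruct q2 as [(c1 & c2 & c3)|(c1 & c2 & c3)].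
  - exists (k + D + 1). split; [exact q1|]. rewrite c2, c3.
    assert (E : forall v : R, (lamv (bval b) (k + D + 1) (n + L) (p - L) * v = INR (bval b) * (lamv (bval b) (k + D) (n + L) (p - L) * v))%R).
    { intros v. unfold lamv. rewrite (Nat.pow_add_r _ (k + D)), mult_INR, Nat.pow_1_r. pose proof (INR_pow2 (n + L)). field. lra. }
    split; [|split].
    + rewrite <- (Rmult_1_r (lamv _ _ _ _)), E, Rmult_1_r. now apply near_scal.
    + rewrite E. now apply nearm_mod, nearm_scal.
    + rewrite hD in mP. rewrite (Nat.pow_add_r 2). replace (k + D + 1 + 1) with ((k + 1) + S D) by lia.
      rewrite (Nat.pow_add_r _ (k + 1)), Nat.pow_succ_r'. now apply Nat.mul_le_mono.
  - exists (k + D). split; [exact q1|]. rewrite c2, c3. split; [|split].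
    + apply near_weak with (1 := hl). nia.
    + apply nearm_weak with (1 := hy). nia.
    + destruct hl as [hl _]. rewrite (Nat.pow_add_r _ (k + D)), Nat.pow_1_r. apply INR_le.
      apply (Rmult_le_reg_r (INR (2 ^ (p - L)))); [apply INR_pow2|].
      apply le_INR in c1. rewrite mult_INR in *. unfold lamv in hl.
      pose proof (INR_pow2 (n + L)) as N0. set (N := INR (2 ^ (n + L))) in *.
      apply (Rmult_le_compat_r N) in hl; [|lra].
      replace (INR (bval b ^ (k + D)) * INR (2 ^ (p - L)) / N * N)%R with (INR (bval b ^ (k + D)) * INR (2 ^ (p - L)))%R in hl by (field; lra).
      apply (Rmult_le_compat_l N) in c1; [|lra].
      assert (0 <= INR (bval b))%R by apply pos_INR. nra.
Qed.

Lemma approx_root g W0 b P D r : maxpow (length W0) b P -> bval P = bval b ^ D -> root1 g W0 P r ->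
  approx (bval b) (g + length W0) 0 (bval W0) (length W0) D r.
Proof.
  intros (lP & _ & mP) hD (h1 & h2 & h3). split; [exact h1|]. rewrite h2, h3.
  pose proof (INR_pow2 (length W0)) as n0.
  assert (E : lamv (bval b) D (length W0) (g + length W0) = INR (2 ^ g * bval P)).
  { unfold lamv. rewrite Nat.pow_add_r, !mult_INR, hD. field. lra. }
  rewrite E. split; [|split].
  - split; rewrite ?Nat.add_0_r; lra.
  - exists (bval P * bval W0 / 2 ^ length W0). rewrite Nat.pow_add_r.
    replace (bval P * bval W0 / 2 ^ length W0 * (2 ^ g * 2 ^ length W0) + 2 ^ g * ((bval P * bval W0) mod 2 ^ length W0))
      with (2 ^ g * bval P * bval W0).
    + rewrite mult_INR. split; rewrite ?Nat.add_0_r; rewrite ?mult_INR; lra.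
    + rewrite <- Nat.mul_assoc. rewrite (Nat.div_mod_eq (bval P * bval W0) (2 ^ length W0)) at 1. ring.
  - rewrite Nat.add_1_r, Nat.pow_succ_r', <- hD. exact mP.
Qed.

(* If [z] lies in the binary cell of [Z 2^l + u] and [Q = b ^ kap], then the [kap] base-b digits of [z]
   after position [k] form one of the numbers [d], [d + 1], [d + 2] modulo [Q]. *)
Definition block_ok (b Q l Z n u d : nat) : Prop := exists k q,
  2 ^ n <= b ^ (k + 1) /\ b ^ k <= 2 ^ (n + 1) /\ d < Q /\
  (q * Q + d) * 2 ^ (n + l) <= b ^ k * Q * (Z * 2 ^ l + u) /\
  b ^ k * Q * (Z * 2 ^ l + u + 1) < (q * Q + d + 3) * 2 ^ (n + l).

Lemma near_nat b k n p Z a e : near (lamv b k n p * INR Z) a e ->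
  a * 2 ^ n <= b ^ k * 2 ^ p * Z <= (a + e) * 2 ^ n.
Proof.
  intros [h1 h2]. pose proof (INR_pow2 n) as n0. unfold lamv in *.
  apply (Rmult_le_compat_r (INR (2 ^ n))) in h1, h2; [|lra..].
  replace (INR (b ^ k) * INR (2 ^ p) / INR (2 ^ n) * INR Z * INR (2 ^ n))%R with (INR (b ^ k * 2 ^ p * Z)) in *
    by (rewrite !mult_INR; field; lra).
  rewrite <- mult_INR in h1, h2. split; now apply INR_le.
Qed.

(** The 3 is made of one unit for rounding down to [d], one for the errors of the fractions, and one
    for the width of the binary cell, which is about Q / T < 1 in units of the word. *)
Lemma block_arith q A Y N B Q Z d e T M : 1 <= A -> Q < T -> N = M * T ->
  (q * A + Y) * N <= B * A * Z -> B * A * Z <= (q * A + Y + (2 * e + 1)) * N -> B * A <= (A + e) * M ->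
  A * d <= Q * Y -> Q * Y < A * (d + 1) -> T * (2 * e + 2) <= A -> 1 <= M ->
  (q * Q + d) * N <= B * Q * Z /\ B * Q * (Z + 1) < (q * Q + d + 3) * N.
Proof.
  intros a1 qt -> h1 h2 h3 h4 h5 h6 m1. split.
  - apply (Nat.mul_le_mono_pos_l _ _ A); [lia|].
    apply (Nat.mul_le_mono_l _ _ Q) in h1. apply (Nat.mul_le_mono_r _ _ (M * T)) in h4. lia.
  - apply (Nat.mul_lt_mono_pos_l A); [lia|].
    apply (Nat.mul_le_mono_l _ _ Q) in h2, h3.
    assert (h7 : Q * ((A + e) * M) <= T * ((A + e) * M)) by (apply Nat.mul_le_mono_r; lia).
    assert (mt : 1 <= M * T) by nia.
    assert (h8 : Q * Y * (M * T) + 1 <= A * (d + 1) * (M * T)) by nia.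
    assert (h9 : (Q * (2 * e + 1) + e) * (M * T) <= A * (M * T)).
    { apply Nat.mul_le_mono_r. apply Nat.le_trans with (2 := h6). clear -qt. nia. }
    lia.
Qed.

Lemma wordr_block b p e Z n k P r u l : 1 <= bval P -> approx b p e Z n k r -> length u = l ->
  bval P < 2 ^ l -> 2 ^ l * (2 * e + 2) <= 2 ^ p -> block_ok b (bval P) l Z n (bval u) (wordr P r u).
Proof.
  intros q0 hr lu hk he. unfold wordr, wordN. pose proof hr as ([l1 l2] & h1 & h2 & h3). rewrite l1, lu.
  assert (hu : bval u <= 2 ^ l) by (rewrite <- lu; apply Nat.lt_le_incl, bval_lt).
  destruct (approx_read _ _ _ _ _ _ _ (bval u) l hr hu) as [q hy]. apply near_nat in hy.
  set (Y := (bval (fst r) + bval (snd r) * bval u / 2 ^ l) mod 2 ^ p) in *.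
  assert (hY : Y < 2 ^ p) by (apply Nat.mod_upper_bound; pose proof (pow2_pos p); lia).
  set (d := bval P * Y / 2 ^ p). pose proof (pow2_pos p) as p0. pose proof (pow2_pos l) as l0.
  assert (d1 : 2 ^ p * d <= bval P * Y) by apply Nat.Div0.mul_div_le.
  assert (d2 : bval P * Y < 2 ^ p * (d + 1)) by (rewrite Nat.add_1_r; apply Nat.mul_succ_div_gt; lia).
  assert (d3 : d < bval P).
  { apply Nat.Div0.div_lt_upper_bound. rewrite Nat.mul_comm. apply Nat.mul_lt_mono_pos_r; lia. }
  assert (hl : b ^ k * 2 ^ p <= (2 ^ p + e) * 2 ^ n).
  { pose proof (bval_lt (snd r)) as lt. rewrite l2 in lt.
    rewrite <- (Rmult_1_r (lamv _ _ _ _)) in h1. change 1%R with (INR 1) in h1. apply near_nat in h1.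
    destruct h1 as [_ h1]. rewrite Nat.mul_1_r in h1. apply Nat.le_trans with (1 := h1).
    apply Nat.mul_le_mono_r. lia. }
  assert (ep : e <= 2 ^ p) by nia.
  exists k, q. split; [exact h3|]. split; [|split; [exact d3|]].
  - apply (Nat.mul_le_mono_pos_r _ _ (2 ^ p)); [lia|]. apply Nat.le_trans with (1 := hl).
    rewrite Nat.pow_add_r, Nat.pow_1_r. nia.
  - destruct hy as [y1 y2].
    apply (block_arith q (2 ^ p) Y (2 ^ (n + l)) (b ^ k) (bval P) (Z * 2 ^ l + bval u) d e (2 ^ l) (2 ^ n)); auto.
    + apply Nat.pow_add_r.
    + apply pow2_pos.
Qed.

(** * Density of words and the potential of the greedy choice *)

Lemma min_exists (x : nat) S : exists m, In m (x :: S) /\ forall y, In y (x :: S) -> m <= y.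
Proof.
  revert x. induction S as [|a S IH]; intros x.
  - exists x. split; [now left|]. intros y [->|[]]; lia.
  - destruct (IH a) as (m & h1 & h2). destruct (le_lt_dec x m).
    + exists x. split; [now left|]. intros y [->|h]; [lia|]. specialize (h2 y h). lia.
    + exists m. split; [now right|]. intros y [->|h]; [lia|]. auto.
Qed.

Lemma close_length (M : nat) S : NoDup S -> (forall x y, In x S -> In y S -> x - y < M) -> length S <= M.
Proof.
  intros nd h. destruct S as [|x S]; [simpl; lia|]. destruct (min_exists x S) as (m & h1 & h2).
  rewrite <- (length_seq M m). apply NoDup_incl_length; auto.
  intros y hy. apply in_seq. specialize (h y m hy h1). specialize (h2 y hy). lia.
Qed.

Lemma filter_split {A} (f g : A -> bool) S :
  length (filter f S) = length (filter (fun x => f x && g x) S) + length (filter (fun x => f x && negb (g x)) S).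
Proof. induction S as [|x S IH]; simpl; auto. destruct (f x), (g x); simpl; lia. Qed.

(** Raising u by one moves P (X + lam u / 2^l) / 2^p by at least 1 / (2 b^2), as P >= 2^l / b and
    lam >= 2^p / (2b). Two candidates with the same word and the same wrap [q] are less than two
    units apart, the second unit paying for the rounding of lam u / 2^l. *)
Lemma word_close P X lam u1 u2 p l b d q : 1 <= b -> b * P >= 2 ^ l -> P < 2 ^ l -> l <= p -> 2 ^ p <= 2 * b * lam ->
  (X + lam * u1 / 2 ^ l) / 2 ^ p = q -> (X + lam * u2 / 2 ^ l) / 2 ^ p = q ->
  wordN P X lam u1 p l = d -> wordN P X lam u2 p l = d -> u2 - u1 < 4 * (b * b).
Proof.
  intros b1 hP PT lp hl q1 q2 w1 w2. unfold wordN in *.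
  set (a1 := lam * u1 / 2 ^ l) in *. set (a2 := lam * u2 / 2 ^ l) in *.
  pose proof (pow2_pos p) as p0. pose proof (pow2_pos l) as l0.
  pose proof (Nat.div_mod_eq (X + a1) (2 ^ p)) as e1. pose proof (Nat.div_mod_eq (X + a2) (2 ^ p)) as e2.
  rewrite q1 in e1. rewrite q2 in e2.
  set (y1 := (X + a1) mod 2 ^ p) in *. set (y2 := (X + a2) mod 2 ^ p) in *.
  assert (f1 : 2 ^ p * d <= P * y1) by (rewrite <- w1; apply Nat.Div0.mul_div_le).
  assert (f2 : P * y2 < 2 ^ p * (d + 1)) by (rewrite <- w2, Nat.add_1_r; apply Nat.mul_succ_div_gt; lia).
  assert (g1 : 2 ^ l * a1 <= lam * u1) by apply Nat.Div0.mul_div_le.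
  assert (g2 : lam * u2 < 2 ^ l * (a2 + 1)) by (rewrite Nat.add_1_r; apply Nat.mul_succ_div_gt; lia).
  assert (TA : 2 ^ l <= 2 ^ p) by (apply Nat.pow_le_mono_r; lia).
  set (T := 2 ^ l) in *. set (A := 2 ^ p) in *.
  destruct (le_lt_dec u2 u1) as [le|lt]; [clear -le b1; nia|].
  set (v := u2 - u1). assert (ev : u2 = u1 + v) by lia.
  assert (k1 : P * a2 < P * a1 + A).
  { assert (P * (X + a1) = P * (A * q + y1)) by now rewrite e1. assert (P * (X + a2) = P * (A * q + y2)) by now rewrite e2. lia. }
  assert (k2 : lam * v + T * a1 < T * (a2 + 1)) by (rewrite ev in g2; lia).
  assert (P1 : 1 <= P) by (clear -hP l0; nia).
  assert (k3 : P * (lam * v) < T * (A + P)).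
  { assert (P * (lam * v + T * a1) < P * (T * (a2 + 1))) by (apply Nat.mul_lt_mono_pos_l; lia).
    assert (T * (P * a2) <= T * (P * a1 + A)) by (apply Nat.mul_le_mono_l; lia). lia. }
  assert (k4 : T * A * v <= 2 * (b * b) * (P * (lam * v))).
  { assert (T * A <= (b * P) * (2 * b * lam)) by (apply Nat.mul_le_mono; auto).
    replace (2 * (b * b) * (P * (lam * v))) with ((b * P) * (2 * b * lam) * v) by ring. now apply Nat.mul_le_mono_r. }
  assert (k5 : T * A * v < T * A * (4 * (b * b))).
  { apply Nat.le_lt_trans with (1 := k4). apply Nat.lt_le_trans with (2 * (b * b) * (T * (A + P))).
    - apply Nat.mul_lt_mono_pos_l; auto. clear -b1; nia.
    - replace (T * A * (4 * (b * b))) with (2 * (b * b) * (T * (A + A))) by ring.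
      apply Nat.mul_le_mono_l, Nat.mul_le_mono_l. lia. }
  apply Nat.mul_lt_mono_pos_l in k5; auto. clear -l0 p0. nia.
Qed.

(** The fraction wraps around at most once, so the candidates for a word fall into two classes of
    diameter less than 4 b^2. *)
Lemma word_density P X lam p l b d : 1 <= b -> b * P >= 2 ^ l -> P < 2 ^ l -> l <= p -> 2 ^ p <= 2 * b * lam ->
  X < 2 ^ p -> lam < 2 ^ p ->
  length (filter (fun u => wordN P X lam (bval u) p l =? d) (words l)) <= 8 * (b * b).
Proof.
  intros b1 hP PT lp hl hX hlam.
  rewrite (filter_split _ (fun u => (X + lam * bval u / 2 ^ l) / 2 ^ p =? 0)).
  assert (key : forall q f, (forall u, In u (words l) -> f u = true ->
      wordN P X lam (bval u) p l = d /\ (X + lam * bval u / 2 ^ l) / 2 ^ p = q) ->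
    length (filter f (words l)) <= 4 * (b * b)).
  { intros q f hf. rewrite <- (length_map bval). apply close_length.
    - apply NoDup_map_NoDup_ForallPairs; [|apply NoDup_filter, words_nodup].
      intros x y hx hy. apply filter_In in hx, hy. destruct hx as [hx _], hy as [hy _].
      apply words_in in hx, hy. apply bval_inj. congruence.
    - intros x y hx hy. apply in_map_iff in hx, hy. destruct hx as (u & <- & hu), hy as (v & <- & hv).
      apply filter_In in hu, hv. destruct hu as [hu fu], hv as [hv fv].
      destruct (hf u hu fu), (hf v hv fv). eapply word_close with (q := q) (d := d); eauto. }
  assert (hu : forall u, In u (words l) -> (X + lam * bval u / 2 ^ l) / 2 ^ p <= 1).
  { intros u hu. apply words_in in hu. pose proof (bval_lt u) as lt. rewrite hu in lt.
    assert (lam * bval u / 2 ^ l <= lam).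
    { apply Nat.Div0.div_le_upper_bound. rewrite Nat.mul_comm. apply Nat.mul_le_mono_r. lia. }
    apply Nat.lt_succ_r. apply Nat.Div0.div_lt_upper_bound.
    set (w := lam * bval u / 2 ^ l) in *. clearbody w. lia. }
  replace (8 * (b * b)) with (4 * (b * b) + 4 * (b * b)) by ring. apply Nat.add_le_mono.
  - apply (key 0). intros u _ h. apply andb_prop in h. destruct h as [h1 h2]. now apply Nat.eqb_eq in h1, h2.
  - apply (key 1). intros u h0 h. apply andb_prop in h. destruct h as [h1 h2].
    apply Bool.negb_true_iff in h2. apply Nat.eqb_neq in h2. apply Nat.eqb_eq in h1. specialize (hu u h0). lia.
Qed.

Lemma list_sum_map_add {A} (f g : A -> nat) S :
  list_sum (map (fun u => f u + g u) S) = list_sum (map f S) + list_sum (map g S).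
Proof. induction S; simpl; lia. Qed.

(** Double counting: each earlier word in [H] contributes the candidates that would reproduce it, at
    most [c]. *)
Lemma sum_cnt {A} (f : A -> nat) c H S : (forall d, length (filter (fun u => f u =? d) S) <= c) ->
  list_sum (map (fun u => cnt H (f u)) S) <= length H * c.
Proof.
  intros h. induction H as [|d H IH].
  - induction S; simpl in *; auto. apply IHS. intros d. specialize (h d). destruct (f a =? d); simpl in h; lia.
  - replace (list_sum (map (fun u => cnt (d :: H) (f u)) S)) with
      (length (filter (fun u => f u =? d) S) + list_sum (map (fun u => cnt H (f u)) S)).
    + specialize (h d). cbn [length]. lia.
    + rewrite (map_ext (fun u => cnt (d :: H) (f u)) (fun u => (if f u =? d then 1 else 0) + cnt H (f u))).
      * rewrite list_sum_map_add. f_equal. clear. induction S as [|u S IH]; simpl; auto.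
        destruct (f u =? d); simpl; lia.
      * intros u. cbn [count_occ]. destruct (Nat.eq_dec d (f u)), (Nat.eqb_spec (f u) d); try congruence; lia.
Qed.

Lemma sum_costN c h cs rs : forall Ps Hs,
  (forall i d, i < length rs -> length (filter (fun u => wordr (nth i Ps []) (nth i rs ([], [])) u =? d) cs) <= c) ->
  (forall i, i < length rs -> length (nth i Hs []) <= h) ->
  list_sum (map (costN Ps rs Hs) cs) <= length rs * (h * c).
Proof.
  induction rs as [|r rs IH]; intros Ps Hs hd hh.
  - cbn [length]. clear. induction cs; simpl; auto.
  - cbn [costN]. rewrite list_sum_map_add. cbn [length]. rewrite Nat.mul_succ_l, Nat.add_comm. apply Nat.add_le_mono.
    + apply IH.
      * intros i d hi. assert (si : S i < length (r :: rs)) by (simpl; lia). specialize (hd _ d si).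
        destruct Ps; cbn [nth tl] in *; auto. destruct i; auto.
      * intros i hi. assert (si : S i < length (r :: rs)) by (simpl; lia). specialize (hh _ si).
        destruct Hs; cbn [nth tl] in *; auto. destruct i; auto.
    + assert (si : 0 < length (r :: rs)) by (simpl; lia).
      apply Nat.le_trans with (length (List.hd [] Hs) * c).
      * apply sum_cnt. intros d. specialize (hd 0 d si). destruct Ps; auto.
      * apply Nat.mul_le_mono_r. specialize (hh 0 si). destruct Hs; simpl in *; lia.
Qed.

Lemma min_le_sum {A} (f : A -> nat) x S : (forall u, In u S -> x <= f u) -> length S * x <= list_sum (map f S).
Proof.
  induction S as [|u S IH]; intros h; simpl; auto.
  assert (x <= f u) by (apply h; now left). assert (length S * x <= list_sum (map f S)) by (apply IH; intros; apply h; now right).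
  lia.
Qed.

(** The sum of squared multiplicities ([phi_rsum]), built up word by word through (x + 1)^2 - x^2 =
    2x + 1. This form shows the greedy cost in the increment ([psi_push]). *)
Fixpoint phi (H : list nat) : nat := match H with [] => 0 | d :: H => phi H + 2 * cnt H d + 1 end.

Inductive trace (b Q l : nat) : nat -> nat -> list nat -> nat -> Prop :=
| trace0 Z n : trace b Q l Z n [] Z
| traceS Z n ds Z1 u d : trace b Q l Z n ds Z1 -> u < 2 ^ l -> block_ok b Q l Z1 (n + l * length ds) u d ->
    trace b Q l Z n (d :: ds) (Z1 * 2 ^ l + u).

Lemma trace_app b Q l Z n ds Z1 ds' Z2 : trace b Q l Z n ds Z1 -> trace b Q l Z1 (n + l * length ds) ds' Z2 ->
  trace b Q l Z n (ds' ++ ds) Z2.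
Proof.
  intros h h'. remember (n + l * length ds) as n1 eqn:en. revert h. induction h'; intros h; cbn [app]; auto.
  constructor; auto. rewrite length_app. subst n0.
  replace (n + l * (length ds0 + length ds)) with (n + l * length ds + l * length ds0) by ring. auto.
Qed.

Notation nil2 := (([], []) : rec).

Lemma nth_push rs : forall i Ps Hs u, i < length rs ->
  nth i (push Ps rs Hs u) [] = wordr (nth i Ps []) (nth i rs nil2) u :: nth i Hs [].
Proof.
  induction rs as [|r rs IH]; intros i Ps Hs u h; [simpl in h; lia|]. destruct i as [|i]; cbn [push nth].
  - destruct Ps, Hs; reflexivity.
  - simpl in h. rewrite IH by lia. destruct Ps, Hs; cbn [tl nth]; try reflexivity; destruct i; reflexivity.
Qed.

Lemma nth_trunc rs : forall i Ps, i < length rs -> nth i (trunc Ps rs) nil2 =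
  (skipn (length (nth i Ps [])) (fst (nth i rs nil2)), skipn (length (nth i Ps [])) (snd (nth i rs nil2))).
Proof.
  induction rs as [|r rs IH]; intros i Ps h; [simpl in h; lia|]. destruct i as [|i]; cbn [trunc nth].
  - destruct Ps; reflexivity.
  - simpl in h. rewrite IH by lia. destruct Ps; cbn [tl nth]; try reflexivity; destruct i; reflexivity.
Qed.

Lemma nth_adv U rs : forall i bs Ps rs', i < length rs -> adv bs Ps rs U rs' ->
  adv1 (nth i bs []) (nth i Ps []) (nth i rs nil2) U (nth i rs' nil2).
Proof.
  induction rs as [|r rs IH]; intros i bs Ps rs' h ha; [simpl in h; lia|].
  destruct rs' as [|r' rs']; [destruct ha|]. destruct ha as [h1 h2]. destruct i as [|i]; cbn [nth].
  - destruct bs, Ps; exact h1.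
  - simpl in h. apply IH with (i := i) in h2; [|lia].
    destruct bs, Ps; cbn [tl] in h2; auto; destruct i; auto.
Qed.

Lemma adv_length U rs : forall bs Ps rs', adv bs Ps rs U rs' -> length rs' = length rs.
Proof.
  induction rs as [|r rs IH]; intros bs Ps [|r' rs'] h; simpl in h; try tauto. simpl. f_equal. eapply IH. apply h.
Qed.

Lemma costN_sum rs : forall Ps Hs u, costN Ps rs Hs u =
  list_sum (map (fun i => cnt (nth i Hs []) (wordr (nth i Ps []) (nth i rs nil2) u)) (seq 0 (length rs))).
Proof.
  induction rs as [|r rs IH]; intros Ps Hs u; auto. cbn [costN length seq map]. rewrite <- seq_shift, map_map.
  change (list_sum (?a :: ?b)) with (a + list_sum b). rewrite IH. f_equal.
  - destruct Ps, Hs; reflexivity.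
  - f_equal. apply map_ext. intros i. destruct Ps, Hs; cbn [tl nth]; try reflexivity; destruct i; reflexivity.
Qed.

Definition psi K (Hs : list (list nat)) := list_sum (map (fun i => phi (nth i Hs [])) (seq 0 K)).

Lemma psi_push Ps rs Hs u : psi (length rs) (push Ps rs Hs u) = psi (length rs) Hs + 2 * costN Ps rs Hs u + length rs.
Proof.
  unfold psi. rewrite costN_sum.
  rewrite (map_ext_in _ (fun i => phi (nth i Hs []) + (2 * cnt (nth i Hs []) (wordr (nth i Ps []) (nth i rs nil2) u) + 1))).
  - rewrite !list_sum_map_add, <- Nat.add_assoc. f_equal. f_equal.
    + induction (seq 0 (length rs)); simpl in *; lia.
    + rewrite <- (length_seq (length rs) 0) at 2. induction (seq 0 (length rs)); simpl in *; lia.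
  - intros i hi. apply in_seq in hi. rewrite nth_push by lia. cbn [phi]. lia.
Qed.

Lemma sol_nil_inv l bs P0 rs Hs u Hs' : sol l bs P0 [] rs Hs u Hs' -> length u = l /\
  (forall u', length u' = l -> costN P0 rs Hs u <= costN P0 rs Hs u') /\ Hs' = push P0 rs Hs u.
Proof. intros h. inversion h; auto. Qed.

Lemma sol_cons_inv l bs P0 Ps lv rs Hs U H2 : sol l bs P0 (Ps :: lv) rs Hs U H2 -> exists rs' U1 H1 U2,
  U = U2 ++ U1 /\ sol l bs P0 lv (trunc Ps rs) Hs U1 H1 /\ adv bs Ps rs U1 rs' /\ sol l bs P0 lv rs' H1 U2 H2.
Proof. intros h. inversion h; subst. repeat eexists; eauto. Qed.

Lemma maxpow_bval L b P : 2 <= bval b -> maxpow L b P -> 1 <= bval P < 2 ^ L.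
Proof.
  intros hb (h1 & (D & h2) & _). split; [rewrite h2; pose proof (Nat.pow_nonzero (bval b) D); lia|].
  rewrite <- h1. apply bval_lt.
Qed.

Section SolTrace.
Context (l g K Bm E J : nat) (bs P0 : list (list bool)).
Context (hK : length bs = K) (hP0 : Forall2 (maxpow l) bs P0)
  (hB : 2 <= Bm) (hbs : forall i, i < K -> 2 <= bval (nth i bs []) <= Bm) (hE : Bm * (2 * E + 2) <= 2 ^ g).

Lemma maxpow_nth L Ps i : Forall2 (maxpow L) bs Ps -> i < K -> maxpow L (nth i bs []) (nth i Ps []).
Proof.
  intros h. rewrite <- hK. revert i. clear -h. induction h; intros [|i] hi; simpl in *; try lia; auto. apply IHh. lia.
Qed.

Lemma leaf_density Z n e i k r d : i < K -> e <= E -> approx (bval (nth i bs [])) (l + g) e Z n k r ->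
  length (filter (fun u => wordr (nth i P0 []) r u =? d) (words l)) <= 8 * (Bm * Bm).
Proof.
  intros hi he ([l1 l2] & h1 & _ & h3). destruct (hbs i hi) as [b2 bB].
  pose proof (maxpow_nth _ _ _ hP0 hi) as hm. pose proof (maxpow_bval _ _ _ b2 hm) as [P1 P2].
  destruct hm as (lP & _ & mP). set (b := bval (nth i bs [])) in *.
  rewrite (filter_ext_in _ (fun u => wordN (bval (nth i P0 [])) (bval (fst r)) (bval (snd r)) (bval u) (l + g) l =? d)).
  2:{ intros u hu. apply words_in in hu. unfold wordr. now rewrite l1, hu. }
  apply Nat.le_trans with (8 * (b * b)); [|apply Nat.mul_le_mono_l; now apply Nat.mul_le_mono].
  apply word_density; auto; try lia.
  - rewrite <- (Rmult_1_r (lamv _ _ _ _)) in h1. change 1%R with (INR 1) in h1. apply near_nat in h1.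
    destruct h1 as [_ h1]. rewrite Nat.mul_1_r in h1. rewrite Nat.pow_add_r, Nat.pow_1_r in h3.
    assert (a1 : 2 ^ (l + g) <= b * (bval (snd r) + e)).
    { apply (Nat.mul_le_mono_pos_r _ _ (2 ^ n)); [pose proof (pow2_pos n); lia|].
      apply (Nat.mul_le_mono_l _ _ b) in h1. apply (Nat.mul_le_mono_l _ _ (2 ^ (l + g))) in h3. lia. }
    assert (a2 : 2 * (b * e) <= 2 ^ (l + g)).
    { apply Nat.le_trans with (2 ^ g); [|apply Nat.pow_le_mono_r; lia]. apply Nat.le_trans with (2 := hE).
      assert (b * e <= Bm * E) by (apply Nat.mul_le_mono; auto). lia. }
    lia.
  - rewrite <- l1. apply bval_lt.
  - rewrite <- l2. apply bval_lt.
Qed.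

(** The factor [4 * Bm] per level covers both error recurrences, e + 1 for a truncation and Bm (2e +
    2) for an advance. The histories reach at most [J] words, which bounds the increment of [psi] at
    every leaf. *)
Lemma sol_trace lv : forall rs Hs U Hs' Z n e h, sol l bs P0 lv rs Hs U Hs' -> levels_pow l bs lv -> length rs = K ->
  (forall i, i < K -> exists k, approx (bval (nth i bs [])) (l * 2 ^ length lv + g) e Z n k (nth i rs nil2)) ->
  (4 * Bm) ^ length lv * (e + 1) <= E -> (forall i, i < K -> length (nth i Hs []) = h) -> h + 2 ^ length lv <= J ->
  (forall i, i < K -> exists ds, nth i Hs' [] = ds ++ nth i Hs [] /\ length ds = 2 ^ length lv /\
     trace (bval (nth i bs [])) (bval (nth i P0 [])) l Z n ds (Z * 2 ^ length U + bval U)) /\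
  2 ^ l * psi K Hs' <= 2 ^ l * psi K Hs + 2 ^ length lv * (2 * J * (K * (8 * (Bm * Bm))) + K * 2 ^ l).
Proof.
  induction lv as [|Ps lv IH]; intros rs Hs U Hs' Z n e h hs hlv lrs hr he hH hJ.
  - apply sol_nil_inv in hs. destruct hs as (lu & hmin & ->). cbn [length Nat.pow] in *. rewrite !Nat.mul_1_r, Nat.mul_1_l in *.
    assert (eE : e <= E) by lia. split.
    + intros i hi. rewrite nth_push by lia. destruct (hbs i hi) as [b2 bB].
      pose proof (maxpow_nth _ _ _ hP0 hi) as hm. pose proof (maxpow_bval _ _ _ b2 hm) as [P1 P2].
      eexists [_]. split; [reflexivity|]. split; [reflexivity|]. rewrite lu. apply traceS; [constructor|rewrite <- lu; apply bval_lt|].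
      destruct (hr i hi) as [k hk]. cbn [length]. rewrite Nat.mul_0_r, Nat.add_0_r.
      eapply wordr_block; eauto. rewrite Nat.pow_add_r. apply Nat.mul_le_mono_l.
      apply Nat.le_trans with (2 := hE). apply Nat.le_trans with (2 * E + 2); [lia|]. apply mul_ge_r. lia.
    + rewrite <- lrs at 1 2. rewrite psi_push, lrs.
      (* The minimum is at most the average over all [2 ^ l] candidates, and the density of words
         bounds the sum. *)
      assert (hc : 2 ^ l * costN P0 rs Hs U <= K * (h * (8 * (Bm * Bm)))).
      { rewrite <- words_length. eapply Nat.le_trans; [apply (min_le_sum (costN P0 rs Hs))|].
        - intros u hu. apply words_in in hu. auto.
        - rewrite <- lrs. apply sum_costN.
          + intros i d hi. destruct (hr i) as [k hk]; [lia|]. eapply leaf_density; eauto. lia.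
          + intros i hi. rewrite hH; lia. }
      assert (K * (h * (8 * (Bm * Bm))) <= J * (K * (8 * (Bm * Bm)))).
      { replace (K * (h * (8 * (Bm * Bm)))) with (h * (K * (8 * (Bm * Bm)))) by ring. apply Nat.mul_le_mono_r. lia. }
      rewrite !Nat.mul_add_distr_l. lia.
  - apply sol_cons_inv in hs. destruct hs as (rs' & U1 & H1 & U2 & -> & s1 & ha & s2).
    cbn [length levels_pow] in *. destruct hlv as [hPs hlv].
    set (L := l * 2 ^ length lv) in *.
    assert (eL : l * 2 ^ S (length lv) = 2 * L) by (unfold L; rewrite Nat.pow_succ_r'; lia).
    rewrite eL in *. rewrite !Nat.pow_succ_r' in *.
    pose proof (sol_length _ _ _ _ _ _ _ _ s1) as lU1. fold L in lU1.
    pose proof (sol_length _ _ _ _ _ _ _ _ s2) as lU2. fold L in lU2.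
    assert (hvP : forall i, i < K -> length (nth i Ps []) = L) by (intros i hi; apply (maxpow_nth _ _ _ hPs hi)).
    destruct (IH _ _ _ _ Z n (e + 1) h s1) as [t1 p1]; auto.
    { now rewrite trunc_length. }
    { intros i hi. destruct (hr i hi) as [k hk]. exists k. rewrite nth_trunc, hvP by lia.
      replace (L + g) with (2 * L + g - L) by lia. apply approx_trunc; auto. lia. }
    { eapply Nat.le_trans; [|exact he]. rewrite (Nat.mul_comm (4 * Bm)), <- Nat.mul_assoc. apply Nat.mul_le_mono_l. nia. }
    { lia. }
    assert (hH1 : forall i, i < K -> length (nth i H1 []) = h + 2 ^ length lv).
    { intros i hi. destruct (t1 i hi) as (ds & e1 & e2 & _). rewrite e1, length_app, hH by auto. lia. }
    destruct (IH _ _ _ _ (Z * 2 ^ L + bval U1) (n + L) (Bm * (2 * e + 2)) (h + 2 ^ length lv) s2) as [t2 p2]; auto.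
    { now rewrite (adv_length _ _ _ _ _ ha). }
    { intros i hi. destruct (hr i hi) as [k hk]. assert (hi' : i < length rs) by lia.
      pose proof (nth_adv _ _ _ _ _ _ hi' ha) as ha1. destruct (hbs i hi) as [b2 bB].
      pose proof (maxpow_nth _ _ _ hPs hi) as hm. pose proof hm as (_ & [D hD] & _).
      assert (Lp : L <= 2 * L + g) by lia.
      destruct (approx_adv _ _ _ _ _ _ _ _ D _ _ L b2 hk hm hD lU1 Lp ha1) as [k' hk'].
      exists k'. replace (L + g) with (2 * L + g - L) by lia. destruct hk' as (q1 & q2 & q3 & q4).
      assert (le : bval (nth i bs []) * (2 * e + 2) <= Bm * (2 * e + 2)) by now apply Nat.mul_le_mono_r.
      split; [|split; [|split]]; auto; [eapply near_weak; eauto|eapply nearm_weak; eauto]. }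
    { eapply Nat.le_trans; [|exact he]. rewrite (Nat.mul_comm (4 * Bm)), <- Nat.mul_assoc. apply Nat.mul_le_mono_l. clear -hB; nia. }
    { lia. }
    split; [|lia].
    intros i hi. destruct (t1 i hi) as (ds1 & e1 & e2 & e3), (t2 i hi) as (ds2 & f1 & f2 & f3).
    exists (ds2 ++ ds1). rewrite f1, e1, app_assoc. split; [reflexivity|]. split; [rewrite length_app; lia|].
    eapply trace_app; [exact e3|]. rewrite e2, lU1. fold L.
    replace (Z * 2 ^ length (U2 ++ U1) + bval (U2 ++ U1)) with ((Z * 2 ^ L + bval U1) * 2 ^ length U2 + bval U2); auto.
    rewrite bval_app, length_app, lU1, lU2, Nat.pow_add_r. ring.
Qed.
End SolTrace.

(** * Normality *)

Open Scope R_scope.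

Fixpoint rsum (f : nat -> R) (N : nat) : R := match N with O => 0 | S N => rsum f N + f N end.

Lemma rsum_ext f g N : (forall i, (i < N)%nat -> f i = g i) -> rsum f N = rsum g N.
Proof. induction N as [|N IH]; intros h; simpl; auto. rewrite IH, (h N); auto. Qed.

Lemma rsum_le f g N : (forall i, (i < N)%nat -> f i <= g i) -> rsum f N <= rsum g N.
Proof. induction N as [|N IH]; intros h; simpl; [lra|]. pose proof (h N (Nat.lt_succ_diag_r N)). specialize (IH (fun i hi => h i (Nat.lt_lt_succ_r _ _ hi))). lra. Qed.

Lemma rsum_add f g N : rsum (fun i => f i + g i) N = rsum f N + rsum g N.
Proof. induction N; simpl; lra. Qed.

Lemma rsum_scal c f N : rsum (fun i => c * f i) N = c * rsum f N.
Proof. induction N as [|N IH]; simpl; [ring|]. rewrite IH. ring. Qed.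

Lemma rsum_const c N : rsum (fun _ => c) N = INR N * c.
Proof. induction N as [|N IH]; [simpl; ring|]. rewrite S_INR. simpl rsum. rewrite IH. ring. Qed.

Lemma rsum_app f N M : rsum f (N + M) = rsum f N + rsum (fun i => f (N + i)%nat) M.
Proof. induction M as [|M IH]; [rewrite Nat.add_0_r; simpl; ring|]. rewrite Nat.add_succ_r. simpl. rewrite IH. ring. Qed.

Lemma rsum_mul f N M : rsum f (N * M) = rsum (fun q => rsum (fun r => f (q * M + r)%nat) M) N.
Proof. induction N as [|N IH]; auto. rewrite Nat.mul_succ_l, rsum_app, IH. reflexivity. Qed.

Lemma rsum_shift f N : rsum f (S N) = f 0%nat + rsum (fun i => f (S i)) N.
Proof. induction N as [|N IH]; [simpl; ring|]. simpl in *. rewrite IH. ring. Qed.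

Lemma rsum_rev f N : rsum f N = rsum (fun i => f (N - 1 - i)%nat) N.
Proof.
  induction N as [|N IH]; auto. rewrite (rsum_shift (fun i => f (S N - 1 - i)%nat)). simpl rsum. rewrite IH, Rplus_comm.
  f_equal; [f_equal; lia|]. apply rsum_ext. intros i hi. f_equal. lia.
Qed.

Lemma rsum_abs f c N : (forall i, (i < N)%nat -> Rabs (f i) <= c) -> Rabs (rsum f N) <= INR N * c.
Proof.
  induction N as [|N IH]; intros h; [simpl; rewrite Rabs_R0; lra|]. rewrite S_INR. simpl rsum.
  pose proof (h N (Nat.lt_succ_diag_r N)). specialize (IH (fun i hi => h i (Nat.lt_lt_succ_r _ _ hi))).
  pose proof (Rabs_triang (rsum f N) (f N)). lra.
Qed.

Lemma rsum_single c N v : (v < N)%nat -> rsum (fun i => if i =? v then c else 0) N = c.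
Proof.
  induction N as [|N IH]; intros h; [lia|]. simpl rsum. destruct (Nat.eqb_spec N v) as [->|ne].
  - rewrite (rsum_ext _ (fun _ => 0)), rsum_const; [ring|]. intros i hi. destruct (Nat.eqb_spec i v); [lia|auto].
  - rewrite IH by lia. ring.
Qed.

Lemma rsum_cyc f N c : rsum (fun i => f ((i + c) mod N)%nat) N = rsum f N.
Proof.
  destruct N as [|N]; auto. set (M := S N).
  assert (h1 : forall g, rsum (fun i => g (S i mod M)%nat) M = rsum g M).
  { intros g. unfold M at 2. cbn [rsum]. rewrite (rsum_ext _ (fun i => g (S i))).
    - fold M. rewrite Nat.Div0.mod_same.
      rewrite Rplus_comm. symmetry. apply (rsum_shift g N).
    - intros i hi. f_equal. apply Nat.mod_small. unfold M. lia. }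
  induction c as [|c IH].
  - apply rsum_ext. intros i hi. rewrite Nat.add_0_r, Nat.mod_small; auto.
  - rewrite <- IH, <- (h1 (fun i => f ((i + c) mod M)%nat)). apply rsum_ext. intros i hi. f_equal.
    rewrite Nat.Div0.add_mod_idemp_l. f_equal. lia.
Qed.

Section Word.
Context (b : nat) (hb : (2 <= b)%nat) (s v : nat).

Notation beta := (/ INR b ^ s).
(** Centred indicator that the last s digits of X spell the word of value v. [SD] sums it over all
    kap positions, so near the top the window reaches into leading zeros. *)
Definition xi (X : nat) : R := (if X mod b ^ s =? v then 1 else 0) - beta.
Definition SD (kap D : nat) : R := rsum (fun j => xi (D / b ^ j)) kap.

Lemma b_pos : 0 < INR b.
Proof. apply lt_0_INR. lia. Qed.

Lemma beta_bound : 0 <= beta <= 1.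
Proof.
  assert (1 <= INR b ^ s). { rewrite <- pow_INR. apply (le_INR 1). pose proof (Nat.pow_nonzero b s). lia. }
  split; [left; apply Rinv_0_lt_compat; lra|]. rewrite <- Rinv_1. apply Rinv_le_contravar; lra.
Qed.

Lemma xi_abs X : Rabs (xi X) <= 1.
Proof. unfold xi. pose proof beta_bound. destruct (_ =? _); apply Rabs_le; lra. Qed.

Lemma SD_abs kap D : Rabs (SD kap D) <= INR kap.
Proof. rewrite <- (Rmult_1_r (INR kap)). apply rsum_abs. intros i _. apply xi_abs. Qed.

Context (hs : (1 <= s)%nat) (hv : (v < b ^ s)%nat).

Lemma xi_sum : rsum xi (b ^ s) = 0.
Proof.
  unfold xi. unfold Rminus. rewrite rsum_add, rsum_const.
  rewrite (rsum_ext _ (fun i => if i =? v then 1 else 0)).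
  - rewrite rsum_single by auto. rewrite pow_INR. pose proof (pow_lt _ s b_pos). field. lra.
  - intros i hi. now rewrite Nat.mod_small.
Qed.

Lemma SD_shift kap D : SD (S kap) D = xi D + SD kap (D / b).
Proof.
  unfold SD. rewrite rsum_shift. rewrite Nat.pow_0_r, Nat.div_1_r. f_equal. apply rsum_ext. intros i _.
  rewrite Nat.Div0.div_div, Nat.pow_succ_r'. reflexivity.
Qed.

Lemma SD_app k1 k2 D : SD (k1 + k2) D = SD k1 D + SD k2 (D / b ^ k1).
Proof.
  unfold SD. rewrite rsum_app. f_equal. apply rsum_ext. intros i _. rewrite Nat.Div0.div_div, Nat.pow_add_r. reflexivity.
Qed.

(** With the higher digits fixed, the last s digits run through all residues, over which [xi] has
    mean zero. *)
Lemma cross_zero N G : rsum (fun D => xi D * G (D / b ^ s)%nat) (N * b ^ s) = 0.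
Proof.
  assert (p : (b ^ s <> 0)%nat) by (apply Nat.pow_nonzero; lia).
  rewrite rsum_mul. rewrite (rsum_ext _ (fun _ => 0)); [rewrite rsum_const; ring|]. intros q _.
  rewrite (rsum_ext _ (fun r => G q * xi r)); [rewrite rsum_scal, xi_sum; ring|]. intros r hr.
  replace (q * b ^ s + r)%nat with (r + q * b ^ s)%nat by lia.
  rewrite Nat.div_add, Nat.div_small by auto. unfold xi. rewrite Nat.Div0.mod_add. rewrite Nat.add_0_l. ring.
Qed.

(* Digits at distance at least [s] are uncorrelated, so only [s] cross terms survive. *)
Lemma cross_le kap : rsum (fun D => xi D * SD kap (D / b)) (b ^ S kap) <= INR (b ^ S kap) * INR s.
Proof.
  assert (bnd : forall k D, (k <= s)%nat -> xi D * SD k (D / b) <= INR s).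
  { intros k D hk. apply Rle_trans with (Rabs (xi D * SD k (D / b))); [apply Rle_abs|]. rewrite Rabs_mult.
    pose proof (xi_abs D). pose proof (SD_abs k (D / b)). apply le_INR in hk.
    pose proof (Rabs_pos (xi D)). pose proof (Rabs_pos (SD k (D / b))). nra. }
  destruct (le_lt_dec s (S kap)) as [le|lt].
  - rewrite (rsum_ext _ (fun D => xi D * SD (s - 1) (D / b) + xi D * SD (S kap - s) (D / b ^ s))).
    + rewrite rsum_add. replace (b ^ S kap)%nat with (b ^ (S kap - s) * b ^ s)%nat at 2
        by (rewrite <- Nat.pow_add_r; f_equal; lia).
      rewrite cross_zero, Rplus_0_r. rewrite <- rsum_const. apply rsum_le. intros D _. apply bnd. lia.
    + intros D _. replace kap with ((s - 1) + (S kap - s))%nat at 1 by lia. rewrite SD_app, Rmult_plus_distr_l.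
      f_equal. f_equal. f_equal. rewrite Nat.Div0.div_div. f_equal. rewrite <- Nat.pow_succ_r'. f_equal. lia.
  - rewrite <- rsum_const. apply rsum_le. intros D _. apply bnd. lia.
Qed.

(** Splitting off the last digit adds a diagonal term of mean at most 1 and twice a cross term of
    mean at most s, hence at most 2s + 1 per digit. *)
Lemma variance kap : rsum (fun D => SD kap D * SD kap D) (b ^ kap) <= INR (2 * s + 1) * INR kap * INR (b ^ kap).
Proof.
  induction kap as [|kap IH]; [simpl; unfold SD; simpl; lra|].
  rewrite (rsum_ext _ (fun D => (xi D * xi D + 2 * (xi D * SD kap (D / b))) + SD kap (D / b) * SD kap (D / b)))
    by (intros; rewrite SD_shift; ring).
  rewrite !rsum_add, rsum_scal.
  assert (h1 : rsum (fun D => xi D * xi D) (b ^ S kap) <= INR (b ^ S kap) * 1).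
  { rewrite <- rsum_const. apply rsum_le. intros D _. pose proof (xi_abs D) as h.
    assert (- 1 <= xi D <= 1) by (split; pose proof (Rle_abs (xi D)); pose proof (Rle_abs (- xi D)); rewrite Rabs_Ropp in *; lra). nra. }
  pose proof (cross_le kap) as h2.
  assert (h3 : rsum (fun D => SD kap (D / b) * SD kap (D / b)) (b ^ S kap) = INR b * rsum (fun D => SD kap D * SD kap D) (b ^ kap)).
  { rewrite Nat.pow_succ_r', Nat.mul_comm, rsum_mul, <- rsum_scal. apply rsum_ext. intros q _.
    rewrite <- rsum_const. apply rsum_ext. intros r hr. replace (q * b + r)%nat with (r + q * b)%nat by lia.
    rewrite Nat.div_add, Nat.div_small by lia. reflexivity. }
  rewrite h3. rewrite Nat.pow_succ_r', mult_INR in *. rewrite S_INR.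
  pose proof b_pos. apply (Rmult_le_compat_l (INR b)) in IH; [|lra].
  rewrite plus_INR, mult_INR in *. change (INR 1) with 1 in *. change (INR 2) with 2 in *.
  set (q := INR (b ^ kap)) in *. nra.
Qed.

End Word.

(** * Digits and deviations along a stage *)

Lemma Int_part_eq x m : INR m <= x < INR m + 1 -> Int_part x = Z.of_nat m.
Proof. intros h. symmetry. apply Int_part_spec. rewrite <- INR_IZR_INZ. lra. Qed.

Lemma digit_floor b x k kap F i : (2 <= b)%nat -> INR F <= x * INR b ^ (k + kap) < INR F + 1 -> (i < kap)%nat ->
  digit b x (k + i) = ((F / b ^ (kap - 1 - i)) mod b)%nat.
Proof.
  intros hb hF hi. unfold digit. set (e := (kap - 1 - i)%nat).
  assert (be : (b ^ e <> 0)%nat) by (apply Nat.pow_nonzero; lia).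
  rewrite (Int_part_eq _ (F / b ^ e)).
  - rewrite <- Nat2Z.inj_mod, Nat2Z.id. reflexivity.
  - replace (k + kap)%nat with (S (k + i) + e)%nat in hF by (unfold e; lia). rewrite pow_add, <- (pow_INR b e) in hF.
    set (y := x * INR b ^ S (k + i)) in *. rewrite <- Rmult_assoc in hF. fold y in hF.
    set (G := (F / b ^ e)%nat).
    assert (g1 : (b ^ e * G <= F)%nat) by apply Nat.Div0.mul_div_le.
    assert (g2 : (F + 1 <= b ^ e * (G + 1))%nat) by (rewrite !Nat.add_1_r; apply Nat.mul_succ_div_gt; lia).
    apply le_INR in g1, g2. rewrite mult_INR, !plus_INR in *. change (INR 1) with 1 in *.
    assert (p : 0 < INR (b ^ e)) by (apply lt_0_INR; lia).
    split; [apply Rmult_le_reg_l with (INR (b ^ e))|apply Rmult_lt_reg_l with (INR (b ^ e))]; lra.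
Qed.

Lemma div_pow_mod b F kap j s : (2 <= b)%nat -> (j + s <= kap)%nat ->
  ((F / b ^ j) mod b ^ s = ((F mod b ^ kap) / b ^ j) mod b ^ s)%nat.
Proof.
  intros hb h. assert (p : forall m, (b ^ m <> 0)%nat) by (intros; apply Nat.pow_nonzero; lia).
  rewrite (Nat.div_mod_eq F (b ^ kap)) at 1.
  replace kap with (kap - j - s + s + j)%nat at 1 by lia. rewrite !(Nat.pow_add_r b).
  set (A := (F mod b ^ kap)%nat). set (B := (F / b ^ kap)%nat). set (C := (b ^ (kap - j - s))%nat).
  replace (C * b ^ s * b ^ j * B + A)%nat with (A + (C * B * b ^ s) * b ^ j)%nat by ring.
  rewrite Nat.div_add, Nat.Div0.mod_add by auto. reflexivity.
Qed.

Fixpoint wv (b : nat) (w : list nat) : nat :=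
  match w with [] => 0 | a :: w => a * b ^ length w + wv b w end.

Lemma wv_lt b w : Forall (fun d => d < b)%nat w -> (wv b w < b ^ length w)%nat.
Proof.
  induction 1 as [|a w h hw IH]; [simpl; lia|]. cbn [wv length]. rewrite Nat.pow_succ_r'. nia.
Qed.

Lemma forallb_shift f m : forallb f (map S (seq 0 m)) = forallb (fun j => f (S j)) (seq 0 m).
Proof. induction (seq 0 m); simpl; auto. now rewrite IHl. Qed.

Lemma forallb_eq {A} (f g : A -> bool) l : (forall x, In x l -> f x = g x) -> forallb f l = forallb g l.
Proof.
  induction l as [|x l IH]; intros h; auto. simpl. rewrite IH by (intros; apply h; now right). f_equal. apply h. now left.
Qed.

Lemma forallb_wv b w : (2 <= b)%nat -> Forall (fun d => d < b)%nat w -> forall X,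
  forallb (fun j => (X / b ^ (length w - 1 - j)) mod b =? nth j w 0)%nat (seq 0 (length w)) =
  (X mod b ^ length w =? wv b w)%nat.
Proof.
  intros hb. induction 1 as [|a w h hw IH]; intros X; [cbn [length Nat.pow wv seq forallb]; now rewrite Nat.mod_1_r|].
  cbn [length seq forallb]. rewrite <- seq_shift, forallb_shift.
  rewrite (forallb_eq _ (fun j => (X / b ^ (length w - 1 - j)) mod b =? nth j w 0)%nat).
  2:{ intros j _. cbn [nth]. do 4 f_equal. lia. }
  rewrite IH. cbn [nth wv]. rewrite Nat.pow_succ_r', (Nat.mul_comm b), Nat.Div0.mod_mul_r.
  replace (S (length w) - 1 - 0)%nat with (length w) by lia.
  pose proof (wv_lt b w hw) as lt. set (Q := (b ^ length w)%nat) in *.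
  assert (hx : (X mod Q < Q)%nat) by (apply Nat.mod_upper_bound; lia).
  set (x := (X mod Q)%nat) in *. set (y := ((X / Q) mod b)%nat).
  destruct (Nat.eqb_spec y a) as [->|n1]; cbn [andb].
  - destruct (Nat.eqb_spec x (wv b w)) as [->|n2]; symmetry; [apply Nat.eqb_eq; lia|apply Nat.eqb_neq; lia].
  - symmetry. apply Nat.eqb_neq. intros e. apply n1.
    destruct (Nat.lt_trichotomy y a) as [c|[c|c]]; auto; exfalso; nia.
Qed.

(** The integer part of n log 2 / log b: the number of base-b digits that n bits correspond to. *)
Fixpoint kfl (b n : nat) : nat :=
  match n with O => O | S n' => if (b ^ S (kfl b n') <=? 2 ^ S n')%nat then S (kfl b n') else kfl b n' end.

Lemma kfl_spec b n : (2 <= b)%nat -> (b ^ kfl b n <= 2 ^ n < b ^ S (kfl b n))%nat.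
Proof.
  intros hb. induction n as [|n IH]; [simpl; lia|]. cbn [kfl]. destruct (Nat.leb_spec (b ^ S (kfl b n)) (2 ^ S n)).
  - split; auto. rewrite (Nat.pow_succ_r' b), (Nat.pow_succ_r' 2). apply Nat.lt_le_trans with (2 * b ^ S (kfl b n))%nat; [lia|].
    now apply Nat.mul_le_mono_r.
  - split; auto. rewrite (Nat.pow_succ_r' 2). lia.
Qed.

Lemma kfl_S b n : (kfl b n <= kfl b (S n) <= S (kfl b n))%nat.
Proof. cbn [kfl]. destruct (_ <=? _)%nat; lia. Qed.

Lemma kfl_add b n m : (kfl b n <= kfl b (n + m) <= kfl b n + m)%nat.
Proof.
  induction m as [|m IH]; [rewrite Nat.add_0_r; lia|]. rewrite Nat.add_succ_r. pose proof (kfl_S b (n + m)). lia.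
Qed.

(** Closed on the right, since an expansion ending in ones reaches the right end. *)
Definition cell (z : R) (Z n : nat) := INR Z <= z * 2 ^ n <= INR Z + 1.

Lemma pow2_INR n : INR (2 ^ n) = 2 ^ n.
Proof. now rewrite pow_INR. Qed.

Section Dev.
Context (b : nat) (hb : (2 <= b)%nat) (w : list nat) (hw : (1 <= length w)%nat) (hwb : Forall (fun d => d < b)%nat w).
Context (z : R).
Notation s := (length w).
Notation beta := (/ INR b ^ s).

Definition om (i : nat) : R := (if occurs_at b z w i then 1 else 0) - beta.
Definition Dev (N : nat) : R := INR (occ_count b z w N) - INR N * beta.

Lemma Dev_rsum N : Dev N = rsum om N.
Proof.
  unfold Dev, om, Rminus. rewrite rsum_add, rsum_const.
  assert (h : INR (occ_count b z w N) = rsum (fun i => if occurs_at b z w i then 1 else 0) N).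
  { unfold occ_count. induction N as [|N IH]; auto. rewrite seq_S, filter_app, length_app, plus_INR, IH.
    simpl rsum. f_equal. cbn [Nat.add filter]. destruct (occurs_at b z w N); reflexivity. }
  rewrite h. ring.
Qed.

Lemma om_abs i : Rabs (om i) <= 1.
Proof. unfold om. pose proof (beta_bound b hb s). destruct (occurs_at b z w i); apply Rabs_le; lra. Qed.

Lemma Dev_lip N M : Rabs (Dev (N + M) - Dev N) <= INR M.
Proof.
  rewrite !Dev_rsum, rsum_app. replace (rsum om N + rsum (fun i => om (N + i)%nat) M - rsum om N)
    with (rsum (fun i => om (N + i)%nat) M) by ring. rewrite <- (Rmult_1_r (INR M)). apply rsum_abs.
  intros i _. apply om_abs.
Qed.

Lemma Dev_near N M c : (N <= M + c)%nat -> (M <= N + c)%nat -> Rabs (Dev N - Dev M) <= INR c.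
Proof.
  intros h1 h2. destruct (le_lt_dec N M) as [le|lt].
  - replace M with (N + (M - N))%nat by lia. rewrite Rabs_minus_sym. eapply Rle_trans; [apply Dev_lip|].
    apply le_INR. lia.
  - replace N with (M + (N - M))%nat by lia. eapply Rle_trans; [apply Dev_lip|]. apply le_INR. lia.
Qed.

Lemma occurs_floor k kap F i : INR F <= z * INR b ^ (k + kap) < INR F + 1 -> (i + s <= kap)%nat ->
  occurs_at b z w (k + i) = ((F mod b ^ kap / b ^ (kap - s - i)) mod b ^ s =? wv b w)%nat.
Proof.
  intros hF hi. rewrite <- div_pow_mod by lia. rewrite <- forallb_wv by auto. unfold occurs_at.
  apply forallb_eq. intros j hj. apply in_seq in hj. f_equal. rewrite <- Nat.add_assoc.
  rewrite (digit_floor b z k kap F (i + j)) by (auto; lia).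
  rewrite Nat.Div0.div_div, <- Nat.pow_add_r. do 3 f_equal. lia.
Qed.

(** Windows inside the block are read off F mod b^kap, in reverse order since [SD] counts positions
    from the last digit. The s - 1 windows that leave the block, and the s - 1 positions of [SD]
    that reach into leading zeros, cost at most s each. *)
Lemma Dev_block k kap F : INR F <= z * INR b ^ (k + kap) < INR F + 1 ->
  Rabs (Dev (k + kap) - Dev k) <= Rabs (SD b s (wv b w) kap (F mod b ^ kap)) + 2 * INR s.
Proof.
  intros hF. set (D := (F mod b ^ kap)%nat).
  destruct (le_lt_dec s kap) as [le|lt].
  2:{ pose proof (Dev_lip k kap). pose proof (Rabs_pos (SD b s (wv b w) kap D)). apply lt_INR in lt.
      pose proof (pos_INR s). lra. }
  rewrite !Dev_rsum, rsum_app. replace (rsum om k + rsum (fun i => om (k + i)%nat) kap - rsum om k)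
    with (rsum (fun i => om (k + i)%nat) kap) by ring.
  set (N := S (kap - s)). set (M := (s - 1)%nat). assert (e : kap = (N + M)%nat) by (unfold N, M; lia).
  unfold SD. rewrite e at 1 2. rewrite !rsum_app.
  set (a := rsum (fun i => om (k + (N + i))%nat) M). set (c := rsum (fun i => xi b s (wv b w) (D / b ^ (N + i))) M).
  assert (ha : Rabs a <= INR s).
  { apply Rle_trans with (INR M * 1); [apply rsum_abs; intros; apply om_abs|]. rewrite Rmult_1_r. apply le_INR. unfold M; lia. }
  assert (hc : Rabs c <= INR s).
  { apply Rle_trans with (INR M * 1); [apply rsum_abs; intros; apply xi_abs; auto|]. rewrite Rmult_1_r. apply le_INR. unfold M; lia. }
  rewrite (rsum_rev (fun j => xi b s (wv b w) (D / b ^ j)) N).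
  rewrite (rsum_ext (fun i => om (k + i)%nat) (fun i => xi b s (wv b w) (D / b ^ (N - 1 - i)))).
  - set (x := rsum _ N). pose proof (Rabs_triang x a). pose proof (Rabs_triang (x + c) (- c)) as h. rewrite Rabs_Ropp in h.
    replace (x + c + - c) with x in h by ring. lra.
  - intros i hi. unfold om, xi. rewrite (occurs_floor k kap F i hF) by (unfold N in hi; lia).
    fold D. replace (N - 1 - i)%nat with (kap - s - i)%nat by (unfold N; lia). reflexivity.
Qed.

(** The true word is only known to be one of d, d + 1, d + 2 modulo Q, so all three deviations are
    charged. *)
Definition Mw (kap d : nat) : R := let Q := (b ^ kap)%nat in
  Rabs (SD b s (wv b w) kap (d mod Q)) + Rabs (SD b s (wv b w) kap ((d + 1) mod Q)) + Rabs (SD b s (wv b w) kap ((d + 2) mod Q)).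

(** The position k of the block agrees with [kfl b n] up to 1, and its end with [kfl b (n + l)] up
    to 3. As [Dev] is 1-Lipschitz, the shifts cost less than 5. *)
Lemma block_Dev kap l Z n u d : block_ok b (b ^ kap) l Z n u d -> cell z (Z * 2 ^ l + u) (n + l) ->
  (b ^ kap < 2 ^ l)%nat -> (2 ^ l <= b ^ S kap)%nat ->
  Rabs (Dev (kfl b (n + l)) - Dev (kfl b n)) <= Mw kap d + 2 * INR s + 5.
Proof.
  intros (k & q & h1 & h2 & h3 & h4 & h5) hz g1 g2. set (Q := (b ^ kap)%nat) in *.
  set (x := z * INR b ^ (k + kap)).
  assert (hx : INR (q * Q + d) <= x < INR (q * Q + d + 3)).
  { apply le_INR in h4. apply lt_INR in h5. rewrite !(mult_INR _ (2 ^ _)), !(mult_INR (b ^ k * Q)), pow2_INR in *.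
    rewrite (plus_INR _ 1) in h5. change (INR 1) with 1 in h5.
    replace (INR (b ^ k * Q)) with (INR b ^ (k + kap)) in *
      by (unfold Q; rewrite <- Nat.pow_add_r, pow_INR; reflexivity).
    destruct hz as [z1 z2]. pose proof (pow_lt 2 (n + l) ltac:(lra)) as p2. pose proof (pow_lt _ (k + kap) (b_pos b hb)) as pb.
    set (B := INR b ^ (k + kap)) in *. set (N := 2 ^ (n + l)) in *. set (Z' := INR (Z * 2 ^ l + u)) in *.
    apply (Rmult_le_compat_l B) in z1, z2; [|lra..].
    split; [apply Rmult_le_reg_r with N|apply Rmult_lt_reg_r with N]; auto; unfold x; lra. }
  assert (hF : exists F, INR F <= x < INR F + 1 /\ (q * Q + d <= F <= q * Q + d + 2)%nat).
  { set (F0 := (q * Q + d)%nat) in *. rewrite plus_INR in hx. change (INR 3) with (1 + 1 + 1) in hx.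
    destruct (Rlt_le_dec x (INR F0 + 1)); [exists F0; split; [lra|lia]|].
    destruct (Rlt_le_dec x (INR F0 + 2)); [exists (F0 + 1)%nat; rewrite plus_INR; change (INR 1) with 1; split; [lra|lia]|].
    exists (F0 + 2)%nat. rewrite plus_INR. change (INR 2) with 2. split; [lra|lia]. }
  destruct hF as (F & hF1 & hF2). pose proof (Dev_block k kap F hF1) as hD.
  assert (hM : Rabs (SD b s (wv b w) kap (F mod b ^ kap)) <= Mw kap d).
  { unfold Mw. fold Q.
    assert (hc : exists c, (c <= 2)%nat /\ (F mod Q = (d + c) mod Q)%nat).
    { exists (F - (q * Q + d))%nat. split; [lia|]. replace F with (d + (F - (q * Q + d)) + q * Q)%nat at 1 by lia.
      apply Nat.Div0.mod_add. }
    destruct hc as (c & c2 & ->).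
    pose proof (Rabs_pos (SD b s (wv b w) kap (d mod Q))). pose proof (Rabs_pos (SD b s (wv b w) kap ((d + 1) mod Q))).
    pose proof (Rabs_pos (SD b s (wv b w) kap ((d + 2) mod Q))).
    destruct c as [|[|[|c]]]; [rewrite Nat.add_0_r| | |lia]; lra. }
  pose proof (kfl_spec b n hb) as [k1 k2]. pose proof (kfl_spec b (n + l) hb) as [k3 k4].
  assert (lt_pow : forall x y, (b ^ x < b ^ y -> x < y)%nat) by (intros ? ?; apply Nat.pow_lt_mono_r_iff; lia).
  assert (le_pow : forall x y, (b ^ x <= b ^ y -> x <= y)%nat) by (intros ? ?; apply Nat.pow_le_mono_r_iff; lia).
  assert (a1 : (kfl b n <= k + 1)%nat) by (apply le_pow; lia).
  assert (a2 : (k <= kfl b n + 1)%nat).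
  { assert (k < S (S (kfl b n)))%nat; [|lia]. apply lt_pow. rewrite Nat.pow_succ_r'.
    rewrite Nat.add_1_r, Nat.pow_succ_r' in h2. nia. }
  assert (a3 : (kfl b n + kap <= kfl b (n + l))%nat).
  { apply Nat.lt_succ_r, lt_pow. rewrite !(Nat.pow_add_r) in *. fold Q. nia. }
  assert (a4 : (kfl b (n + l) <= kfl b n + kap + 1)%nat).
  { apply Nat.lt_succ_r. replace (S (kfl b n + kap + 1)) with (S (kfl b n) + S kap)%nat by lia. apply lt_pow.
    rewrite !(Nat.pow_add_r) in *. nia. }
  pose proof (Dev_near (kfl b n) k 1 ltac:(lia) ltac:(lia)) as d1.
  pose proof (Dev_near (kfl b (n + l)) (k + kap) 3 ltac:(lia) ltac:(lia)) as d2.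
  change (INR 1) with 1 in d1. change (INR 3) with (1 + 1 + 1) in d2.
  set (A := Dev (kfl b (n + l))) in *. set (B := Dev (k + kap)) in *. set (C := Dev k) in *. set (E := Dev (kfl b n)) in *.
  replace (A - E) with ((A - B) + ((B - C) + - (E - C))) by ring.
  pose proof (Rabs_triang (A - B) ((B - C) + - (E - C))). pose proof (Rabs_triang (B - C) (- (E - C))).
  rewrite (Rabs_Ropp (E - C)) in *. lra.
Qed.

Definition Msum (kap : nat) (ds : list nat) : R := fold_right (fun d a => Mw kap d + a) 0 ds.

Lemma Mw_pos kap d : 0 <= Mw kap d.
Proof.
  unfold Mw. pose proof (Rabs_pos (SD b s (wv b w) kap (d mod b ^ kap))).
  pose proof (Rabs_pos (SD b s (wv b w) kap ((d + 1) mod b ^ kap))).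
  pose proof (Rabs_pos (SD b s (wv b w) kap ((d + 2) mod b ^ kap))). lra.
Qed.

Lemma cell_up Z l u n : (u < 2 ^ l)%nat -> cell z (Z * 2 ^ l + u) (n + l) -> cell z Z n.
Proof.
  intros hu [h1 h2]. rewrite plus_INR, mult_INR, pow2_INR, pow_add in *. pose proof (pow_lt 2 l ltac:(lra)) as p.
  assert (u1 : INR u + 1 <= 2 ^ l). { rewrite <- pow2_INR, <- S_INR. apply le_INR. lia. }
  pose proof (pos_INR u). split; apply Rmult_le_reg_r with (2 ^ l); auto; nra.
Qed.

(* All prefixes of the stage are covered, because [cell_up] recovers the intermediate cells. *)
Lemma trace_Dev kap l Z n ds Z' : trace b (b ^ kap) l Z n ds Z' -> cell z Z' (n + l * length ds) ->
  (b ^ kap < 2 ^ l)%nat -> (2 ^ l <= b ^ S kap)%nat -> forall j, (j <= length ds)%nat ->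
  Rabs (Dev (kfl b (n + l * j)) - Dev (kfl b n)) <= Msum kap ds + INR (length ds) * (2 * INR s + 5).
Proof.
  intros ht. induction ht as [Z n|Z n ds Z1 u d ht IH hu hbk]; intros hz g1 g2 j hj.
  - simpl in hj. replace j with 0%nat by lia. rewrite Nat.mul_0_r, Nat.add_0_r, Rminus_diag, Rabs_R0. simpl. lra.
  - cbn [length] in *. replace (n + l * S (length ds))%nat with (n + l * length ds + l)%nat in hz by lia.
    pose proof (block_Dev _ _ _ _ _ _ hbk hz g1 g2) as hB. apply cell_up in hz; auto.
    specialize (IH hz g1 g2). rewrite S_INR. cbn [Msum fold_right]. fold (Msum kap ds).
    pose proof (Mw_pos kap d). pose proof (pos_INR s).
    destruct (le_lt_dec j (length ds)) as [le|lt].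
    + specialize (IH j le). lra.
    + replace j with (S (length ds)) by lia. specialize (IH (length ds) (le_n _)).
      replace (n + l * S (length ds))%nat with (n + l * length ds + l)%nat by lia.
      set (A := Dev (kfl b (n + l * length ds + l))) in *. set (B := Dev (kfl b (n + l * length ds))) in *.
      replace (A - Dev (kfl b n)) with ((A - B) + (B - Dev (kfl b n))) by ring.
      pose proof (Rabs_triang (A - B) (B - Dev (kfl b n))). lra.
Qed.
End Dev.

(** * From the potential to the deviation in a stage *)

Lemma cnt_cons d ds D : INR (cnt (d :: ds) D) = INR (cnt ds D) + (if D =? d then 1 else 0).
Proof.
  cbn [count_occ]. destruct (Nat.eq_dec d D), (Nat.eqb_spec D d); try congruence; [rewrite S_INR; ring|ring].
Qed.

Lemma rsum_pick f N d : (d < N)%nat -> rsum (fun D => (if D =? d then 1 else 0) * f D) N = f d.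
Proof.
  intros h. rewrite <- (rsum_single (f d) N d h). apply rsum_ext. intros D _. destruct (Nat.eqb_spec D d) as [->|]; ring.
Qed.

Lemma phi_rsum Q ds : Forall (fun d => d < Q)%nat ds ->
  INR (phi ds) = rsum (fun D => INR (cnt ds D) * INR (cnt ds D)) Q.
Proof.
  induction 1 as [|d ds h hds IH].
  - rewrite (rsum_ext _ (fun _ => 0)), rsum_const; [simpl; ring|intros; simpl; ring].
  - rewrite (rsum_ext _ (fun D => INR (cnt ds D) * INR (cnt ds D) + (if D =? d then 1 else 0) * (2 * INR (cnt ds D) + 1))).
    + rewrite rsum_add, (rsum_pick (fun D => 2 * INR (cnt ds D) + 1)) by auto.
      cbn [phi]. rewrite !plus_INR, mult_INR, IH. simpl (INR 1). simpl (INR 2). ring.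
    + intros D _. rewrite cnt_cons. destruct (D =? d); ring.
Qed.

Section Bound.
Context (b : nat) (hb : (2 <= b)%nat) (w : list nat) (hw : (1 <= length w)%nat) (hwb : Forall (fun d => d < b)%nat w).
Context (z : R).
Notation s := (length w).

Lemma Msum_rsum kap ds : Forall (fun d => d < b ^ kap)%nat ds ->
  Msum b w kap ds = rsum (fun D => INR (cnt ds D) * Mw b w kap D) (b ^ kap).
Proof.
  induction 1 as [|d ds h hds IH].
  - rewrite (rsum_ext _ (fun _ => 0)), rsum_const; [simpl; ring|intros; simpl; ring].
  - rewrite (rsum_ext _ (fun D => INR (cnt ds D) * Mw b w kap D + (if D =? d then 1 else 0) * Mw b w kap D))
      by (intros; rewrite cnt_cons; ring).
    rewrite rsum_add, rsum_pick by auto. cbn [Msum fold_right]. fold (Msum b w kap ds). rewrite IH. ring.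
Qed.

(** A cyclic shift permutes the words, so the three terms of [Mw] have the same sum of squares. The
    9 is a factor 3 from squaring a sum of three, times the three terms. *)
Lemma Mw_square kap : rsum (fun D => Mw b w kap D * Mw b w kap D) (b ^ kap) <=
  9 * (INR (2 * s + 1) * INR kap * INR (b ^ kap)).
Proof.
  pose proof (variance b hb s (wv b w) hw (wv_lt b w hwb) kap) as hv.
  set (f := fun D => SD b s (wv b w) kap D * SD b s (wv b w) kap D) in *. set (Q := (b ^ kap)%nat) in *.
  apply Rle_trans with (rsum (fun D => 3 * f ((D + 0) mod Q)%nat + (3 * f ((D + 1) mod Q)%nat + 3 * f ((D + 2) mod Q)%nat)) Q).
  - apply rsum_le. intros D _. unfold Mw. fold Q. unfold f. rewrite Nat.add_0_r.
    set (x := SD b s (wv b w) kap (D mod Q)). set (y := SD b s (wv b w) kap ((D + 1) mod Q)).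
    set (t := SD b s (wv b w) kap ((D + 2) mod Q)).
    replace (x * x) with (Rabs x * Rabs x) by (rewrite <- Rabs_mult; apply Rabs_right; nra).
    replace (y * y) with (Rabs y * Rabs y) by (rewrite <- Rabs_mult; apply Rabs_right; nra).
    replace (t * t) with (Rabs t * Rabs t) by (rewrite <- Rabs_mult; apply Rabs_right; nra).
    pose proof (Rle_0_sqr (Rabs x - Rabs y)). pose proof (Rle_0_sqr (Rabs x - Rabs t)). pose proof (Rle_0_sqr (Rabs y - Rabs t)).
    unfold Rsqr in *. lra.
  - rewrite !rsum_add, !rsum_scal, !rsum_cyc. lra.
Qed.

(** Cauchy-Schwarz in the form xy <= th x^2 / 2 + y^2 / (2 th), with [th] left free; this avoids
    square roots. *)
Lemma Msum_le kap ds th : 0 < th -> Forall (fun d => d < b ^ kap)%nat ds ->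
  Msum b w kap ds <= th / 2 * INR (phi ds) + / (2 * th) * (9 * (INR (2 * s + 1) * INR kap * INR (b ^ kap))).
Proof.
  intros ht hd. rewrite (Msum_rsum kap ds hd), (phi_rsum (b ^ kap) ds hd).
  apply Rle_trans with (rsum (fun D => th / 2 * (INR (cnt ds D) * INR (cnt ds D)) + / (2 * th) * (Mw b w kap D * Mw b w kap D)) (b ^ kap)).
  - apply rsum_le. intros D _. set (x := INR (cnt ds D)). set (y := Mw b w kap D).
    apply Rmult_le_reg_l with (2 * th); [lra|].
    replace (2 * th * (th / 2 * (x * x) + / (2 * th) * (y * y))) with (th * th * (x * x) + y * y) by (field; lra).
    pose proof (Rle_0_sqr (th * x - y)). unfold Rsqr in *. lra.
  - rewrite rsum_add, !rsum_scal. apply Rplus_le_compat_l, Rmult_le_compat_l.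
    + left. apply Rinv_0_lt_compat. lra.
    + apply Mw_square.
Qed.

Lemma trace_lt Q l Z n ds Z' : trace b Q l Z n ds Z' -> Forall (fun d => d < Q)%nat ds.
Proof. induction 1 as [|Z n ds Z1 u d ht IH hu (k & q & h)]; constructor; tauto. Qed.

Lemma Msum_stage kap l ds eps c K : 0 < eps -> Forall (fun d => d < b ^ kap)%nat ds -> (1 <= length ds)%nat ->
  (b ^ kap <= 2 ^ l)%nat ->
  (2 ^ l * phi ds <= length ds * (2 * length ds * c + K * 2 ^ l))%nat -> 54 * INR s * INR c <= eps * eps * INR kap ->
  Msum b w kap ds <= eps * INR kap * INR (length ds) + 14 * INR s / eps * INR (K * 2 ^ l).
Proof.
  intros he hd hJ hQ hphi hc. set (J := length ds) in *.
  assert (J1 : 1 <= INR J) by (apply (le_INR 1); auto).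
  assert (s1 : 1 <= INR s) by (apply (le_INR 1); auto).
  pose proof (INR_pow2 l) as p2. set (P := INR (2 ^ l)) in *.
  (* With th = 2^l mu / J the variance contributes at most eps / 2 times kap J. Here 27 is the 9 of
     [Mw_square] times the 3 in 2s + 1 <= 3s; the potential then fits into the other half by the
     hypothesis on [c]. *)
  set (mu := 27 * INR s / eps). assert (mu0 : 0 < mu) by (apply Rdiv_lt_0_compat; lra).
  assert (th0 : 0 < P * mu / INR J) by (apply Rdiv_lt_0_compat; nra).
  apply Rle_trans with (1 := Msum_le kap ds _ th0 hd).
  assert (A : P * mu / INR J / 2 * INR (phi ds) <= mu * INR c * INR J + mu / 2 * INR (K * 2 ^ l)).
  { apply le_INR in hphi. rewrite !mult_INR, plus_INR, !mult_INR in hphi. fold P in hphi. change (INR 2) with 2 in hphi.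
    rewrite mult_INR. fold P.
    replace (P * mu / INR J / 2 * INR (phi ds)) with (mu / (2 * INR J) * (P * INR (phi ds))) by (field; lra).
    replace (mu * INR c * INR J + mu / 2 * (INR K * P)) with
      (mu / (2 * INR J) * (INR J * (2 * INR J * INR c + INR K * P))) by (field; lra).
    apply Rmult_le_compat_l; auto. left. apply Rdiv_lt_0_compat; lra. }
  assert (B : / (2 * (P * mu / INR J)) * (9 * (INR (2 * s + 1) * INR kap * INR (b ^ kap))) <= eps / 2 * INR kap * INR J).
  { assert (q1 : INR (b ^ kap) <= P) by now apply le_INR. pose proof (pos_INR kap). pose proof (pos_INR (b ^ kap)).
    assert (s3 : INR (2 * s + 1) <= 3 * INR s) by (rewrite plus_INR, mult_INR; simpl (INR 2); simpl (INR 1); lra).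
    assert (q2 : INR (2 * s + 1) * INR kap * INR (b ^ kap) <= 3 * INR s * INR kap * P).
    { apply Rmult_le_compat; auto; [apply Rmult_le_pos; apply pos_INR|]. apply Rmult_le_compat_r; auto. }
    apply Rle_trans with (/ (2 * (P * mu / INR J)) * (9 * (3 * INR s * INR kap * P))).
    - apply Rmult_le_compat_l; [left; apply Rinv_0_lt_compat; lra|lra].
    - right. unfold mu. field. lra. }
  assert (C : mu * INR c * INR J <= eps / 2 * INR kap * INR J).
  { apply Rmult_le_compat_r; [lra|]. unfold mu. apply Rmult_le_reg_l with (2 * eps); [lra|].
    replace (2 * eps * (27 * INR s / eps * INR c)) with (54 * INR s * INR c) by (field; lra).
    replace (2 * eps * (eps / 2 * INR kap)) with (eps * eps * INR kap) by field. exact hc. }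
  assert (D : mu / 2 * INR (K * 2 ^ l) <= 14 * INR s / eps * INR (K * 2 ^ l)).
  { apply Rmult_le_compat_r; [apply pos_INR|]. unfold mu. apply Rmult_le_reg_l with eps; [lra|].
    replace (eps * (27 * INR s / eps / 2)) with (27 / 2 * INR s) by (field; lra).
    replace (eps * (14 * INR s / eps)) with (14 * INR s) by (field; lra). lra. }
  lra.
Qed.
End Bound.

Lemma arch (x : R) : exists n, x <= INR n.
Proof. destruct (INR_unbounded x) as [n h]. exists n. lra. Qed.

(** The last clause compares the sum of squares with J^2 / 2^l, its order for random words; the term
    with [K] is the unavoidable diagonal, one per base and block. *)
Definition stage_ok (b l c K n Z Z' : nat) : Prop := exists kap ds,
  trace b (b ^ kap) l Z n ds Z' /\ (1 <= length ds)%nat /\ (l * length ds = n)%nat /\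
  (b ^ kap < 2 ^ l)%nat /\ (2 ^ l <= b ^ S kap)%nat /\
  (2 ^ l * phi ds <= length ds * (2 * length ds * c + K * 2 ^ l))%nat.

(** One eps n each for the main part of the potential, its diagonal part, the block boundaries, and
    the incomplete last block. Since 2^l <= b^(kap+1) gives l <= 2 b kap, the conditions on l become
    conditions on kap. *)
Lemma stage_Dev b w z eps l c K n Z Z' : (2 <= b)%nat -> (1 <= length w)%nat -> Forall (fun d => d < b)%nat w -> 0 < eps ->
  stage_ok b l c K n Z Z' -> cell z Z' (n + n) -> (1 <= c)%nat -> (1 <= K)%nat ->
  54 * INR (length w) * INR c * INR b * 2 <= eps * eps * INR l -> (2 * INR (length w) + 5) * INR b * 2 <= eps * INR l ->
  INR b * 2 <= INR l ->
  14 * INR (length w) * INR (K * 2 ^ l) <= eps * eps * INR n -> INR (K * 2 ^ l) <= eps * INR n ->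
  forall nu, (n <= nu <= n + n)%nat -> Rabs (Dev b w z (kfl b nu) - Dev b w z (kfl b n)) <= 4 * eps * INR n.
Proof.
  intros hb hw hwb he (kap & ds & ht & hJ & hn & q1 & q2 & hphi) hz hc hK g1 g2 g3 g4 g5 nu hnu.
  assert (b1 : 2 <= INR b) by (apply (le_INR 2); auto).
  assert (s1 : 1 <= INR (length w)) by (apply (le_INR 1); auto).
  assert (c1 : 1 <= INR c) by (apply (le_INR 1); auto).
  assert (kl : (kap <= l)%nat).
  { apply Nat.lt_le_incl. apply (Nat.pow_lt_mono_r_iff 2); [lia|]. apply Nat.le_lt_trans with (b ^ kap)%nat; auto.
    apply Nat.pow_le_mono_l; auto. }
  assert (lk : INR l <= INR b * INR kap * 2).
  { assert (h : (l <= b * S kap)%nat).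
    { apply (Nat.pow_le_mono_r_iff 2); [lia|]. apply Nat.le_trans with (1 := q2). rewrite Nat.pow_mul_r.
      apply Nat.pow_le_mono_l. apply Nat.lt_le_incl, Nat.pow_gt_lin_r. lia. }
    apply le_INR in h. rewrite mult_INR, S_INR in h. nra. }
  set (s := INR (length w)) in *.
  assert (k1 : 54 * s * INR c <= eps * eps * INR kap).
  { apply Rmult_le_reg_r with (INR b * 2); [lra|]. apply Rle_trans with (eps * eps * INR l); [lra|].
    replace (eps * eps * INR kap * (INR b * 2)) with (eps * eps * (INR b * INR kap * 2)) by ring.
    apply Rmult_le_compat_l; nra. }
  assert (k2 : 2 * s + 5 <= eps * INR kap).
  { apply Rmult_le_reg_r with (INR b * 2); [lra|]. apply Rle_trans with (eps * INR l); [lra|].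
    replace (eps * INR kap * (INR b * 2)) with (eps * (INR b * INR kap * 2)) by ring.
    apply Rmult_le_compat_l; lra. }
  pose proof (Msum_stage b hb w hw hwb kap l ds eps c K he (trace_lt _ _ _ _ _ _ _ ht) hJ (Nat.lt_le_incl _ _ q1) hphi k1) as hM.
  fold s in hM.
  assert (kJ : INR kap * INR (length ds) <= INR n).
  { rewrite <- mult_INR. apply le_INR. rewrite <- hn. now apply Nat.mul_le_mono_r. }
  assert (l1 : (1 <= l)%nat) by (destruct l; [simpl in q1; pose proof (Nat.pow_nonzero b kap); lia|lia]).
  set (j := ((nu - n) / l)%nat).
  assert (j1 : (l * j <= nu - n)%nat) by apply Nat.Div0.mul_div_le.
  assert (j2 : (nu - n < l * S j)%nat) by (apply Nat.mul_succ_div_gt; lia).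
  assert (hj : (j <= length ds)%nat) by nia.
  assert (hz' : cell z Z' (n + l * length ds)) by now rewrite hn.
  pose proof (trace_Dev b hb w hw hwb z kap l Z n ds Z' ht hz' q1 q2 j hj) as hD. fold s in hD.
  assert (hN : Rabs (Dev b w z (kfl b nu) - Dev b w z (kfl b (n + l * j))) <= eps * INR n).
  { apply Rle_trans with (2 := g5). apply Rle_trans with (INR l).
    - replace nu with (n + l * j + (nu - (n + l * j)))%nat by lia.
      pose proof (kfl_add b (n + l * j) (nu - (n + l * j))). apply Dev_near; auto; lia.
    - apply le_INR. pose proof (Nat.pow_gt_lin_r 2 l ltac:(lia)). nia. }
  assert (h14 : 14 * s / eps * INR (K * 2 ^ l) <= eps * INR n).
  { apply Rmult_le_reg_l with eps; auto. replace (eps * (14 * s / eps * INR (K * 2 ^ l))) with (14 * s * INR (K * 2 ^ l)) by (field; lra). lra. }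
  assert (hJ2 : INR (length ds) * (2 * s + 5) <= eps * INR n).
  { pose proof (pos_INR (length ds)). apply Rle_trans with (INR (length ds) * (eps * INR kap)); [now apply Rmult_le_compat_l|].
    replace (INR (length ds) * (eps * INR kap)) with (eps * (INR kap * INR (length ds))) by ring. apply Rmult_le_compat_l; lra. }
  assert (hk : eps * INR kap * INR (length ds) <= eps * INR n) by (rewrite Rmult_assoc; apply Rmult_le_compat_l; lra).
  set (A := Dev b w z (kfl b nu)) in *. set (B := Dev b w z (kfl b (n + l * j))) in *. set (C := Dev b w z (kfl b n)) in *.
  replace (A - C) with ((A - B) + (B - C)) by ring. pose proof (Rabs_triang (A - B) (B - C)). lra.
Qed.

(** * From stages to normality *)

Section Normal.
Context (z : R) (lf cf Kf Zf : nat -> nat).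
Notation nf t := (2 ^ (4 + t))%nat.
Context (hcell : forall t, cell z (Zf t) (nf t)) (hc : forall t, (1 <= cf t)%nat) (hK : forall t, (1 <= Kf t)%nat).
Context (hst : forall b, (2 <= b)%nat -> exists t0, forall t, (t0 <= t)%nat ->
  stage_ok b (lf t) (cf t) (Kf t) (nf t) (Zf t) (Zf (S t))).
Context (hl : forall A, exists t0, forall t, (t0 <= t)%nat -> (A * cf t <= lf t)%nat).
Context (hn : forall A, exists t0, forall t, (t0 <= t)%nat -> (A * (Kf t * 2 ^ lf t) <= nf t)%nat).

Lemma nf_S t : (nf (S t) = nf t + nf t)%nat.
Proof. rewrite Nat.add_succ_r, Nat.pow_succ_r'. lia. Qed.

(** Lengths double, so the errors 4 eps n of the completed stages add up to at most 4 eps times the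
    length reached, and the stage in progress adds no more than that. [C] absorbs the stages before
    the hypotheses take effect. *)
Lemma Dev_small b w eps : (2 <= b)%nat -> (1 <= length w)%nat -> Forall (fun d => d < b)%nat w -> 0 < eps ->
  exists n0 C, forall nu, (n0 <= nu)%nat -> Rabs (Dev b w z (kfl b nu)) <= C + 8 * eps * INR nu.
Proof.
  intros hb hw hwb he. set (s := INR (length w)).
  assert (b1 : 2 <= INR b) by (apply (le_INR 2); auto). assert (s1 : 1 <= s) by (apply (le_INR 1); auto).
  assert (e0 : 0 < / eps) by now apply Rinv_0_lt_compat.
  destruct (arch (54 * s * INR b * 2 * (/ eps * / eps) + (2 * s + 5) * INR b * 2 * / eps + INR b * 2)) as [A hA].
  destruct (arch (14 * s * (/ eps * / eps) + / eps)) as [A' hA'].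
  assert (p1 : 0 < 54 * s * INR b * 2) by nra. assert (p2 : 0 < (2 * s + 5) * INR b * 2) by nra.
  assert (p3 : 0 < / eps * / eps) by now apply Rmult_lt_0_compat.
  assert (p4 := Rmult_lt_0_compat _ _ p1 p3). assert (p5 := Rmult_lt_0_compat _ _ p2 e0).
  assert (p6 : 0 < 14 * s * (/ eps * / eps)) by nra.
  destruct (hst b hb) as [t1 h1], (hl A) as [t2 h2], (hn A') as [t3 h3]. set (t0 := (t1 + t2 + t3)%nat).
  assert (step : forall t, (t0 <= t)%nat -> forall nu, (nf t <= nu <= nf (S t))%nat ->
    Rabs (Dev b w z (kfl b nu) - Dev b w z (kfl b (nf t))) <= 4 * eps * INR (nf t)).
  { intros t ht nu hnu. rewrite nf_S in hnu.
    assert (e1 : / eps * eps = 1) by (field; lra).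
    assert (lA : INR A <= INR (lf t) /\ INR A * INR (cf t) <= INR (lf t)).
    { pose proof (h2 t ltac:(unfold t0 in *; lia)) as h. pose proof (hc t). split; [apply le_INR; nia|].
      rewrite <- mult_INR. now apply le_INR. }
    assert (nA : INR A' * INR (Kf t * 2 ^ lf t) <= INR (nf t)).
    { rewrite <- mult_INR. apply le_INR. apply h3. unfold t0 in *; lia. }
    destruct lA as [lA1 lA2]. set (l := INR (lf t)) in *. set (c := INR (cf t)) in *. set (x := INR (Kf t * 2 ^ lf t)) in *.
    set (n := INR (nf t)) in *. assert (c0 : 0 <= c) by apply pos_INR. assert (x0 : 0 <= x) by apply pos_INR.
    eapply stage_Dev with (l := lf t) (c := cf t) (K := Kf t) (Z := Zf t) (Z' := Zf (S t)); auto;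
      fold s l c x n; [apply h1; unfold t0 in *; lia|rewrite <- nf_S; auto|..].
    - apply Rle_trans with (eps * eps * (INR A * c)); [|apply Rmult_le_compat_l; nra].
      apply Rle_trans with (eps * eps * (54 * s * INR b * 2 * (/ eps * / eps) * c)).
      + right. field. lra.
      + apply Rmult_le_compat_l; [nra|]. apply Rmult_le_compat_r; lra.
    - apply Rle_trans with (eps * INR A); [|apply Rmult_le_compat_l; lra].
      apply Rle_trans with (eps * ((2 * s + 5) * INR b * 2 * / eps)); [right; field; lra|].
      apply Rmult_le_compat_l; lra.
    - lra.
    - apply Rle_trans with (eps * eps * (INR A' * x)); [|apply Rmult_le_compat_l; nra].
      apply Rle_trans with (eps * eps * (14 * s * (/ eps * / eps) * x)); [right; field; lra|].
      apply Rmult_le_compat_l; [nra|]. apply Rmult_le_compat_r; lra.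
    - apply Rle_trans with (eps * (INR A' * x)); [|apply Rmult_le_compat_l; lra].
      apply Rle_trans with (eps * (/ eps * x)); [right; field; lra|].
      apply Rmult_le_compat_l; [lra|]. apply Rmult_le_compat_r; lra. }
  set (C := Rabs (Dev b w z (kfl b (nf t0)))).
  assert (ind : forall k, Rabs (Dev b w z (kfl b (nf (t0 + k)))) <= C + 4 * eps * INR (nf (t0 + k))).
  { induction k as [|k IH].
    - rewrite Nat.add_0_r. fold C. pose proof (pos_INR (nf t0)). nra.
    - rewrite Nat.add_succ_r. specialize (step (t0 + k)%nat ltac:(lia) (nf (S (t0 + k))) ltac:(rewrite nf_S; lia)).
      set (X := Dev b w z (kfl b (nf (S (t0 + k))))) in *. set (Y := Dev b w z (kfl b (nf (t0 + k)))) in *.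
      replace X with ((X - Y) + Y) by ring. pose proof (Rabs_triang (X - Y) Y).
      rewrite (nf_S (t0 + k)), plus_INR. lra. }
  exists (nf t0), C. intros nu hnu.
  set (L := Nat.log2 nu). assert (nu0 : (0 < nu)%nat) by (pose proof (Nat.pow_nonzero 2 (4 + t0)); lia).
  pose proof (Nat.log2_spec nu nu0) as hL. fold L in hL.
  assert (tL : (4 + t0 <= L)%nat) by (unfold L; rewrite <- (Nat.log2_pow2 (4 + t0)) by lia; now apply Nat.log2_le_mono).
  specialize (ind (L - (4 + t0))%nat). set (t := (t0 + (L - (4 + t0)))%nat) in *.
  assert (eL : L = (4 + t)%nat) by (unfold t; lia). rewrite eL in hL.
  replace (S (4 + t)) with (4 + S t)%nat in hL by lia.
  specialize (step t ltac:(unfold t; lia) nu ltac:(lia)).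
  assert (nn : INR (nf t) <= INR nu) by (apply le_INR; lia).
  set (X := Dev b w z (kfl b nu)) in *. set (Y := Dev b w z (kfl b (nf t))) in *.
  replace X with ((X - Y) + Y) by ring. pose proof (Rabs_triang (X - Y) Y).
  assert (eps * INR (nf t) <= eps * INR nu) by (apply Rmult_le_compat_l; lra). lra.
Qed.

Theorem stages_normal : absolutely_normal z.
Proof.
  intros b hb w hw hwb eta heta. assert (b1 : 2 <= INR b) by (apply (le_INR 2); auto).
  (* Below, nu <= b N, so this choice turns the error 8 eps nu into at most eta N / 2. *)
  set (eps := eta / (16 * INR b)). assert (he : 0 < eps) by (apply Rdiv_lt_0_compat; lra).
  destruct (Dev_small b w eps hb hw hwb he) as (n0 & C & h).
  destruct (arch ((1 + Rabs C) * 4 / eta)) as [N1 hN1].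
  exists (1 + n0 + N1)%nat. intros N hN. unfold Rdist.
  assert (N0 : 0 < INR N) by (apply lt_0_INR; lia).
  replace (INR (occ_count b z w N) / INR N - / INR b ^ length w) with (Dev b w z N / INR N)
    by (unfold Dev; field; split; [apply pow_nonzero; lra|lra]).
  unfold Rdiv. rewrite Rabs_mult, (Rabs_inv (INR N)), (Rabs_right (INR N)) by lra.
  (* The number of bits that match N base-b digits: [kfl b nu] is N or N - 1. *)
  set (nu := Nat.log2 (b ^ N)).
  assert (bN : (0 < b ^ N)%nat) by (pose proof (Nat.pow_nonzero b N); lia).
  pose proof (Nat.log2_spec _ bN) as [l1 l2]. fold nu in l1, l2. rewrite Nat.pow_succ_r' in l2.
  assert (hnu1 : (N <= nu)%nat).
  { unfold nu. rewrite <- (Nat.log2_pow2 N) at 1 by lia. apply Nat.log2_le_mono. now apply Nat.pow_le_mono_l. }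
  assert (hnu2 : (nu <= b * N)%nat).
  { apply (Nat.pow_le_mono_r_iff 2); [lia|]. apply Nat.le_trans with (1 := l1). rewrite Nat.pow_mul_r.
    apply Nat.pow_le_mono_l. apply Nat.lt_le_incl, Nat.pow_gt_lin_r. lia. }
  pose proof (kfl_spec b nu hb) as [k1 k2].
  assert (a1 : (kfl b nu <= N)%nat) by (apply (Nat.pow_le_mono_r_iff b); lia).
  assert (a2 : (N <= kfl b nu + 1)%nat).
  { apply Nat.lt_succ_r. apply (Nat.pow_lt_mono_r_iff b); [lia|]. rewrite Nat.add_1_r, (Nat.pow_succ_r' _ (S _)). nia. }
  pose proof (Dev_near b hb w hw z N (kfl b nu) 1 ltac:(lia) ltac:(lia)) as d1. change (INR 1) with 1 in d1.
  specialize (h nu ltac:(lia)). apply le_INR in hnu2. rewrite mult_INR in hnu2.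
  assert (hD : Rabs (Dev b w z N) <= 1 + Rabs C + eta / 2 * INR N).
  { set (X := Dev b w z N) in *. set (Y := Dev b w z (kfl b nu)) in *.
    replace X with ((X - Y) + Y) by ring. pose proof (Rabs_triang (X - Y) Y). pose proof (Rle_abs C).
    assert (8 * eps * INR nu <= eta / 2 * INR N).
    { apply Rle_trans with (8 * eps * (INR b * INR N)); [apply Rmult_le_compat_l; lra|]. right. unfold eps. field. lra. }
    lra. }
  apply Rle_lt_trans with ((1 + Rabs C + eta / 2 * INR N) * / INR N).
  { apply Rmult_le_compat_r; auto. left. now apply Rinv_0_lt_compat. }
  apply Rmult_lt_reg_r with (INR N); auto. replace ((1 + Rabs C + eta / 2 * INR N) * / INR N * INR N) with (1 + Rabs C + eta / 2 * INR N) by (field; lra).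
  assert (hNN : INR N1 < INR N) by (apply lt_INR; lia).
  assert ((1 + Rabs C) * 4 <= eta * INR N).
  { apply Rmult_le_reg_r with (/ eta); [now apply Rinv_0_lt_compat|].
    replace (eta * INR N * / eta) with (INR N) by (field; lra). unfold Rdiv in hN1. lra. }
  pose proof (Rabs_pos C). lra.
Qed.
End Normal.

(** * The schedule of the stages *)

Open Scope nat_scope.

Lemma list_sum_ge (f : nat -> nat) i S : In i S -> f i <= list_sum (map f S).
Proof. induction S as [|x S IH]; intros []; simpl; [subst; lia|]. specialize (IH H). lia. Qed.

Lemma stage_sol l K m g Bm bs P0 lv Ps rs W0 Ub Hs : length bs = K -> Forall2 (maxpow l) bs P0 -> length lv = m ->
  levels_pow l bs lv -> Forall2 (maxpow (length W0)) bs Ps -> Forall2 (root1 g W0) Ps rs -> length W0 = l * 2 ^ m ->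
  sol l bs P0 lv rs [] Ub Hs -> 2 <= Bm -> (forall i, i < K -> 2 <= bval (nth i bs []) <= Bm) ->
  Bm * (2 * (4 * Bm) ^ m + 2) <= 2 ^ g -> 1 <= l ->
  forall i, i < K -> stage_ok (bval (nth i bs [])) l (K * (8 * (Bm * Bm))) K (length W0) (bval W0) (bval (Ub ++ W0)).
Proof.
  intros hK hP0 lm hlv hPs hrs lW hs hB hbs hE hl i hi.
  assert (lrs : length rs = K) by (rewrite <- (Forall2_length hrs), <- (Forall2_length hPs); auto).
  assert (hroot : forall j, j < K -> root1 g W0 (nth j Ps []) (nth j rs nil2)).
  { intros j hj. rewrite <- lrs in hj. clear -hrs hj. revert j hj. induction hrs; intros [|j] hj; simpl in *; try lia; auto. apply IHhrs. lia. }
  destruct (sol_trace l g K Bm ((4 * Bm) ^ m) (2 ^ m) bs P0 hK hP0 hB hbs hE lv rs [] Ub Hs (bval W0) (length W0) 0 0 hs hlv lrs)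
    as [ht hpsi].
  - intros j hj. pose proof (maxpow_nth K bs hK _ _ j hPs hj) as hm. pose proof hm as (_ & [D hD] & _). exists D.
    rewrite lm, <- lW, Nat.add_comm. eapply approx_root; eauto.
  - rewrite lm. lia.
  - intros j _. now destruct j.
  - rewrite lm. lia.
  - destruct (ht i hi) as (ds & e1 & e2 & e3). pose proof (maxpow_nth K bs hK _ _ i hP0 hi) as hm.
    destruct (hbs i hi) as [b2 _]. pose proof (maxpow_bval _ _ _ b2 hm) as [q1 q2].
    destruct hm as (_ & [kap hk] & mP). rewrite lm in *.
    assert (p0 : 2 ^ m <> 0) by (apply Nat.pow_nonzero; lia).
    exists kap, ds. rewrite <- hk, e2. split; [|split; [lia|split; [auto|split; [auto|split]]]].
    + rewrite bval_app, Nat.add_comm, (Nat.mul_comm (2 ^ _)). exact e3.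
    + rewrite Nat.pow_succ_r', <- hk. exact mP.
    + replace (nth i [] []) with (@nil nat) in e1 by now destruct i. rewrite app_nil_r in e1.
      assert (z0 : psi K [] = 0).
      { unfold psi. induction (seq 0 K) as [|a q IH]; auto. change (phi (nth a [] []) + list_sum (map (fun i => phi (nth i [] [])) q) = 0).
        rewrite IH. now destruct a. }
      rewrite z0, Nat.mul_0_r, Nat.add_0_l in hpsi. apply Nat.le_trans with (2 := hpsi). apply Nat.mul_le_mono_l.
      rewrite <- e1. unfold psi. apply (list_sum_ge (fun i => phi (nth i Hs []))). apply in_seq. lia.
Qed.

Fixpoint bases (n : nat) : list (list bool) :=
  match n with 0 => [[false; true]] | S n => next_base (bases n) :: bases n end.

Lemma bases_length n : length (bases n) = n + 1.
Proof. induction n; simpl; lia. Qed.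

(** Each new base is one bit longer than the previous one, so the increment cannot overflow. *)
Lemma bases_hd n : length (hd [] (bases n)) = n + 2 /\ bval (hd [] (bases n)) = n + 2.
Proof.
  induction n as [|n [IH1 IH2]]; [auto|]. cbn [bases hd]. unfold next_base. set (x := hd [] (bases n)) in *.
  assert (lx : length (x ++ [false]) = S n + 2) by (rewrite length_app; simpl; lia).
  rewrite adds_length, lx. split; auto.
  destruct (adds_val (x ++ [false]) true []) as [k hk]; [simpl; lia|].
  rewrite bval_app, IH2, lx in hk. cbn [bval Nat.b2n] in hk.
  pose proof (bval_lt (adds false true (x ++ [false]) [])) as lt. rewrite adds_length, lx in lt.
  pose proof (Nat.pow_gt_lin_r 2 (S n + 2) ltac:(lia)).
  destruct k; [lia|]. exfalso. nia.
Qed.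

Lemma bases_nth n : forall i, i <= n -> length (nth i (bases n) []) = n + 2 - i /\ bval (nth i (bases n) []) = n + 2 - i.
Proof.
  induction n as [|n IH]; intros i hi.
  - replace i with 0 by lia. auto.
  - destruct i as [|i]; [pose proof (bases_hd (S n)) as h; cbn [bases hd] in h; cbn [bases nth]; lia|].
    cbn [bases nth]. specialize (IH i). lia.
Qed.

(** Stage t has blocks of length [2 ^ lam t] and the bases from 2 to [lam t + 2]; both grow just
    when the test of [code_main], 2^l <= 16 + t, succeeds. *)
Fixpoint lam (t : nat) : nat :=
  match t with 0 => 0 | S t => if 2 ^ (2 ^ lam t) <=? 16 + t then S (lam t) else lam t end.

Lemma lam_le t : lam t <= t.
Proof. induction t; cbn [lam]; [lia|]. destruct (_ <=? _); lia. Qed.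

Lemma lam_mono t t' : t <= t' -> lam t <= lam t'.
Proof. induction 1; [lia|]. cbn [lam]. destruct (_ <=? _); lia. Qed.

(** Doubling l squares 2^l, and it happens only when 2^l is at most 16 + t. *)
Lemma lam_sq t : 2 ^ (2 ^ lam t) <= (16 + t) * (16 + t).
Proof.
  induction t as [|t IH]; [simpl; lia|]. cbn [lam]. destruct (Nat.leb_spec (2 ^ (2 ^ lam t)) (16 + t)) as [h|h].
  - rewrite (Nat.pow_succ_r' 2 (lam t)). replace (2 * 2 ^ lam t) with (2 ^ lam t + 2 ^ lam t) by lia.
    rewrite Nat.pow_add_r. apply Nat.mul_le_mono; lia.
  - apply Nat.le_trans with (1 := IH). apply Nat.mul_le_mono; lia.
Qed.

Lemma lam_unbounded a : exists t0, forall t, t0 <= t -> a <= lam t.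
Proof.
  enough (h : exists t0, a <= lam t0).
  { destruct h as [t0 h]. exists t0. intros t ht. pose proof (lam_mono t0 t ht). lia. }
  induction a as [|a [t h]]; [exists 0; lia|].
  exists (S (t + 2 ^ (2 ^ a))). cbn [lam]. set (t' := t + 2 ^ (2 ^ a)).
  pose proof (lam_mono t t' ltac:(unfold t'; lia)) as hm.
  destruct (Nat.eq_dec (lam t') a) as [e|ne].
  - rewrite e. destruct (Nat.leb_spec (2 ^ (2 ^ a)) (16 + t')) as [h'|h']; [lia|]. unfold t' in h'. lia.
  - destruct (_ <=? _); lia.
Qed.

(** With y the quotient of x by k + 1, one factor 2^y dominates the constants and k further ones
    dominate x^k. *)
Lemma poly_exp A k : exists x0, forall x, x0 <= x -> A * x ^ k <= 2 ^ x.
Proof.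
  exists ((k + 1) * (A * (k + 1) ^ k)). intros x hx. set (y := x / (k + 1)).
  assert (y1 : A * (k + 1) ^ k <= y) by (apply Nat.div_le_lower_bound; lia).
  assert (y2 : (k + 1) * y <= x) by apply Nat.Div0.mul_div_le.
  assert (y3 : x < (k + 1) * S y) by (apply Nat.mul_succ_div_gt; lia).
  pose proof (Nat.pow_gt_lin_r 2 y ltac:(lia)) as y4.
  apply Nat.le_trans with (A * ((k + 1) * 2 ^ y) ^ k).
  - apply Nat.mul_le_mono_l, Nat.pow_le_mono_l. apply Nat.le_trans with ((k + 1) * S y); [lia|]. apply Nat.mul_le_mono_l. lia.
  - rewrite Nat.pow_mul_l, Nat.mul_assoc, <- Nat.pow_mul_r.
    apply Nat.le_trans with (2 ^ y * 2 ^ (y * k)); [apply Nat.mul_le_mono_r; lia|].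
    rewrite <- Nat.pow_add_r. apply Nat.pow_le_mono_r; lia.
Qed.

Lemma W_init : W fMAIN <<Leaf>> (fun v n => exists y, y = repeat false 16 /\
  v = Node (B y) <<state_enc y 1 (bases 0) 16>> /\ n <= 3000).
Proof.
  body.
  change (Node Leaf (Node Leaf (Node Leaf (Node Leaf Leaf)))) with (B (repeat false 4)).
  use (W_app b2t (repeat false 4) (repeat false 4)). rewrite <- repeat_app. cbn [Nat.add].
  use (W_app b2t (repeat false 8) (repeat false 8)). rewrite <- repeat_app. cbn [Nat.add].
  exists (repeat false 16). split; [reflexivity|]. split; [reflexivity|]. rewrite !repeat_length in *. lia.
Qed.

Definition C1 := 40 * (1000 * CI).

Lemma main_cost_le l K m t : 16 <= t -> m + 2 <= t -> 2 ^ l <= t * t -> K + 2 <= 2 * t ->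
  main_cost t l K m t <= C1 * (2 ^ t * t ^ 13).
Proof.
  intros ht hm hl hK. unfold main_cost, C1, QR.
  assert (tt : 16 * 16 <= t * t) by (apply Nat.mul_le_mono; auto).
  pose proof (Nat.pow_gt_lin_r 2 l ltac:(lia)) as ll.
  assert (h1 : 2 ^ m <= 2 ^ t) by (apply Nat.pow_le_mono_r; lia).
  (* The factors 2, 2, 2 and 5 on the right give 40, and the powers of t add up to 1 + 2 + 1 + 2 + 5
     + 2 = 13. *)
  replace (40 * (1000 * CI) * (2 ^ t * t ^ 13)) with
   (1000 * (2 ^ t * (t * (2 * (t * t) * (2 * t * (2 * (t * t) * (CI * t ^ 5 * (5 * (t * t)))))))))
    by (change (t ^ 13) with (t * (t * (t * (t * (t * (t * (t * (t * t ^ 5)))))))); generalize 1000 CI (2 ^ t) (t ^ 5); intros; ring).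
  apply Nat.mul_le_mono_l. repeat (apply Nat.mul_le_mono; [lia|]). lia.
Qed.

(** * The invariant along the stages *)

Definition st t W := <<state_enc W (2 ^ lam t) (bases (lam t)) (16 + t)>>.
Definition Nb t := (C1 + 4000) * (2 ^ (16 + t) * (16 + t) ^ 13).
Definition cfn t := (lam t + 1) * (8 * ((lam t + 2) * (lam t + 2))).
(** There are [S t] rounds because the first one only prints the sixteen initial zeros. [W] has its
    lowest bit first, so the output so far is [rev W]. *)
Definition Inv t W := length W = 2 ^ (4 + t) /\ exists N, N <= Nb t /\ rounds prog (S t) (st t W) (rev W) N.
Definition Rel t W W' := (exists Ub, W' = Ub ++ W) /\ forall b, 2 <= b <= lam t + 2 ->
  stage_ok b (2 ^ lam t) (cfn t) (lam t + 1) (2 ^ (4 + t)) (bval W) (bval W').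

Lemma Nb_ge t : C1 + 4000 <= Nb t.
Proof.
  unfold Nb. rewrite <- (Nat.mul_1_r (C1 + 4000)) at 1. apply Nat.mul_le_mono_l.
  pose proof (Nat.pow_nonzero 2 (16 + t)). pose proof (Nat.pow_nonzero (16 + t) 13). nia.
Qed.

Lemma Inv_init : Inv 0 (repeat false 16).
Proof.
  split; [reflexivity|]. destruct W_init as (v & n & he & y & -> & -> & hn).
  exists (0 + n + length (repeat false 16) + 1). split; [pose proof (Nb_ge 0); rewrite repeat_length; lia|].
  change (rev (repeat false 16)) with ([] ++ repeat false 16).
  eapply roundsS; [constructor|exact he].
Qed.

Lemma sq_le_pow2 t : 16 <= t -> 16 * (t * t) <= 2 ^ t.
Proof.
  intros ht. replace t with (16 + (t - 16)) by lia. induction (t - 16) as [|k IH].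
  - rewrite Nat.add_0_r. replace 16 with (8 + 8) at 4 by lia. rewrite Nat.pow_add_r.
    apply Nat.mul_le_mono; change (2 ^ 8) with 256; lia.
  - rewrite Nat.add_succ_r, Nat.pow_succ_r'. nia.
Qed.

Lemma Inv_step t W : Inv t W -> exists W', Inv (S t) W' /\ Rel t W W'.
Proof.
  intros (lW & N & hN & hr). set (T := 16 + t) in *. set (l := 2 ^ lam t). set (K := lam t + 1). set (m := 4 + t - lam t).
  pose proof (lam_le t) as hlam. pose proof (lam_sq t) as hsq. fold T l in hsq.
  assert (T16 : 16 <= T) by (unfold T; lia). pose proof (sq_le_pow2 T T16) as hT.
  assert (TT : 16 * T <= T * T) by (apply Nat.mul_le_mono_r; auto).
  pose proof (Nat.pow_gt_lin_r 2 l ltac:(lia)) as ll. pose proof (pow2_pos (lam t)) as l1. fold l in l1.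
  assert (e1 : l * 2 ^ m = 2 ^ (4 + t)) by (unfold l, m; rewrite <- Nat.pow_add_r; f_equal; lia).
  assert (e2 : 2 ^ (4 + t) * 2 <= 2 ^ T).
  { unfold T. replace (16 + t) with (4 + t + S 11) by lia. rewrite (Nat.pow_add_r 2 (4 + t)), Nat.pow_succ_r'.
    apply Nat.mul_le_mono_l. pose proof (pow2_pos 11). lia. }
  assert (e3 : 2 ^ (2 * T) <= 2 ^ (T * T)) by (apply Nat.pow_le_mono_r; lia).
  assert (e4 : 2 ^ (2 * T) = 2 ^ T * 2 ^ T) by (rewrite <- Nat.pow_add_r; f_equal; lia).
  assert (e5 : 2 ^ m <= 2 ^ T) by (apply Nat.pow_le_mono_r; unfold m, T; lia).
  pose proof (bases_length (lam t)) as lb. pose proof (bases_nth (lam t)) as nb. set (bs := bases (lam t)) in *.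
  assert (lT : lam t + 2 <= T) by (unfold T; lia).
  assert (hbs : Forall (fun b => 2 <= bval b /\ length b <= T * T) bs).
  { apply Forall_forall. intros x hx. apply In_nth with (d := []) in hx. destruct hx as (i & hi & <-).
    destruct (nb i ltac:(lia)). lia. }
  assert (c1 : 2 * (l * 2 ^ m + T * T) <= 2 ^ T).
  { rewrite e1. assert (2 ^ (4 + t) * 2 * 2 <= 2 ^ T); [|lia].
    unfold T. replace (16 + t) with (4 + t + S (S 10)) by lia. rewrite (Nat.pow_add_r 2 (4 + t)), (Nat.pow_succ_r' 2 11), (Nat.pow_succ_r' 2 10).
    rewrite <- Nat.mul_assoc. apply Nat.mul_le_mono_l. pose proof (pow2_pos 10). lia. }
  assert (c2 : (K + 1) * 2 ^ m < 2 ^ (T * T)).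
  { apply Nat.lt_le_trans with (2 := e3). rewrite e4. apply Nat.lt_le_trans with (2 ^ T * 2 ^ m).
    - apply Nat.mul_lt_mono_pos_r; [pose proof (pow2_pos m); lia|]. unfold K, T in *. lia.
    - now apply Nat.mul_le_mono_l. }
  destruct (W_main T l K m T bs W) as (v & n & he & P0 & lv & Ps & rs & Ub & Hs & h1 & h2 & h3 & h4 & h5 & h6 & -> & hn);
    auto; try (unfold K, T in *; lia).
  exists (Ub ++ W).
  assert (lU : length Ub = 2 ^ (4 + t)) by (rewrite (sol_length _ _ _ _ _ _ _ _ h6), h2; exact e1).
  split; [split|split].
  - rewrite length_app, lU, lW, Nat.add_succ_r, Nat.pow_succ_r'. lia.
  - exists (N + n + length (rev Ub) + 1). split.
    + rewrite length_rev, lU.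
      assert (hc : n <= C1 * (2 ^ T * T ^ 13)).
      { apply Nat.le_trans with (1 := hn). apply main_cost_le; auto; unfold K, m, T; lia. }
      (* The cost of all earlier stages is absorbed because the factor 2^T of [Nb] doubles from one
         stage to the next. *)
      unfold Nb in *. fold T in hN. replace (16 + S t) with (S T) by (unfold T; lia). rewrite (Nat.pow_succ_r' 2 T).
      assert (h13 : T ^ 13 <= S T ^ 13) by (apply Nat.pow_le_mono_l; lia).
      assert (p13 : 1 <= T ^ 13) by (pose proof (Nat.pow_nonzero T 13); lia).
      set (x := T ^ 13) in *. set (y := S T ^ 13) in *. set (q := 2 ^ T) in *.
      assert (qx : q <= q * x) by (rewrite <- (Nat.mul_1_r q) at 1; now apply Nat.mul_le_mono_l).
      assert (qy : q * x <= q * y) by now apply Nat.mul_le_mono_l.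
      assert (hC : C1 + 2 <= C1 + 4000) by lia. set (c := C1 + 4000) in *. clearbody c.
      assert (hA : c * (q * x) <= c * (q * y)) by now apply Nat.mul_le_mono_l.
      assert (hB : C1 * (q * x) + 2 * (q * x) <= c * (q * y)).
      { rewrite <- Nat.mul_add_distr_r. now apply Nat.mul_le_mono. }
      replace (c * (2 * q * y)) with (c * (q * y) + c * (q * y)) by ring.
      pose proof (pow2_pos (4 + t)). lia.
    + rewrite rev_app_distr. eapply roundsS; [exact hr|]. unfold st. fold T l bs.
      replace (<<state_enc (Ub ++ W) (2 ^ lam (S t)) (bases (lam (S t))) (16 + S t)>>) with
        (<<if 2 ^ l <=? T then state_enc (Ub ++ W) (2 * l) (next_base bs :: bs) (S T) else state_enc (Ub ++ W) l bs (S T)>>).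
      * exact he.
      * cbn [lam]. fold l T. replace (16 + S t) with (S T) by (unfold T; lia).
        destruct (2 ^ l <=? T); [rewrite Nat.pow_succ_r'|]; reflexivity.
  - now exists Ub.
  - intros b hb. set (i := lam t + 2 - b). destruct (nb i ltac:(unfold i; lia)) as [_ vi].
    replace b with (bval (nth i bs [])) by (rewrite vi; unfold i; lia). rewrite <- lW.
    eapply (stage_sol l K m (T * T) (lam t + 2)); eauto; try lia.
    + intros j hj. destruct (nb j ltac:(unfold K in hj; lia)) as [_ vj]. unfold K in hj. lia.
    (* Guard bits: the errors are at most about (4 Bm)^(m+1) <= 2^(T (m+1)), and m < T, so T^2 bits
       suffice. *)
    + set (Bm := lam t + 2). assert (B1 : 4 * Bm <= 2 ^ T) by (unfold Bm, T in *; lia).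
      assert (hp : (4 * Bm) ^ m <= 2 ^ (T * m)) by (rewrite Nat.pow_mul_r; now apply Nat.pow_le_mono_l).
      assert (p1 : 1 <= (4 * Bm) ^ m) by (pose proof (Nat.pow_nonzero (4 * Bm) m); unfold Bm in *; lia).
      apply Nat.le_trans with (4 * Bm * (4 * Bm) ^ m); [clear -p1; nia|].
      apply Nat.le_trans with (2 ^ T * 2 ^ (T * m)); [now apply Nat.mul_le_mono|].
      rewrite <- Nat.pow_add_r. apply Nat.pow_le_mono_r; [lia|].
      replace (T + T * m) with (T * S m) by ring. apply Nat.mul_le_mono_l. unfold m, T. lia.
Qed.

(** [Inv_step] only asserts existence, so the sequence of states is extracted by a choice axiom.
    [Inv] ties it to the actual run of the program. *)
Definition next t (x : {W | Inv t W}) : {W | Inv (S t) W /\ Rel t (proj1_sig x) W} :=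
  constructive_indefinite_description _ (Inv_step t (proj1_sig x) (proj2_sig x)).

Fixpoint Wseq (t : nat) : {W | Inv t W} :=
  match t with
  | 0 => exist _ _ Inv_init
  | S t => exist _ (proj1_sig (next t (Wseq t))) (proj1 (proj2_sig (next t (Wseq t))))
  end.

Definition Wt t := proj1_sig (Wseq t).

Lemma Wt_inv t : Inv t (Wt t).
Proof. exact (proj2_sig (Wseq t)). Qed.

Lemma Wt_rel t : Rel t (Wt t) (Wt (S t)).
Proof. exact (proj2 (proj2_sig (next t (Wseq t)))). Qed.

Lemma Wt_length t : length (Wt t) = 2 ^ (4 + t).
Proof. apply Wt_inv. Qed.

Lemma Wt_prefix t k i : i < 2 ^ (4 + t) -> nth i (rev (Wt (t + k))) false = nth i (rev (Wt t)) false.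
Proof.
  intros hi. induction k as [|k IH]; [now rewrite Nat.add_0_r|]. rewrite Nat.add_succ_r, <- IH.
  destruct (Wt_rel (t + k)) as [[Ub ->] _]. rewrite rev_app_distr. apply app_nth1.
  rewrite length_rev, Wt_length. apply Nat.lt_le_trans with (1 := hi). apply Nat.pow_le_mono_r; lia.
Qed.

Definition zbit n := nth n (rev (Wt n)) false.

Lemma zbit_eq t i : i < 2 ^ (4 + t) -> nth i (rev (Wt t)) false = zbit i.
Proof.
  intros hi. unfold zbit.
  assert (hi' : i < 2 ^ (4 + i)).
  { apply Nat.lt_le_trans with (2 ^ i); [apply Nat.pow_gt_lin_r; lia|apply Nat.pow_le_mono_r; lia]. }
  destruct (le_lt_dec t i) as [h|h].
  - replace i with (t + (i - t)) at 3 by lia. symmetry. now apply Wt_prefix.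
  - replace t with (i + (t - i)) by lia. now apply Wt_prefix.
Qed.

Fixpoint Zb (f : nat -> bool) (n : nat) : nat := match n with 0 => 0 | S n => 2 * Zb f n + Nat.b2n (f n) end.

Lemma Zb_bval f W : (forall i, i < length W -> nth i (rev W) false = f i) -> Zb f (length W) = bval W.
Proof.
  induction W as [|a W IH]; intros h; auto. cbn [length Zb bval]. rewrite IH.
  - rewrite <- h by (simpl; lia). cbn [rev]. rewrite app_nth2 by (rewrite length_rev; lia).
    rewrite length_rev, Nat.sub_diag. cbn [nth]. lia.
  - intros i hi. rewrite <- h by (simpl; lia). cbn [rev]. rewrite app_nth1; auto. now rewrite length_rev.
Qed.

Lemma bval_Wt t : bval (Wt t) = Zb zbit (2 ^ (4 + t)).
Proof.
  rewrite <- (Wt_length t). symmetry. apply Zb_bval. intros i hi. apply zbit_eq. now rewrite <- Wt_length.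
Qed.

Open Scope R_scope.

(** * The real number and its binary cells *)

Lemma bin_sum f n : sum_f_R0 (bin_term f) n * 2 ^ S n = INR (Zb f (S n)).
Proof.
  assert (h2 : forall n, 2 ^ S n <> 0) by (intros; apply pow_nonzero; lra).
  assert (hb : forall n, bin_term f n * 2 ^ S n = INR (Nat.b2n (f n))).
  { intros k. unfold bin_term. specialize (h2 k). destruct (f k); simpl INR; field; auto. }
  induction n as [|n IH].
  - change (sum_f_R0 (bin_term f) 0) with (bin_term f 0). rewrite hb. reflexivity.
  - cbn [sum_f_R0]. rewrite Rmult_plus_distr_r, hb. cbn [Zb] in *. set (Z := (2 * Zb f n + Nat.b2n (f n))%nat) in *.
    rewrite (plus_INR (2 * Z)), mult_INR, <- IH. change (INR 2) with 2. change (2 ^ S (S n)) with (2 * 2 ^ S n). ring.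
Qed.

Lemma bin_tail f n k : sum_f_R0 (bin_term f) n <= sum_f_R0 (bin_term f) (n + k) <= sum_f_R0 (bin_term f) n + / 2 ^ S n - / 2 ^ S (n + k).
Proof.
  induction k as [|k IH]; [rewrite Nat.add_0_r; lra|]. rewrite Nat.add_succ_r. cbn [sum_f_R0].
  assert (h : 0 < / 2 ^ S (S (n + k))) by (apply Rinv_0_lt_compat, pow_lt; lra).
  assert (e : / 2 ^ S (n + k) = 2 * / 2 ^ S (S (n + k))) by (simpl; field; apply pow_nonzero; lra).
  assert (hx : 0 <= bin_term f (S (n + k)) <= / 2 ^ S (S (n + k))) by (unfold bin_term; destruct (f (S (n + k))); lra).
  lra.
Qed.

Lemma bin_limit f : exists z, infinite_sum (bin_term f) z /\ 0 <= z <= 1 /\ forall n, (1 <= n)%nat -> cell z (Zb f n) n.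
Proof.
  set (u := sum_f_R0 (bin_term f)).
  assert (hg : Un_growing u).
  { intros n. pose proof (bin_tail f n 1). rewrite Nat.add_1_r in *. fold u in H. lra. }
  assert (p : forall n, 0 < / 2 ^ n) by (intros; apply Rinv_0_lt_compat, pow_lt; lra).
  destruct (growing_cv u hg) as [z hz].
  { exists (u 0%nat + / 2 ^ 1). intros x [n ->]. pose proof (bin_tail f 0 n) as h. specialize (p (S n)). fold u in h. cbn [Nat.add] in h. lra. }
  assert (lo : forall n, u n <= z) by (apply growing_ineq; auto).
  assert (hi : forall n, z <= u n + / 2 ^ S n).
  { intros n. apply Rnot_lt_le. intros lt. destruct (hz (z - (u n + / 2 ^ S n))) as [N hN]; [lra|].
    specialize (hN (n + N)%nat ltac:(lia)). unfold Rdist in hN. pose proof (bin_tail f n N) as ht. fold u in ht.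
    specialize (p (S (n + N))). rewrite Rabs_left in hN by lra. lra. }
  exists z. split; [exact hz|]. split.
  - pose proof (lo 0%nat) as l0. pose proof (hi 0%nat) as h0. unfold u in *. simpl in *. unfold bin_term in *. simpl in *.
    destruct (f 0%nat); lra.
  - intros n hn. destruct n as [|n]; [lia|]. unfold cell. rewrite <- bin_sum. fold u.
    assert (q : 0 < 2 ^ S n) by (apply pow_lt; lra). specialize (lo n). specialize (hi n).
    split; [apply Rmult_le_compat_r; lra|].
    apply Rle_trans with ((u n + / 2 ^ S n) * 2 ^ S n); [apply Rmult_le_compat_r; lra|].
    right. field. lra.
Qed.

(** The series is only bounded by 1, and this excludes the value 1: by [digit] its binary digits are
    those of the integer 2^(k+1) modulo 2, all zero, so the word 1 never occurs. *)
Lemma not_normal_1 : ~ absolutely_normal 1.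
Proof.
  intros h. specialize (h 2%nat (le_n _) [1%nat] (le_n _) ltac:(repeat constructor)).
  assert (d0 : forall k, digit 2 1 k = 0%nat).
  { intros k. unfold digit. rewrite (Int_part_eq _ (2 ^ S k)).
    - rewrite <- (Nat2Z.inj_mod _ 2), Nat2Z.id. rewrite Nat.pow_succ_r', Nat.mul_comm. apply Nat.Div0.mod_mul.
    - rewrite pow_INR. simpl (INR 2). lra. }
  assert (c0 : forall N, occ_count 2 1 [1%nat] N = 0%nat).
  { intros N. unfold occ_count. induction (seq 0 N) as [|a q IH]; auto. simpl.
    unfold occurs_at at 1. cbn [length seq forallb]. rewrite d0. cbn [nth Nat.eqb andb]. exact IH. }
  destruct (h (1 / 4)) as [N hN]; [lra|]. specialize (hN N (le_n _)). unfold Rdist in hN. rewrite c0 in hN.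
  simpl in hN. rewrite Rabs_left in hN; lra.
Qed.

Lemma zbit_normal z : (forall n, (1 <= n)%nat -> cell z (Zb zbit n) n) -> absolutely_normal z.
Proof.
  intros hz. apply (stages_normal z (fun t => 2 ^ lam t)%nat cfn (fun t => lam t + 1)%nat (fun t => bval (Wt t))).
  - intros t. rewrite bval_Wt. apply hz. pose proof (Nat.pow_nonzero 2 (4 + t)). lia.
  - intros t. unfold cfn. nia.
  - intros t. lia.
  - intros b hb. destruct (lam_unbounded b) as [t0 h0]. exists t0. intros t ht. apply (Wt_rel t). specialize (h0 t ht). lia.
  (* Both lam + 1 and lam + 2 are at most 3 lam, so [cfn] is at most 8 * 27 lam^3, which the block
     length 2^lam outgrows. *)
  - intros A. destruct (poly_exp (A * (8 * 27)) 3) as [x0 h0]. destruct (lam_unbounded (x0 + 1)) as [t0 h1]. exists t0.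
    intros t ht. specialize (h1 t ht). specialize (h0 (lam t) ltac:(lia)). eapply Nat.le_trans; [|exact h0].
    unfold cfn. rewrite <- Nat.mul_assoc. apply Nat.mul_le_mono_l. set (x := lam t) in *.
    apply Nat.le_trans with (3 * x * (8 * (3 * x * (3 * x))))%nat.
    + repeat (apply Nat.mul_le_mono; try lia).
    + simpl Nat.pow. lia.
  (* With T = 16 + t, K 2^l is at most T^3, and the stage length 2^(4+t) is 2^T / 2^12. *)
  - intros A. destruct (poly_exp (A * 2 ^ 12) 3) as [x0 h0]. exists x0. intros t ht.
    specialize (h0 (16 + t)%nat ltac:(lia)). pose proof (lam_sq t) as h1. pose proof (lam_le t) as h2.
    apply (Nat.mul_le_mono_pos_l _ _ (2 ^ 12)); [pose proof (pow2_pos 12); lia|].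
    rewrite <- Nat.pow_add_r. replace (12 + (4 + t))%nat with (16 + t)%nat by lia. eapply Nat.le_trans; [|exact h0].
    set (T := (16 + t)%nat) in *. rewrite (Nat.mul_comm A (2 ^ 12)), <- Nat.mul_assoc. do 2 apply Nat.mul_le_mono_l.
    change (T ^ 3)%nat with (T * (T * (T * 1)))%nat. rewrite Nat.mul_1_r. apply Nat.mul_le_mono; [unfold T; lia|auto].
Qed.

Open Scope nat_scope.

(** * The running time *)

Lemma log2_poly (a k x y : nat) : 1 <= Nat.log2 y -> x <= a * y ^ k -> lcost x <= (a + 2 * k + 1) * Nat.log2 y.
Proof.
  intros hy hx. assert (y0 : 0 < y) by (destruct y; [change (1 <= 0) in hy; lia|apply Nat.lt_0_succ]).
  unfold lcost. set (L := Nat.log2 y) in *.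
  pose proof (Nat.log2_spec y y0) as [_ h2]. fold L in h2.
  assert (h : x < 2 ^ (a + S L * k)).
  { apply Nat.le_lt_trans with (1 := hx). rewrite Nat.pow_add_r, Nat.pow_mul_r.
    assert (y ^ k <= (2 ^ S L) ^ k) by (apply Nat.pow_le_mono_l; lia).
    pose proof (Nat.pow_gt_lin_r 2 a ltac:(lia)) as h3. pose proof (Nat.pow_nonzero (2 ^ S L) k ltac:(apply Nat.pow_nonzero; lia)).
    apply Nat.le_lt_trans with (a * (2 ^ S L) ^ k); [now apply Nat.mul_le_mono_l|]. apply Nat.mul_lt_mono_pos_r; lia. }
  assert (Nat.log2 x <= a + S L * k).
  { destruct x as [|x]; [apply Nat.le_0_l|]. apply Nat.lt_le_incl. apply Nat.log2_lt_pow2; lia. }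
  clear -H hy. nia.
Qed.

(** Stage log2 (n + 2) has printed bit n, and its parameters exceed n and log n by constant factors
    only; 16 + L <= 17 L because L >= 1. *)
Lemma stage_index n : exists t L, L = Nat.log2 (n + 2) /\ 1 <= L /\ n < 2 ^ (4 + t) /\ 16 + t <= 17 * L /\
  2 ^ (16 + t) <= 2 ^ 16 * (n + 2).
Proof.
  set (L := Nat.log2 (n + 2)). assert (L1 : 1 <= L) by (change 1 with (Nat.log2 2); apply Nat.log2_le_mono; lia).
  pose proof (Nat.log2_spec (n + 2) ltac:(lia)) as [h1 h2]. fold L in h1, h2.
  exists L, L. split; [reflexivity|]. split; [auto|]. split; [|split; [lia|]].
  - apply Nat.lt_le_trans with (2 ^ S L); [lia|apply Nat.pow_le_mono_r; lia].
  - rewrite Nat.pow_add_r. now apply Nat.mul_le_mono_l.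
Qed.

Lemma cost_mono A a b x X Y q L k : X <= a * x -> Y <= b * L -> q = L ^ k -> A * (X * Y ^ k) <= A * (a * b ^ k) * (x * q).
Proof.
  intros h1 h2 ->. replace (A * (a * b ^ k) * (x * L ^ k)) with (A * ((a * x) * (b ^ k * L ^ k))) by ring.
  apply Nat.mul_le_mono_l, Nat.mul_le_mono; auto. rewrite <- Nat.pow_mul_l. now apply Nat.pow_le_mono_l.
Qed.

(** Thirteen of the logarithms are in the number of transitions ([Nb]); the fourteenth is the
    logarithmic cost of each instruction, as addresses are polynomial in n. *)
Lemma time_bound : exists C, forall n, exists t,
  n < length (out (fst (run (machine prog) t))) /\ nth n (out (fst (run (machine prog) t))) false = zbit n /\
  snd (run (machine prog) t) <= C * (n + 2) * Nat.log2 (n + 2) ^ 14.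
Proof.
  destruct (machine_rounds prog) as [c hc].
  assert (hC2 : exists C2, forall n t L, 16 + t <= 17 * L -> 2 ^ (16 + t) <= 2 ^ 16 * (n + 2) ->
    Nb t <= C2 * ((n + 2) * L ^ 13)) by (eexists; intros; eapply cost_mono; eauto).
  destruct hC2 as [C2 hC2]. set (C3 := c + 100 * C2).
  exists (C3 * (2 * (C3 + 2 * 14 + 1))). intros n.
  destruct (stage_index n) as (t & L & eL & L1 & hn & hT & h2). rewrite <- eL.
  destruct (Wt_inv t) as (lW & N & hN & hr). destruct (hc _ _ _ _ hr) as (k & ho & hk). exists k.
  rewrite ho. split; [now rewrite length_rev, lW|]. split; [now apply zbit_eq|].
  assert (L0 : 1 <= L ^ 13) by (pose proof (Nat.pow_nonzero L 13); lia).
  assert (hN2 : N <= C2 * ((n + 2) * L ^ 13)).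
  { apply Nat.le_trans with (1 := hN). now apply hC2. }
  set (y := (n + 2) * L ^ 13) in *.
  assert (y1 : 1 <= y) by (unfold y; nia).
  assert (hx : c + 100 * N <= C3 * y) by (unfold C3; clear -hN2 y1; nia).
  assert (hl : lcost (c + 12 * N) <= (C3 + 2 * 14 + 1) * L).
  { rewrite eL. apply log2_poly; [lia|]. apply Nat.le_trans with (C3 * y); [lia|]. apply Nat.mul_le_mono_l.
    unfold y. change ((n + 2) ^ 14) with ((n + 2) * (n + 2) ^ 13). apply Nat.mul_le_mono_l, Nat.pow_le_mono_l.
    rewrite eL. apply Nat.log2_le_lin. lia. }
  apply Nat.le_trans with (1 := hk). apply Nat.le_trans with (C3 * y * (2 * ((C3 + 2 * 14 + 1) * L))).
  - apply Nat.mul_le_mono; [auto|]. now apply Nat.mul_le_mono_l.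
  - change (L ^ 14) with (L * L ^ 13). unfold y. generalize (C3 + 2 * 14 + 1) (L ^ 13). intros a q. apply Nat.eq_le_incl. ring.
Qed.

Open Scope R_scope.

Theorem mainTheorem11 :
  exists (P : program) (c C : nat) (f : nat -> bool),
    (forall n : nat, exists t : nat,
        (n < length (out (fst (run P t))))%nat /\
        nth n (out (fst (run P t))) false = f n /\
        (snd (run P t) <= C * (n + 2) * (Nat.log2 (n + 2)) ^ c)%nat) /\
    exists z : R,
      infinite_sum (bin_term f) z /\ 0 <= z < 1 /\ absolutely_normal z.
Proof.
  destruct time_bound as [C hC]. exists (machine prog), 14%nat, C, zbit. split; [exact hC|].
  destruct (bin_limit zbit) as (z & h1 & h2 & h3). pose proof (zbit_normal z h3) as h4.
  exists z. split; [exact h1|]. split; [|exact h4]. split; [lra|].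
  destruct (Rle_lt_or_eq_dec z 1) as [lt|e]; [lra|exact lt|]. subst z. destruct (not_normal_1 h4).
Qed.
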